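(* Suppose the scaling assumptions (1)–(8) on $(r_1,\gamma,\tilde\alpha)$ listed in the context hold, and that $\cos\tau_*>1-\varsigma_{\min}/\varsigma_{\max}$. Let $\omega\in\Lambda_{d_0}=\{z\in\mathbb{C}:\Re(izd_0)\neq0\}$. Then $A(\omega)$ is weakly $T(\omega)$-coercive, i.e. there exists a compact operator $K(\omega)\in L(H^1_0(\Omega))$ such that $$\inf_{u\in H^1_0(\Omega)\setminus\{0\}}\frac{\big|\langle (T(\omega)^*A(\omega)+K(\omega))u,u\rangle_{H^1(\Omega)}\big|}{\|u\|_{H^1(\Omega)}^2}>0.$$
   Context: **Setting.** $B_r\subset\mathbb{R}^3$ is the open ball of radius $r$ centered at $0$. $\Omega\subset\mathbb{R}^3$ is a connected Lipschitz domain whose complement $\Omega^c$ is compact and non-empty; $r_0>0$ is such that $\Omega^c\subset B_{r_0}$. $\varsigma\in\mathbb{R}^{3\times3}$ is symmetric positive definite with minimal and maximal eigenvalues $\varsigma_{\min},\varsigma_{\max}$. Functions are complex valued, $\langle f,g\rangle_{L^2}=\int f\cdot\overline g$. $L(X)$ denotes the bounded linear operators on $X$. The argument is normalized by $\arg:\mathbb{C}\setminus\{0\}\to[-\pi,\pi)$. **Scaling assumptions.** $r_1>r_0$, $\gamma\in\{z\in\mathbb{C}:\Re z\ge0,\ \Im z>0\}$, and $\tilde\alpha:[0,\infty)\to[0,\infty)$ satisfies: (1) $\tilde\alpha(r)=0$ for $r\le r_1$; (2) $\tilde\alpha$ is continuous; (3) $\tilde\alpha(r)>0$ for $r>r_1$;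 (4) $\tilde\alpha$ is non-decreasing; (5) $\tilde\alpha$ is twice continuously differentiable in $(r_1,\infty)$ and $\partial_r\tilde\alpha,\partial_r^2\tilde\alpha$ extend continuously to $[r_1,\infty)$; (6) $\tilde\alpha$ and $\alpha(r):=r\partial_r\tilde\alpha(r)+\tilde\alpha(r)$ (defined piecewise) are bounded. With $\tilde d(r):=1+\gamma\tilde\alpha(r)$ and $d(r):=1+\gamma\alpha(r)$: (7) $\lim_{r\to\infty}\tilde d(r)|d(r)|/(|\tilde d(r)|d(r))=1$; (8) $\lim_{r\to\infty}(\partial_r(\tilde d/|\tilde d|))(r)=\lim_{r\to\infty}(\partial_r(d/|d|))(r)=0$. **Derived quantities.** $d_0:=\lim_{r\to\infty}\tilde d(r)/|\tilde d(r)|$ and $\tau_*:=\sup_{r>r_1}|\arg(\tilde d(r)/d(r))|$. Radial functions are regarded as functions on $\mathbb{R}^3$ via $f(x):=f(|x|)$. With spherical coordinates $\hat x(\phi,\theta)=(\sin\theta\cos\phi,\sin\theta\sin\phi,\cos\theta)^\top$ let $F:=(\hat x,\ (\sin\theta)^{-1}\partial_\phi\hat x,\ \partial_\theta\hat x)$ (a real orthogonal matrix), $M:=\operatorname{diag}(\tilde d^2,\tilde dd,\tilde dd)$, $\tilde\varsigma:=(\tilde d^2d)^{-1}FMF^*\varsigma FMF^*$. **Operator $A$.** $A(\omega)\in L(H^1_0(\Omega))$ is defined by $$\langle A(\omega)u,u'\rangle_{H^1(\Omega)}:=\langle\tilde\varsigma\nabla u,\nabla u'\rangle_{L^2(\Omega)}-\omega^2\langle\tilde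 d^2d\,u,u'\rangle_{L^2(\Omega)},\quad u,u'\in H^1_0(\Omega).$$ **Operator $T$.** Let $\hat\alpha(r):=\lim_{\rho\to r_1+}\alpha(\rho)$ for $0\le r\le r_1$ and $\hat\alpha(r):=\alpha(r)$ for $r>r_1$; $\hat d(r):=1+\gamma\hat\alpha(r)$; $\hat\tau(r):=\arg(\tilde d(r)/\hat d(r))$; $\hat\psi(r):=\arg\big(\varsigma_{\min}-(1-\cos\tau_* )\varsigma_{\max}-i\varsigma_{\max}\sin\hat\tau(r)\big)$. For $\omega\in\Lambda_{d_0}$, $T(\omega)$ is the multiplication operator on $H^1_0(\Omega)$ $$T(\omega)u:=\begin{cases}\dfrac{|\tilde d|}{\overline{\tilde d}}\,e^{i\hat\psi}u&\text{if }\arg(-\omega^2d_0^2)\in[-\pi,0],\\[3mm]\dfrac{|\tilde d|}{\overline{\tilde d}}\,e^{-i\hat\psi}u&\text{if }\arg(-\omega^2d_0^2)\in(0,\pi).\end{cases}$$ Under the hypotheses of the claim, $T(\omega)\in L(H^1_0(\Omega))$ and is bijective. $T(\omega)^*$ is the adjoint with respect to the $H^1(\Omega)$ inner product. *)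

(* Defs.v *)
From HB Require Import structures.
From mathcomp Require Import all_boot all_order all_algebra.
From mathcomp Require Import complex.
From mathcomp Require Import all_classical all_reals all_analysis.

Set Implicit Arguments.
Unset Strict Implicit.
Unset Printing Implicit Defensive.

Import Order.TTheory GRing.Theory Num.Theory.
Import numFieldNormedType.Exports.

Local Open Scope complex_scope.
Local Open Scope ring_scope.
Local Open Scope classical_set_scope.

Section Complex.
Variable R : realType.

Definition absC (z : R[i]) : R := complex.Re `|z|.

(* Characterized by argP below: values in [-pi, pi) on nonzero z. *)
Definition arg (z : R[i]) : R :=
  let t := acos (complex.Re z / absC z) in
  if (complex.Im z < 0) || ((complex.Im z == 0) && (complex.Re z < 0))
  then - t else t.

Definition expi (t : R) : R[i] := cos t +i* sin t.

Lemma argP (z : R[i]) : z != 0 ->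
  [/\ - pi <= arg z, arg z < pi & z = (absC z)%:C * expi (arg z)].
Proof.
case: z => a b nz; rewrite /arg /absC /expi /=.
set n := Num.sqrt (a ^+ 2 + b ^+ 2).
have n2 : n ^+ 2 = a ^+ 2 + b ^+ 2 by rewrite sqr_sqrtr // addr_ge0 ?sqr_ge0.
have n0 : 0 < n.
  rewrite lt_def sqrtr_ge0 andbT; apply: contra_neq nz => n_0.
  move: n2; rewrite n_0 expr0n /= => /esym/eqP.
  by rewrite paddr_eq0 ?sqr_ge0// !sqrf_eq0 => /andP[/eqP-> /eqP->].
have xE : (a / n) ^+ 2 + (b / n) ^+ 2 = 1.
  by rewrite !expr_div_n -mulrDl -n2 divff// sqrf_eq0 gt_eqF.
have x2 : (a / n) ^+ 2 <= 1 by rewrite -xE lerDl sqr_ge0.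
have x1 : -1 <= a / n <= 1 by rewrite -ler_norml
    -(@ler_sqr _ _ 1) ?nnegrE// expr1n real_normK ?num_real.
have sE : sin (acos (a / n)) = `|b| / n.
  rewrite sin_acos // -[1]xE addrC addKr sqrtr_sqr normrM normfV (gtr0_norm n0) //.
have cosE : cos (acos (a / n)) = a / n by rewrite acosK // in_itv.
have na : n * (a / n) = a by rewrite mulrC divfK ?gt_eqF.
have nb : n * (`|b| / n) = `|b| by rewrite mulrC divfK ?gt_eqF.
case: ifPn => [C|].
  split.
  - by rewrite lerN2 acos_lepi.
  - by rewrite (le_lt_trans _ (pi_gt0 R)) // oppr_le0 acos_ge0.
  - rewrite sinN cosN cosE sE; simpc; rewrite na nb ler0_norm ?opprK //.
    by case/orP: C => [/ltW|/andP[/eqP->]].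
rewrite negb_or negb_and -!leNgt => /andP[b0 C]; split.
- by rewrite (le_trans _ (acos_ge0 x1)) // oppr_le0 pi_ge0.
- case/andP: x1 => xl xr; rewrite acos_ltpi // xr andbT lt_neqAle xl andbT.
  apply/eqP => /esym xN; have aN : a = - n by rewrite -na xN mulrN1.
  have b_0 : b == 0.
    by rewrite -sqrf_eq0; apply/eqP/(addrI (a ^+ 2)); rewrite -n2 aN sqrrN addr0.
  by move: C; rewrite b_0 /= aN leNgt oppr_lt0 n0.
- by rewrite sE cosE; simpc; rewrite na nb ger0_norm.
Qed.

Definition derive1C (f : R -> R[i]) (r : R) : R[i] :=
  derive1 (fun s => complex.Re (f s)) r +i*
  derive1 (fun s => complex.Im (f s)) r.

End Complex.

(* R^3 is the product R * R * R, which carries both the product topology and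
   the product sigma-algebra of the library; its library norm is the maximum
   norm. *)
Section Space.
Variable R : realType.
Local Notation R3 := (R * R * R)%type.

Definition vec (x : R3) : 'cV[R]_3 := \col_i nth 0 [:: x.1.1; x.1.2; x.2] i.

Definition basis3 (i : 'I_3) : R3 :=
  ((i == 0%N :> nat)%:R, (i == 1%N :> nat)%:R, (i == 2%N :> nat)%:R).

Definition enorm (x : R3) : R := Num.sqrt (\sum_i vec x i 0 ^+ 2).

Definition eball (r : R) : set R3 := [set x | enorm x < r].

(* Near every boundary point, after a rotation, the domain is the strict
   epigraph of a Lipschitz function of two variables. *)
Definition lipschitz_domain (Om : set R3) : Prop :=
  open Om /\
  forall x, (closure Om `\` Om) x ->
    exists (Q : 'M[R]_3) (g : R * R -> R) (k : R),
      [/\ Q^T *m Q = 1%:M, k.-lipschitz g &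
          \forall y \near x,
            let z := Q *m vec y in
            Om y <-> g (z 0 0, z 1 0) < z 2 0].

(* R^3 with the Borel product sigma-algebra on which Lebesgue measure lives. *)
Definition mR3 : measurableType _ :=
  (measurableTypeR R * measurableTypeR R * measurableTypeR R)%type.

Definition mu3 : {measure set mR3 -> \bar R} :=
  ((@lebesgue_measure R \x @lebesgue_measure R) \x @lebesgue_measure R)%E.

Definition integralC (Om : set R3) (f : R3 -> R[i]) : R[i] :=
  Rintegral mu3 Om (fun x => complex.Re (f x)) +i*
  Rintegral mu3 Om (fun x => complex.Im (f x)).

Definition partial (i : 'I_3) (f : R3 -> R) : R3 -> R :=
  fun x => 'D_(basis3 i) f x.

Definition smooth (f : R3 -> R) : Prop :=
  forall (s : seq 'I_3) (x : R3), differentiable (foldr partial f s) x.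

Definition partialC (i : 'I_3) (f : R3 -> R[i]) : R3 -> R[i] :=
  fun x => partial i (fun y => complex.Re (f y)) x +i*
           partial i (fun y => complex.Im (f y)) x.

Definition test_function (Om : set R3) (phi : R3 -> R[i]) : Prop :=
  [/\ smooth (fun x => complex.Re (phi x)),
      smooth (fun x => complex.Im (phi x)) &
      exists K : set R3, [/\ compact K, K `<=` Om &
                             forall x, ~ K x -> phi x = 0]].

End Space.

(* Elements of Lebesgue and Sobolev spaces on Om are given by representatives
   R^3 -> C, of which only the values on Om matter, up to equality almost
   everywhere. *)
Section Sobolev.
Variables (R : realType) (Om : set (R * R * R)).
Local Notation R3 := (R * R * R)%type.
Local Notation fct := (R3 -> R[i]).

Definition eq_ae (u v : fct) : Prop :=
  {ae @mu3 R, forall x, Om x -> u x = v x}.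

Definition L2 (u : fct) : Prop :=
  [/\ measurable_fun (Om : set (mR3 R)) (fun x => complex.Re (u x)),
      measurable_fun (Om : set (mR3 R)) (fun x => complex.Im (u x)) &
      (\int[@mu3 R]_(x in Om) ((absC (u x)) ^+ 2)%:E < +oo)%E].

Definition weak_gradient (u : fct) (g : R3 -> 'cV[R[i]]_3) : Prop :=
  (forall i, L2 (fun x => g x i 0)) /\
  forall phi, test_function Om phi -> forall i,
    integralC Om (fun x => u x * partialC i phi x) =
    - integralC Om (fun x => g x i 0 * phi x).

Definition H1 (u : fct) : Prop := L2 u /\ exists g, weak_gradient u g.

(* Some weak gradient of u in L^2(Om)^3; it is unique almost everywhere. *)
Definition grad (u : fct) : R3 -> 'cV[R[i]]_3 :=
  xget (fun=> 0) [set g | weak_gradient u g].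

Definition dotL2 (u v : fct) : R[i] :=
  integralC Om (fun x => u x * (v x)^*).

Definition dotL2v (f g : R3 -> 'cV[R[i]]_3) : R[i] :=
  integralC Om (fun x => \sum_i f x i 0 * (g x i 0)^*).

Definition dotH1 (u v : fct) : R[i] := dotL2 u v + dotL2v (grad u) (grad v).

Definition normH1 (u : fct) : R := Num.sqrt (complex.Re (dotH1 u u)).

Definition H10 (u : fct) : Prop :=
  H1 u /\ forall e : R, 0 < e ->
    exists2 phi, test_function Om phi & normH1 (fun x => u x - phi x) < e.

(* Linearity is modulo equality almost everywhere; with the bound, it makes
   the operator compatible with that equality. *)
Definition bounded_operator (B : fct -> fct) : Prop :=
  [/\ forall u, H10 u -> H10 (B u),
      forall (a : R[i]) u v, H10 u -> H10 v ->
        eq_ae (B (fun x => a * u x + v x)) (fun x => a * B u x + B v x) &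
      exists C : R, forall u, H10 u -> normH1 (B u) <= C * normH1 u].

Definition compact_operator (B : fct -> fct) : Prop :=
  bounded_operator B /\
  forall u_ : nat -> fct,
    (forall n, H10 (u_ n)) -> (exists C : R, forall n, normH1 (u_ n) <= C) ->
    exists (s : nat -> nat) (v : fct),
      [/\ {homo s : m n / (m < n)%N}, H10 v &
          normH1 (fun x => B (u_ (s n)) x - v x) @[n --> \oo] --> (0 : R)].

(* The bounded operator on H^1_0(Om) that represents a bounded sesquilinear
   form b, i.e. <B u, v> = b(u, v); Riesz gives existence, and uniqueness up to
   equality almost everywhere. *)
Definition represents (b : fct -> fct -> R[i]) (B : fct -> fct) : Prop :=
  bounded_operator B /\
  forall u v, H10 u -> H10 v -> dotH1 (B u) v = b u v.

Definition form_operator (b : fct -> fct -> R[i]) : fct -> fct :=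
  xget (fun=> fun=> 0) [set B | represents b B].

(* <B^* u, v> = <u, B v>. *)
Definition adjoint (B : fct -> fct) : fct -> fct :=
  form_operator (fun u v => dotH1 u (B v)).

Definition weakly_T_coercive (T A : fct -> fct) : Prop :=
  exists2 K, compact_operator K &
    (0%:E < ereal_inf
      [set (absC (dotH1 (fun x => adjoint T (A u) x + K u x) u) /
            normH1 u ^+ 2)%:E
       | u in [set u | H10 u /\ ~ eq_ae u (fun=> 0%R)]])%E.

End Sobolev.

Section Eigenvalues.
Variable R : realType.
Implicit Type s : 'M[R]_3.

Definition sym_posdef s : Prop :=
  s^T = s /\ forall v : 'cV[R]_3, v != 0 -> 0 < (v^T *m s *m v) 0 0.

Definition eig_min s : R := inf [set a | eigenvalue s a].
Definition eig_max s : R := sup [set a | eigenvalue s a].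

End Eigenvalues.

Section Scaling.
Variables (R : realType) (r1 : R) (gamma : R[i]) (ta : R -> R).
Local Notation R3 := (R * R * R)%type.

Definition alpha (r : R) : R := if r1 < r then r * derive1 ta r + ta r else 0.

Definition dtilde (r : R) : R[i] := 1 + gamma * (ta r)%:C.
Definition dfun (r : R) : R[i] := 1 + gamma * (alpha r)%:C.

Record scaling_assumptions : Prop := {
  gammaP : 0 <= complex.Re gamma /\ 0 < complex.Im gamma;
  ta_ge0 : forall r : R, 0 <= r -> 0 <= ta r;
  ta_eq0 : forall r : R, 0 <= r -> r <= r1 -> ta r = 0;
  ta_continuous : {within `[0, +oo[, continuous ta};
  ta_gt0 : forall r, r1 < r -> 0 < ta r;
  ta_nondecreasing : forall r s : R, 0 <= r -> r <= s -> ta r <= ta s;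
  ta_C2 : forall r, r1 < r ->
    [/\ derivable ta r 1, derivable (derive1 ta) r 1 &
        {for r, continuous (derive1n 2 ta)}];
  ta_C2_extends : cvg (derive1 ta r @[r --> r1^'+]) /\
                  cvg (derive1n 2 ta r @[r --> r1^'+]);
  ta_alpha_bounded : exists C : R, forall r : R, 0 <= r ->
    `|ta r| <= C /\ `|alpha r| <= C;
  phase_ratio_lim :
    dtilde r * `|dfun r| / (`|dtilde r| * dfun r) @[r --> +oo] --> (1 : R[i]^o);
  phase_derive_lim :
    derive1C (fun s => dtilde s / `|dtilde s|) r @[r --> +oo] --> (0 : R[i]^o) /\
    derive1C (fun s => dfun s / `|dfun s|) r @[r --> +oo] --> (0 : R[i]^o)
}.

Definition d0 : R[i] := lim ((dtilde r / `|dtilde r| : R[i]^o) @[r --> +oo]).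

Definition tau_star : R :=
  sup [set `|arg (dtilde r / dfun r)| | r in [set r : R | r1 < r]].

Definition Lambda : set R[i] := [set z | complex.Re ('i%C * z * d0) != 0].

Definition xhat (phi theta : R) : 'cV[R]_3 :=
  \col_i nth 0 [:: sin theta * cos phi; sin theta * sin phi; cos theta] i.

(* Spherical coordinates; x = |x| xhat(phi, theta) for x != 0. *)
Definition sph_phi (x : R3) : R := arg (x.1.1 +i* x.1.2).
Definition sph_theta (x : R3) : R := acos (x.2 / enorm x).

Definition Fmx (x : R3) : 'M[R]_3 :=
  let phi := sph_phi x in let theta := sph_theta x in
  \matrix_(i, j) nth 0
    [:: xhat phi theta i 0;
        (sin theta)^-1 * derive1 (fun p => xhat p theta i 0) phi;
        derive1 (fun t => xhat phi t i 0) theta] j.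

Definition Mmx (r : R) : 'M[R[i]]_3 :=
  diag_mx (\row_j nth 0 [:: dtilde r ^+ 2; dtilde r * dfun r;
                            dtilde r * dfun r] j).

Variables (sigma : 'M[R]_3) (Om : set R3) (omega : R[i]).

Definition sigma_tilde (x : R3) : 'M[R[i]]_3 :=
  let r := enorm x in
  let F := map_mx (real_complex R) (Fmx x) in
  let FMF := F *m Mmx r *m F^T in
  (dtilde r ^+ 2 * dfun r)^-1 *:
    (FMF *m map_mx (real_complex R) sigma *m FMF).

Definition scaled_form (u v : R3 -> R[i]) : R[i] :=
  dotL2v Om (fun x => sigma_tilde x *m grad Om u x) (grad Om v)
  - omega ^+ 2 *
    dotL2 Om (fun x => dtilde (enorm x) ^+ 2 * dfun (enorm x) * u x) v.

Definition opA : (R3 -> R[i]) -> R3 -> R[i] := form_operator Om scaled_form.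

Definition alpha_hat (r : R) : R :=
  if r1 < r then alpha r else lim (alpha rho @[rho --> r1^'+]).

Definition d_hat (r : R) : R[i] := 1 + gamma * (alpha_hat r)%:C.

Definition tau_hat (r : R) : R := arg (dtilde r / d_hat r).

Definition psi_hat (r : R) : R :=
  arg ((eig_min sigma - (1 - cos tau_star) * eig_max sigma) -i*
       (eig_max sigma * sin (tau_hat r))).

(* As arg < pi, and arg (- omega ^+ 2 * d0 ^+ 2) != - pi for omega in Lambda,
   the sign of the argument separates the two cases. *)
Definition opT (u : R3 -> R[i]) : R3 -> R[i] := fun x =>
  let r := enorm x in
  `|dtilde r| / (dtilde r)^* *
  (if arg (- omega ^+ 2 * d0 ^+ 2) <= 0
   then expi (psi_hat r) else expi (- psi_hat r)) * u x.

End Scaling.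

(* Main.v *)
(** The sesquilinear form of [T^* A] has, off the polar axis, the integrand
    [conj t * (sigma~ g . conj g) - omega^2 d~^2 d conj t |u|^2] plus a term carrying the
    gradient of the multiplier [t].  The spherical frame reduces [sigma~] to
    [d * P sigma P], where [P] scales the radial direction by [q = d~ / d].  Splitting off
    the phase of [q] exhibits [sigma~ g . conj g] as [d] times that phase times a number
    [Z] with [Re Z >= k0 N] and [|Im Z| <= k1 N], where [k0 = s_min - (1 - cos tau_star) s_max > 0],
    [k1 = - s_max sin tau_hat >= 0] and [N] dominates [|g|^2]; the phase of [t] leaves
    [|d| (k0 -+ i k1) Z / |k0 + i k1|].  Multiplication by [eta +- i] with [eta > 0] small makes
    the real part of this at least a multiple of [|g|^2], and does the same to the limit
    [- omega^2 d_0^2] of the normalized zero order coefficient.  As [grad t] vanishes at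
    infinity, only the [L^2] norm of [u] on a ball is left uncontrolled.  A Poincare
    inequality on small cubes bounds it by a small multiple of the [H^1] norm and
    finitely many averages of [u], so the compact operator can be taken of finite rank.

    That [t u] stays in [H^1_0] is shown by approximating the profile of [t], as a function
    of [|x|^2], by Bernstein polynomials: a polynomial in [|x|^2] times a test function is a
    test function. *)
From HB Require Import structures.
Require Import Defs.
From mathcomp Require Import all_boot all_order all_algebra.
From mathcomp Require Import complex.
From mathcomp Require Import all_classical all_reals all_analysis.
From mathcomp Require Import measurable_realfun ring lra.
Import Order.TTheory GRing.Theory Num.Theory.
Import numFieldNormedType.Exports.
Local Open Scope complex_scope.
Local Open Scope ring_scope.
Local Open Scope classical_set_scope.
Set Implicit Arguments.
Unset Strict Implicit.
Unset Printing Implicit Defensive.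

(** * Real and complex L2 functions *)

(** With [theta = arctan (k1 / k0)], the values [Z] lie in the sector [|arg Z| <= theta], and the
    factor [k0 -+ i k1] turns it into [[-2 theta, 0]] or [[0, 2 theta]]. The sign is the one for
    which [nu = - omega^2 d_0^2] lies in the same closed half plane. So multiplication by [+-i]
    makes both real parts nonnegative, and [eta] makes them positive: [2 theta] stays away from [pi]
    because [k1] is bounded and [k0 > 0], and [nu] is not a negative real number because [omega] is
    in [Lambda]. The bounds on [Z] rest on [P = e^(i tau) (cos tau + i sin tau S) P^H], with [tau]
    the argument of [q], [S] the reflection fixing the radial direction and [P^H] the adjoint of
    [P]. The derivative of the profile of [t] may jump at [r1]. The derivatives of the Bernstein
    polynomials converge off that sphere, a null set, under a uniform bound, so dominated
    convergence applies. The cubes of the Poincare inequality may cross the boundary of [Om]: the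
    inequality is proved for test functions, which vanish off [Om], and passes to [H^1_0] by
    density. *)

Section RealL2.
Context d (T : measurableType d) (R : realType) (mu : {measure set T -> \bar R}).
Variables (D : set T) (mD : measurable D).
Implicit Types (f g h : T -> R).

Definition L2r f := measurable_fun D f /\
  (\int[mu]_(x in D) ((f x) ^+ 2)%:E < +oo)%E.

Definition ipr f g : R := \int[mu]_(x in D) (f x * g x).

Lemma iprE f g : ipr f g = \int[mu]_(x in D) (f x * g x).
Proof. by []. Qed.

Lemma L2r_measurable f : L2r f -> measurable_fun D f.
Proof. by case. Qed.

Lemma L2r_sqr_integrable f : L2r f ->
  mu.-integrable D (EFin \o (fun x => f x ^+ 2)).
Proof.
case=> mf fi; apply/integrableP; split.
  by apply/measurable_EFinP; exact: measurable_funX.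
rewrite (eq_integral (fun x => ((f x) ^+ 2)%:E)) // => x _ /=.
by rewrite ger0_norm ?sqr_ge0.
Qed.

Lemma L2r_intro f g : measurable_fun D f ->
  mu.-integrable D (EFin \o g) -> (forall x, D x -> f x ^+ 2 <= g x) -> L2r f.
Proof.
move=> mf ig fg; split=> //.
have : mu.-integrable D (EFin \o (fun x => f x ^+ 2)).
  apply: (@le_integrable _ _ _ mu D mD _ (EFin \o g)) => //.
    by apply/measurable_EFinP; exact: measurable_funX.
  move=> x Dx /=; rewrite lee_fin ger0_norm ?sqr_ge0// (le_trans (fg _ Dx))//.
  exact: ler_norm.
case/integrableP => _; rewrite (eq_integral (fun x => ((f x) ^+ 2)%:E)) // => x _ /=.
by rewrite ger0_norm ?sqr_ge0.
Qed.

Lemma L2r_mul_integrable f g : L2r f -> L2r g ->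
  mu.-integrable D (EFin \o (fun x => f x * g x)).
Proof.
move=> Lf Lg.
have := integrableD mD (L2r_sqr_integrable Lf) (L2r_sqr_integrable Lg).
apply: le_integrable => //.
  by apply/measurable_EFinP/measurable_funM; [case: Lf|case: Lg].
move=> x Dx /=; rewrite lee_fin [leRHS]ger0_norm ?addr_ge0 ?sqr_ge0// normrM.
rewrite -[f x ^+ 2]real_normK ?num_real// -[g x ^+ 2]real_normK ?num_real//.
have := sqr_ge0 (`|f x| - `|g x|); have := normr_ge0 (f x); have := normr_ge0 (g x).
nra.
Qed.

Lemma L2rD f g : L2r f -> L2r g -> L2r (fun x => f x + g x).
Proof.
move=> Lf Lg.
have := integrableZl mD 2 (integrableD mD (L2r_sqr_integrable Lf) (L2r_sqr_integrable Lg)).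
move=> /L2r_intro; apply.
  by apply: measurable_funD; [case: Lf|case: Lg].
move=> x Dx /=; have := sqr_ge0 (f x - g x); nra.
Qed.

Lemma L2rM (m : T -> R) f (C : R) : measurable_fun D m -> (forall x, D x -> `|m x| <= C) ->
  L2r f -> L2r (fun x => m x * f x).
Proof.
move=> mm mC Lf.
have := integrableZl mD (C ^+ 2) (L2r_sqr_integrable Lf).
move=> /L2r_intro; apply; first by apply: measurable_funM => //; case: Lf.
move=> x Dx /=; rewrite exprMn ler_wpM2r ?sqr_ge0//.
by rewrite -[m x ^+ 2]real_normK ?num_real// lerXn2r ?nnegrE ?(le_trans _ (mC x Dx)) ?mC.
Qed.

Lemma L2rZ a f : L2r f -> L2r (fun x => a * f x).
Proof. by move=> Lf; apply: (@L2rM (fun=> a) f `|a|). Qed.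

Lemma L2rN f : L2r f -> L2r (fun x => - f x).
Proof.
by move=> /(L2rZ (-1)); congr L2r; apply/funext => x; rewrite mulN1r.
Qed.

Lemma L2rB f g : L2r f -> L2r g -> L2r (fun x => f x - g x).
Proof. by move=> Lf Lg; apply: L2rD => //; exact: L2rN. Qed.

Lemma L2r0 : L2r (fun=> 0).
Proof.
split; first exact: measurable_cst.
by rewrite expr0n /= integral0_eq// ltry.
Qed.

Lemma iprC f g : ipr f g = ipr g f.
Proof. by apply: eq_Rintegral => x _; rewrite mulrC. Qed.

Lemma iprDl f g h : L2r f -> L2r g -> L2r h ->
  ipr (fun x => f x + g x) h = ipr f h + ipr g h.
Proof.
move=> Lf Lg Lh; rewrite /ipr -RintegralD//; last 2 first.
- exact: L2r_mul_integrable.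
- exact: L2r_mul_integrable.
by apply: eq_Rintegral => x _; rewrite mulrDl.
Qed.

Lemma iprZl a f h : L2r f -> L2r h -> ipr (fun x => a * f x) h = a * ipr f h.
Proof.
move=> Lf Lh; rewrite /ipr -RintegralZl//; last exact: L2r_mul_integrable.
by apply: eq_Rintegral => x _; rewrite mulrA.
Qed.

Lemma iprr_ge0 f : 0 <= ipr f f.
Proof. by apply: Rintegral_ge0 => x _; rewrite -expr2 sqr_ge0. Qed.

Lemma iprrE f : L2r f -> (ipr f f)%:E = (\int[mu]_(x in D) ((f x) ^+ 2)%:E)%E.
Proof.
case=> _ fi; rewrite /ipr /Rintegral fineK.
  by apply: eq_integral => x _; rewrite expr2.
rewrite ge0_fin_numE; first by under eq_integral do rewrite -expr2.
by apply: integral_ge0 => x _; rewrite lee_fin -expr2 sqr_ge0.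
Qed.

Lemma iprr_eq0 f : L2r f -> ipr f f = 0 -> {ae mu, forall x, D x -> f x = 0}.
Proof.
move=> Lf f0; have := iprrE Lf; rewrite f0 => /esym i0.
have /(ae_eq_integral_abs mu mD) : measurable_fun D (EFin \o (fun x => f x ^+ 2)).
  by apply/measurable_EFinP; apply: measurable_funX; case: Lf.
case=> + _; rewrite (eq_integral (fun x => ((f x) ^+ 2)%:E)); last first.
  by move=> x _ /=; rewrite ger0_norm ?sqr_ge0.
move=> /(_ i0); apply: filterS => x /= h Dx.
by have [/eqP] := h Dx; rewrite sqrf_eq0 => /eqP.
Qed.

Lemma ae_ipr f f' g g' :
  measurable_fun D f -> measurable_fun D f' ->
  measurable_fun D g -> measurable_fun D g' ->
  {ae mu, forall x, D x -> f x = f' x} -> {ae mu, forall x, D x -> g x = g' x} ->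
  ipr f g = ipr f' g'.
Proof.
move=> mf mf' mg mg' ff gg; congr fine; apply: ae_eq_integral => //.
- by apply/measurable_EFinP/measurable_funM.
- by apply/measurable_EFinP/measurable_funM.
by apply: filterS2 ff gg => x fx gx Dx /=; rewrite fx// gx.
Qed.

Lemma le_iprr f g : L2r f -> L2r g -> (forall x, D x -> f x ^+ 2 <= g x ^+ 2) ->
  ipr f f <= ipr g g.
Proof.
move=> Lf Lg fg; rewrite /ipr; apply: le_Rintegral => //.
- exact: L2r_mul_integrable.
- exact: L2r_mul_integrable.
Qed.

Lemma iprr_dominated (f_ : nat -> T -> R) f g :
  (forall n, L2r (f_ n)) -> L2r f -> L2r g ->
  {ae mu, forall x, D x -> f_ n x @[n --> \oo] --> f x} ->
  (forall n x, D x -> `|f_ n x - f x| <= g x) ->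
  ipr (fun x => f_ n x - f x) (fun x => f_ n x - f x) @[n --> \oo] --> (0 : R).
Proof.
move=> Lf_ Lf Lg ff fg.
have mf n : measurable_fun D (EFin \o (fun x => (f_ n x - f x) ^+ 2)).
  apply/measurable_EFinP/measurable_funX/measurable_funB; [by case: (Lf_ n)|by case: Lf].
have [] := @dominated_convergence _ _ _ mu D mD
   (fun n => EFin \o (fun x => (f_ n x - f x) ^+ 2)) (cst 0%E)
   (EFin \o (fun x => g x ^+ 2)) mf _ _ (L2r_sqr_integrable Lg) _.
- exact: measurable_cst.
- apply: filterS ff => x /[apply] h.
  have : (f_ n x - f x) ^+ 2 @[n --> \oo] --> (0:R).
    rewrite -[X in _ --> X](_ : (f x - f x) ^+ 2 = 0); last by rewrite subrr expr0n.
    rewrite expr2; under eq_fun do rewrite expr2.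
    by apply: cvgM; apply: cvgB => //; exact: cvg_cst.
  by move=> h0; apply/fine_cvgP; split; [exact: nearW|exact: h0].
- apply: aeW => x n Dx /=; rewrite lee_fin ger0_norm ?sqr_ge0//.
  rewrite -real_normK ?num_real// lerXn2r ?nnegrE ?fg//.
  exact: le_trans (fg n x Dx).
move=> _ _; rewrite /= integral0 => /fine_cvgP[_].
apply: cvg_trans; apply: near_eq_cvg; near=> n.
by rewrite /ipr /Rintegral /=; congr fine; apply: eq_integral => x _; rewrite expr2.
Unshelve. all: by end_near. Qed.

(** The Riesz-Fischer argument: the sum [F] of the [4^k g_k^2] has integral at most 1, so it is
    finite almost everywhere, and where it is finite [|g_k| <= sqrt F 2^-k] makes the telescoping
    series of the [g_k] converge. *)
Lemma L2r_rapid (f_ : nat -> T -> R) : (forall n, L2r (f_ n)) ->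
  (forall k, ipr (fun x => f_ k.+1 x - f_ k x) (fun x => f_ k.+1 x - f_ k x) <=
             1 / (2 ^ k.+1)%:R / (2 ^ k)%:R ^+ 2) ->
  exists (f : T -> R) (h_ : nat -> T -> R),
    [/\ forall n, measurable_fun D (h_ n),
        forall n, {ae mu, forall x, D x -> h_ n x = f_ n x},
        measurable_fun D f &
        forall x, D x -> h_ n x @[n --> \oo] --> f x].
Proof.
move=> Lf small.
pose g k x := f_ k.+1 x - f_ k x.
have Lg k : L2r (g k) by exact: L2rB.
pose w k x := ((2 ^ k)%:R ^+ 2 * g k x ^+ 2)%:E.
have w0 k x : (0 <= w k x)%E by rewrite lee_fin mulr_ge0 ?sqr_ge0.
have mw k : measurable_fun D (w k).
  apply/measurable_EFinP; apply: measurable_funM; first exact: measurable_cst.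
  by apply: measurable_funX; case: (Lg k).
pose F x := (\sum_(0 <= k <oo) w k x)%E.
have F0 x : (0 <= F x)%E by apply: nneseries_ge0.
have mF : measurable_fun D F by apply: ge0_emeasurable_sum.
have iF : mu.-integrable D F.
  apply/integrableP; split => //.
  under eq_integral do rewrite gee0_abs//.
  rewrite integral_nneseries//.
  apply: (@le_lt_trans _ _ 1%:E); last exact: ltry.
  apply: le_trans (@epsilon_trick0 R 1 xpredT ler01).
  apply: lee_nneseries => [k _ _|k _]; first exact: integral_ge0.
  rewrite /w; under eq_integral do rewrite EFinM.
  rewrite ge0_integralZl_EFin ?sqr_ge0//; last 2 first.
  - by move=> x _; rewrite lee_fin sqr_ge0.
  - by apply/measurable_EFinP/measurable_funX; case: (Lg k).
  rewrite -iprrE// -EFinM lee_fin mulrC -ler_pdivlMr ?small// exprn_gt0// ltr0n expn_gt0.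
have aeF := integrable_ae mD iF.
(* Replacing [f_ n] by 0 where [F] is infinite makes the sequence converge at every point, so that
   its limit is measurable. *)
pose h_ n x := if (F x < +oo)%E then f_ n x else 0.
have mh n : measurable_fun D (h_ n).
  apply: measurable_fun_if => //.
  - by apply: measurable_fun_lte => //; exact: measurable_cst.
  - by apply: measurable_funS (L2r_measurable (Lf n)) => // x [].
have ch x : cvgn (h_ ^~ x).
  rewrite /h_; case: (boolP (F x < +oo)%E) => [Fx|_]; last exact: is_cvg_cst.
  have Ffin : F x \is a fin_num by rewrite ge0_fin_numE.
  pose M := fine (F x).
  have gM k : (2 ^ k)%:R ^+ 2 * g k x ^+ 2 <= M.
    rewrite -lee_fin /M fineK//.
    apply: le_trans (nneseries_lim_ge k.+1 _); last by move=> n _ _.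
    rewrite big_nat_recr//= leeDr//.
    by apply: sume_ge0.
  have M0 : 0 <= M by rewrite fine_ge0.
  have cg : cvgn (series (fun k => g k x)).
    apply: normed_cvg.
    apply: (@series_le_cvg _ _ (geometric (Num.sqrt M) (2^-1))) => //.
    - by move=> n /=.
    - move=> n /=; rewrite mulr_ge0 ?sqrtr_ge0// exprn_ge0// invr_ge0.
    - move=> n /=.
      rewrite exprVn ler_pdivlMr ?exprn_gt0// -[leLHS]ger0_norm ?mulr_ge0//.
      rewrite -sqrtr_sqr ler_wsqrtr// exprMn real_normK ?num_real// mulrC.
      by rewrite -natrX gM.
    - by apply: is_cvg_geometric_series; rewrite ger0_norm ?invr_ge0// invf_lt1// ltr1n.
  have -> : f_ ^~ x = (fun n => f_ 0%N x + series (fun k => g k x) n).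
    apply/funext => n.
    by rewrite (eq_sum_telescope (f_ ^~ x) n).
  by apply: is_cvgD => //; exact: is_cvg_cst.
exists (fun x => limn (h_ ^~ x)), h_; split => //.
- move=> n; apply: filterS aeF => x /[apply].
  by rewrite ge0_fin_numE// /h_ => ->.
- by apply: (measurable_fun_cvg mh) => x Dx; exact: ch.
Qed.

Lemma limn_einf_le (u : nat -> \bar R) (e : \bar R) :
  (\forall n \near \oo, u n <= e)%E -> (limn_einf u <= e)%E.
Proof.
move=> ue; rewrite limn_einf_lim; apply: lime_le; first exact: is_cvg_einfs.
apply: filterS ue => n; apply: le_trans.
by apply: ereal_inf_lbound; exists n => /=.
Qed.

(** A rapidly Cauchy subsequence has a pointwise limit, and Fatou's lemma along it bounds the
    distance of every late [f_ n] to that limit. Hence the whole sequence converges, not only the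
    subsequence. *)
Lemma L2r_complete (f_ : nat -> T -> R) : (forall n, L2r (f_ n)) ->
  (forall e, 0 < e -> exists N, forall m n, (N <= m)%N -> (N <= n)%N ->
     ipr (fun x => f_ m x - f_ n x) (fun x => f_ m x - f_ n x) <= e) ->
  exists2 f, L2r f & forall e, 0 < e -> exists N, forall n, (N <= n)%N ->
     ipr (fun x => f_ n x - f x) (fun x => f_ n x - f x) <= e.
Proof.
move=> Lf cauchy.
have /boolp.choice [N hN] : forall k, exists N, forall m n,
    (N <= m)%N -> (N <= n)%N ->
    ipr (fun x => f_ m x - f_ n x) (fun x => f_ m x - f_ n x) <=
      1 / (2 ^ k.+1)%:R / (2 ^ k)%:R ^+ 2.
  move=> k.
  apply: cauchy.
  by rewrite !divr_gt0// ?exprn_gt0// ltr0n expn_gt0.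
(* Partial sums of [N] give indices that dominate [N k] and do not decrease; the summand [k] in [r]
   below makes them tend to infinity as well. *)
pose s k := (\sum_(j < k.+1) N j)%N.
have sN k : (N k <= s k)%N by rewrite /s big_ord_recr/= leq_addl.
have sS k : (s k <= s k.+1)%N by rewrite /s [leqRHS]big_ord_recr/= leq_addr.
have sk k : (k <= s k + k)%N by rewrite leq_addl.
pose r k := (s k + k)%N.
have rN k m : (k <= m)%N -> (s k <= s m)%N.
  by elim: m => [|m ih]; [rewrite leqn0 => /eqP->|
    rewrite leq_eqVlt => /predU1P[->//|]; rewrite ltnS => /ih/leq_trans; apply].
have [f [h_ [mh hf mf hcvg]]] : exists (f : T -> R) (h_ : nat -> T -> R),
    [/\ forall n, measurable_fun D (h_ n),
        forall n, {ae mu, forall x, D x -> h_ n x = f_ (r n) x},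
        measurable_fun D f &
        forall x, D x -> h_ n x @[n --> \oo] --> f x].
  apply: L2r_rapid => [n|k]; first exact: Lf.
  have h1 : (N k <= r k)%N by exact: leq_trans (sN k) (leq_addr _ _).
  have h2 : (N k <= r k.+1)%N.
    exact: leq_trans (sN k) (leq_trans (sS k) (leq_addr _ _)).
  exact: hN h2 h1.
have mfn n : measurable_fun D (f_ n) by exact: L2r_measurable.
have key (e : R) : 0 < e -> exists M, forall n, (M <= n)%N ->
    (\int[mu]_(x in D) ((f_ n x - f x) ^+ 2)%:E <= e%:E)%E.
  move=> e0; have [M hM] := cauchy e e0; exists M => n Mn.
  have -> : (\int[mu]_(x in D) ((f_ n x - f x) ^+ 2)%:E =
      \int[mu]_(x in D) limn_einf (fun k => ((f_ n x - h_ k x) ^+ 2)%:E))%E.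
    apply: eq_integral => x; rewrite inE => Dx.
    have : ((f_ n x - h_ k x) ^+ 2)%:E @[k --> \oo] --> ((f_ n x - f x) ^+ 2)%:E.
      apply/fine_cvgP; split; first exact: nearW.
      rewrite /= expr2; under eq_fun do rewrite /= expr2.
      by apply: cvgM; apply: cvgB; [exact: cvg_cst|exact: hcvg|exact: cvg_cst|exact: hcvg].
    by move=> /cvg_limn_einf_sup [].
  apply: le_trans.
    apply: fatou => //.
    - move=> k; apply/measurable_EFinP/measurable_funX/measurable_funB => //.
    - by move=> k x _; rewrite lee_fin sqr_ge0.
  apply: limn_einf_le; near=> k.
  have -> : (\int[mu]_(x in D) ((f_ n x - h_ k x) ^+ 2)%:E =
             \int[mu]_(x in D) ((f_ n x - f_ (r k) x) ^+ 2)%:E)%E.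
    apply: ae_eq_integral => //.
    - by apply/measurable_EFinP/measurable_funX/measurable_funB.
    - by apply/measurable_EFinP/measurable_funX/measurable_funB.
    by apply: filterS (hf k) => x h Dx; rewrite h.
  rewrite -iprrE; last exact: L2rB.
  rewrite lee_fin hM// /r.
  apply: leq_trans (leq_addl _ _).
  by near: k; exists M.
have Lff : L2r f.
  have [M hM] := key 1 ltr01.
  have L1 : L2r (fun x => f_ M x - f x).
    split; first exact: measurable_funB.
    by apply: le_lt_trans (hM M (leqnn M)) _; rewrite ltry.
  by have := L2rB (Lf M) L1; congr L2r; apply/funext => x; rewrite subKr.
exists f => // e /key[M hM]; exists M => n Mn.
by rewrite -lee_fin iprrE ?hM//; exact: L2rB.
Unshelve. all: by end_near. Qed.

End RealL2.

(** * Components and modulus of complex numbers *)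

Section ComplexComponents.
Variable R : realType.
Implicit Types (x y z : R[i]) (k : R).
Local Notation Re := complex.Re.
Local Notation Im := complex.Im.

Lemma complex_eq x y : Re x = Re y -> Im x = Im y -> x = y.
Proof. by case: x y => [a b] [c d] /= -> ->. Qed.

Lemma ReD x y : Re (x + y) = Re x + Re y. Proof. by case: x y => [? ?] []. Qed.
Lemma ImD x y : Im (x + y) = Im x + Im y. Proof. by case: x y => [? ?] []. Qed.
Lemma ReN x : Re (- x) = - Re x. Proof. by case: x. Qed.
Lemma ImN x : Im (- x) = - Im x. Proof. by case: x. Qed.
Lemma ReM x y : Re (x * y) = Re x * Re y - Im x * Im y.
Proof. by case: x y => [? ?] []. Qed.
Lemma ImM x y : Im (x * y) = Re x * Im y + Im x * Re y.
Proof. by case: x y => [? ?] []. Qed.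
Lemma ReJ x : Re x^* = Re x. Proof. by case: x. Qed.
Lemma ImJ x : Im x^* = - Im x. Proof. by case: x. Qed.
Lemma ReC k : Re k%:C = k. Proof. by []. Qed.
Lemma ImC k : Im k%:C = 0. Proof. by []. Qed.
Lemma Re0 : Re 0 = 0 :> R. Proof. by []. Qed.
Lemma Im0 : Im 0 = 0 :> R. Proof. by []. Qed.
Lemma Re1 : Re 1 = 1 :> R. Proof. by []. Qed.
Lemma Im1 : Im 1 = 0 :> R. Proof. by []. Qed.
Lemma Rei : Re 'i%C = 0 :> R. Proof. by []. Qed.
Lemma Imi : Im 'i%C = 1 :> R. Proof. by []. Qed.
Lemma Re_sum (I : Type) (r : seq I) (P : pred I) (F : I -> R[i]) :
  Re (\sum_(i <- r | P i) F i) = \sum_(i <- r | P i) Re (F i).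
Proof. by elim/big_rec2: _ => // i y x _ <-; rewrite ReD. Qed.
Lemma Im_sum (I : Type) (r : seq I) (P : pred I) (F : I -> R[i]) :
  Im (\sum_(i <- r | P i) F i) = \sum_(i <- r | P i) Im (F i).
Proof. by elim/big_rec2: _ => // i y x _ <-; rewrite ImD. Qed.

Definition ReImE := (ReD, ImD, ReN, ImN, ReM, ImM, ReJ, ImJ, ReC, ImC,
  Re0, Im0, Re1, Im1, Rei, Imi).

Lemma absCE z : `|z| = (absC z)%:C. Proof. by rewrite /absC normc_def. Qed.

Lemma absC_def z : absC z = Num.sqrt (Re z ^+ 2 + Im z ^+ 2).
Proof. by rewrite /absC normc_def. Qed.

Lemma absC_sqr z : absC z ^+ 2 = Re z ^+ 2 + Im z ^+ 2.
Proof. by rewrite absC_def sqr_sqrtr// addr_ge0// sqr_ge0. Qed.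

Lemma absC_ge0 z : 0 <= absC z. Proof. by rewrite absC_def sqrtr_ge0. Qed.

Lemma absCM x y : absC (x * y) = absC x * absC y.
Proof. by apply: complexI; rewrite -absCE normrM !absCE; simpc. Qed.

Lemma absCD x y : absC (x + y) <= absC x + absC y.
Proof. by rewrite -lecR -absCE (le_trans (ler_normD _ _))// rmorphD/= !absCE. Qed.

Lemma absCN x : absC (- x) = absC x.
Proof. by apply: complexI; rewrite -!absCE normrN. Qed.

Lemma absCJ x : absC x^* = absC x.
Proof. by rewrite !absC_def !ReImE sqrrN. Qed.

Lemma absCV x : absC x^-1 = (absC x)^-1.
Proof.
by apply: complexI; rewrite -absCE normfV absCE fmorphV.
Qed.

Lemma absCR k : absC k%:C = `|k|.
Proof. by rewrite absC_def !ReImE expr0n addr0 sqrtr_sqr. Qed.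

Lemma absC0 : absC 0 = 0 :> R. Proof. by rewrite (absCR 0) normr0. Qed.
Lemma absC1 : absC 1 = 1 :> R. Proof. by rewrite (absCR 1) normr1. Qed.

Lemma absC_eq0 z : (absC z == 0) = (z == 0).
Proof. by rewrite -[RHS]normr_eq0 absCE eq_complex/= eqxx andbT. Qed.

Lemma absC_gt0 z : (0 < absC z) = (z != 0).
Proof. by rewrite lt_def absC_ge0 andbT absC_eq0. Qed.

Lemma absCX z n : absC (z ^+ n) = absC z ^+ n.
Proof. by elim: n => [|n ih]; rewrite ?expr0 ?absC1// !exprS absCM ih. Qed.

Lemma ReZ_absC z : `|Re z| <= absC z.
Proof.
rewrite absC_def -sqrtr_sqr ler_wsqrtr// lerDl sqr_ge0//.
Qed.

Lemma ImZ_absC z : `|Im z| <= absC z.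
Proof.
rewrite absC_def -sqrtr_sqr ler_wsqrtr// lerDr sqr_ge0//.
Qed.

Lemma absC_le z : absC z <= `|Re z| + `|Im z|.
Proof.
rewrite -ler_sqr ?nnegrE ?absC_ge0 ?addr_ge0// absC_sqr.
rewrite sqrrD !real_normK ?num_real// addrAC lerDl mulrn_wge0// mulr_ge0//.
Qed.

Lemma mulJ_absC z : z * z^* = (absC z ^+ 2)%:C.
Proof.
apply: complex_eq; rewrite absC_sqr !ReImE; first by rewrite mulrN opprK !expr2.
by rewrite mulrN mulrC addrC subrr.
Qed.

Lemma conjcD x y : (x + y)^* = x^* + y^*. Proof. exact: rmorphD. Qed.
Lemma conjcM x y : (x * y)^* = x^* * y^*. Proof. exact: rmorphM. Qed.
Lemma conjcN x : (- x)^* = - x^*. Proof. exact: rmorphN. Qed.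

Lemma conjC_real k : (k%:C)^* = k%:C.
Proof. by apply: complex_eq; rewrite ?ReJ ?ImJ ?oppr0. Qed.
Lemma conjCi_K z : (z^*)^* = z.
Proof. by apply: complex_eq; rewrite ?ReJ ?ImJ ?ReJ ?opprK. Qed.

End ComplexComponents.

(** * Semidefinite inner products on spaces of representatives *)

Section PreHilbert.
Variables (T : Type) (R : realType).
Local Notation V := (T -> R[i]).
Local Notation Re := complex.Re.
Local Notation Im := complex.Im.
Implicit Types (u v w : V) (a : R[i]).

(** Vectors are functions, not classes modulo almost everywhere equality, so the form is only
    required to be semidefinite. Definiteness is recovered where it matters by [normH1_eq0]. *)
Record prehilbert (dom : V -> Prop) (ip : V -> V -> R[i]) : Prop := {
  ph_dom0 : dom (fun=> 0);
  ph_domD : forall u v, dom u -> dom v -> dom (fun x => u x + v x);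
  ph_domZ : forall a u, dom u -> dom (fun x => a * u x);
  ph_ipDl : forall u v w, dom u -> dom v -> dom w ->
    ip (fun x => u x + v x) w = ip u w + ip v w;
  ph_ipZl : forall a u w, dom u -> dom w -> ip (fun x => a * u x) w = a * ip u w;
  ph_ipC : forall u v, dom u -> dom v -> ip v u = (ip u v)^*;
  ph_ip_ge0 : forall u, dom u -> 0 <= Re (ip u u)
}.

Definition hnorm (ip : V -> V -> R[i]) u : R := Num.sqrt (Re (ip u u)).

Definition ph_complete (dom : V -> Prop) (ip : V -> V -> R[i]) : Prop :=
  forall u_ : nat -> V, (forall n, dom (u_ n)) ->
  (forall e, 0 < e -> exists N, forall m n, (N <= m)%N -> (N <= n)%N ->
     hnorm ip (fun x => u_ m x - u_ n x) <= e) ->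
  exists2 u, dom u & forall e, 0 < e -> exists N, forall n, (N <= n)%N ->
     hnorm ip (fun x => u_ n x - u x) <= e.

Variables (dom : V -> Prop) (ip : V -> V -> R[i]).
Hypothesis H : prehilbert dom ip.
Local Notation nrm := (hnorm ip).

Lemma ph_domN u : dom u -> dom (fun x => - u x).
Proof.
by move=> /(ph_domZ H (-1)); congr dom; apply/funext => x; rewrite mulN1r.
Qed.

Lemma ph_domB u v : dom u -> dom v -> dom (fun x => u x - v x).
Proof. by move=> du dv; apply: (ph_domD H) => //; exact: ph_domN. Qed.

Lemma ph_ipNl u v : dom u -> dom v -> ip (fun x => - u x) v = - ip u v.
Proof.
move=> du dv; rewrite -mulN1r -(ph_ipZl H)//.
by congr ip; apply/funext => x; rewrite mulN1r.
Qed.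

Lemma ph_ipBl u v w : dom u -> dom v -> dom w ->
  ip (fun x => u x - v x) w = ip u w - ip v w.
Proof.
by move=> du dv dw; rewrite (ph_ipDl H)// ?ph_ipNl//; exact: ph_domN.
Qed.

Lemma ph_ipDr u v w : dom u -> dom v -> dom w ->
  ip w (fun x => u x + v x) = ip w u + ip w v.
Proof.
move=> du dv dw; rewrite (ph_ipC H) ?(ph_ipDl H)//; last exact: (ph_domD H).
by rewrite conjcD -!(ph_ipC H).
Qed.

Lemma ph_ipZr a u w : dom u -> dom w ->
  ip w (fun x => a * u x) = a^* * ip w u.
Proof.
move=> du dw; rewrite (ph_ipC H) ?(ph_ipZl H)//; last exact: (ph_domZ H).
by rewrite conjcM -(ph_ipC H).
Qed.

Lemma ph_ipBr u v w : dom u -> dom v -> dom w ->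
  ip w (fun x => u x - v x) = ip w u - ip w v.
Proof.
move=> du dv dw; rewrite (ph_ipC H) ?ph_ipBl//; last exact: ph_domB.
by rewrite conjcD conjcN -!(ph_ipC H).
Qed.

Lemma ph_ReC u v : dom u -> dom v -> Re (ip v u) = Re (ip u v).
Proof. by move=> du dv; rewrite (ph_ipC H du dv) ReJ. Qed.

Lemma nrm_ge0 u : 0 <= nrm u. Proof. exact: sqrtr_ge0. Qed.

Lemma nrm_sqr u : dom u -> nrm u ^+ 2 = Re (ip u u).
Proof. by move=> du; rewrite sqr_sqrtr// (ph_ip_ge0 H). Qed.

Lemma nrmZ a u : dom u -> nrm (fun x => a * u x) = absC a * nrm u.
Proof.
move=> du; apply: (pexpIrn (n := 2)) => //;
  rewrite ?nnegrE ?nrm_ge0 ?mulr_ge0 ?absC_ge0 ?nrm_ge0//.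
rewrite exprMn !nrm_sqr//; last exact: (ph_domZ H).
rewrite (ph_ipZl H) ?ph_ipZr//; last exact: (ph_domZ H).
by rewrite mulrA mulJ_absC ReM ReC ImC mul0r subr0.
Qed.

Lemma nrmN u : dom u -> nrm (fun x => - u x) = nrm u.
Proof.
move=> du; have := nrmZ (-1) du; rewrite absCN absC1 mul1r => <-.
by congr nrm; apply/funext => x; rewrite mulN1r.
Qed.

Lemma nrm0 : nrm (fun=> 0) = 0.
Proof.
by have := nrmZ 0 (ph_dom0 H); rewrite absC0 !mul0r.
Qed.

Lemma nrm_sqrD u v : dom u -> dom v ->
  nrm (fun x => u x + v x) ^+ 2 = nrm u ^+ 2 + nrm v ^+ 2 + 2 * Re (ip u v).
Proof.
move=> du dv; rewrite !nrm_sqr//; last exact: (ph_domD H).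
rewrite (ph_ipDl H) ?ph_ipDr//; last exact: (ph_domD H).
by rewrite !ReD (ph_ReC du dv); ring.
Qed.

Lemma nrm_sqrB u v : dom u -> dom v ->
  nrm (fun x => u x - v x) ^+ 2 = nrm u ^+ 2 + nrm v ^+ 2 - 2 * Re (ip u v).
Proof.
move=> du dv; rewrite !nrm_sqr//; last exact: ph_domB.
rewrite ph_ipBl ?ph_ipBr//; last exact: ph_domB.
by rewrite !ReD !ReN ReD ReN (ph_ReC du dv); ring.
Qed.

(** The polynomial [|u - t v|^2 >= 0] in the real variable [t]. As the form is only semidefinite, a
    vector of norm zero need not be zero, and the cases where [v] or [u] has norm zero each need
    their own [t]. *)
Lemma ph_CS_Re u v : dom u -> dom v -> Re (ip u v) <= nrm u * nrm v.
Proof.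
move=> du dv.
have key (t : R) : 0 <= nrm u ^+ 2 + t ^+ 2 * nrm v ^+ 2 - 2 * t * Re (ip u v).
  have dtv := ph_domZ H t%:C dv.
  have := sqr_ge0 (nrm (fun x => u x - t%:C * v x)).
  rewrite nrm_sqrB// nrmZ// ph_ipZr// absCR exprMn real_normK ?num_real//.
  by rewrite conjC_real ReM ReC ImC mul0r subr0 mulrA.
have nu := nrm_ge0 u; have nv := nrm_ge0 v.
have [v0|v0] := eqVneq (nrm v) 0.
  rewrite v0 mulr0 leNgt; apply/negP => r0.
  (* With [nrm v = 0] the polynomial is affine in [t], and this [t] gives it the value -1. *)
  have := key ((nrm u ^+ 2 + 1) / (2 * Re (ip u v))).
  rewrite v0 expr0n/= mulr0 addr0.
  have -> : 2 * ((nrm u ^+ 2 + 1) / (2 * Re (ip u v))) * Re (ip u v) = nrm u ^+ 2 + 1.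
    by field; rewrite gt_eqF.
  by rewrite opprD addrA subrr sub0r oppr_ge0 ler10.
have v1 : 0 < nrm v by rewrite lt_def v0.
have [u0|u0] := eqVneq (nrm u) 0.
  rewrite u0 mul0r leNgt; apply/negP => r0.
  have := key (Re (ip u v) / nrm v ^+ 2).
  rewrite u0 expr0n/= add0r expr_div_n.
  have -> : Re (ip u v) ^+ 2 / (nrm v ^+ 2) ^+ 2 * nrm v ^+ 2 =
    Re (ip u v) ^+ 2 / nrm v ^+ 2 by field.
  have -> : Re (ip u v) ^+ 2 / nrm v ^+ 2 - 2 * (Re (ip u v) / nrm v ^+ 2) * Re (ip u v) =
    - (Re (ip u v) ^+ 2 / nrm v ^+ 2) by field.
  by rewrite oppr_ge0 leNgt divr_gt0// exprn_gt0.
have u1 : 0 < nrm u by rewrite lt_def u0.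
have := key (nrm u / nrm v).
have -> : nrm u ^+ 2 + (nrm u / nrm v) ^+ 2 * nrm v ^+ 2 - 2 * (nrm u / nrm v) * Re (ip u v) =
  2 * (nrm u / nrm v) * (nrm u * nrm v - Re (ip u v)) by field.
by rewrite pmulr_rge0 ?mulr_gt0 ?invr_gt0// subr_ge0.
Qed.

(** Multiplying [u] by the conjugate of [ip u v] turns the inner product into the real number
    [|ip u v|^2], which the bound on real parts controls. *)
Lemma ph_CS u v : dom u -> dom v -> absC (ip u v) <= nrm u * nrm v.
Proof.
move=> du dv; have [->|z0] := eqVneq (ip u v) 0.
  by rewrite absC0 mulr_ge0 ?nrm_ge0.
have a0 : 0 < absC (ip u v) by rewrite absC_gt0.
have dw := ph_domZ H (ip u v)^* du.
have := ph_CS_Re dw dv; rewrite (ph_ipZl H)// nrmZ// absCJ mulrC mulJ_absC.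
by rewrite ReC expr2 -mulrA ler_pM2l.
Qed.

Lemma nrmD u v : dom u -> dom v -> nrm (fun x => u x + v x) <= nrm u + nrm v.
Proof.
move=> du dv; rewrite -ler_sqr ?nnegrE ?addr_ge0 ?nrm_ge0// nrm_sqrD// sqrrD.
have := ph_CS_Re du dv; rewrite mulr2n; lra.
Qed.

Lemma nrm_distC u v : dom u -> dom v ->
  nrm (fun x => u x - v x) = nrm (fun x => v x - u x).
Proof.
move=> du dv; rewrite -nrmN; last exact: ph_domB.
by congr nrm; apply/funext => x; rewrite opprB.
Qed.

Lemma nrm_triangle w u v : dom u -> dom v -> dom w ->
  nrm (fun x => u x - v x) <= nrm (fun x => u x - w x) + nrm (fun x => w x - v x).
Proof.
move=> du dv dw; apply: le_trans (nrmD (ph_domB du dw) (ph_domB dw dv)).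
rewrite le_eqVlt; apply/orP; left; apply/eqP; congr nrm.
by apply/funext => x; rewrite addrA subrK.
Qed.

Lemma nrm_parallelogram u v : dom u -> dom v ->
  nrm (fun x => u x + v x) ^+ 2 + nrm (fun x => u x - v x) ^+ 2 =
  2 * nrm u ^+ 2 + 2 * nrm v ^+ 2.
Proof. by move=> du dv; rewrite nrm_sqrD// nrm_sqrB//; ring. Qed.

Lemma nrm_sub_le u v : dom u -> dom v -> nrm u <= nrm v + nrm (fun x => u x - v x).
Proof.
move=> du dv; apply: le_trans (nrmD dv (ph_domB du dv)).
rewrite le_eqVlt; apply/orP; left; apply/eqP; congr nrm.
by apply/funext => x; rewrite addrC subrK.
Qed.

End PreHilbert.

(** * Riesz representation of functionals and of sesquilinear forms *)

Section Riesz.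
Variables (T : Type) (R : realType).
Local Notation V := (T -> R[i]).
Local Notation Re := complex.Re.
Local Notation Im := complex.Im.
Variables (dom : V -> Prop) (ip : V -> V -> R[i]).
Hypothesis H : prehilbert dom ip.
Hypothesis complete : ph_complete dom ip.
Local Notation nrm := (hnorm ip).

(* The representing vector is the limit of a minimizing sequence of
   |v|^2 - 2 Re (l v), which is Cauchy by the parallelogram identity. *)
Lemma riesz_Re (l : V -> R) (C : R) :
  (forall u v, dom u -> dom v -> l (fun x => u x + v x) = l u + l v) ->
  (forall (t : R) v, dom v -> l (fun x => t%:C * v x) = t * l v) ->
  (forall v, dom v -> `|l v| <= C * nrm v) ->
  exists2 w, dom w & forall v, dom v -> Re (ip w v) = l v.
Proof.
move=> lD lZ lC.
pose J v := nrm v ^+ 2 - 2 * l v.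
pose E := [set J v | v in dom].
have J_lb v : dom v -> - C ^+ 2 <= J v.
  move=> dv; have := lC v dv; have := ler_norm (l v).
  have := sqr_ge0 (nrm v - C); rewrite /J; nra.
have E0 : E !=set0 by exists (J (fun=> 0)), (fun=> 0) => //; exact: (ph_dom0 H).
have Elb : has_lbound E by exists (- C ^+ 2) => _ [v dv <-]; exact: J_lb.
have hE : has_inf E by split.
pose m := inf E.
have mJ v : dom v -> m <= J v by move=> dv; apply: (ge_inf Elb); exists v.
have /boolp.choice [v_ hv_] : forall n : nat, exists v, dom v /\ J v < m + n.+1%:R^-1.
  move=> n; have [_ [v dv <-] Jv] := @inf_adherent _ E n.+1%:R^-1 (eqbRL (invr_gt0 _) (ltr0Sn _ _)) hE.
  by exists v.
have dv_ n : dom (v_ n) by case: (hv_ n).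
have Jv_ n : J (v_ n) < m + n.+1%:R^-1 by case: (hv_ n).
have hhalf : absC (2^-1)%:C = 2^-1 :> R.
  by rewrite absCR ger0_norm// invr_ge0.
(* The parallelogram identity: [J] at the midpoint is at least [m], while [J (v_ n)] and [J (v_ p)]
   exceed [m] by less than [1/(n+1)] and [1/(p+1)]. *)
have dist n p : nrm (fun x => v_ n x - v_ p x) ^+ 2 <= 2 * n.+1%:R^-1 + 2 * p.+1%:R^-1.
  have dh := ph_domZ H (2^-1)%:C (ph_domD H (dv_ n) (dv_ p)).
  have := mJ _ dh; rewrite /J (nrmZ H)//; last exact: (ph_domD H).
  rewrite lZ; last exact: (ph_domD H).
  rewrite lD// hhalf exprMn.
  have := nrm_parallelogram H (dv_ n) (dv_ p).
  have := Jv_ n; have := Jv_ p; rewrite /J.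
  move: (n.+1%:R^-1) (p.+1%:R^-1) (l (v_ n)) (l (v_ p)) => rn rp a b.
  move: (nrm (v_ n) ^+ 2) (nrm (v_ p) ^+ 2) => c e.
  have -> : 2^-1 ^+ 2 = 4^-1 :> R by rewrite expr2; lra.
  move: (nrm _ ^+ 2) (nrm _ ^+ 2) => f g; lra.
have inv_small (e : R) : 0 < e -> exists N, forall n, (N <= n)%N -> n.+1%:R^-1 <= e.
  move=> e0; exists (Num.truncn e^-1) => n Nn.
  rewrite -[leRHS]invrK lef_pV2 ?posrE ?invr_gt0 ?ltr0Sn//.
  apply/ltW; apply: lt_le_trans (truncnS_gt _) _.
  by rewrite ler_nat ltnS.
have [|w dw hw] := complete dv_.
  move=> e e0; have [|N hN] := inv_small (e ^+ 2 / 4).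
    by rewrite divr_gt0// exprn_gt0.
  exists N => n p Nn Np; rewrite -ler_sqr ?nnegrE ?nrm_ge0 ?(ltW e0)//.
  apply: le_trans (dist n p) _; move: (hN _ Nn) (hN _ Np).
  by move: (n.+1%:R^-1) (p.+1%:R^-1) (e ^+ 2) => rn rp e2; lra.
exists w => // v dv.
apply/eqP; rewrite -subr_eq0; apply/eqP; set D := _ - _.
(* Moving from [v_ n] by [t v] cannot bring [J] below [m]; in the limit this is the inequality
   [key2], the first variation of [J] at [w]. *)
have key (t : R) n : - n.+1%:R^-1 <=
    2 * t * (Re (ip (v_ n) v) - l v) + t ^+ 2 * nrm v ^+ 2.
  have dtv := ph_domZ H t%:C dv.
  have := mJ _ (ph_domD H (dv_ n) dtv); rewrite /J (nrm_sqrD H)// (nrmZ H)// lD// lZ//.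
  rewrite (ph_ipZr H)// conjC_real ReM ReC ImC mul0r subr0 absCR exprMn.
  rewrite real_normK ?num_real//; have := Jv_ n; rewrite /J.
  move: (n.+1%:R^-1) (nrm (v_ n) ^+ 2) (nrm v ^+ 2) (Re _) (l (v_ n)) (l v).
  by move=> rn a b c f g; nra.
have key2 (t : R) : 0 <= 2 * t * D + t ^+ 2 * nrm v ^+ 2.
  apply/ler_addgt0Pr => e e0.
  have t1 : 0 < 1 + 2 * `|t| * (1 + nrm v).
    by rewrite ltr_pwDl// !mulr_ge0// addr_ge0// nrm_ge0.
  have e1 : 0 < e / 2 / (1 + 2 * `|t| * (1 + nrm v)) by rewrite !divr_gt0.
  have [N1 h1] := inv_small (e / 2) (divr_gt0 e0 (ltr0Sn _ _)).
  have [N2 h2] := hw _ e1.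
  set n := maxn N1 N2.
  have {}h1 := h1 n (leq_maxl _ _).
  have {}h2 := h2 n (leq_maxr _ _).
  have := key t n; move: (n.+1%:R^-1) h1 => rn h1.
  have := ReZ_absC (ip (fun x => v_ n x - w x) v).
  have dB := ph_domB H (dv_ n) dw.
  rewrite (ph_ipBl H)// ReD ReN => h3.
  have h4 := ph_CS H dB dv; rewrite (ph_ipBl H)// in h4.
  have {h3 h4} h3 := le_trans h3 h4.
  have h5 : 2 * `|t| * `|Re (ip (v_ n) v) - Re (ip w v)| <= e / 2.
    rewrite ler_pdivlMr// in h2.
    apply: le_trans h2.
    apply: (@le_trans _ _ (2 * `|t| * (nrm (fun x => v_ n x - w x) * nrm v))).
      by rewrite ler_wpM2l// mulr_ge0.
    have := nrm_ge0 ip v; have := nrm_ge0 ip (fun x => v_ n x - w x).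
    have := normr_ge0 t; nra.
  have h6 : 2 * (t * (Re (ip (v_ n) v) - Re (ip w v))) <= e / 2.
    by apply: le_trans h5; rewrite -mulrA ler_wpM2l// -normrM ler_norm.
  rewrite /D; move: h1 h6; move: (Re _) (Re _) (l v) (nrm v ^+ 2) => a b c f.
  by clear; nra.
have [//|D0] := eqVneq D 0; exfalso.
have D2 : 0 < D ^+ 2 by rewrite exprn_even_gt0.
have p0 : 0 < 1 + nrm v ^+ 2 by rewrite ltr_pwDl// sqr_ge0.
(* The minimizer would be [- D / nrm v ^+ 2]; the added 1 keeps the denominator positive when [v]
   has norm zero, and the value is still negative. *)
have := key2 (- D / (1 + nrm v ^+ 2)).
have -> : 2 * (- D / (1 + nrm v ^+ 2)) * D +
    (- D / (1 + nrm v ^+ 2)) ^+ 2 * nrm v ^+ 2 =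
    - (D ^+ 2 / (1 + nrm v ^+ 2) ^+ 2 * (2 + nrm v ^+ 2)).
  by field; rewrite gt_eqF.
rewrite oppr_ge0 leNgt => /negP; apply; apply: mulr_gt0.
  by apply: divr_gt0 => //; exact: exprn_gt0.
by rewrite ltr_pwDl// sqr_ge0.
Qed.

(** The imaginary part of [ip w v] is the real part of [ip w (i v)], so representing the real part
    of the conjugate linear [l] represents all of it. *)
Lemma riesz (l : V -> R[i]) (C : R) :
  (forall u v, dom u -> dom v -> l (fun x => u x + v x) = l u + l v) ->
  (forall a v, dom v -> l (fun x => a * v x) = a^* * l v) ->
  (forall v, dom v -> absC (l v) <= C * nrm v) ->
  exists2 w, dom w & forall v, dom v -> ip w v = l v.
Proof.
move=> lD lZ lC.
have [||v dv|w dw hw] := @riesz_Re (fun v => Re (l v)) C.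
- by move=> u v du dv; rewrite lD// ReD.
- by move=> t v dv; rewrite lZ// conjC_real ReM ReC ImC mul0r subr0.
- exact: le_trans (ReZ_absC _) (lC v dv).
exists w => // v dv; apply: complex_eq; first exact: hw.
have := hw _ (ph_domZ H 'i%C dv); rewrite (ph_ipZr H)// lZ//.
by rewrite !ReM !ImJ !ReJ !Rei !Imi !mul0r !mulNr !mul1r !opprK !add0r.
Qed.

(** [B u] is picked separately for each [u], so linearity holds only up to functions of norm zero;
    it is recovered in [bounded_form_represents]. The bound on [B] tests with [v = B u]. *)
Lemma riesz_operator (b : V -> V -> R[i]) (C : R) : 0 <= C ->
  (forall w u v, dom w -> dom u -> dom v ->
     b w (fun x => u x + v x) = b w u + b w v) ->
  (forall a w v, dom w -> dom v -> b w (fun x => a * v x) = a^* * b w v) ->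
  (forall u v, dom u -> dom v -> absC (b u v) <= C * (nrm u * nrm v)) ->
  exists B : V -> V, [/\ forall u, dom u -> dom (B u),
    forall u v, dom u -> dom v -> ip (B u) v = b u v &
    forall u, dom u -> nrm (B u) <= C * nrm u].
Proof.
move=> C0 bD bZ bC.
have /boolp.choice[B hB] : forall u, exists w, dom u ->
    dom w /\ forall v, dom v -> ip w v = b u v.
  move=> u; have [du|ndu] := pselect (dom u); last by exists (fun=> 0).
  have [||v dv|w dw hw] := @riesz (b u) (C * nrm u).
  - by move=> v1 v2 d1 d2; rewrite bD.
  - by move=> a v dv; rewrite bZ.
  - by rewrite -mulrA bC.
  by exists w => _.
have dB u : dom u -> dom (B u) by move=> /hB[].
have eB u v : dom u -> dom v -> ip (B u) v = b u v by move=> /hB[_]; exact.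
exists B; split => // u du.
have [n0|n0] := eqVneq (nrm (B u)) 0; first by rewrite n0 mulr_ge0// nrm_ge0.
have n1 : 0 < nrm (B u) by rewrite lt_def n0 nrm_ge0.
rewrite -(ler_pM2r n1) -expr2 (nrm_sqr H); last exact: dB.
rewrite eB//; last exact: dB.
apply: le_trans (ler_norm _) _; apply: le_trans (ReZ_absC _) _.
by rewrite -mulrA; apply: bC => //; exact: dB.
Qed.

End Riesz.

(** * Complex L^2 over an abstract measure space *)

Section ComplexL2.
Context d (T : measurableType d) (R : realType) (mu : {measure set T -> \bar R}).
Variables (Om : set T) (mOm : measurable Om).
Local Notation fct := (T -> R[i]).
Local Notation Re := complex.Re.
Local Notation Im := complex.Im.
Implicit Types (u v w : fct).

Local Notation re u := (fun x => Re (u x)).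
Local Notation im u := (fun x => Im (u x)).
Local Notation L2r := (L2r mu Om).
Local Notation ipr := (ipr mu Om).

Definition intC (f : fct) : R[i] :=
  Rintegral mu Om (re f) +i* Rintegral mu Om (im f).

Definition L2c u : Prop :=
  [/\ measurable_fun Om (re u), measurable_fun Om (im u) &
      (\int[mu]_(x in Om) ((absC (u x)) ^+ 2)%:E < +oo)%E].

Definition dotc u v : R[i] := intC (fun x => u x * (v x)^*).

Definition aeqc u v : Prop := {ae mu, forall x, Om x -> u x = v x}.

Lemma L2P u : L2c u <-> L2r (re u) /\ L2r (im u).
Proof.
split=> [[mr mi ui]|[lr li]].
  have iu : mu.-integrable Om (EFin \o (fun x => absC (u x) ^+ 2)).
    apply/integrableP; split.
      apply/measurable_EFinP; under eq_fun do rewrite absC_sqr.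
      by apply: measurable_funD; exact: measurable_funX.
    rewrite (eq_integral (fun x => (absC (u x) ^+ 2)%:E)) // => x _ /=.
    by rewrite ger0_norm ?sqr_ge0.
  by split; apply: (L2r_intro mOm _ iu) => // x _; rewrite absC_sqr ?lerDl ?lerDr sqr_ge0.
split; [by case: lr|by case: li|].
have := integrableD mOm (L2r_sqr_integrable lr) (L2r_sqr_integrable li).
case/integrableP => _; apply: le_lt_trans; rewrite le_eqVlt; apply/orP; left; apply/eqP.
apply: eq_integral => x _ /=.
by rewrite ger0_norm ?addr_ge0 ?sqr_ge0// absC_sqr.
Qed.

Lemma L2_re u : L2c u -> L2r (re u). Proof. by move/L2P => []. Qed.
Lemma L2_im u : L2c u -> L2r (im u). Proof. by move/L2P => []. Qed.

Lemma dotcE u v : L2c u -> L2c v ->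
  dotc u v = (ipr (re u) (re v) + ipr (im u) (im v)) +i*
                 (ipr (im u) (re v) - ipr (re u) (im v)).
Proof.
move=> /L2P[ru iu] /L2P[rv iv]; rewrite /dotc /intC; congr (_ +i* _).
  rewrite -RintegralD//; last 2 first.
  - exact: L2r_mul_integrable.
  - exact: L2r_mul_integrable.
  by apply: eq_Rintegral => x _; rewrite !ReImE mulrN opprK.
rewrite -RintegralB//; last 2 first.
- exact: L2r_mul_integrable.
- exact: L2r_mul_integrable.
by apply: eq_Rintegral => x _; rewrite !ReImE mulrN addrC.
Qed.

Lemma L2D u v : L2c u -> L2c v -> L2c (fun x => u x + v x).
Proof.
move=> /L2P[ru iu] /L2P[rv iv]; apply/L2P; split.
  by under eq_fun do rewrite ReD; exact: L2rD.
by under eq_fun do rewrite ImD; exact: L2rD.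
Qed.

Lemma L2M (m : fct) u (C : R) :
  measurable_fun Om (re m) ->
  measurable_fun Om (im m) ->
  (forall x, Om x -> absC (m x) <= C) -> L2c u -> L2c (fun x => m x * u x).
Proof.
move=> mr mi mC /L2P[ru iu].
have rC x : Om x -> `|Re (m x)| <= C by move=> /mC; exact/le_trans/ReZ_absC.
have iC x : Om x -> `|Im (m x)| <= C by move=> /mC; exact/le_trans/ImZ_absC.
apply/L2P; split.
  under eq_fun do rewrite ReM.
  apply: L2rB => //; [exact: (L2rM mOm mr rC)|exact: (L2rM mOm mi iC)].
under eq_fun do rewrite ImM.
apply: L2rD => //; [exact: (L2rM mOm mr rC)|exact: (L2rM mOm mi iC)].
Qed.

Lemma L2Z a u : L2c u -> L2c (fun x => a * u x).
Proof. by apply: (@L2M (fun=> a) u (absC a)) => //. Qed.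

Lemma L20 : L2c (fun=> 0).
Proof. by apply/L2P; split; exact: L2r0. Qed.

Lemma L2_prehilbert : prehilbert (L2c) (dotc).
Proof.
split; [exact: L20|exact: L2D|exact: L2Z|..].
- move=> u v w Lu Lv Lw; rewrite !dotcE//; last exact: L2D.
  under [fun x => Re (u x + v x)]eq_fun do rewrite ReD.
  under [fun x => Im (u x + v x)]eq_fun do rewrite ImD.
  move/L2P: Lu => [ru iu]; move/L2P: Lv => [rv iv]; move/L2P: Lw => [rw iw].
  rewrite !iprDl//.
  apply: complex_eq; rewrite !(ReD, ImD) /=; ring.
- move=> a u w Lu Lw; rewrite !dotcE//; last exact: L2Z.
  under [fun x => Re (a * u x)]eq_fun do rewrite ReM -mulNr.
  under [fun x => Im (a * u x)]eq_fun do rewrite ImM.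
  move/L2P: Lu => [ru iu]; move/L2P: Lw => [rw iw].
  rewrite !iprDl ?iprZl//; try exact: L2rZ.
  apply: complex_eq; rewrite !(ReM, ImM) /=; ring.
- move=> u v Lu Lv; rewrite !dotcE//.
  apply: complex_eq; rewrite !ReImE/= ![ipr (re v) _]iprC ![ipr (im v) _]iprC //.
  by rewrite opprB.
- move=> u Lu; rewrite dotcE//= addr_ge0//; exact: iprr_ge0.
Qed.
Local Notation PH := L2_prehilbert.

Lemma dotc_sqr u : L2c u ->
  Re (dotc u u) = ipr (re u) (re u) + ipr (im u) (im u).
Proof. by move=> Lu; rewrite dotcE. Qed.

Lemma L2_ph_complete : ph_complete (L2c) (dotc).
Proof.
move=> u_ Lu cauchy.
have sub n p : Re (dotc (fun x => u_ n x - u_ p x) (fun x => u_ n x - u_ p x)) =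
   ipr (fun x => re (u_ n) x - re (u_ p) x) (fun x => re (u_ n) x - re (u_ p) x) +
   ipr (fun x => im (u_ n) x - im (u_ p) x) (fun x => im (u_ n) x - im (u_ p) x).
  rewrite dotc_sqr; last exact: (ph_domB PH).
  by congr (ipr _ _ + ipr _ _); apply/funext => x; rewrite !ReImE.
have C2 e : 0 < e -> exists N, forall m n, (N <= m)%N -> (N <= n)%N ->
    Re (dotc (fun x => u_ m x - u_ n x) (fun x => u_ m x - u_ n x)) <= e.
  move=> e0; have [|N hN] := cauchy (Num.sqrt e); first by rewrite sqrtr_gt0.
  exists N => m n Nm Nn; have := hN m n Nm Nn.
  by rewrite /hnorm ler_sqrt// ltW.
have [||fr Lfr hr] := @L2r_complete _ _ _ mu _ mOm (fun n => re (u_ n)).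
- by move=> n; exact: L2_re.
- move=> e /C2[N hN]; exists N => m n Nm Nn.
  apply: le_trans (hN m n Nm Nn); rewrite sub lerDl; exact: iprr_ge0.
have [||fi Lfi hi] := @L2r_complete _ _ _ mu _ mOm (fun n => im (u_ n)).
- by move=> n; exact: L2_im.
- move=> e /C2[N hN]; exists N => m n Nm Nn.
  apply: le_trans (hN m n Nm Nn); rewrite sub lerDr; exact: iprr_ge0.
exists (fun x => fr x +i* fi x); first by apply/L2P.
have Lf : L2c (fun x => fr x +i* fi x) by apply/L2P.
move=> e e0; have e2 : 0 < e ^+ 2 / 2 by rewrite divr_gt0// exprn_gt0.
have [N1 h1] := hr _ e2; have [N2 h2] := hi _ e2.
exists (maxn N1 N2) => n; rewrite geq_max => /andP[/h1 r1 /h2 i1].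
rewrite -ler_sqr ?nnegrE ?nrm_ge0 ?(ltW e0)// (nrm_sqr PH); last exact: (ph_domB PH).
rewrite dotc_sqr; last exact: (ph_domB PH).
under [fun x => Re _]eq_fun do rewrite !ReImE/=.
under [fun x => Im _]eq_fun do rewrite !ReImE/=.
move: r1 i1; move: (ipr _ _) (ipr _ _) => a b ha hb; lra.
Qed.

Lemma ae_dotc u u' v v' : L2c u -> L2c u' -> L2c v -> L2c v' ->
  aeqc u u' -> aeqc v v' -> dotc u v = dotc u' v'.
Proof.
move=> /[dup] Lu /L2P[[? _] [? _]] /[dup] Lu' /L2P[[? _] [? _]].
move=> /[dup] Lv /L2P[[? _] [? _]] /[dup] Lv' /L2P[[? _] [? _]] uu vv.
have aer w w' : aeqc w w' -> {ae mu, forall x, Om x -> re w x = re w' x}.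
  by apply: filterS => x h /h ->.
have aei w w' : aeqc w w' -> {ae mu, forall x, Om x -> im w x = im w' x}.
  by apply: filterS => x h /h ->.
rewrite !dotcE//.
rewrite (ae_ipr mOm _ _ _ _ (aer _ _ uu) (aer _ _ vv))//.
rewrite (ae_ipr mOm _ _ _ _ (aei _ _ uu) (aei _ _ vv))//.
rewrite (ae_ipr mOm _ _ _ _ (aei _ _ uu) (aer _ _ vv))//.
by rewrite (ae_ipr mOm _ _ _ _ (aer _ _ uu) (aei _ _ vv)).
Qed.

Lemma L2_nrm_eq0 u : L2c u -> Re (dotc u u) = 0 -> aeqc u (fun=> 0).
Proof.
move=> Lu; rewrite dotc_sqr// => /eqP; rewrite paddr_eq0 ?iprr_ge0//.
move=> /andP[/eqP/(iprr_eq0 mOm (L2_re Lu)) r0 /eqP/(iprr_eq0 mOm (L2_im Lu)) i0].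
by apply: filterS2 r0 i0 => x r0 i0 Ox; apply: complex_eq; [exact: r0|exact: i0].
Qed.

Lemma le_nrm_L2 u v : L2c u -> L2c v ->
  (forall x, Om x -> absC (u x) <= absC (v x)) ->
  hnorm dotc u <= hnorm dotc v.
Proof.
move=> Lu Lv uv; rewrite ler_wsqrtr//.
have E w : L2c w -> Re (dotc w w) = ipr (fun x => absC (w x)) (fun x => absC (w x)).
  move=> Lw; rewrite dotc_sqr// !iprE -RintegralD//; last 2 first.
  - by apply: L2r_mul_integrable => //; exact: L2_re.
  - by apply: L2r_mul_integrable => //; exact: L2_im.
  by apply: eq_Rintegral => x _; rewrite -!expr2 absC_sqr.
have La w : L2c w -> L2r (fun x => absC (w x)).
  move=> [mr mi wi]; split=> //.
  under eq_fun do rewrite absC_def.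
  apply: (measurableT_comp (continuous_measurable_fun (@sqrt_continuous R))) => //.
  by apply: measurable_funD; exact: measurable_funX.
rewrite !E//; apply: le_iprr => //; [exact: La|exact: La|].
by move=> x Ox; rewrite lerXn2r ?nnegrE ?absC_ge0// uv.
Qed.

Lemma nrm_L2M (m : fct) u (C : R) :
  measurable_fun Om (re m) ->
  measurable_fun Om (im m) ->
  (forall x, Om x -> absC (m x) <= C) -> L2c u ->
  hnorm dotc (fun x => m x * u x) <= `|C| * hnorm dotc u.
Proof.
move=> mr mi mC Lu; rewrite -absCR -(nrmZ PH)//.
apply: le_nrm_L2; [exact: (L2M mr mi mC)|exact: L2Z|].
move=> x Ox; rewrite !absCM ler_wpM2r ?absC_ge0// absCR (le_trans (mC x Ox))//.
exact: ler_norm.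
Qed.

Lemma L2_dominated (u_ : nat -> fct) u (g : T -> R) :
  (forall n, L2c (u_ n)) -> L2c u -> L2r g ->
  {ae mu, forall x, Om x -> (Re (u_ n x) @[n --> \oo] --> Re (u x)) /\
                            (Im (u_ n x) @[n --> \oo] --> Im (u x))} ->
  (forall n x, Om x -> absC (u_ n x - u x) <= g x) ->
  hnorm dotc (fun x => u_ n x - u x) @[n --> \oo] --> (0 : R).
Proof.
move=> Lu_ Lu Lg cv ug.
have hr := @iprr_dominated _ _ _ mu _ mOm (fun n => re (u_ n)) (re u) g
  (fun n => L2_re (Lu_ n)) (L2_re Lu) Lg.
have hi := @iprr_dominated _ _ _ mu _ mOm (fun n => im (u_ n)) (im u) g
  (fun n => L2_im (Lu_ n)) (L2_im Lu) Lg.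
have {}hr : ipr (fun x => Re (u_ n x) - Re (u x)) (fun x => Re (u_ n x) - Re (u x))
    @[n --> \oo] --> (0 : R).
  apply: hr; first by apply: filterS cv => x /[apply] -[].
  by move=> n x Ox; rewrite -ReN -ReD; exact: le_trans (ReZ_absC _) (ug n x Ox).
have {}hi : ipr (fun x => Im (u_ n x) - Im (u x)) (fun x => Im (u_ n x) - Im (u x))
    @[n --> \oo] --> (0 : R).
  apply: hi; first by apply: filterS cv => x /[apply] -[].
  by move=> n x Ox; rewrite -ImN -ImD; exact: le_trans (ImZ_absC _) (ug n x Ox).
rewrite /hnorm -[X in _ --> X](@sqrtr0 R).
apply: continuous_cvg; first exact: sqrt_continuous.
rewrite -(addr0 0).
under eq_fun => n.
  rewrite dotc_sqr; last exact: (ph_domB PH).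
  over.
apply: cvgD.
  under eq_fun => n.
    under [fun x => Re _]eq_fun do rewrite ReD ReN.
    over.
  exact: hr.
under eq_fun => n.
  under [fun x => Im _]eq_fun do rewrite ImD ImN.
  over.
exact: hi.
Qed.

End ComplexL2.

(** * Smooth functions and integration by parts *)

Section BorelR3.
Variable R : realType.
Local Notation R3 := (R * R * R)%type.
Implicit Types (x c : R3) (e : R).

Definition obox c e : set R3 := [set x | [/\ `|x.1.1 - c.1.1| < e,
  `|x.1.2 - c.1.2| < e & `|x.2 - c.2| < e]].

Definition cbox c e : set R3 := [set x | [/\ `|x.1.1 - c.1.1| <= e,
  `|x.1.2 - c.1.2| <= e & `|x.2 - c.2| <= e]].

Lemma nbhs_obox (U : set R3) x : nbhs x U <-> exists2 e, 0 < e & obox x e `<=` U.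
Proof.
rewrite -nbhs_ballE; split=> [[e /= e0 eU]|[e e0 eU]].
  exists e => // y [h1 h2 h3]; apply: eU; split; first split; rewrite /ball/= distrC//.
exists e => // y [[h1 h2] h3]; apply: eU; split; rewrite distrC; [exact: h1|exact: h2|exact: h3].
Qed.

Lemma obox_measurable c e : measurable (obox c e : set (mR3 R)).
Proof.
have -> : obox c e = ([set t | `|t - c.1.1| < e] `*` [set t | `|t - c.1.2| < e])
    `*` [set t | `|t - c.2| < e].
  by apply/seteqP; split => [x [h1 h2 h3]|x [[h1 h2] h3]].
have op (k : R) : measurable ([set t | `|t - k| < e] : set (measurableTypeR R)).
  rewrite (_ : [set t | _] = ball k e).
    by apply: open_measurable; exact: ball_open_nbhs || exact: ball_open.
  by apply/seteqP; split => t /=; rewrite /ball/= distrC.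
exact: measurableX (measurableX (op _) (op _)) (op _).
Qed.

(** Boxes with rational centre and radius [1/(k+1)], kept when even the closed box lies in [U]: the
    closed box is compact and later supports test functions of [U]. *)
Lemma open_bigcup_obox (U : set R3) : open U ->
  exists B : nat -> set R3, U = \bigcup_n B n /\
    forall n, B n = set0 \/ exists c e, [/\ 0 < e, B n = obox c e & cbox c e `<=` U].
Proof.
move=> oU.
pose rc (t : rat * rat * rat * nat) : R3 :=
  (ratr t.1.1.1, ratr t.1.1.2, ratr t.1.2).
pose re (t : rat * rat * rat * nat) : R := t.2.+1%:R^-1.
pose B n := if unpickle n is Some t then
  if `[< cbox (rc t) (re t) `<=` U >] then obox (rc t) (re t) else set0 else set0.
exists B; split; last first.
  move=> n; rewrite /B; case: unpickle => [t|]; last by left.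
  case: asboolP => [tU|_]; last by left.
  by right; exists (rc t), (re t); split => //; rewrite invr_gt0.
apply/seteqP; split => [x Ux|x [n _]]; last first.
  rewrite /B; case: unpickle => [t|//]; case: asboolP => // tU [h1 h2 h3].
  by apply: tU; split; exact: ltW.
have /nbhs_obox[e e0 eU] : nbhs x U by exact: open_nbhs_nbhs.
have e2 : 0 < (e / 2)^-1 by rewrite invr_gt0 divr_gt0.
(* A radius below [e / 2]: a closed box of this radius, centred at a rational point closer than this
   to [x], stays within [e] of [x]. *)
pose k := Num.truncn (e / 2)^-1.
have ke : k.+1%:R^-1 < e / 2.
  rewrite -[ltRHS]invrK ltf_pV2 ?posrE ?ltr0Sn ?invr_gt0 ?divr_gt0//.
  exact: truncnS_gt.
have k0 : 0 < k.+1%:R^-1 :> R by rewrite invr_gt0.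
have rat_near (y : R) : exists q : rat, `|y - ratr q| < k.+1%:R^-1.
  have [|q] := @rat_in_itvoo R (y - k.+1%:R^-1) (y + k.+1%:R^-1).
    by rewrite ltrBlDr -addrA ltrDl addr_gt0.
  rewrite in_itv/= => /andP[q1 q2]; exists q.
  rewrite ltr_norml; move: q1 q2; move: (k.+1%:R^-1) (ratr q) => w z q1 q2.
  by apply/andP; split; lra.
have [q1 h1] := rat_near x.1.1; have [q2 h2] := rat_near x.1.2.
have [q3 h3] := rat_near x.2.
have [N hN] : exists N : nat, unpickle N = Some (q1, q2, q3, k).
  by exists (pickle (q1, q2, q3, k)); exact: pickleK.
exists N; first exact: I.
rewrite /B hN.
case: asboolP => [_|]; first by split.
case => y [/= g1 g2 g3]; apply: eU; rewrite /rc /re /= in g1 g2 g3.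
have T (a b c : R) : `|a - c| <= k.+1%:R^-1 -> `|b - c| < k.+1%:R^-1 -> `|a - b| < e.
  move=> ac bc; have -> : a - b = (a - c) - (b - c) by ring.
  apply: le_lt_trans (ler_normB _ _) _; move: ac bc ke.
  move: (k.+1%:R^-1) => w; lra.
by split; [apply: T g1 h1|apply: T g2 h2|apply: T g3 h3].
Qed.

Lemma open_measurable3 (U : set R3) : open U -> measurable (U : set (mR3 R)).
Proof.
move=> /open_bigcup_obox[B [-> hB]]; apply: bigcupT_measurable => n.
by case: (hB n) => [->|[c [e [_ -> _]]]]; [exact: measurable0|exact: obox_measurable].
Qed.

Lemma continuous_measurable3 (f : R3 -> R) : continuous f ->
  measurable_fun (setT : set (mR3 R)) f.
Proof.
move=> cf; apply: (measurability _ (RGenOInfty.measurableE R)) => _ [_ [a ->] <-].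
rewrite setTI; apply: open_measurable3.
by apply: open_comp => // x _; exact: cf.
Qed.

End BorelR3.

(** * A smooth function vanishing on a half line *)

Section FlatFunction.
Variable R : realType.

(* The family y^-k exp (-1/y), extended by 0 to y <= 0, is closed under
   differentiation up to linear combinations. *)
Definition flat (k : nat) (y : R) : R :=
  if 0 < y then (y^-1) ^+ k * expR (- y^-1) else 0.

Lemma flat_ge0 k y : 0 <= flat k y.
Proof.
rewrite /flat; case: ifP => // y0.
by rewrite mulr_ge0 ?expR_ge0// exprn_ge0// invr_ge0 ltW.
Qed.

Lemma flatS k y : flat k.+1 y = flat k y / y.
Proof.
by rewrite /flat; case: ifP => _; rewrite ?mul0r// exprSr mulrAC.
Qed.

(** From [exp z >= z^(k+1) / (k+1)!] at [z = 1/y]. It yields the derivative at 0, where the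
    difference quotient of [flat k] is [flat k.+1]. *)
Lemma flat_le k y : 0 < y -> flat k y <= k.+1`!%:R * y.
Proof.
move=> y0; rewrite /flat y0 expRN.
have iy : 0 < y^-1 by rewrite invr_gt0.
have h : y^-1 ^+ k.+1 <= k.+1`!%:R * expR y^-1.
  have f0 : 0 < k.+1`!%:R :> R by rewrite ltr0n fact_gt0.
  rewrite -ler_pdivrMl// mulrC.
  apply: le_trans (expR_ge1Dxn k (ltW iy)); rewrite lerDr//.
rewrite ler_pdivrMr ?expR_gt0//.
have -> : y^-1 ^+ k = y^-1 ^+ k.+1 * y by rewrite exprSr mulfVK// gt_eqF.
by rewrite mulrAC ler_pM2r.
Qed.

Lemma flat_le1 y : flat 0 y <= 1.
Proof.
rewrite /flat; case: ifP => // y0; rewrite expr0 mul1r.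
by rewrite -expR0 ler_expR oppr_le0 invr_ge0 ltW.
Qed.

Lemma is_derive_flat k (y : R) :
  is_derive y 1 (flat k) (- k%:R * flat k.+1 y + flat k.+2 y).
Proof.
have [y0|y0|->] := ltrgtP y 0.
- have -> : - k%:R * flat k.+1 y + flat k.+2 y = 0.
    by rewrite /flat ltNge (ltW y0)/= mulr0 addr0.
  have H : is_derive y 1 (cst (0 : R)) (0 : R) by apply: is_derive_cst.
  apply: near_eq_is_derive H.
  near=> z; rewrite /flat ifN// -leNgt ltW//.
  by near: z; exact: lt_nbhsl.
- have yN : y != 0 by rewrite gt_eqF.
  have dV : is_derive y 1 (fun z : R => z^-1) (- y ^- 2).
    have := @is_deriveV R id y 1 1 yN _.
    by rewrite /GRing.scale/= mulr1; apply; exact: is_derive_id.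
  have dN : is_derive y 1 (fun z : R => - z^-1) (y ^- 2).
    by rewrite -[y ^- 2]opprK; exact: is_deriveN.
  have dE : is_derive y 1 (expR \o (fun z : R => - z^-1)) (expR (- y^-1) * y ^- 2).
    exact: is_derive1_comp.
  have dX := is_deriveX k dV.
  have H := is_deriveM dX dE.
  apply: (near_eq_is_derive _ (is_derive_eq H _)).
    near=> z; rewrite /flat ifT; last by near: z; exact: lt_nbhsr.
    by rewrite /= !fctE.
  rewrite /flat y0 !fctE /GRing.scale/=.
  rewrite -!exprVn; move: (y^-1) (expR _) => w e {dX H}.
  by case: k => [|k] /=; rewrite !exprS ?expr0; ring.
- have -> : - k%:R * flat k.+1 0 + flat k.+2 0 = 0 by rewrite /flat ltxx mulr0 addr0.
  have cv : h^-1 *: ((flat k \o shift 0) (h *: 1) - flat k 0) @[h --> 0^'] --> (0 : R).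
    apply/cvgr0Pnorm_le => e e0; near=> h.
    have hN : h != 0 by near: h; exact: nbhs_dnbhs_neq.
    rewrite /= {2}/flat ltxx subr0 addr0 /GRing.scale/= mulr1 mulrC -flatS.
    rewrite ger0_norm ?flat_ge0//.
    have [h0|h0] := ltP 0 h; last by rewrite /flat ifN ?ltW// -leNgt.
    apply: le_trans (flat_le _ h0) _.
    rewrite -ler_pdivlMl ?ltr0n ?fact_gt0// ltW//.
    apply: le_lt_trans (ler_norm h) _.
    near: h; apply: dnbhs0_lt.
    by rewrite mulr_gt0// invr_gt0 ltr0n fact_gt0.
  apply: DeriveDef; first by apply/cvg_ex; exists 0.
  exact: cvg_lim cv.
Unshelve. all: by end_near. Qed.

End FlatFunction.

(** * Stability properties of smooth functions *)

Section Smooth.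
Variable R : realType.
Local Notation R3 := (R * R * R)%type.
Implicit Types (f g : R3 -> R) (x : R3).

Definition coord (i : 'I_3) x : R := vec x i 0.

Lemma coordE x : [/\ coord 0 x = x.1.1, coord 1 x = x.1.2 & coord 2 x = x.2].
Proof. by rewrite /coord /vec; split; rewrite mxE. Qed.

Lemma differentiable_coord i x : differentiable (coord i) x /\
  forall v, 'D_v (coord i) x = coord i v.
Proof.
have lin (l : {linear R3 -> R}) : continuous l -> coord i =1 l ->
    differentiable (coord i) x /\ forall v, 'D_v (coord i) x = coord i v.
  move=> cl /funext ->; have dl := linear_differentiable x cl.
  by split=> // v; rewrite deriveE// diff_lin.
have cf (U W : topologicalType) : continuous (@fst U W) by move=> z; exact: cvg_fst.
have cs (U W : topologicalType) : continuous (@snd U W) by move=> z; exact: cvg_snd.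
case: i lin => [[|[|[|//]]] hi] lin.
- apply: (lin (@fst R R \o @fst (R * R)%type R)).
    by move=> z; apply: continuous_comp; [exact: cf|exact: cf].
  by move=> z; rewrite /coord mxE.
- apply: (lin (@snd R R \o @fst (R * R)%type R)).
    by move=> z; apply: continuous_comp; [exact: cf|exact: cs].
  by move=> z; rewrite /coord mxE.
- apply: (lin (@snd (R * R)%type R)); first exact: cs.
  by move=> z; rewrite /coord mxE.
Qed.

Lemma coord_basis3 i j : coord i (basis3 R j) = (i == j)%:R.
Proof.
rewrite /coord /vec mxE /basis3.
by case: i j => [[|[|[|//]]] ?] [[|[|[|//]]] ?].
Qed.

Lemma smooth_class (P : (R3 -> R) -> Prop) :
  (forall f, P f -> forall x, differentiable f x) ->
  (forall f i, P f -> P (partial i f)) -> forall f, P f -> smooth f.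
Proof.
move=> Pd Pp f Pf s; apply: Pd; elim: s => //= i s; exact: Pp.
Qed.

Lemma smooth_partial i f : smooth f -> smooth (partial i f).
Proof. by move=> sf s x; have := sf (rcons s i) x; rewrite foldr_rcons. Qed.

Lemma smooth_differentiable f x : smooth f -> differentiable f x.
Proof. by move=> /(_ [::]). Qed.

(** Differentiating a product gives a sum of products, and differentiating [flat k] raises [k], so a
    direct induction on the list of derivatives does not close. The class generated here is stable
    under [partial], which suffices by [smooth_class]. *)
Inductive smooth_gen : (R3 -> R) -> Prop :=
| sg_smooth f : smooth f -> smooth_gen f
| sg_cst c : smooth_gen (fun=> c)
| sg_coord i : smooth_gen (coord i)
| sg_add f g : smooth_gen f -> smooth_gen g -> smooth_gen (fun x => f x + g x)
| sg_mul f g : smooth_gen f -> smooth_gen g -> smooth_gen (fun x => f x * g x)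
| sg_flat k f : smooth_gen f -> smooth_gen (fun x => flat k (f x)).

Lemma partialD i f g x : differentiable f x -> differentiable g x ->
  partial i (fun x => f x + g x) x = partial i f x + partial i g x.
Proof. by move=> df dg; rewrite /partial -deriveD//; exact: diff_derivable. Qed.

Lemma partialM i f g x : differentiable f x -> differentiable g x ->
  partial i (fun x => f x * g x) x = partial i f x * g x + f x * partial i g x.
Proof.
move=> df dg; rewrite /partial deriveM; try exact: diff_derivable.
by rewrite addrC; congr (_ + _); rewrite /GRing.scale/= mulrC.
Qed.

Lemma partial_comp i (h : R -> R) f x (dh : R) : differentiable f x ->
  is_derive (f x) 1 h dh ->
  differentiable (h \o f) x /\ partial i (h \o f) x = dh * partial i f x.
Proof.
move=> df [dh1 dh2]; have dh' : differentiable h (f x) by exact/derivable1_diffP.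
split; first exact: differentiable_comp.
rewrite /partial !deriveE//; last exact: differentiable_comp.
by rewrite diff_comp//= diff1E// derive1E dh2 /GRing.scale/= mulrC.
Qed.

Lemma smooth_gen_smooth f : smooth_gen f -> smooth f.
Proof.
have Pd g : smooth_gen g -> forall x, differentiable g x.
  elim=> {g} [g sg x|c x|i x|g h _ dg _ dh x|g h _ dg _ dh x|k g _ dg x].
  - exact: smooth_differentiable.
  - exact: differentiable_cst.
  - by case: (differentiable_coord i x).
  - exact: differentiableD.
  - exact: differentiableM.
  - by have [] := partial_comp 0 (dg x) (is_derive_flat k (g x)).
apply: smooth_class => // {}f i.
elim=> {f} [f sf|c|j|f g sf pf sg pg|f g sf pf sg pg|k f sf pf].
- exact/sg_smooth/smooth_partial.
- rewrite (_ : partial i _ = fun=> 0); first exact: sg_cst.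
  by apply/funext => x; rewrite /partial derive_cst.
- rewrite (_ : partial i _ = fun=> coord j (basis3 R i)); first exact: sg_cst.
  by apply/funext => x; have [_] := differentiable_coord j x; exact.
- rewrite (_ : partial i _ = fun x => partial i f x + partial i g x); first exact: sg_add.
  by apply/funext => x; rewrite partialD//; exact: Pd.
- rewrite (_ : partial i _ = fun x => partial i f x * g x + f x * partial i g x).
    by apply: sg_add; exact: sg_mul.
  by apply/funext => x; rewrite partialM//; exact: Pd.
- rewrite (_ : partial i _ = fun x =>
    ((- k%:R) * flat k.+1 (f x) + flat k.+2 (f x)) * partial i f x).
    apply: sg_mul => //; apply: sg_add; last exact: sg_flat.
    by apply: sg_mul; [exact: sg_cst|exact: sg_flat].
  apply/funext => x.
  by have [] := partial_comp i (Pd _ sf x) (is_derive_flat k (f x)).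
Qed.

Lemma smoothD f g : smooth f -> smooth g -> smooth (fun x => f x + g x).
Proof. by move=> sf sg; apply/smooth_gen_smooth/sg_add; exact: sg_smooth. Qed.

Lemma smoothM f g : smooth f -> smooth g -> smooth (fun x => f x * g x).
Proof. by move=> sf sg; apply/smooth_gen_smooth/sg_mul; exact: sg_smooth. Qed.

Lemma smooth_cst c : smooth (fun=> c : R).
Proof. exact/smooth_gen_smooth/sg_cst. Qed.

Lemma smooth_coord i : smooth (coord i).
Proof. exact/smooth_gen_smooth/sg_coord. Qed.

Lemma smooth_flat k f : smooth f -> smooth (fun x => flat k (f x)).
Proof. by move=> sf; apply/smooth_gen_smooth/sg_flat; exact: sg_smooth. Qed.

Lemma smoothN f : smooth f -> smooth (fun x => - f x).
Proof.
move=> sf; rewrite (_ : (fun x => _) = (fun x => -1 * f x)).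
  exact: smoothM (smooth_cst _) sf.
by apply/funext => x; rewrite mulN1r.
Qed.

Lemma smoothB f g : smooth f -> smooth g -> smooth (fun x => f x - g x).
Proof. by move=> sf sg; apply: smoothD => //; exact: smoothN. Qed.

Lemma smooth_continuous f : smooth f -> continuous f.
Proof. by move=> sf x; exact/differentiable_continuous/smooth_differentiable. Qed.

End Smooth.

Section BoundedSupport.
Context d (T : measurableType d) (R : realType) (mu : {measure set T -> \bar R}).
Variables (D K : set T) (mD : measurable D) (mK : measurable K).
Hypothesis muK : (mu K < +oo)%E.

Lemma integrable_cst_indic (c : R) :
  mu.-integrable D (EFin \o (fun x => c * \1_K x)).
Proof.
have m1 : measurable_fun D (\1_K : T -> R) by exact/measurable_funTS/measurable_indic.
have : mu.-integrable D (EFin \o (\1_K : T -> R)).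
  apply/integrableP; split; first exact/measurable_EFinP.
  rewrite (eq_integral (fun x => (\1_K x)%:E)); last first.
    by move=> x _; rewrite /= ger0_norm.
  rewrite integral_indic//; apply: le_lt_trans muK.
  by apply: le_measure; rewrite ?inE//; exact: measurableI.
by move=> /(integrableZl mD c).
Qed.

Lemma L2r_bounded_support (f : T -> R) (M : R) : measurable_fun D f ->
  (forall x, D x -> K x -> `|f x| <= M) -> (forall x, D x -> ~ K x -> f x = 0) ->
  L2r mu D f.
Proof.
move=> mf hM f0; apply: (L2r_intro mD mf (integrable_cst_indic (M ^+ 2))) => x Dx.
rewrite indicE; case: (boolP (x \in K)) => [|/negP].
  rewrite inE mulr1 => Kx; rewrite -real_normK ?num_real//.
  by rewrite lerXn2r ?nnegrE ?hM// (le_trans _ (hM x Dx Kx)).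
by rewrite inE => /(f0 _ Dx) ->; rewrite mulr0 expr0n.
Qed.

End BoundedSupport.

(** * Boxes: measure, compactness, generation of the Borel sets *)

Section Boxes.
Variable R : realType.
Local Notation R3 := (R * R * R)%type.
Implicit Types (a b x c : R3) (e : R).
Local Notation mu := (@mu3 R).

Definition gbox a b : set R3 := [set x | [/\ a.1.1 < x.1.1 < b.1.1,
  a.1.2 < x.1.2 < b.1.2 & a.2 < x.2 < b.2]].

Definition gcbox a b : set R3 := [set x | [/\ a.1.1 <= x.1.1 <= b.1.1,
  a.1.2 <= x.1.2 <= b.1.2 & a.2 <= x.2 <= b.2]].

Lemma gbox_prod a b : gbox a b =
  (`]a.1.1, b.1.1[%classic `*` `]a.1.2, b.1.2[%classic) `*` `]a.2, b.2[%classic.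
Proof.
by apply/seteqP; split => x /=; rewrite !in_itv/= => -[] // [].
Qed.

Lemma gcbox_prod a b : gcbox a b =
  (`[a.1.1, b.1.1]%classic `*` `[a.1.2, b.1.2]%classic) `*` `[a.2, b.2]%classic.
Proof.
by apply/seteqP; split => x /=; rewrite !in_itv/= => -[] // [].
Qed.

Lemma gbox_measurable a b : measurable (gbox a b : set (mR3 R)).
Proof. by rewrite gbox_prod; apply: measurableX => //; exact: measurableX. Qed.

Lemma gcbox_measurable a b : measurable (gcbox a b : set (mR3 R)).
Proof. by rewrite gcbox_prod; apply: measurableX => //; exact: measurableX. Qed.

Lemma gcbox_compact a b : compact (gcbox a b).
Proof.
rewrite gcbox_prod; apply: compact_setX; last exact: segment_compact.
by apply: compact_setX; exact: segment_compact.
Qed.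

Lemma mu3_prod (A : set (measurableTypeR R * measurableTypeR R))
    (C : set (measurableTypeR R)) : measurable A -> measurable C ->
  mu (A `*` C) =
  ((@lebesgue_measure R \x @lebesgue_measure R) A * lebesgue_measure C)%E.
Proof. by move=> mA mC; apply: product_measure1E. Qed.

Lemma mu3_gcbox_fin a b : (mu (gcbox a b) < +oo)%E.
Proof.
rewrite gcbox_prod mu3_prod//; last exact: measurableX.
rewrite product_measure1E//.
have fin (r s : R) : lebesgue_measure `[r, s]%classic \is a fin_num.
  by rewrite lebesgue_measure_itv/= lte_fin; case: ifP.
by rewrite ltey_eq; apply/orP; left; apply: fin_numM; [apply: fin_numM|]; exact: fin.
Qed.

Lemma gboxI a b c d : gbox a b `&` gbox c d =
  gbox (Num.max a.1.1 c.1.1, Num.max a.1.2 c.1.2, Num.max a.2 c.2)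
       (Num.min b.1.1 d.1.1, Num.min b.1.2 d.1.2, Num.min b.2 d.2).
Proof.
apply/seteqP; split => x /=.
  move=> [[/andP[? ?] /andP[? ?] /andP[? ?]] [/andP[? ?] /andP[? ?] /andP[? ?]]].
  by split; rewrite /= gt_max lt_min; apply/andP; split; apply/andP.
case; rewrite /= !gt_max !lt_min.
move=> /andP[/andP[? ?] /andP[? ?]] /andP[/andP[? ?] /andP[? ?]].
by move=> /andP[/andP[? ?] /andP[? ?]]; split; split; apply/andP.
Qed.

Lemma obox_gbox c e : obox c e = gbox (c.1.1 - e, c.1.2 - e, c.2 - e)
  (c.1.1 + e, c.1.2 + e, c.2 + e).
Proof.
by apply/seteqP; split => x; rewrite /obox /gbox /= !ltr_distl.
Qed.

Lemma cbox_gcbox c e : cbox c e = gcbox (c.1.1 - e, c.1.2 - e, c.2 - e)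
  (c.1.1 + e, c.1.2 + e, c.2 + e).
Proof.
by apply/seteqP; split => x; rewrite /cbox /gcbox /= !ler_distl.
Qed.

Definition gboxes : set (set (mR3 R)) := [set B | exists a b, B = gbox a b].

Lemma gboxes_setI : setI_closed gboxes.
Proof. by move=> _ _ [a [b ->]] [c [d ->]]; rewrite gboxI; eexists; eexists. Qed.

(** The three coordinates are measurable for the sigma-algebra generated by the boxes, hence so is
    the identity map. As boxes are stable under intersection, this prepares a Dynkin class
    argument. *)
Lemma measurable_gboxes : @measurable _ (mR3 R) = <<s gboxes >>.
Proof.
apply/seteqP; split; last first.
  apply: smallest_sub; first exact: sigma_algebra_measurable.
  by move=> _ [a [b ->]]; exact: gbox_measurable.
pose T := g_sigma_algebraType gboxes.
have coordP (p : R3 -> R) :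
    (forall r (t : R3), exists2 B : nat -> set R3, (forall n, gboxes (B n)) &
      [set x | r < p x] = \bigcup_n B n) ->
    measurable_fun (setT : set T) (p : T -> R).
  move=> hp; apply: (measurability _ (RGenOInfty.measurableE R)) => _ [_ [r ->] <-].
  have [B hB rB] := hp r 0.
  rewrite setTI (_ : _ @^-1` _ = [set x | r < p x]); last first.
    by apply/seteqP; split => x /=; rewrite in_itv/= andbT.
  rewrite rB; apply: bigcupT_measurable => n.
  exact: sub_sigma_algebra.
pose N n : R := n%:R.
have arch (x : R) : exists M : nat, forall n, (M <= n)%N -> - N n < x < N n.
  exists (Num.truncn `|x|).+1 => n Mn; rewrite -ltr_norml.
  by apply: lt_le_trans (truncnS_gt _) _; rewrite ler_nat.
have arch3 (x : R3) : exists n, [/\ - N n < x.1.1 < N n, - N n < x.1.2 < N n &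
    - N n < x.2 < N n].
  have [M1 h1] := arch x.1.1; have [M2 h2] := arch x.1.2; have [M3 h3] := arch x.2.
  exists (maxn M1 (maxn M2 M3)); split;
    [apply: h1|apply: h2|apply: h3]; rewrite ?leq_maxl// leq_max ?leq_maxl ?leq_maxr ?orbT//.
have m1 : measurable_fun (setT : set T) (fun x : T => (x : R3).1.1).
  apply: coordP => r _; exists (fun n => gbox (r, - N n, - N n) (N n, N n, N n)).
    by move=> n; eexists; eexists.
  apply/seteqP; split => [x /= rx|x [n _] [/= /andP[]]//].
  have [n [/andP[_ h1] h2 h3]] := arch3 x.
  by exists n => //; split => //=; apply/andP.
have m2 : measurable_fun (setT : set T) (fun x : T => (x : R3).1.2).
  apply: coordP => r _; exists (fun n => gbox (- N n, r, - N n) (N n, N n, N n)).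
    by move=> n; eexists; eexists.
  apply/seteqP; split => [x /= rx|x [n _] [/= _ /andP[]]//].
  have [n [h2 /andP[_ h1] h3]] := arch3 x.
  by exists n => //; split => //=; apply/andP.
have m3 : measurable_fun (setT : set T) (fun x : T => (x : R3).2).
  apply: coordP => r _; exists (fun n => gbox (- N n, - N n, r) (N n, N n, N n)).
    by move=> n; eexists; eexists.
  apply/seteqP; split => [x /= rx|x [n _] [/= _ _ /andP[]]//].
  have [n [h2 h3 /andP[_ h1]]] := arch3 x.
  by exists n => //; split => //=; apply/andP.
have mid : measurable_fun (setT : set T)
    (fun x : T => ((x : R3).1.1, (x : R3).1.2, (x : R3).2) : mR3 R).
  by apply: measurable_fun_pair => //; exact: measurable_fun_pair.
move=> E mE; have := mid (@measurableT _ T) E mE; rewrite setTI.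
rewrite (_ : _ @^-1` _ = E)//.
by apply/seteqP; split => -[[x1 x2] x3].
Qed.

Lemma compact_sub_gcbox (K : set R3) : compact K -> exists n : R,
  K `<=` gcbox (- n, - n, - n) (n, n, n).
Proof.
move=> cK; have c1 : continuous (fun x : R3 => x.1.1).
  by move=> z; apply: continuous_comp; exact: cvg_fst.
have c2 : continuous (fun x : R3 => x.1.2).
  by move=> z; apply: continuous_comp; [exact: cvg_fst|exact: cvg_snd].
have c3 : continuous (fun x : R3 => x.2) by move=> z; exact: cvg_snd.
have bd (f : R3 -> R) : continuous f -> exists M, forall x, K x -> `|f x| <= M.
  move=> cf; have /compact_bounded : compact (f @` K).
    by apply: continuous_compact => //; exact: continuous_subspaceT.
  move=> [M [_ hM]]; exists (M + 1) => x Kx.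
  by apply: (hM (M + 1)); [rewrite ltrDl|exists x].
have [M1 h1] := bd _ c1; have [M2 h2] := bd _ c2; have [M3 h3] := bd _ c3.
exists (Num.max M1 (Num.max M2 M3)) => x Kx; split; rewrite /= -ler_norml.
- by rewrite le_max h1.
- by rewrite !le_max h2 ?orbT.
- by rewrite !le_max h3 ?orbT.
Qed.

Lemma compact_measurable3 (K : set R3) : compact K -> measurable (K : set (mR3 R)).
Proof.
move=> /compact_closed cl; rewrite -[K]setCK; apply: measurableC.
apply: open_measurable3; apply: closed_openC; apply: cl; exact: norm_hausdorff.
Qed.

Lemma compact_mu3_fin (K : set R3) : compact K -> (mu K < +oo)%E.
Proof.
move=> /[dup] cK /compact_sub_gcbox[n Kn].
apply: le_lt_trans (mu3_gcbox_fin (- n, - n, - n) (n, n, n)).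
by apply: le_measure => //; rewrite inE; [exact: compact_measurable3|exact: gcbox_measurable].
Qed.

Lemma L2r_compact_support (Om : set R3) (f : R3 -> R) (K : set R3) :
  measurable (Om : set (mR3 R)) -> continuous f -> compact K ->
  (forall x, ~ K x -> f x = 0) -> L2r mu (Om : set (mR3 R)) f.
Proof.
move=> mOm cf cK f0.
have mK := compact_measurable3 cK.
have [M hM] : exists M, forall x, K x -> `|f x| <= M.
  have /compact_bounded : compact (f @` K).
    by apply: continuous_compact => //; exact: continuous_subspaceT.
  move=> [M [_ hM]]; exists (M + 1) => x Kx.
  by apply: (hM (M + 1)); [rewrite ltrDl|exists x].
have mf : measurable_fun (Om : set (mR3 R)) f.
  by apply: measurable_funTS; exact: continuous_measurable3.
apply: (L2r_bounded_support mOm mK (compact_mu3_fin cK) mf (M := M)).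
  by move=> x _; exact: hM.
by move=> x _; exact: f0.
Qed.

End Boxes.

#[global] Instance ae_mu3_filter (R : realType) :
  Filter (nbhs (almost_everywhere (@mu3 R))).
Proof. by apply: ae_filter_ringOfSetsType. Qed.

(** * Test functions and the fundamental lemma of the calculus of variations *)

Section TestFunctions.
Variables (R : realType) (Om : set (R * R * R)).
Hypothesis oOm : open Om.
Local Notation R3 := (R * R * R)%type.
Local Notation mu := (@mu3 R).
Local Notation Re := complex.Re.
Local Notation Im := complex.Im.
Local Notation L2r := (L2r mu (Om : set (mR3 R))).
Local Notation ipr := (ipr mu (Om : set (mR3 R))).
Local Notation mOm := (open_measurable3 oOm).
Implicit Types (f g : R3 -> R) (phi : R3 -> R[i]).

Definition real_test f := smooth f /\
  exists K : set R3, [/\ compact K, K `<=` Om & forall x, ~ K x -> f x = 0].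

Lemma test_real phi : test_function Om phi <->
  real_test (fun x => Re (phi x)) /\ real_test (fun x => Im (phi x)).
Proof.
split=> [[sr si [K [cK KO K0]]]|[[sr [K [cK KO K0]]] [si [L [cL LO L0]]]]].
  by split; split => //; exists K; split => // x /K0 ->.
split=> //; exists (K `|` L); split.
- exact: compactU.
- by move=> x [/KO|/LO].
- move=> x /not_orP[nK nL]; apply: complex_eq; [exact: K0|exact: L0].
Qed.

Lemma real_test_partial i f : real_test f -> real_test (partial i f).
Proof.
move=> [sf [K [cK KO K0]]]; split; first exact: smooth_partial.
exists K; split => // x nK.
have clK : closed K by apply: compact_closed => //; exact: norm_hausdorff.
have nK' : \forall y \near x, ~ K y.
  by apply: open_nbhs_nbhs; split => //; exact: closed_openC.
have -> : partial i f x = partial i (fun=> 0) x.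
  by apply: near_eq_derive; apply: filterS nK' => y /K0.
by rewrite /partial derive_cst.
Qed.

Lemma real_testM f g : smooth f -> real_test g -> real_test (fun x => f x * g x).
Proof.
move=> sf [sg [K [cK KO K0]]]; split; first exact: smoothM.
by exists K; split => // x /K0 ->; rewrite mulr0.
Qed.

Lemma real_testD f g : real_test f -> real_test g -> real_test (fun x => f x + g x).
Proof.
move=> [sf [K [cK KO K0]]] [sg [L [cL LO L0]]]; split; first exact: smoothD.
exists (K `|` L); split; [exact: compactU|by move=> x [/KO|/LO]|].
by move=> x /not_orP[/K0 -> /L0 ->]; rewrite addr0.
Qed.

Lemma real_test0 : real_test (fun=> 0).
Proof.
by split; [exact: smooth_cst|exists set0; split => //; exact: compact0].
Qed.

Lemma real_testB f g : real_test f -> real_test g -> real_test (fun x => f x - g x).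
Proof.
move=> tf tg; apply: real_testD => //.
have := real_testM (smooth_cst (-1)) tg.
by congr real_test; apply/funext => x; rewrite mulN1r.
Qed.

Lemma real_test_L2r f : real_test f -> L2r f.
Proof.
move=> [sf [K [cK KO K0]]].
exact: (L2r_compact_support mOm (smooth_continuous sf) cK K0).
Qed.

Lemma L2c_L2r (u : R3 -> R[i]) : L2 Om u <->
  L2r (fun x => Re (u x)) /\ L2r (fun x => Im (u x)).
Proof. exact: (@L2P _ _ R mu _ mOm u). Qed.

Lemma dotL2_dotc (u v : R3 -> R[i]) : dotL2 Om u v = dotc mu (Om : set (mR3 R)) u v.
Proof. by []. Qed.

Lemma L2_L2c (u : R3 -> R[i]) : L2 Om u = L2c mu (Om : set (mR3 R)) u.
Proof. by []. Qed.

Lemma L2_ph : prehilbert (L2 Om) (dotL2 Om).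
Proof. exact: (@L2_prehilbert _ _ R mu _ mOm). Qed.

Lemma test_L2 phi : test_function Om phi -> L2 Om phi.
Proof. by move=> /test_real[? ?]; apply/L2c_L2r; split; exact: real_test_L2r. Qed.

Lemma test_partialC i phi : test_function Om phi -> test_function Om (partialC i phi).
Proof.
by move=> /test_real[tr ti]; apply/test_real; split; exact: real_test_partial.
Qed.

Lemma test_conj phi : test_function Om phi -> test_function Om (fun x => (phi x)^*).
Proof.
move=> /test_real[tr ti]; apply/test_real; split.
  by under eq_fun do rewrite ReJ.
have := real_testB real_test0 ti.
by congr real_test; apply/funext => x; rewrite ImJ sub0r.
Qed.

Lemma test0 : test_function Om (fun=> 0).
Proof. by apply/test_real; split; exact: real_test0. Qed.

Lemma testD phi psi : test_function Om phi -> test_function Om psi ->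
  test_function Om (fun x => phi x + psi x).
Proof.
move=> /test_real[ar ai] /test_real[br bi]; apply/test_real; split.
  by under eq_fun do rewrite ReD; exact: real_testD.
by under eq_fun do rewrite ImD; exact: real_testD.
Qed.

Lemma test_smoothM (m phi : R3 -> R[i]) :
  smooth (fun x => Re (m x)) -> smooth (fun x => Im (m x)) ->
  test_function Om phi -> test_function Om (fun x => m x * phi x).
Proof.
move=> sr si /test_real[tr ti]; apply/test_real; split.
  by under eq_fun do rewrite ReM; apply: real_testB; exact: real_testM.
by under eq_fun do rewrite ImM; apply: real_testD; exact: real_testM.
Qed.

Lemma testZ (a : R[i]) phi : test_function Om phi ->
  test_function Om (fun x => a * phi x).
Proof. by apply: test_smoothM; exact: smooth_cst. Qed.

(** As [n] grows, [flat 0 (n.+1 y)] tends to the indicator of [y > 0], so the bumps tend to the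
    indicator of the open box while they stay supported in the closed one. *)
Definition bump (a b : R3) (n : nat) (x : R3) : R :=
  flat 0 (n.+1%:R * (coord 0 x - a.1.1)) * flat 0 (n.+1%:R * (b.1.1 - coord 0 x)) *
  (flat 0 (n.+1%:R * (coord 1 x - a.1.2)) * flat 0 (n.+1%:R * (b.1.2 - coord 1 x))) *
  (flat 0 (n.+1%:R * (coord 2 x - a.2)) * flat 0 (n.+1%:R * (b.2 - coord 2 x))).

Lemma flat_le0 k (y : R) : y <= 0 -> flat k y = 0.
Proof. by move=> y0; rewrite /flat ltNge y0. Qed.

Lemma bump_test a b n : gcbox a b `<=` Om -> real_test (bump a b n).
Proof.
move=> abO; split.
  have sf (k c t : R) i : smooth (fun x =>
      flat 0 (k * (coord i x - c)) * flat 0 (k * (t - coord i x))).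
    by apply: smoothM; apply: smooth_flat; apply: smoothM => //;
      (try exact: smooth_cst); apply: smoothB; (exact: smooth_coord || exact: smooth_cst).
  by apply: smoothM; [apply: smoothM; exact: sf|exact: sf].
exists (gcbox a b); split => //; first exact: gcbox_compact.
move=> x nx; have [c0 c1 c2] := coordE x; rewrite /bump c0 c1 c2.
have out (r s t : R) : ~ (r <= t <= s) ->
    flat 0 (n.+1%:R * (t - r)) * flat 0 (n.+1%:R * (s - t)) = 0.
  move=> /negP; rewrite negb_and -!ltNge => /orP[tr|ts].
    by rewrite flat_le0 ?mul0r// pmulr_rle0// subr_le0 ltW.
  by rewrite [X in _ * X]flat_le0 ?mulr0// pmulr_rle0// subr_le0 ltW.
have [h1|h1] := pselect (a.1.1 <= x.1.1 <= b.1.1); last by rewrite out// !mul0r.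
have [h2|h2] := pselect (a.1.2 <= x.1.2 <= b.1.2); last first.
  by rewrite [X in _ * X * _]out// mulr0 mul0r.
have [h3|h3] := pselect (a.2 <= x.2 <= b.2); last by rewrite [X in _ * X]out// mulr0.
by case: nx.
Qed.

Lemma bump_ge0 a b n x : 0 <= bump a b n x.
Proof. by rewrite !mulr_ge0// flat_ge0. Qed.

Lemma bump_le a b n x : bump a b n x <= \1_(gcbox a b) x.
Proof.
rewrite indicE; case: (boolP (x \in _)) => [_|].
  have M (y z : R) : 0 <= y -> y <= 1 -> 0 <= z -> z <= 1 -> y * z <= 1.
    by move=> y0 y1 z0 z1; apply: le_trans (ler_pM y0 z0 y1 z1) _; rewrite mulr1.
  by rewrite /bump !M ?mulr_ge0 ?M ?flat_ge0 ?flat_le1.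
rewrite notin_setE /bump => nx; have [c0 c1 c2] := coordE x; rewrite c0 c1 c2.
have out (r s t : R) : ~ (r <= t <= s) ->
    flat 0 (n.+1%:R * (t - r)) * flat 0 (n.+1%:R * (s - t)) = 0.
  move=> /negP; rewrite negb_and -!ltNge => /orP[tr|ts].
    by rewrite flat_le0 ?mul0r// pmulr_rle0// subr_le0 ltW.
  by rewrite [X in _ * X]flat_le0 ?mulr0// pmulr_rle0// subr_le0 ltW.
have [h1|h1] := pselect (a.1.1 <= x.1.1 <= b.1.1); last by rewrite out// !mul0r.
have [h2|h2] := pselect (a.1.2 <= x.1.2 <= b.1.2); last first.
  by rewrite [X in _ * X * _]out// mulr0 mul0r.
have [h3|h3] := pselect (a.2 <= x.2 <= b.2); last by rewrite [X in _ * X]out// mulr0.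
by case: nx.
Qed.

Lemma bump_cvg a b x : bump a b n x @[n --> \oo] --> (\1_(gbox a b) x : R).
Proof.
have [c0 c1 c2] := coordE x; rewrite /bump c0 c1 c2.
have F (y : R) : flat 0 (n.+1%:R * y) @[n --> \oo] --> ((0 < y)%R%:R : R).
  have [y0|y0] := ltP 0 y; last first.
    under eq_fun do rewrite flat_le0 ?pmulr_rle0//; exact: cvg_cst.
  rewrite /= (_ : (fun n => _) = (fun n => expR (- (harmonic n / y)))); last first.
    apply/funext => n; rewrite /flat pmulr_rgt0// y0 expr0 mul1r invfM /harmonic//.
  rewrite -(@expR0 R) -[X in expR X](_ : - (0 / y) = 0); last by rewrite mul0r oppr0.
  apply: continuous_cvg; first exact: continuous_expR.
  by apply: cvgN; apply: cvgM; [exact: cvg_harmonic|exact: cvg_cst].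
have -> : \1_(gbox a b) x =
    (0 < x.1.1 - a.1.1)%R%:R * (0 < b.1.1 - x.1.1)%R%:R *
    ((0 < x.1.2 - a.1.2)%R%:R * (0 < b.1.2 - x.1.2)%R%:R) *
    ((0 < x.2 - a.2)%R%:R * (0 < b.2 - x.2)%R%:R) :> R.
  rewrite indicE !subr_gt0 -!natrM !mulnb; congr ((nat_of_bool _)%:R).
  apply/idP/idP; first by rewrite inE => -[-> -> ->].
  by move=> /andP[/andP[? ?] ?]; rewrite inE.
by apply: cvgM; [apply: cvgM; apply: cvgM|apply: cvgM]; exact: F.
Qed.

Lemma L2r_indic_gcbox a b : L2r (\1_(gcbox a b)).
Proof.
apply: (L2r_bounded_support mOm (gcbox_measurable a b) (mu3_gcbox_fin a b) (M := 1)).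
- by apply/measurable_funTS/measurable_indic; exact: gcbox_measurable.
- by move=> x _ _; rewrite indicE ger0_norm// lern1 leq_b1.
- by move=> x _ nx; rewrite indicE memNset.
Qed.

(** The bumps are test functions dominated by the indicator of the closed box, so the vanishing of
    their pairings with [g] passes to the limit. *)
Lemma test_orth_box g a b : L2r g -> (forall f, real_test f -> ipr g f = 0) ->
  gcbox a b `<=` Om -> (\int[mu]_(x in gbox a b) (g x)%:E = 0)%E.
Proof.
move=> Lg g0 abO.
have mab : measurable (gbox a b : set (mR3 R)) by exact: gbox_measurable.
have mg : measurable_fun (Om : set (mR3 R)) g by case: Lg.
have Lb n := real_test_L2r (bump_test n abO).
have Lc := L2r_indic_gcbox a b.
have i0 n : (\int[mu]_(x in Om) (g x * bump a b n x)%:E = 0)%E.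
  have := g0 _ (bump_test n abO); rewrite !iprE /Rintegral => h.
  rewrite -[LHS]fineK; first by rewrite h.
  exact: (integrable_fin_num mOm (L2r_mul_integrable mOm Lg (Lb n))).
have gb : gbox a b = Om `&` gbox a b.
  apply/seteqP; split => [x abx|x []//]; split => //; apply: abO.
  by case: abx => /andP[? ?] /andP[? ?] /andP[? ?]; split; apply/andP; split; exact: ltW.
have -> : (\int[mu]_(x in gbox a b) (g x)%:E = \int[mu]_(x in Om) (g x * \1_(gbox a b) x)%:E)%E.
  rewrite {1}gb integral_mkcondr; apply: eq_integral => x _.
  by rewrite patchE indicE; case: ifP; rewrite ?mulr1 ?mulr0.
have : (\int[mu]_(x in Om) (g x * bump a b n x)%:E)%E @[n --> \oo] -->
       (\int[mu]_(x in Om) (g x * \1_(gbox a b) x)%:E)%E.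
  apply: (@dominated_cvg _ _ _ mu _ mOm _ _ (EFin \o (fun x => `|g x * \1_(gcbox a b) x|))).
  - by move=> n; apply/measurable_EFinP/measurable_funM => //; case: (Lb n).
  - move=> x _; apply/fine_cvgP; split; first exact: nearW.
    by apply: cvgM; [exact: cvg_cst|exact: bump_cvg].
  - by move=> x _.
  - exact: (integrable_abse (L2r_mul_integrable mOm Lg Lc)).
  - move=> n x _ /=; rewrite lee_fin (normrM (g x) (bump _ _ _ _)) (normrM (g x) _) ler_wpM2l//.
    rewrite (ger0_norm (bump_ge0 _ _ _ _)) ger0_norm ?bump_le//.
under eq_fun do rewrite i0.
by move=> h; have /cvg_lim := h => <- //; rewrite lim_cst.
Qed.

(** On each box of a countable cover, the Borel sets over whose part in the box [g] has zero
    integral form a Dynkin class containing the boxes, hence all Borel sets. So [g] vanishes almost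
    everywhere on the box. *)
Lemma test_orth_real g : L2r g -> (forall f, real_test f -> ipr g f = 0) ->
  {ae mu, forall x, Om x -> g x = 0}.
Proof.
move=> Lg g0; have [B [OmB hB]] := open_bigcup_obox oOm.
suff hn n : {ae mu, forall x, B n x -> g x = 0}.
  have := @ae_foralln _ _ _ mu (fun n x => B n x -> g x = 0) hn.
  by apply: filterS => x h; rewrite OmB => -[n _]; exact: h.
case: (hB n) => [->|[c [e [e0 -> ceO]]]]; first exact: aeW.
rewrite cbox_gcbox in ceO; rewrite obox_gbox.
move: ceO; set a := (_, _, _); set b := (_, _, _) => abO.
have mQ := gbox_measurable a b.
have QO : gbox a b `<=` Om.
  move=> x [/andP[? ?] /andP[? ?] /andP[? ?]]; apply: abO.
  by split; apply/andP; split; exact: ltW.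
have mg : measurable_fun (gbox a b : set (mR3 R)) g.
  by case: Lg => mg _; apply: measurable_funS mg => //; exact: mOm.
have iQ : mu.-integrable (gbox a b) (EFin \o g).
  have Lc := L2r_indic_gcbox a b.
  have := integrableS mOm mQ QO (L2r_mul_integrable mOm Lg Lc).
  apply: eq_integrable => // x; rewrite inE => -[/andP[? ?] /andP[? ?] /andP[? ?]].
  rewrite /= indicE mem_set ?mulr1//.
  by split; apply/andP; split; exact: ltW.
pose P (E : set (mR3 R)) := (\int[mu]_(x in E `&` gbox a b) (g x)%:E = 0)%E.
have PE E : measurable E -> P E.
  rewrite (measurable_gboxes R); apply: dynkin_induction.
  - exact: measurable_gboxes.
  - exact: gboxes_setI.
  - by rewrite /P setTI; exact: (test_orth_box Lg g0 abO).
  - move=> _ [p [q ->]]; rewrite /P gboxI; apply: (test_orth_box Lg g0).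
    move=> x [/=]; rewrite !ge_max !le_min.
    move=> /andP[/andP[? ?] /andP[? ?]] /andP[/andP[? ?] /andP[? ?]].
    by move=> /andP[/andP[? ?] /andP[? ?]]; apply: abO; split; apply/andP.
  - move=> S mS PS; rewrite /P.
    have mSQ : measurable (S `&` gbox a b : set (mR3 R)) by exact: measurableI.
    have mSQ' : measurable (~` S `&` gbox a b : set (mR3 R)).
      by apply: measurableI => //; exact: measurableC.
    have := test_orth_box Lg g0 abO.
    rewrite {1}(_ : gbox a b = (S `&` gbox a b) `|` (~` S `&` gbox a b)); last first.
      by rewrite -setIUl setUv setTI.
    rewrite integral_setU_EFin//; last 2 first.
    + by rewrite -setIUl setUv setTI.
    + by apply/disj_setPS => x [[? ?] []].
    by rewrite [X in (X + _)%E]PS add0e.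
  - move=> F mF tF PF; rewrite /P setI_bigcupl integral_bigcup//.
    + by apply: eseries0 => i _ _; exact: PF.
    + by apply: trivIset_setIr.
    + by move=> k; exact: measurableI.
    + apply: integrableS iQ => //; last by move=> x [k _ []].
      by apply: bigcupT_measurable => k; exact: measurableI.
have := @integral_ae_eq _ _ _ mu _ mQ (cst 0%E) (EFin \o g) iQ (measurable_cst _).
case=> [E EQ mE|N [mN N0 hN]].
  rewrite integral0; have := PE _ mE; rewrite /P.
  by rewrite (_ : E `&` _ = E)//; apply/setIidPl.
exists N; split => // x /= hx; apply: hN => /= h; apply: hx => Qx.
by have := h Qx => -[].
Qed.

Lemma test_orth (u : R3 -> R[i]) : L2 Om u ->
  (forall phi, test_function Om phi -> dotL2 Om u phi = 0) -> eq_ae Om u (fun=> 0).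
Proof.
move=> Lu u0; have /L2c_L2r[Lr Li] := Lu.
have key f : real_test f -> ipr (fun x => Re (u x)) f = 0 /\ ipr (fun x => Im (u x)) f = 0.
  move=> tf; have tc : test_function Om (fun x => (f x)%:C).
    by apply/test_real; split => //; exact: real_test0.
  have := u0 _ tc; rewrite dotL2_dotc (dotcE mOm)//; last exact: test_L2.
  have z h : L2r h -> ipr h (fun x => Im (f x)%:C) = 0.
    move=> Lh; rewrite iprC (_ : (fun x => Im _) = fun x => 0 * f x).
      by rewrite iprZl ?mul0r//; [exact: mOm|exact: real_test_L2r].
    by apply/funext => x; rewrite mul0r.
  by rewrite !z// addr0 subr0 => -[].
have r0 := test_orth_real Lr (fun f tf => (key f tf).1).
have i0 := test_orth_real Li (fun f tf => (key f tf).2).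
by apply: filterS2 r0 i0 => x hr hi Ox; apply: complex_eq; [exact: hr|exact: hi].
Qed.

End TestFunctions.

Section SigmaFiniteProduct.
Context d1 d2 (T1 : measurableType d1) (T2 : measurableType d2) (R : realType).
Variables (m1 : {sigma_finite_measure set T1 -> \bar R})
  (m2 : {sigma_finite_measure set T2 -> \bar R}).

(** A named copy of the product measure that carries a sigma-finite structure, so that Fubini's
    theorem applies to R^3 as the product of a plane and a line. *)
Definition sfprod : set (T1 * T2) -> \bar R := (m1 \x m2)%E.

HB.instance Definition _ := Measure.copy sfprod (m1 \x m2)%E.

Lemma sfprod_sigma_finite : sigma_finite setT sfprod.
Proof.
have /sigma_finiteP[F [TF ndF Foo]] := sigma_finiteT m1.
have /sigma_finiteP[G [TG ndG Goo]] := sigma_finiteT m2.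
exists (fun n => F n `*` G n) => [|n].
  apply/seteqP; split => // -[x y] _.
  have [i _ Fx] : (\bigcup_n F n) x by rewrite -TF.
  have [j _ Gy] : (\bigcup_n G n) y by rewrite -TG.
  exists (maxn i j) => //; split => /=.
    by move: (x) Fx; apply/subsetPset/ndF/leq_maxl.
  by move: (y) Gy; apply/subsetPset/ndG/leq_maxr.
have [mF ?] := Foo n; have [mG ?] := Goo n; split; first exact: measurableX.
by rewrite /sfprod product_measure1E// lte_mul_pinfty// ge0_fin_numE.
Qed.

HB.instance Definition _ :=
  Measure_isSigmaFinite.Build _ _ _ sfprod sfprod_sigma_finite.

End SigmaFiniteProduct.

(** * Derivatives of compactly supported functions have zero integral *)

Section IntegralPartial.
Variable R : realType.
Local Notation R3 := (R * R * R)%type.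
Local Notation mu := (@mu3 R).
Local Notation lam := (@lebesgue_measure R).
Local Notation lam2 := (sfprod lam lam).
Implicit Types (f : R3 -> R).

Lemma integrable_bounded_support d (T : measurableType d)
    (nu : {measure set T -> \bar R}) (K : set T) (f : T -> R) (M : R) :
  measurable K -> (nu K < +oo)%E -> measurable_fun setT f ->
  (forall x, K x -> `|f x| <= M) -> (forall x, ~ K x -> f x = 0) ->
  nu.-integrable setT (EFin \o f).
Proof.
move=> mK nK mf fM f0.
apply: (le_integrable measurableT _ _ (integrable_cst_indic measurableT mK nK M)).
  exact/measurable_EFinP.
move=> x _ /=; rewrite lee_fin indicE; case: (boolP (x \in K)) => [|/negP].
  by rewrite inE mulr1 => /fM fx; rewrite (le_trans fx)// ler_norm.
by rewrite inE => /f0 ->; rewrite normr0 mulr0 normr0.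
Qed.

Lemma mu3_fubini1 (f : mR3 R -> \bar R) : mu.-integrable setT f ->
  (\int[mu]_w f w = \int[lam2]_p \int[lam]_z f (p, z))%E.
Proof. by move=> h; rewrite (integral12_prod_meas1 (m1 := lam2) h). Qed.

Lemma mu3_fubini2 (f : mR3 R -> \bar R) : mu.-integrable setT f ->
  (\int[mu]_w f w = \int[lam]_z \int[lam2]_p f (p, z))%E.
Proof. by move=> h; rewrite (integral21_prod_meas1 (m1 := lam2) h). Qed.

Lemma integral_derive_compact (F : R -> R) (n : R) :
  (forall t, derivable F t 1) -> continuous (derive1 F) ->
  (forall t, n <= `|t| -> F t = 0) -> (forall t, n <= `|t| -> derive1 F t = 0) ->
  (\int[lam]_t (derive1 F t)%:E = 0)%E.
Proof.
move=> dF cF F0 F'0.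
pose m : R := `|n| + 1.
have nm : n <= `|m| by rewrite ger0_norm ?addr_ge0// (le_trans (ler_norm n))// lerDl.
have m0 : - m < m by rewrite gtrN// ltr_wpDl.
have : (\int[lam]_(t in `[(- m)%R, m]%classic) (derive1 F t)%:E = 0)%E.
  have cont (t : R) : F x @[x --> t] --> F t.
    by apply/differentiable_continuous/derivable1_diffP; exact: dF.
  have lr : derivable_oo_LRcontinuous F (- m) m.
    split; first by move=> t _; exact: dF.
      by apply: cvg_at_right_filter; exact: cont.
    by apply: cvg_at_left_filter; exact: cont.
  have cw : {within `[- m, m], continuous (derive1 F)} by exact: continuous_subspaceT.
  have ein : {in `]- m, m[%R, derive1 F =1 derive1 F} by [].
  rewrite (continuous_FTC2 m0 cw lr ein).
  by rewrite !F0 ?normrN ?subee.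
rewrite integral_mkcond => <-; apply: eq_integral => t _.
rewrite patchE; case: ifPn => // /negP; rewrite inE/= in_itv/= -ler_norml => /negP.
rewrite -ltNge => mt; rewrite F'0//; apply: le_trans (ltW mt).
by apply: le_trans (ler_norm n) _; rewrite lerDl.
Qed.

(** [hl] says that [l] runs along a line in the direction [basis3 i], so both difference quotients
    are the same function of the increment. *)
Lemma slice_derive f (i : 'I_3) (l : R -> R3) t :
  (forall s h, l (h + s) = h *: basis3 R i + l s) -> differentiable f (l t) ->
  derivable (f \o l) t 1 /\ derive1 (f \o l) t = partial i f (l t).
Proof.
move=> hl df; have dfi := diff_derivable (v := basis3 R i) df.
have E : (fun h : R => h^-1 *: (((f \o l) \o shift t) (h *: 1) - (f \o l) t)) =
         (fun h : R => h^-1 *: ((f \o shift (l t)) (h *: basis3 R i) - f (l t))).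
  by apply/funext => h /=; rewrite hl /GRing.scale/= mulr1.
split; first by rewrite /derivable E.
by rewrite derive1E /derive E.
Qed.

Lemma slice_integral0 f (i : 'I_3) (l : R -> R3) (n : R) :
  (forall s h, l (h + s) = h *: basis3 R i + l s) -> continuous l ->
  smooth f -> (forall t, n <= `|t| -> f (l t) = 0 /\ partial i f (l t) = 0) ->
  (\int[lam]_t (partial i f (l t))%:E = 0)%E.
Proof.
move=> hl cl sf f0.
have D t := slice_derive hl (smooth_differentiable (l t) sf).
have E : derive1 (f \o l) = partial i f \o l.
  by apply/funext => t; have [_ ->] := D t.
rewrite -[RHS](@integral_derive_compact (f \o l) n).
- by rewrite E.
- by move=> t; have [] := D t.
- rewrite E => t; apply: continuous_comp; first exact: cl.
  exact/smooth_continuous/smooth_partial.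
- by move=> t /f0[].
- by move=> t /f0[_]; rewrite E.
Qed.

(** Fubini's theorem is used in the order that puts the integral along the direction [i] innermost,
    where the fundamental theorem of calculus gives zero. *)
Lemma integral_partial0 f (i : 'I_3) (K : set R3) : smooth f -> compact K ->
  (forall x, ~ K x -> f x = 0) -> (\int[mu]_x (partial i f x)%:E = 0)%E.
Proof.
move=> sf cK f0.
have [n Kn] := compact_sub_gcbox cK.
have cn : compact (gcbox (- n, - n, - n) (n, n, n)) by exact: gcbox_compact.
have nK x : ~ gcbox (- n, - n, - n) (n, n, n) x -> ~ K x by move=> h /Kn.
have f0' x : ~ gcbox (- n, - n, - n) (n, n, n) x -> f x = 0 by move=> /nK; exact: f0.
have t1 : real_test setT f by split => //; exists (gcbox (- n, - n, - n) (n, n, n)).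
have [sp _] := real_test_partial i t1.
have p0 x : ~ gcbox (- n, - n, - n) (n, n, n) x -> partial i f x = 0.
  move=> nx.
  have clK : closed (gcbox (- n, - n, - n) (n, n, n)).
    by apply: compact_closed => //; exact: norm_hausdorff.
  have nK' : \forall y \near x, ~ gcbox (- n, - n, - n) (n, n, n) y.
    by apply: open_nbhs_nbhs; split => //; exact: closed_openC.
  have -> : partial i f x = partial i (fun=> 0) x.
    by apply: near_eq_derive; apply: filterS nK' => y /f0'.
  by rewrite /partial derive_cst.
have [M hM] : exists M : R, forall x, gcbox (- n, - n, - n) (n, n, n) x -> `|partial i f x| <= M.
  have /compact_bounded : compact (partial i f @` gcbox (- n, - n, - n) (n, n, n)).
    apply: continuous_compact => //; apply: continuous_subspaceT.
    exact: smooth_continuous.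
  move=> [M [_ hM]]; exists (M + 1) => x Kx.
  by apply: (hM (M + 1)); [rewrite ltrDl|exists x].
have mp : measurable_fun (setT : set (mR3 R)) (partial i f).
  by apply: continuous_measurable3; exact: smooth_continuous.
have ip : mu.-integrable setT (EFin \o (partial i f : mR3 R -> R)).
  apply: (integrable_bounded_support (gcbox_measurable (- n, - n, - n) (n, n, n))
    _ mp hM p0).
  exact: mu3_gcbox_fin.
have ip2 (z : R) : (lam \x lam)%E.-integrable setT
    (EFin \o (fun p : measurableTypeR R * measurableTypeR R => partial i f (p, z))).
  apply: (@integrable_bounded_support _ _ (lam \x lam)%E
    (`[-n, n]%classic `*` `[-n, n]%classic) _ M).
  - exact: measurableX.
  - have fin : lam `[- n, n]%classic \is a fin_num.
      by rewrite lebesgue_measure_itv/= lte_fin; case: ifP.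
    apply: (@le_lt_trans _ _ (lam `[(- n)%R, n]%classic * lam `[(- n)%R, n]%classic)%E).
      by rewrite le_eqVlt; apply/orP; left; apply/eqP; exact: product_measure1E.
    by rewrite ltey_eq fin_numM.
  - exact: (measurableT_comp mp (pair2_measurable z)).
  - move=> [x y] [/= hx hy].
    have [hz|hz] := pselect (gcbox (- n, - n, - n) (n, n, n) (x, y, z)); first exact: hM.
    rewrite p0// normr0; apply: le_trans (hM (x, y, 0) _) => //.
    by split => //=; move: hx; rewrite /= in_itv/= => /andP[? ?]; apply/andP; split; lra.
  - move=> [x y] h; apply: p0 => -[/= hx hy _]; apply: h.
    by split; rewrite /= in_itv/=.
(* The closed box contains points with a coordinate equal to [n]; a modulus of at least [n + 1] is
   certainly outside. *)
have out (x y z m : R) : n + 1 <= m -> [\/ m = `|x|, m = `|y| | m = `|z|] ->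
    ~ gcbox (- n, - n, - n) (n, n, n) (x, y, z).
  move=> nm h [/= ]; rewrite -!ler_norml => h1 h2 h3.
  by case: h => h; rewrite -h in h1 h2 h3; lra.
have z0 (x y z m : R) : n + 1 <= m -> [\/ m = `|x|, m = `|y| | m = `|z|] ->
    f (x, y, z) = 0 /\ partial i f (x, y, z) = 0.
  by move=> nm h; have o := out _ _ _ _ nm h; rewrite f0' ?p0.
have cpair (U V W : topologicalType) (a : U -> V) (b : U -> W) :
    continuous a -> continuous b -> continuous (fun t => (a t, b t)).
  by move=> ca cb t; apply: cvg_pair; [exact: ca|exact: cb].
have ccst (U V : topologicalType) (c : V) : continuous (fun _ : U => c).
  by move=> t; exact: cvg_cst.
have cid : continuous (fun t : R => t) by move=> t; exact: cvg_id.
case: i sp p0 hM mp ip ip2 z0 {t1} => [[|[|[|//]]] hi] sp p0 hM mp ip ip2 z0.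
- rewrite (mu3_fubini2 ip) integral0_eq// => z _.
  have {}ip2 := ip2 z.
  rewrite -[LHS](integral21_prod_meas1 ip2) integral0_eq// => y _.
  apply: (@slice_integral0 f (Ordinal hi) (fun x => (x, y, z)) (n + 1)) => //.
  + move=> s h; transitivity (h * 1 + s, h * 0 + y, h * 0 + z); last by [].
    by rewrite mulr1 mulr0 !add0r.
  + by apply: (cpair _ _ _ (fun t => (t, y))) => //; apply: cpair.
  + by move=> t nt; apply: (z0 _ _ _ `|t|) => //; exact: Or31.
- rewrite (mu3_fubini2 ip) integral0_eq// => z _.
  have {}ip2 := ip2 z.
  rewrite -[LHS](integral12_prod_meas1 ip2) integral0_eq// => x _.
  apply: (@slice_integral0 f (Ordinal hi) (fun y => (x, y, z)) (n + 1)) => //.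
  + move=> s h; transitivity (h * 0 + x, h * 1 + s, h * 0 + z); last by [].
    by rewrite mulr1 mulr0 !add0r.
  + by apply: (cpair _ _ _ (fun t => (x, t))) => //; apply: cpair.
  + by move=> t nt; apply: (z0 _ _ _ `|t|) => //; exact: Or32.
- rewrite (mu3_fubini1 ip) integral0_eq// => -[x y] _.
  apply: (@slice_integral0 f (Ordinal hi) (fun z => (x, y, z)) (n + 1)) => //.
  + move=> s h; transitivity (h * 0 + x, h * 0 + y, h * 1 + s); last by [].
    by rewrite mulr1 mulr0 !add0r.
  + by apply: (cpair _ _ _ (fun=> (x, y))).
  + by move=> t nt; apply: (z0 _ _ _ `|t|) => //; exact: Or33.
Qed.

End IntegralPartial.

(** * The Sobolev space and bounded forms *)

Section SobolevSpace.
Variables (R : realType) (Om : set (R * R * R)).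
Hypothesis oOm : open Om.
Local Notation R3 := (R * R * R)%type.
Local Notation fct := (R3 -> R[i]).
Local Notation gfct := (R3 -> 'cV[R[i]]_3).
Local Notation mu := (@mu3 R).
Local Notation Re := complex.Re.
Local Notation Im := complex.Im.
Local Notation L2r := (L2r mu (Om : set (mR3 R))).
Local Notation ipr := (ipr mu (Om : set (mR3 R))).
Local Notation mOm := (open_measurable3 oOm).
Local Notation PH := (L2_ph oOm).
Local Notation nrm2 := (hnorm (dotL2 Om)).
Implicit Types (f : R3 -> R) (u v w phi psi : fct) (g h : gfct) (a : R[i]).

(** The derivative of the product vanishes outside [Om], so its integral over R^3, which is zero, is
    an integral over [Om]. *)
Lemma ibp_real f (f' : R3 -> R) i : real_test Om f -> real_test Om f' ->
  ipr (partial i f) f' = - ipr f (partial i f').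
Proof.
move=> tf tf'; have [sf [K [cK KO K0]]] := tf; have [sf' _] := tf'.
have tp := real_testM sf tf'; have [sp _] := tp.
have [_ [L [cL LO L0]]] := real_test_partial i tp.
have Lf := real_test_L2r oOm tf; have Lf' := real_test_L2r oOm tf'.
have Lp := real_test_L2r oOm (real_test_partial i tf).
have Lp' := real_test_L2r oOm (real_test_partial i tf').
have E : (fun x => partial i (fun x => f x * f' x) x) =
         (fun x => partial i f x * f' x + f x * partial i f' x).
  by apply/funext => x; rewrite partialM//; exact: smooth_differentiable.
have K0' x : ~ K x -> f x * f' x = 0 by move=> /K0 ->; rewrite mul0r.
have := integral_partial0 i sp cK K0'.
rewrite (_ : (\int[mu]_x _ = \int[mu]_(x in Om)
    (partial i f x * f' x + f x * partial i f' x)%:E)%E); last first.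
  rewrite [RHS]integral_mkcond; apply: eq_integral => x _.
  rewrite patchE -[_ + _](congr1 (fun F => F x) E); case: ifPn => // /negP; rewrite inE => nO.
  by rewrite L0// => /LO.
move=> /(congr1 (@fine R)) h; apply/eqP; rewrite -addr_eq0; apply/eqP.
rewrite -[RHS]h !iprE -RintegralD//; first exact: mOm.
  exact: (L2r_mul_integrable mOm Lp Lf').
exact: (L2r_mul_integrable mOm Lf Lp').
Qed.

Lemma dotL2E u v : L2 Om u -> L2 Om v -> dotL2 Om u v =
  (ipr (fun x => Re (u x)) (fun x => Re (v x)) +
   ipr (fun x => Im (u x)) (fun x => Im (v x))) +i*
  (ipr (fun x => Im (u x)) (fun x => Re (v x)) -
   ipr (fun x => Re (u x)) (fun x => Im (v x))).
Proof. move=> Lu Lv; exact: (@dotcE _ _ R mu _ mOm u v Lu Lv). Qed.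

Lemma ibp phi psi i : test_function Om phi -> test_function Om psi ->
  dotL2 Om (partialC i phi) psi = - dotL2 Om phi (partialC i psi).
Proof.
move=> tphi tpsi.
have L1 := test_L2 oOm tphi; have L2 := test_L2 oOm tpsi.
have L3 := test_L2 oOm (test_partialC i tphi).
have L4 := test_L2 oOm (test_partialC i tpsi).
rewrite (dotL2E L3 L2) (dotL2E L1 L4).
move/test_real: tphi => [pr pi]; move/test_real: tpsi => [qr qi].
rewrite /partialC /= !ibp_real//.
by apply: complex_eq; rewrite /= ?opprD ?opprK.
Qed.

Lemma partialC_conj phi i : test_function Om phi ->
  partialC i (fun x => (phi x)^*) = (fun x => (partialC i phi x)^*).
Proof.
move=> /test_real[[sr _] [si _]]; apply/funext => x; rewrite /partialC.
apply: complex_eq; rewrite ?ReJ ?ImJ /=.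
  by congr (partial i _ x); apply/funext => y; rewrite ReJ.
rewrite (_ : (fun y => Im _) = (fun y => -1 * Im (phi y))); last first.
  by apply/funext => y; rewrite ImJ mulN1r.
rewrite partialM; [|exact: differentiable_cst|exact: smooth_differentiable].
by rewrite /partial derive_cst mul0r add0r mulN1r.
Qed.

Lemma integralC_mul u v : integralC Om (fun x => u x * v x) =
  dotL2 Om u (fun x => (v x)^*).
Proof. by congr integralC; apply/funext => x; rewrite conjCi_K. Qed.

(** Test functions are stable under conjugation, so the bilinear pairing of the definition can be
    traded for the inner product of L^2. *)
Lemma weak_gradientP u g : weak_gradient Om u g <->
  (forall i, L2 Om (fun x => g x i 0)) /\
  forall phi, test_function Om phi -> forall i,
    dotL2 Om u (partialC i phi) = - dotL2 Om (fun x => g x i 0) phi.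
Proof.
split=> -[Lg H]; split => // phi tphi i.
  have tc := test_conj tphi.
  have := H _ tc i; rewrite !integralC_mul.
  rewrite (_ : (fun x => (partialC i _ x)^*) = partialC i phi); last first.
    by rewrite partialC_conj//; apply/funext => x; rewrite conjCi_K.
  by rewrite (_ : (fun x => ((phi x)^*)^*) = phi)//; apply/funext => x; rewrite conjCi_K.
rewrite !integralC_mul -partialC_conj//; apply: H; exact: test_conj.
Qed.

Lemma weak_gradient_unique u g h : weak_gradient Om u g -> weak_gradient Om u h ->
  forall i, eq_ae Om (fun x => g x i 0) (fun x => h x i 0).
Proof.
move=> /weak_gradientP[Lg Hg] /weak_gradientP[Lh Hh] i.
have Ld := ph_domB PH (Lg i) (Lh i).
have : eq_ae Om (fun x => g x i 0 - h x i 0) (fun=> 0).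
  apply: test_orth => // phi tphi.
  rewrite (ph_ipBl PH)//; last exact: test_L2.
  by rewrite -[dotL2 Om (fun x => g x i 0) _]opprK -Hg// Hh// opprK subrr.
by apply: filterS => x hx Ox; apply/eqP; rewrite -subr_eq0; apply/eqP; exact: hx.
Qed.

Lemma weak_gradientD u v g h : L2 Om u -> L2 Om v ->
  weak_gradient Om u g -> weak_gradient Om v h ->
  weak_gradient Om (fun x => u x + v x) (fun x => g x + h x).
Proof.
move=> Lu Lv /weak_gradientP[Lg Hg] /weak_gradientP[Lh Hh].
have E i : (fun x => (g x + h x) i 0) = (fun x => g x i 0 + h x i 0).
  by apply/funext => x; rewrite mxE.
apply/weak_gradientP; split=> [i|phi tphi i]; rewrite E.
  exact: (ph_domD PH).
have Lp : L2 Om (partialC i phi) by exact/test_L2/test_partialC.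
have Lphi : L2 Om phi by exact: test_L2.
by rewrite (ph_ipDl PH)// (ph_ipDl PH)// Hg// Hh// opprD.
Qed.

Lemma weak_gradientZ a u g : L2 Om u -> weak_gradient Om u g ->
  weak_gradient Om (fun x => a * u x) (fun x => a *: g x).
Proof.
move=> Lu /weak_gradientP[Lg Hg].
have E i : (fun x => (a *: g x) i 0) = (fun x => a * g x i 0).
  by apply/funext => x; rewrite mxE.
apply/weak_gradientP; split=> [i|phi tphi i]; rewrite E.
  exact: (ph_domZ PH).
have Lp : L2 Om (partialC i phi) by exact/test_L2/test_partialC.
have Lphi : L2 Om phi by exact: test_L2.
by rewrite (ph_ipZl PH)// (ph_ipZl PH)// Hg// mulrN.
Qed.

Lemma weak_gradient_test phi : test_function Om phi ->
  weak_gradient Om phi (fun x => \col_i partialC i phi x).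
Proof.
move=> tphi.
have E i : (fun x => (\col_i partialC i phi x) i 0) = partialC i phi.
  by apply/funext => x; rewrite mxE.
apply/weak_gradientP; split=> [i|psi tpsi i]; rewrite E.
  exact/test_L2/test_partialC.
by rewrite ibp// opprK.
Qed.

Lemma dotL2_lim (u_ : nat -> fct) u v : (forall n, L2 Om (u_ n)) -> L2 Om u -> L2 Om v ->
  (forall e, 0 < e -> exists N, forall n, (N <= n)%N -> nrm2 (fun x => u_ n x - u x) <= e) ->
  forall e, 0 < e -> exists N, forall n, (N <= n)%N ->
    absC (dotL2 Om (u_ n) v - dotL2 Om u v) <= e.
Proof.
move=> Lu_ Lu Lv cv e e0.
have nv := nrm_ge0 (dotL2 Om) v.
have [|N hN] := cv (e / (1 + nrm2 v)); first by rewrite divr_gt0// ltr_pwDl.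
exists N => n Nn; rewrite -(ph_ipBl PH)//.
apply: le_trans (ph_CS PH (ph_domB PH (Lu_ n) Lu) Lv) _.
have := hN n Nn; rewrite ler_pdivlMr ?ltr_pwDl//.
have := nrm_ge0 (dotL2 Om) (fun x => u_ n x - u x); nra.
Qed.

(** For a fixed test function both sides of the defining identity are continuous in L^2. *)
Lemma weak_gradient_closed (u_ : nat -> fct) (g_ : nat -> gfct) u g :
  (forall n, L2 Om (u_ n)) -> L2 Om u ->
  (forall n, weak_gradient Om (u_ n) (g_ n)) -> (forall i, L2 Om (fun x => g x i 0)) ->
  (forall e, 0 < e -> exists N, forall n, (N <= n)%N -> nrm2 (fun x => u_ n x - u x) <= e) ->
  (forall i e, 0 < e -> exists N, forall n, (N <= n)%N ->
     nrm2 (fun x => g_ n x i 0 - g x i 0) <= e) ->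
  weak_gradient Om u g.
Proof.
move=> Lu_ Lu wg Lg cu cg; apply/weak_gradientP; split => // phi tphi i.
have Lp : L2 Om (partialC i phi) by exact/test_L2/test_partialC.
have Lphi : L2 Om phi by exact: test_L2.
have Lg_ n j : L2 Om (fun x => g_ n x j 0) by have /weak_gradientP[] := wg n.
apply/eqP; rewrite -subr_eq0 opprK -absC_eq0 eq_le absC_ge0 andbT.
apply/ler_addgt0Pr => e e0; rewrite add0r.
have e2 : 0 < e / 2 by rewrite divr_gt0.
have [N1 h1] := dotL2_lim Lu_ Lu Lp cu e2.
have [N2 h2] := dotL2_lim (fun n => Lg_ n i) (Lg i) Lphi (cg i) e2.
pose n := maxn N1 N2.
have {}h1 := h1 n (leq_maxl _ _); have {}h2 := h2 n (leq_maxr _ _).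
have /weak_gradientP[_ hn] := wg n.
have {}hn := hn _ tphi i.
have -> : dotL2 Om u (partialC i phi) + dotL2 Om (fun x => g x i 0) phi =
  - (dotL2 Om (u_ n) (partialC i phi) - dotL2 Om u (partialC i phi)) +
  - (dotL2 Om (fun x => g_ n x i 0) phi - dotL2 Om (fun x => g x i 0) phi).
  by rewrite hn; ring.
by apply: le_trans (absCD _ _) _; rewrite !absCN; lra.
Qed.

Lemma dotL2vE g h : (forall i, L2 Om (fun x => g x i 0)) ->
  (forall i, L2 Om (fun x => h x i 0)) ->
  dotL2v Om g h = \sum_i dotL2 Om (fun x => g x i 0) (fun x => h x i 0).
Proof.
move=> Lg Lh; rewrite /dotL2v.
have rr i := L2r_mul_integrable mOm ((L2c_L2r oOm _).1 (Lg i)).1 ((L2c_L2r oOm _).1 (Lh i)).1.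
have ri i := L2r_mul_integrable mOm ((L2c_L2r oOm _).1 (Lg i)).1 ((L2c_L2r oOm _).1 (Lh i)).2.
have ir i := L2r_mul_integrable mOm ((L2c_L2r oOm _).1 (Lg i)).2 ((L2c_L2r oOm _).1 (Lh i)).1.
have ii i := L2r_mul_integrable mOm ((L2c_L2r oOm _).1 (Lg i)).2 ((L2c_L2r oOm _).1 (Lh i)).2.
have iRe i : mu.-integrable (Om : set (mR3 R))
    (EFin \o (fun x => Re (g x i 0 * (h x i 0)^*))).
  have := integrableD mOm (rr i) (ii i); apply: eq_integrable; first exact: mOm.
  by move=> x _ /=; rewrite !ReImE mulrN opprK.
have iIm i : mu.-integrable (Om : set (mR3 R))
    (EFin \o (fun x => Im (g x i 0 * (h x i 0)^*))).
  have := integrableB mOm (ir i) (ri i); apply: eq_integrable; first exact: mOm.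
  by move=> x _ /=; rewrite !ReImE mulrN addrC.
rewrite !big_ord_recr !big_ord0 /= /integralC.
apply: complex_eq; rewrite !(ReD, ImD) !(Re0, Im0) /= !add0r.
  rewrite -!RintegralD//; try exact: iRe; try exact: mOm.
    by apply: eq_Rintegral => x _; rewrite !big_ord_recr big_ord0 /= !ReD Re0 add0r.
  have := integrableD mOm (iRe (widen_ord (leqnSn 2) (widen_ord (leqnSn 1) ord_max)))
    (iRe (widen_ord (leqnSn 2) ord_max)).
  by apply: eq_integrable; first exact: mOm.
rewrite -!RintegralD//; try exact: iIm; try exact: mOm.
  by apply: eq_Rintegral => x _; rewrite !big_ord_recr big_ord0 /= !ImD Im0 add0r.
have := integrableD mOm (iIm (widen_ord (leqnSn 2) (widen_ord (leqnSn 1) ord_max)))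
  (iIm (widen_ord (leqnSn 2) ord_max)).
by apply: eq_integrable; first exact: mOm.
Qed.

Lemma gradP u : H1 Om u -> weak_gradient Om u (grad Om u).
Proof. by move=> [_ [g wg]]; exact: (xgetPex (fun=> 0) (ex_intro [set g | weak_gradient Om u g] g wg)). Qed.

Lemma H1_L2 u : H1 Om u -> L2 Om u. Proof. by case. Qed.

Lemma grad_L2 u i : H1 Om u -> L2 Om (fun x => grad Om u x i 0).
Proof. by move=> /gradP[]. Qed.

Lemma grad_ae u g i : H1 Om u -> weak_gradient Om u g ->
  eq_ae Om (fun x => grad Om u x i 0) (fun x => g x i 0).
Proof. by move=> /gradP wg /(weak_gradient_unique wg). Qed.

Lemma eq_ae_refl u : eq_ae Om u u.
Proof. exact: aeW. Qed.

(** Frees the inner product from the arbitrary choice made in [grad]: weak gradients agree almost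
    everywhere. *)
Lemma dotH1E u v g h : H1 Om u -> H1 Om v ->
  weak_gradient Om u g -> weak_gradient Om v h ->
  dotH1 Om u v = dotL2 Om u v + \sum_i dotL2 Om (fun x => g x i 0) (fun x => h x i 0).
Proof.
move=> Hu Hv wg wh; rewrite /dotH1 dotL2vE; try by move=> i; exact: grad_L2.
congr (_ + _); apply: eq_bigr => i _.
apply: (ae_dotc mOm); rewrite -?L2_L2c.
- exact: grad_L2.
- by case: wg.
- exact: grad_L2.
- by case: wh.
- exact: grad_ae.
- exact: grad_ae.
Qed.

Lemma H1_intro u g : L2 Om u -> weak_gradient Om u g -> H1 Om u.
Proof. by move=> Lu wg; split => //; exists g. Qed.

Lemma H1D u v : H1 Om u -> H1 Om v -> H1 Om (fun x => u x + v x).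
Proof.
move=> Hu Hv; apply: H1_intro; first exact: (ph_domD PH (H1_L2 Hu) (H1_L2 Hv)).
by apply: weak_gradientD (gradP Hu) (gradP Hv); exact: H1_L2.
Qed.

Lemma H1Z a u : H1 Om u -> H1 Om (fun x => a * u x).
Proof.
move=> Hu; apply: H1_intro; first exact: (ph_domZ PH a (H1_L2 Hu)).
by apply: weak_gradientZ (gradP Hu); exact: H1_L2.
Qed.

Lemma test_H1 phi : test_function Om phi -> H1 Om phi.
Proof. by move=> tphi; apply: H1_intro (weak_gradient_test tphi); exact: test_L2. Qed.

Lemma H1_prehilbert : prehilbert (H1 Om) (dotH1 Om).
Proof.
split; [exact/test_H1/test0|exact: H1D|exact: H1Z|..].
- move=> u v w Hu Hv Hw.
  have Lu := H1_L2 Hu; have Lv := H1_L2 Hv; have Lw := H1_L2 Hw.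
  have Gu i := grad_L2 i Hu; have Gv i := grad_L2 i Hv; have Gw i := grad_L2 i Hw.
  rewrite (dotH1E (H1D Hu Hv) Hw (weak_gradientD (H1_L2 Hu) (H1_L2 Hv) (gradP Hu) (gradP Hv)) (gradP Hw)).
  rewrite (dotH1E Hu Hw (gradP Hu) (gradP Hw)) (dotH1E Hv Hw (gradP Hv) (gradP Hw)).
  rewrite (ph_ipDl PH)// addrACA -big_split/=; congr (_ + _); apply: eq_bigr => i _.
  rewrite -(ph_ipDl PH)//.
  by congr dotL2; apply/funext => x; rewrite mxE.
- move=> a u w Hu Hw.
  have Lu := H1_L2 Hu; have Lw := H1_L2 Hw.
  have Gu i := grad_L2 i Hu; have Gw i := grad_L2 i Hw.
  rewrite (dotH1E (H1Z a Hu) Hw (weak_gradientZ a (H1_L2 Hu) (gradP Hu)) (gradP Hw)).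
  rewrite (dotH1E Hu Hw (gradP Hu) (gradP Hw)).
  rewrite (ph_ipZl PH)// mulrDr mulr_sumr; congr (_ + _); apply: eq_bigr => i _.
  rewrite -(ph_ipZl PH)//.
  by congr dotL2; apply/funext => x; rewrite mxE.
- move=> u v Hu Hv.
  have Lu := H1_L2 Hu; have Lv := H1_L2 Hv.
  have Gu i := grad_L2 i Hu; have Gv i := grad_L2 i Hv.
  rewrite (dotH1E Hu Hv (gradP Hu) (gradP Hv)) (dotH1E Hv Hu (gradP Hv) (gradP Hu)).
  rewrite (ph_ipC PH Lu Lv) conjcD; congr (_ + _).
  rewrite rmorph_sum; apply: eq_bigr => i _.
  by rewrite (ph_ipC PH (Gu i) (Gv i)).
- move=> u Hu; have Lu := H1_L2 Hu; have Gu i := grad_L2 i Hu; rewrite (dotH1E Hu Hu (gradP Hu) (gradP Hu)) ReD addr_ge0//.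
    by rewrite (ph_ip_ge0 PH).
  by rewrite Re_sum sumr_ge0// => i _; rewrite (ph_ip_ge0 PH).
Qed.
Local Notation PH1 := H1_prehilbert.

Lemma normH1E u : normH1 Om u = hnorm (dotH1 Om) u.
Proof. by []. Qed.

Lemma normH1_sqr u g : H1 Om u -> weak_gradient Om u g ->
  normH1 Om u ^+ 2 = nrm2 u ^+ 2 + \sum_i nrm2 (fun x => g x i 0) ^+ 2.
Proof.
move=> Hu wg; have Lu := H1_L2 Hu; rewrite normH1E (nrm_sqr PH1)// (dotH1E Hu Hu wg wg) ReD Re_sum.
rewrite (nrm_sqr PH)//; congr (_ + _); apply: eq_bigr => i _.
by rewrite (nrm_sqr PH)//; case: wg.
Qed.

Lemma nrm2_le_H1 u : H1 Om u -> nrm2 u <= normH1 Om u.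
Proof.
move=> Hu; rewrite -ler_sqr ?nnegrE ?nrm_ge0// (normH1_sqr Hu (gradP Hu)) lerDl.
by rewrite sumr_ge0// => i _; rewrite sqr_ge0.
Qed.

Lemma nrm2_grad_le_H1 u g i : H1 Om u -> weak_gradient Om u g ->
  nrm2 (fun x => g x i 0) <= normH1 Om u.
Proof.
move=> Hu wg; rewrite -ler_sqr ?nnegrE ?nrm_ge0// (normH1_sqr Hu wg).
rewrite (bigD1 i)//= addrCA lerDl addr_ge0 ?sqr_ge0//.
by rewrite sumr_ge0// => j _; rewrite sqr_ge0.
Qed.

Lemma L2_complete : ph_complete (L2 Om) (dotL2 Om).
Proof. exact: (@L2_ph_complete _ _ R mu _ mOm). Qed.

Lemma H1_complete : ph_complete (H1 Om) (dotH1 Om).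
Proof.
move=> u_ Hu cauchy.
have wgB m n : weak_gradient Om (fun x => u_ m x - u_ n x)
    (fun x => grad Om (u_ m) x - grad Om (u_ n) x).
  have := weak_gradientD (H1_L2 (Hu m)) (H1_L2 (H1Z (-1) (Hu n))) (gradP (Hu m))
    (weak_gradientZ (-1) (H1_L2 (Hu n)) (gradP (Hu n))).
  congr weak_gradient; apply/funext => x; first by rewrite mulN1r.
  by rewrite scaleN1r.
have HB m n := ph_domB PH1 (Hu m) (Hu n).
have [||u Lu cu] := @L2_complete u_.
- by move=> n; exact: H1_L2.
- move=> e /cauchy[N hN]; exists N => m n Nm Nn.
  by apply: le_trans (hN m n Nm Nn); exact: nrm2_le_H1.
have /boolp.choice[g hg] : forall i : 'I_3, exists gi : fct, L2 Om gi /\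
    forall e, 0 < e -> exists N, forall n, (N <= n)%N ->
      nrm2 (fun x => grad Om (u_ n) x i 0 - gi x) <= e.
  move=> i; have [||gi Lgi ci] := @L2_complete (fun n x => grad Om (u_ n) x i 0).
  - by move=> n; exact: grad_L2.
  - move=> e /cauchy[N hN]; exists N => m n Nm Nn.
    apply: le_trans (hN m n Nm Nn).
    have := nrm2_grad_le_H1 i (HB m n) (wgB m n).
    by under eq_fun do rewrite !mxE.
  by exists gi.
pose G x := \col_i g i x.
have GE i : (fun x => G x i 0) = g i by apply/funext => x; rewrite mxE.
have wG : weak_gradient Om u G.
  apply: (@weak_gradient_closed u_ (fun n => grad Om (u_ n))) => //.
  - by move=> n; exact: H1_L2.
  - by move=> n; exact: gradP.
  - by move=> i; rewrite GE; case: (hg i).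
  - move=> i e e0; have [_ /(_ e e0)[N hN]] := hg i; exists N => n Nn.
    by have := hN n Nn; rewrite -GE.
have Hlim : H1 Om u by exact: H1_intro wG.
exists u => // e e0.
(* The function and its three derivatives each contribute at most [(e / 2)^2] to the squared norm,
   together [e^2]. *)
have e4 : 0 < e / 2 by rewrite divr_gt0.
have [N0 h0] := cu _ e4.
have /boolp.choice[M hM] : forall i : 'I_3, exists N, forall n, (N <= n)%N ->
      nrm2 (fun x => grad Om (u_ n) x i 0 - g i x) <= e / 2.
  by move=> i; have [_ /(_ _ e4)] := hg i.
exists (maxn N0 (\sum_i M i)) => n; rewrite geq_max => /andP[n0 nM].
have wB : weak_gradient Om (fun x => u_ n x - u x) (fun x => grad Om (u_ n) x - G x).
  have := weak_gradientD (H1_L2 (Hu n)) (H1_L2 (H1Z (-1) Hlim)) (gradP (Hu n))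
    (weak_gradientZ (-1) Lu wG).
  congr weak_gradient; apply/funext => x; first by rewrite mulN1r.
  by rewrite scaleN1r.
rewrite -normH1E -ler_sqr ?nnegrE ?nrm_ge0 ?(ltW e0)// (normH1_sqr (ph_domB PH1 (Hu n) Hlim) wB).
have q1 : nrm2 (fun x => u_ n x - u x) ^+ 2 <= (e / 2) ^+ 2.
  by rewrite ler_sqr ?nnegrE ?nrm_ge0 ?(ltW e4)// h0.
have q2 i : nrm2 (fun x => (grad Om (u_ n) x - G x) i 0) ^+ 2 <= (e / 2) ^+ 2.
  rewrite ler_sqr ?nnegrE ?nrm_ge0 ?(ltW e4)//.
  under eq_fun do rewrite !mxE; apply: hM; apply: leq_trans nM.
  by rewrite (bigD1 i)//= leq_addr.
apply: (@le_trans _ _ ((e / 2) ^+ 2 + \sum_(i < 3) (e / 2) ^+ 2)).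
  by apply: lerD => //; apply: ler_sum => i _; exact: q2.
by rewrite sumr_const card_ord; rewrite -mulr_natr; lra.
Qed.

End SobolevSpace.

(** * The closed subspace H^1_0 and the operators represented by forms *)

Section H10Space.
Variables (R : realType) (Om : set (R * R * R)).
Hypothesis oOm : open Om.
Local Notation R3 := (R * R * R)%type.
Local Notation fct := (R3 -> R[i]).
Local Notation PH1 := (H1_prehilbert oOm).
Local Notation PH := (L2_ph oOm).
Local Notation N1 := (hnorm (dotH1 Om)).
Implicit Types (u v w phi psi : fct) (a : R[i]).

Lemma H10_H1 u : H10 Om u -> H1 Om u. Proof. by case. Qed.

Lemma H10P u : H10 Om u <-> H1 Om u /\ forall e, 0 < e ->
  exists2 phi, test_function Om phi & N1 (fun x => u x - phi x) < e.
Proof.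
by split=> -[Hu hu]; split => // e /hu[phi tphi h]; exists phi; rewrite // ?normH1E // -normH1E.
Qed.

Lemma test_H10 phi : test_function Om phi -> H10 Om phi.
Proof.
move=> tphi; apply/H10P; split; first exact: test_H1.
move=> e e0; exists phi => //.
have -> : (fun x => phi x - phi x) = (fun=> 0) by apply/funext => x; rewrite subrr.
by rewrite (nrm0 PH1).
Qed.

Lemma H10_closed u : H1 Om u ->
  (forall e, 0 < e -> exists2 v, H10 Om v & N1 (fun x => u x - v x) <= e) -> H10 Om u.
Proof.
move=> Hu appr; apply/H10P; split=> // e e0.
have e2 : 0 < e / 2 by rewrite divr_gt0.
have [v /H10P[Hv hv] uv] := appr _ e2.
have [phi tphi vphi] := hv _ e2; exists phi => //.
apply: le_lt_trans (nrm_triangle PH1 Hu (test_H1 oOm tphi) Hv) _.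
rewrite [ltRHS](splitr e); exact: ler_ltD uv vphi.
Qed.

Lemma H10D u v : H10 Om u -> H10 Om v -> H10 Om (fun x => u x + v x).
Proof.
move=> /H10P[Hu hu] /H10P[Hv hv]; apply: H10_closed; first exact: (ph_domD PH1).
move=> e e0; have e2 : 0 < e / 2 by rewrite divr_gt0.
have [phi tphi uphi] := hu _ e2; have [psi tpsi vpsi] := hv _ e2.
exists (fun x => phi x + psi x); first exact/test_H10/testD.
rewrite (_ : (fun x => _) = fun x => (u x - phi x) + (v x - psi x)); last first.
  by apply/funext => x; ring.
have d1 := ph_domB PH1 Hu (test_H1 oOm tphi).
have d2 := ph_domB PH1 Hv (test_H1 oOm tpsi).
apply: le_trans (nrmD PH1 d1 d2) _.
rewrite [leRHS](splitr e); exact: lerD (ltW uphi) (ltW vpsi).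
Qed.

Lemma H10Z a u : H10 Om u -> H10 Om (fun x => a * u x).
Proof.
move=> /H10P[Hu hu]; apply: H10_closed; first exact: (ph_domZ PH1).
move=> e e0; have a0 := absC_ge0 a.
have [|phi tphi uphi] := hu (e / (1 + absC a)); first by rewrite divr_gt0// ltr_pwDl.
exists (fun x => a * phi x); first exact/test_H10/testZ.
rewrite (_ : (fun x => _) = fun x => a * (u x - phi x)); last first.
  by apply/funext => x; ring.
have d1 := ph_domB PH1 Hu (test_H1 oOm tphi).
rewrite (nrmZ PH1)//.
have n0 := nrm_ge0 (dotH1 Om) (fun x => u x - phi x).
move: uphi n0; move: (hnorm _ _) (absC a) a0 => n b b0.
by rewrite ltr_pdivlMr ?ltr_pwDl//; nra.
Qed.

Lemma H10_prehilbert : prehilbert (H10 Om) (dotH1 Om).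
Proof.
split; [exact/test_H10/test0|exact: H10D|exact: H10Z|..].
- by move=> u v w /H10_H1 ? /H10_H1 ? /H10_H1 ?; exact: (ph_ipDl PH1).
- by move=> a u w /H10_H1 ? /H10_H1 ?; exact: (ph_ipZl PH1).
- by move=> u v /H10_H1 ? /H10_H1 ?; exact: (ph_ipC PH1).
- by move=> u /H10_H1 ?; exact: (ph_ip_ge0 PH1).
Qed.
Local Notation PH0 := H10_prehilbert.

Lemma H10_complete : ph_complete (H10 Om) (dotH1 Om).
Proof.
move=> u_ Hu cauchy.
have [|u H1u cu] := H1_complete oOm _ cauchy; first by move=> n; exact/H10_H1/Hu.
exists u => //; apply: H10_closed => // e e0.
have [N hN] := cu _ e0; exists (u_ N) => //.
by rewrite (nrm_distC PH1)//; [exact: hN|exact/H10_H1/Hu].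
Qed.

Lemma ae_dotL2_0 u v : L2 Om u -> L2 Om v -> eq_ae Om u (fun=> 0) -> dotL2 Om u v = 0.
Proof.
move=> Lu Lv u0.
rewrite (_ : dotL2 Om u v = dotL2 Om (fun=> 0) v); last first.
  exact: (ae_dotc (open_measurable3 oOm) Lu (ph_dom0 PH) Lv Lv u0 (eq_ae_refl _ v)).
by have := ph_ipZl PH 0 (ph_dom0 PH) Lv; rewrite !mul0r.
Qed.

(** The zero field is a weak gradient of a function that vanishes almost everywhere. *)
Lemma normH1_ae0 u : H1 Om u -> eq_ae Om u (fun=> 0) -> N1 u = 0.
Proof.
move=> Hu u0; have Lu := H1_L2 Hu.
have E (i : 'I_3) : (fun x : R3 => (0 : 'cV[R[i]]_3) i 0) = (fun=> 0).
  by apply/funext => x; rewrite mxE.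
have L0 : L2 Om (fun=> 0) by exact: (ph_dom0 PH).
have wg : weak_gradient Om u (fun=> 0).
  apply/weak_gradientP; split=> [i|phi tphi i]; rewrite E//.
  have Lphi := test_L2 oOm tphi.
  have Lp := test_L2 oOm (test_partialC i tphi).
  by rewrite !ae_dotL2_0// ?oppr0//; exact: eq_ae_refl.
apply/eqP; rewrite -sqrf_eq0 -normH1E (normH1_sqr oOm Hu wg); apply/eqP.
rewrite big1 ?addr0; last first.
  by move=> i _; rewrite E (nrm0 PH) expr0n.
by rewrite (nrm_sqr PH)// ae_dotL2_0.
Qed.

Lemma normH1_eq0 u : H1 Om u -> N1 u = 0 -> eq_ae Om u (fun=> 0).
Proof.
move=> Hu n0; have Lu := H1_L2 Hu.
have : hnorm (dotL2 Om) u = 0.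
  by apply/eqP; rewrite eq_le nrm_ge0 andbT -n0 -normH1E; exact: nrm2_le_H1.
move=> h; apply: (L2_nrm_eq0 (open_measurable3 oOm) Lu).
have := nrm_sqr PH Lu; rewrite h expr0n/= => hh; rewrite [RHS]hh.
by [].
Qed.

Lemma dotH1_ae u v w : H1 Om u -> H1 Om v -> H1 Om w -> eq_ae Om u v ->
  dotH1 Om u w = dotH1 Om v w.
Proof.
move=> Hu Hv Hw uv; have Hd := ph_domB PH1 Hu Hv.
have d0 : N1 (fun x => u x - v x) = 0.
  apply: normH1_ae0 => //; apply: filterS uv => x h Ox.
  by rewrite h// subrr.
apply/eqP; rewrite -subr_eq0 -(ph_ipBl PH1)// -absC_eq0 eq_le absC_ge0 andbT.
by apply: le_trans (ph_CS PH1 Hd Hw) _; rewrite d0 mul0r.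
Qed.

Definition bounded_form (b : fct -> fct -> R[i]) : Prop :=
  [/\ forall u v w, H10 Om u -> H10 Om v -> H10 Om w ->
        b (fun x => u x + v x) w = b u w + b v w,
      forall a u w, H10 Om u -> H10 Om w -> b (fun x => a * u x) w = a * b u w,
      forall w u v, H10 Om w -> H10 Om u -> H10 Om v ->
        b w (fun x => u x + v x) = b w u + b w v,
      forall a w v, H10 Om w -> H10 Om v -> b w (fun x => a * v x) = a^* * b w v &
      exists C : R, forall u v, H10 Om u -> H10 Om v -> absC (b u v) <= C * (N1 u * N1 v)].

(** The defect of linearity of [B] is orthogonal to itself, so it has norm zero and vanishes almost
    everywhere. *)
Lemma bounded_form_represents b : bounded_form b ->
  represents Om b (form_operator Om b).
Proof.
move=> [bDl bZl bDr bZr [C hC]].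
have hC' u v : H10 Om u -> H10 Om v -> absC (b u v) <= `|C| * (N1 u * N1 v).
  move=> Hu Hv; apply: le_trans (hC u v Hu Hv) _.
  by rewrite ler_wpM2r ?ler_norm// mulr_ge0// nrm_ge0.
have [B [B1 B2 B3]] := riesz_operator H10_prehilbert H10_complete (normr_ge0 C) bDr bZr hC'.
suff linB a u v : H10 Om u -> H10 Om v ->
    eq_ae Om (B (fun x => a * u x + v x)) (fun x => a * B u x + B v x).
  apply: (xgetPex (fun=> fun=> 0)); exists B; split; last exact: B2.
  by split; [exact: B1|exact: linB|exists `|C| => u Hu; rewrite !normH1E; exact: B3].
move=> Hu Hv.
have Hau := H10Z a Hu; have Hauv := H10D Hau Hv.
have HBa := H10Z a (B1 _ Hu); have HBr := H10D HBa (B1 _ Hv).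
have Hd := ph_domB PH0 (B1 _ Hauv) HBr.
have n0 : N1 (fun x => B (fun x => a * u x + v x) x - (a * B u x + B v x)) = 0.
  apply/eqP; rewrite -sqrf_eq0 (nrm_sqr PH0 Hd) (ph_ipBl PH0 (B1 _ Hauv) HBr Hd).
  rewrite (ph_ipDl PH0 HBa (B1 _ Hv) Hd) (ph_ipZl PH0 a (B1 _ Hu) Hd).
  rewrite (B2 _ _ Hauv Hd) (B2 _ _ Hu Hd) (B2 _ _ Hv Hd).
  by rewrite (bDl _ _ _ Hau Hv Hd) (bZl _ _ _ Hu Hd) subrr.
have := normH1_eq0 (H10_H1 Hd) n0; apply: filterS => x h Ox.
by apply/eqP; rewrite -subr_eq0; apply/eqP; exact: h.
Qed.

Lemma form_operator_H10 b u : bounded_form b -> H10 Om u -> H10 Om (form_operator Om b u).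
Proof. by move=> /bounded_form_represents[[h _ _] _] Hu; exact: (h u Hu). Qed.

Lemma form_operatorE b u v : bounded_form b -> H10 Om u -> H10 Om v ->
  dotH1 Om (form_operator Om b u) v = b u v.
Proof. by move=> /bounded_form_represents[_ h] Hu Hv; exact: (h u v Hu Hv). Qed.

(** [T] is linear only up to almost everywhere equality, which the inner product does not see by
    [dotH1_ae]. *)
Lemma adjoint_form T : bounded_operator Om T -> bounded_form (fun u v => dotH1 Om u (T v)).
Proof.
move=> [T1 T2 [C hC]].
have E a u v w : H10 Om u -> H10 Om v -> H10 Om w ->
    dotH1 Om w (T (fun x => a * u x + v x)) = a^* * dotH1 Om w (T u) + dotH1 Om w (T v).
  move=> Hu Hv Hw.
  have H1' := T1 _ (H10D (H10Z a Hu) Hv).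
  have H2 := H10D (H10Z a (T1 _ Hu)) (T1 _ Hv).
  rewrite (ph_ipC PH0 H1' Hw).
  rewrite (dotH1_ae (H10_H1 H1') (H10_H1 H2) (H10_H1 Hw) (T2 a u v Hu Hv)).
  have Ta := H10Z a (T1 _ Hu); have Tu := T1 _ Hu; have Tv := T1 _ Hv.
  by rewrite -(ph_ipC PH0 H2 Hw) (ph_ipDr PH0 Ta Tv Hw) (ph_ipZr PH0 a Tu Hw).
split.
- by move=> u v w Hu Hv Hw; exact: (ph_ipDl PH0 Hu Hv (T1 _ Hw)).
- by move=> a u w Hu Hw; exact: (ph_ipZl PH0 a Hu (T1 _ Hw)).
- move=> w u v Hw Hu Hv; have := E 1 u v w Hu Hv Hw.
  rewrite rmorph1 mul1r => <-; congr (dotH1 _ _ (T _)).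
  by apply/funext => x; rewrite mul1r.
- move=> a w v Hw Hv; have H0 := ph_dom0 PH0.
  (* Homogeneity is read off the two-term identity [E] with the zero function as second argument, so
     [T] of zero must be orthogonal to everything. [E] with [a = -1] and both functions zero shows
     this. *)
  have T0 : dotH1 Om w (T (fun=> 0)) = 0.
    have := E (-1) _ _ w H0 H0 Hw.
    rewrite (_ : (fun x => _) = (fun=> 0)); last by apply/funext => x; rewrite mulr0 addr0.
    by rewrite rmorphN rmorph1 mulN1r addNr.
  have := E a v _ w Hv H0 Hw; rewrite T0 addr0 => <-; congr (dotH1 _ _ (T _)).
  by apply/funext => x; rewrite addr0.
- exists `|C| => u v Hu Hv; apply: le_trans (ph_CS PH0 Hu (T1 _ Hv)) _.
  rewrite mulrCA ler_wpM2l ?nrm_ge0//.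
  by apply: le_trans (hC v Hv) _; rewrite ler_wpM2r ?nrm_ge0// ler_norm.
Qed.

(** With this identity neither the adjoint nor the operator has to be known explicitly: coercivity
    of their product becomes a statement about [b u (T u)]. *)
Lemma adjoint_form_operatorE T b u v : bounded_operator Om T -> bounded_form b ->
  H10 Om u -> H10 Om v ->
  dotH1 Om (adjoint Om T (form_operator Om b u)) v = b u (T v).
Proof.
move=> hT hb Hu Hv; have [T1 _ _] := hT.
rewrite /adjoint (form_operatorE (adjoint_form hT) (form_operator_H10 hb Hu) Hv).
exact: (form_operatorE hb Hu (T1 _ Hv)).
Qed.

Lemma adjoint_H10 T u : bounded_operator Om T -> H10 Om u -> H10 Om (adjoint Om T u).
Proof. by move=> hT; apply: form_operator_H10; exact: adjoint_form. Qed.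

End H10Space.

(** * Radial multipliers on H10 *)

Section Bernstein.
Variable R : realType.
Implicit Types (f g : nat -> R) (c x : R) (N : nat).

(* Bernstein polynomials in c X: the expectation of f under the binomial law of
   parameters N and c x, built by conditioning on the first trial. *)
Fixpoint bern c N f : {poly R} :=
  if N is M.+1 then (1 - c%:P * 'X) * bern c M f + (c%:P * 'X) * bern c M (f \o S)
  else (f 0)%:P.

Definition bernE N f (t : R) := (bern 1 N f).[t].

Lemma bern_hornerE c N f x : (bern c N f).[x] = bernE N f (c * x).
Proof.
rewrite /bernE; elim: N f => [|N ih] f /=; first by rewrite !hornerC.
by rewrite !(hornerE, ih).
Qed.

Lemma bernE0 f t : bernE 0 f t = f 0.
Proof. by rewrite /bernE /= hornerC. Qed.

Lemma bernES N f t : bernE N.+1 f t = (1 - t) * bernE N f t + t * bernE N (f \o S) t.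
Proof. by rewrite /bernE /= !hornerE. Qed.

Lemma eq_bernE N f g t : (forall j, (j <= N)%N -> f j = g j) -> bernE N f t = bernE N g t.
Proof.
elim: N f g => [|N ih] f g fg; first by rewrite !bernE0 fg.
rewrite !bernES (ih f g) ?(ih (f \o S) (g \o S))// => j jN; apply: fg => //.
exact: leqW.
Qed.

Lemma bernED N f g t : bernE N (fun j => f j + g j) t = bernE N f t + bernE N g t.
Proof.
elim: N f g => [|N ih] f g; first by rewrite !bernE0.
by rewrite !bernES ih [X in _ + t * X](ih (f \o S) (g \o S)); ring.
Qed.

Lemma bernEZ N (a : R) f t : bernE N (fun j => a * f j) t = a * bernE N f t.
Proof.
elim: N f => [|N ih] f; first by rewrite !bernE0.
by rewrite !bernES ih [X in _ + t * X](ih (f \o S)); ring.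
Qed.

Lemma bernE_cst N (a : R) t : bernE N (fun=> a) t = a.
Proof.
elim: N => [|N ih]; first by rewrite bernE0.
by rewrite bernES [X in _ + t * X](_ : _ = bernE N (fun=> a) t)// ih; ring.
Qed.

Lemma bernE_id N t : bernE N (fun j => j%:R) t = N%:R * t.
Proof.
elim: N => [|N ih]; first by rewrite bernE0 mul0r.
rewrite bernES ih [X in _ + t * X](_ : _ = bernE N (fun j => j%:R + 1) t).
  by rewrite bernED ih bernE_cst [in RHS]mulrSr; ring.
by apply: eq_bernE => j _ /=; rewrite -natr1.
Qed.

Lemma bernE_sqr N t : bernE N (fun j => j%:R ^+ 2) t =
  N%:R * t * (1 - t) + N%:R ^+ 2 * t ^+ 2.
Proof.
elim: N => [|N ih]; first by rewrite bernE0; ring.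
rewrite bernES ih [X in _ + t * X](_ : _ = bernE N (fun j => j%:R ^+ 2 + (2 * j%:R + 1)) t).
  by rewrite !bernED ih bernEZ bernE_id bernE_cst -natr1; ring.
by apply: eq_bernE => j _ /=; rewrite -natr1; ring.
Qed.

Lemma ler_bernE N f g t : 0 <= t <= 1 -> (forall j, (j <= N)%N -> f j <= g j) ->
  bernE N f t <= bernE N g t.
Proof.
move=> /andP[t0 t1]; elim: N f g => [|N ih] f g fg; first by rewrite !bernE0 fg.
rewrite !bernES lerD// ler_wpM2l ?subr_ge0//; apply: ih => j jN; apply: fg => //.
exact: leqW.
Qed.

Lemma bernE_normr N f t (C : R) : 0 <= t <= 1 ->
  (forall j, (j <= N)%N -> `|f j| <= C) -> `|bernE N f t| <= C.
Proof.
move=> t01 fC; rewrite ler_norml; apply/andP; split.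
  rewrite -(bernE_cst N (- C) t); apply: ler_bernE => // j /fC.
  by rewrite ler_norml => /andP[].
rewrite -[leRHS](bernE_cst N C t); apply: ler_bernE => // j /fC.
by rewrite ler_norml => /andP[].
Qed.

Lemma bernE_dist N f t (l : R) (g : nat -> R) : 0 <= t <= 1 ->
  (forall j, (j <= N)%N -> `|f j - l| <= g j) -> `|bernE N f t - l| <= bernE N g t.
Proof.
move=> t01 fg.
have -> : bernE N f t - l = bernE N (fun j => f j - l) t.
  by rewrite bernED bernE_cst.
rewrite ler_norml; apply/andP; split.
  rewrite -mulN1r -bernEZ; apply: ler_bernE => // j /fg.
  by rewrite mulN1r ler_norml => /andP[].
by apply: ler_bernE => // j /fg; rewrite ler_norml => /andP[].
Qed.

(** Variance plus squared bias of [b j] as an estimate of [x], for [j] binomial with parameters [N]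
    and [t]. *)
Lemma bernE_var N (b x t : R) : bernE N (fun j => (b * j%:R - x) ^+ 2) t =
  b ^+ 2 * N%:R * t * (1 - t) + (b * N%:R * t - x) ^+ 2.
Proof.
rewrite (@eq_bernE N _ (fun j => b ^+ 2 * j%:R ^+ 2 + ((- 2 * b * x) * j%:R + x ^+ 2))).
  by rewrite !bernED !bernEZ bernE_sqr bernE_id bernE_cst; ring.
by move=> j _; ring.
Qed.

Lemma bernB c N f g : bern c N (fun j => f j - g j) = bern c N f - bern c N g.
Proof.
elim: N f g => [|N ih] f g /=; first by rewrite polyCB.
by rewrite ih [X in _ + _ * X](ih (f \o S) (g \o S)); ring.
Qed.

(** The derivative is again a Bernstein polynomial, of the forward differences and with one trial
    less. The induction uses the conditioning on the first trial for both polynomials. *)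
Lemma deriv_bern c N f : deriv (bern c N.+1 f) =
  c%:P * N.+1%:R * bern c N (fun j => f j.+1 - f j).
Proof.
elim: N f => [|N ih] f.
  rewrite /= !(derivD, derivM, derivN, derivC, derivX) polyCB.
  by ring.
have E : bern c N.+1 (fun j => f j.+1 - f j) = bern c N.+1 (f \o S) - bern c N.+1 f.
  exact: (bernB c N.+1 (f \o S) f).
have E2 : bern c N.+1 (fun j => f j.+1 - f j) =
    (1 - c%:P * 'X) * bern c N (fun j => f j.+1 - f j) +
    c%:P * 'X * bern c N (fun j => (f \o S) j.+1 - (f \o S) j) by [].
have -> : bern c N.+2 f = (1 - c%:P * 'X) * bern c N.+1 f +
    (c%:P * 'X) * bern c N.+1 (f \o S) by [].
have ihf := ih f; have ihS := ih (f \o S).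
move: E E2 ihf ihS; move: (bern c N.+1 f) (bern c N.+1 (f \o S)) => p q E E2 ihf ihS.
rewrite derivD [deriv (_ * p)]derivM [deriv (_ * q)]derivM ihf ihS.
have -> : deriv (1 - c%:P * 'X) = - c%:P.
  have -> : 1 - c%:P * 'X = 1%:P - c%:P * 'X by [].
  by rewrite derivB derivM !derivC derivX; ring.
have -> : deriv (c%:P * 'X) = c%:P by rewrite derivM derivC derivX; ring.
have -> : N.+2%:R = N.+1%:R + 1 :> {poly R} by rewrite natr1.
rewrite [c%:P * (_ + 1)]mulrDr [in RHS]mulrDl mulr1.
rewrite [X in _ = _ + c%:P * X]E [X in _ = X + _](congr1 _ E2).
by move: (bern c N _) (bern c N _) => X Y; ring.
Qed.

(** The shape in which Chebyshev estimates arrive: an arbitrary [e] plus a variance of order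
    [1/n]. *)
Lemma cvg_eps_harmonic (u : nat -> R) (l : R) :
  (forall e : R, 0 < e -> exists A : R, forall n, `|u n - l| <= e + A / n.+1%:R) ->
  u n @[n --> \oo] --> l.
Proof.
move=> H; apply/cvgrPdist_le => e e0.
have [A hA] := H (e / 2) (divr_gt0 e0 (ltr0Sn _ _)).
have : (`|A| * harmonic n) @[n --> \oo] --> (`|A| * 0 : R).
  by apply: cvgM; [exact: cvg_cst|exact: cvg_harmonic].
rewrite mulr0 => /cvgrPdist_le /(_ (e / 2)) hh.
have := hh (divr_gt0 e0 (ltr0Sn _ _)); apply: filterS => n.
rewrite sub0r normrN normrM normr_id => hn.
rewrite distrC (le_trans (hA n))// [leRHS](splitr e) lerD2l.
apply: le_trans hn; apply: le_trans (ler_norm _) _; rewrite normrM /=.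
by rewrite lexx.
Qed.

(** Chebyshev's argument for [P] and for its derivative. The derivative averages the slopes of [k]
    between neighbouring nodes, hence the bound [L]. Strict differentiability off [a] makes the
    slopes near [x] close to [k1 x], and the nodes far from [x] are paid for by the second
    moment. *)
Lemma bernstein_approx (k k1 : R -> R) (B L a : R) : 0 < B -> 0 <= L ->
  (forall x y : R, 0 <= x <= B -> 0 <= y <= B -> `|k x - k y| <= L * `|x - y|) ->
  (forall x, 0 <= x <= B -> x != a -> forall e : R, 0 < e -> exists2 d : R, 0 < d &
     forall y z : R, 0 <= y <= B -> 0 <= z <= B -> `|y - x| < d -> `|z - x| < d ->
     `|k y - k z - k1 x * (y - z)| <= e * `|y - z|) ->
  exists (P : nat -> {poly R}) (C : R), forall x, 0 <= x <= B ->
    [/\ forall n, `|(P n).[x]| <= C, forall n, `|(deriv (P n)).[x]| <= L,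
        (P n).[x] @[n --> \oo] --> k x &
        x != a -> (deriv (P n)).[x] @[n --> \oo] --> k1 x].
Proof.
move=> B0 L0 kL kd.
pose pt n j : R := B * j%:R / n.+1%:R.
pose P n := bern B^-1 n.+1 (fun j => k (pt n j)).
have n0 n : 0 < n.+1%:R :> R by rewrite ltr0Sn.
have pt01 n j : (j <= n.+1)%N -> 0 <= pt n j <= B.
  move=> jn; rewrite /pt; apply/andP; split; first by rewrite divr_ge0// mulr_ge0// ltW.
  by rewrite ler_pdivrMr// ler_wpM2l ?(ltW B0)// ler_nat.
have kbd x : 0 <= x <= B -> `|k x| <= `|k 0| + L * B.
  move=> /[dup] x01 /andP[x0 xB]; rewrite -[k x](subrK (k 0)).
  have := kL x 0 x01; rewrite lexx (ltW B0) => /(_ isT); rewrite subr0 (ger0_norm x0) => h.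
  have h2 : L * x <= L * B by rewrite ler_wpM2l.
  by apply: le_trans (ler_normD _ _) _; lra.
have tx x : 0 <= x <= B -> 0 <= B^-1 * x <= 1.
  move=> /andP[x0 xB]; rewrite mulr_ge0 ?invr_ge0 ?(ltW B0)//=.
  by rewrite mulrC ler_pdivrMr// mul1r.
have ptS n j : pt n j.+1 - pt n j = B / n.+1%:R.
  by rewrite /pt -natr1; field; rewrite gt_eqF.
have dP n x : (deriv (P n)).[x] =
    bernE n (fun j => n.+1%:R / B * (k (pt n j.+1) - k (pt n j))) (B^-1 * x).
  rewrite /P deriv_bern !hornerM hornerC -polyC_natr hornerC bern_hornerE bernEZ.
  by rewrite [B^-1 * _.+1%:R]mulrC.
have BnE n : n.+1%:R / B * (B / n.+1%:R) = 1 :> R.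
  by field; rewrite !gt_eqF.
have BN0 n : 0 <= B / n.+1%:R by rewrite divr_ge0 ?(ltW B0).
have NB0 n : 0 <= n.+1%:R / B by rewrite divr_ge0 ?(ltW B0).
have slope n j : (j <= n)%N -> `|n.+1%:R / B * (k (pt n j.+1) - k (pt n j))| <= L.
  move=> jn; rewrite normrM (ger0_norm (NB0 n)).
  have h := kL _ _ (pt01 n j.+1 jn) (pt01 n j (leqW jn)).
  rewrite ptS (ger0_norm (BN0 n)) in h.
  apply: le_trans (_ : _ <= n.+1%:R / B * (L * (B / n.+1%:R))) _.
    by rewrite ler_wpM2l.
  by rewrite mulrCA BnE mulr1.
exists P, (`|k 0| + L * B) => x x01; have t01 := tx x x01; split.
- move=> n; rewrite bern_hornerE; apply: bernE_normr => // j jn.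
  by apply: kbd; exact: pt01.
- by move=> n; rewrite dP; apply: bernE_normr => // j jn; exact: slope.
- apply: cvg_eps_harmonic => e e0.
  exists (L ^+ 2 * B ^+ 2 / e) => n; rewrite bern_hornerE.
  (* [L |u| <= e + L^2 u^2 / e] turns the Lipschitz bound into a quadratic one, whose average is a
     variance. *)
  apply: (@le_trans _ _ (bernE n.+1 (fun j => e + (L ^+ 2 / e) *
      (B / n.+1%:R * j%:R - x) ^+ 2) (B^-1 * x))).
    apply: bernE_dist => // j jn; apply: le_trans (kL _ _ (pt01 _ _ jn) x01) _.
    have -> : pt n j = B / n.+1%:R * j%:R by rewrite /pt; ring.
    set u := _ - x; rewrite -[u ^+ 2]real_normK ?num_real//.
    rewrite mulrAC -exprMn; move: (mulr_ge0 L0 (normr_ge0 u)); move: (L * _) => w w0.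
    have : 0 <= (w - e) ^+ 2 by rewrite sqr_ge0.
    have -> : e + w ^+ 2 / e = (e * e + w ^+ 2) / e by field; rewrite gt_eqF.
    by rewrite ler_pdivlMr//; nra.
  rewrite bernED bernE_cst lerD2l bernEZ bernE_var.
  have -> : B / n.+1%:R * n.+1%:R * (B^-1 * x) - x = 0 by field; rewrite !gt_eqF.
  rewrite expr0n/= addr0.
  have -> : L ^+ 2 / e * ((B / n.+1%:R) ^+ 2 * n.+1%:R * (B^-1 * x) * (1 - B^-1 * x)) =
    L ^+ 2 * B ^+ 2 / e / n.+1%:R * ((B^-1 * x) * (1 - B^-1 * x)).
    by field; rewrite !gt_eqF.
  rewrite -[leRHS]mulr1 ler_wpM2l ?divr_ge0 ?mulr_ge0 ?sqr_ge0 ?(ltW B0) ?(ltW e0)//.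
  by case/andP: t01; move: (B^-1 * x) => t; nra.
move=> xa; apply: cvg_eps_harmonic => e e0.
have [d d0 hd] := kd x x01 xa e e0.
pose M := L + `|k1 x|; have M0 : 0 <= M by rewrite addr_ge0.
(* The first summand covers the [n] with node spacing [B / n.+1] at least [d / 2], where only the
   trivial bound [M] is available. In the second, [4 u^2 / d^2 >= 1] at nodes at distance [d / 2] or
   more, and [2 B^2 / n.+1] bounds the second moment. *)
exists (M * (2 * B / d) + M * (4 / d ^+ 2) * (2 * B ^+ 2)) => n; rewrite dP.
have [small|big] := ltP (B / n.+1%:R) (d / 2); last first.
  rewrite (le_trans (ler_normB _ _))// (@le_trans _ _ M)//.
    by rewrite lerD2r; apply: bernE_normr => // j; exact: slope.
  apply: (@le_trans _ _ (M * (2 * B / d) / n.+1%:R)).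
    have : 1 <= 2 * B / d / n.+1%:R.
      rewrite ler_pdivlMr// mul1r ler_pdivlMr//.
      by move: big; rewrite ler_pdivlMr//; move: (n.+1%:R) => v; lra.
    by move=> h; rewrite -[leRHS]mulrA -[leLHS]mulr1; exact: ler_wpM2l.
  have : 0 <= M * (4 / d ^+ 2) * (2 * B ^+ 2) / n.+1%:R.
    apply: divr_ge0 => //; apply: mulr_ge0; last by rewrite mulr_ge0// sqr_ge0.
    by rewrite mulr_ge0// divr_ge0// sqr_ge0.
  rewrite [(_ + M * _ * _) / _]mulrDl.
  by move: (M * (4 / _) * _ / _) (M * (2 * B / d) / _) => p q; lra.
apply: (@le_trans _ _ (bernE n (fun j => e + (M * (4 / d ^+ 2)) *
      (B / n.+1%:R * j%:R - x) ^+ 2) (B^-1 * x))).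
  apply: bernE_dist => // j jn.
  have pj : pt n j = B / n.+1%:R * j%:R by rewrite /pt; ring.
  rewrite -pj; set u := pt n j - x.
  have M4 : 0 <= M * (4 / d ^+ 2) by rewrite mulr_ge0// divr_ge0// sqr_ge0.
  have [ud|du] := ltP `|u| (d / 2).
    have u1 : `|pt n j - x| < d by apply: lt_trans ud _; rewrite ltr_pdivrMr//; lra.
    have u2 : `|pt n j.+1 - x| < d.
      have -> : pt n j.+1 - x = (pt n j.+1 - pt n j) + u by rewrite /u; ring.
      rewrite ptS (le_lt_trans (ler_normD _ _))//.
      by rewrite (ger0_norm (BN0 n)) [ltRHS]splitr ltrD.
    have := hd _ _ (pt01 n j.+1 jn) (pt01 n j (leqW jn)) u2 u1.
    rewrite ptS (ger0_norm (BN0 n)) => h.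
    apply: (@le_trans _ _ e); last by rewrite lerDl mulr_ge0// sqr_ge0.
    rewrite (_ : _ - k1 x = n.+1%:R / B *
      (k (pt n j.+1) - k (pt n j) - k1 x * (B / n.+1%:R))); last first.
      by rewrite [RHS]mulrBr [X in _ = _ - X]mulrCA BnE mulr1.
    rewrite normrM (ger0_norm (NB0 n)).
    apply: le_trans (_ : _ <= n.+1%:R / B * (e * (B / n.+1%:R))) _.
      by rewrite ler_wpM2l.
    by rewrite mulrCA BnE mulr1.
  rewrite (le_trans (ler_normB _ _))// (@le_trans _ _ M)//.
    by rewrite lerD2r; exact: slope.
  have d2 : 0 < d ^+ 2 by rewrite exprn_gt0.
  have : 1 <= 4 / d ^+ 2 * u ^+ 2.
    rewrite mulrAC ler_pdivlMr// mul1r -[u ^+ 2]real_normK ?num_real//.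
    by move: du; rewrite ler_pdivrMr//; nra.
  by rewrite -mulrA => h; nra.
rewrite bernED bernE_cst lerD2l bernEZ bernE_var.
rewrite [leRHS]mulrDl -[leLHS]add0r lerD//.
  by rewrite !mulr_ge0 ?invr_ge0 ?(ltW B0) ?(ltW d0).
rewrite -[leRHS]mulrA ler_wpM2l//.
  by rewrite mulr_ge0// divr_ge0// sqr_ge0.
have xE : x = B * (B^-1 * x) by field; rewrite gt_eqF.
move: t01 xE; move: (B^-1 * x) => t /andP[t0 t1] ->.
(* The average runs over [n] trials while the nodes have spacing [B / n.+1], so the mean misses [x]
   by [x / n.+1]. *)
have -> : B / n.+1%:R * n%:R * t - B * t = - (B * t / n.+1%:R).
  by rewrite -natr1; field; rewrite natr1 gt_eqF.
have -> : (B / n.+1%:R) ^+ 2 * n%:R * t * (1 - t) + (- (B * t / n.+1%:R)) ^+ 2 =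
  B ^+ 2 / n.+1%:R * (n%:R / n.+1%:R * (t * (1 - t)) + t ^+ 2 / n.+1%:R).
  by field; rewrite gt_eqF.
have -> : 2 * B ^+ 2 / n.+1%:R = B ^+ 2 / n.+1%:R * 2 by ring.
have h1 : n%:R / n.+1%:R <= 1 :> R by rewrite ler_pdivrMr// mul1r ler_nat.
have h2 : 0 <= n%:R / n.+1%:R :> R by rewrite divr_ge0.
have h3 : n.+1%:R^-1 <= 1 :> R by rewrite invf_le1// ler1n.
have h4 : 0 <= n.+1%:R^-1 :> R by rewrite invr_ge0.
have B2 : 0 <= B ^+ 2 by rewrite sqr_ge0.
have key : n%:R / n.+1%:R * (t * (1 - t)) + t ^+ 2 / n.+1%:R <= 2.
  by move: h1 h2 h3 h4; move: (n%:R / n.+1%:R : R) (n.+1%:R^-1 : R) => p q; nra.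
by apply: ler_wpM2l => //; exact: divr_ge0.
Qed.

End Bernstein.

(** * Profiles that are constant up to [r1], as functions of the squared radius *)

Section RadialProfile.
Variable R : realType.
Implicit Types (p q y z : R).

(** [t1] is the derivative of [t] beyond [r1] and 0 up to and including [r1], so it may jump there.
    The constancy up to [r1] makes the radial function harmless at the origin, where [|x|] is not
    smooth. *)
Record radial_profile (r1 : R) (t t1 : R -> R) (C M : R) : Prop := RadialProfile {
  rp_cst : forall r, r <= r1 -> t r = t r1 /\ t1 r = 0;
  rp_cont : continuous t;
  rp_der : forall r, r1 < r -> is_derive r 1 t (t1 r);
  rp_cont1 : forall r, r1 < r -> {for r, continuous t1};
  rp_le : forall r, `|t r| <= C;
  rp_le1 : forall r, `|t1 r| <= M }.

Variables (r1 : R) (t t1 : R -> R) (C M : R).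
Hypothesis r1_gt0 : 0 < r1.
Hypothesis rp : radial_profile r1 t t1 C M.

Lemma profile_M_ge0 : 0 <= M.
Proof. by apply: le_trans (rp_le1 rp 0). Qed.

Lemma profile_lip p q : `|t p - t q| <= M * `|p - q|.
Proof.
have M0 := profile_M_ge0.
have above a b : r1 <= a -> a < b -> `|t b - t a| <= M * `|b - a|.
  move=> ra ab.
  have [c|| c _ ->] := @MVT R t t1 a b ab.
  - rewrite in_itv/= => /andP[ac _]; apply: (rp_der rp); exact: le_lt_trans ac.
  - by apply: continuous_subspaceT; exact: rp_cont rp.
  by rewrite normrM ler_wpM2r//; exact: (rp_le1 rp).
wlog qp : p q / q <= p.
  move=> H; have [qp|/ltW pq] := leP q p; first exact: H.
  by rewrite distrC [`|p - q|]distrC; exact: H.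
have [pr|rp1] := leP p r1.
  by rewrite (rp_cst rp pr).1 (rp_cst rp (le_trans qp pr)).1 subrr normr0 mulr_ge0.
have [qr|rq] := leP q r1; last first.
  move: qp; rewrite le_eqVlt => /predU1P[->|qp]; last by apply: above => //; exact: ltW.
  by rewrite !subrr normr0 mulr0.
rewrite (rp_cst rp qr).1; apply: le_trans (above _ _ (lexx _) rp1) _.
by rewrite ler_wpM2l// !ger0_norm ?subr_ge0// ?(ltW rp1)// lerD2l lerN2.
Qed.

(** The square root is not Lipschitz at 0, but [t] is constant up to [r1]. When the larger root [p]
    exceeds [r1], [p^2 - q^2 >= r1 (p - q)]. *)
Lemma profile_sqrt_lip y z : 0 <= y -> 0 <= z ->
  `|t (Num.sqrt y) - t (Num.sqrt z)| <= M / r1 * `|y - z|.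
Proof.
move=> y0 z0; have M0 := profile_M_ge0.
wlog zy : y z y0 z0 / z <= y.
  move=> H; have [zy|/ltW yz] := leP z y; first exact: H.
  by rewrite distrC [`|y - z|]distrC; exact: H.
have p0 := sqrtr_ge0 y; have q0 := sqrtr_ge0 z.
have qp : Num.sqrt z <= Num.sqrt y by rewrite ler_wsqrtr.
rewrite -[X in _ * `|X|](_ : Num.sqrt y ^+ 2 - Num.sqrt z ^+ 2 = _); last by rewrite !sqr_sqrtr.
move: p0 q0 qp; move: (Num.sqrt y) (Num.sqrt z) => p q p0 q0 qp.
have pq2 : 0 <= p ^+ 2 - q ^+ 2 by rewrite subr_ge0 ler_sqr ?nnegrE.
rewrite (ger0_norm pq2).
have [pr|rp1] := leP p r1.
  rewrite (rp_cst rp pr).1 (rp_cst rp (le_trans qp pr)).1 subrr normr0.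
  by rewrite mulr_ge0// divr_ge0// ltW.
apply: le_trans (profile_lip p q) _; rewrite -mulrA ler_wpM2l// ger0_norm ?subr_ge0//.
by rewrite mulrC ler_pdivlMr//; nra.
Qed.

Definition profile1 y := t1 (Num.sqrt y) / (2 * Num.sqrt y).

(** Off [r1^2] the derivative of [t (sqrt y)] is continuous, so the mean value theorem gives strict
    differentiability, with both points free to move. This is what slopes between neighbouring nodes
    require. *)
Lemma profile_sqrt_diff y0 : 0 <= y0 -> y0 != r1 ^+ 2 -> forall e : R, 0 < e ->
  exists2 d : R, 0 < d & forall y z, 0 <= y -> 0 <= z -> `|y - y0| < d -> `|z - y0| < d ->
  `|t (Num.sqrt y) - t (Num.sqrt z) - profile1 y0 * (y - z)| <= e * `|y - z|.
Proof.
move=> y00; have r2 : Num.sqrt (r1 ^+ 2) = r1 by rewrite sqrtr_sqr gtr0_norm.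
have r20 : 0 < r1 ^+ 2 by rewrite exprn_gt0.
case: ltgtP => // yr _ e e0.
  exists (r1 ^+ 2 - y0); first by rewrite subr_gt0.
  have below y : `|y - y0| < r1 ^+ 2 - y0 -> Num.sqrt y <= r1.
    by rewrite ltr_norml => /andP[_]; rewrite ltrD2r => /ltW yr2; rewrite -r2 ler_wsqrtr.
  move=> y z _ _ /below yb /below zb.
  rewrite (rp_cst rp yb).1 (rp_cst rp zb).1 subrr sub0r /profile1.
  have /(rp_cst rp)[_ ->] : Num.sqrt y0 <= r1 by rewrite -r2 ler_wsqrtr// ltW.
  by rewrite mul0r mul0r oppr0 normr0 mulr_ge0// ltW.
have above y : r1 ^+ 2 < y -> r1 < Num.sqrt y.
  by move=> ry; rewrite -r2 ltr_sqrt//; exact: lt_trans ry.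
have der y : r1 ^+ 2 < y -> is_derive y 1 (t \o Num.sqrt) (profile1 y).
  move=> ry; have y_gt0 : 0 < y by exact: lt_trans ry.
  exact: (is_derive1_comp (rp_der rp (above _ ry)) (is_derive1_sqrt y_gt0)).
have cont : {for y0, continuous profile1}.
  apply: cvgM.
    apply: continuous_comp; first exact: sqrt_continuous.
    exact: (rp_cont1 rp (above _ yr)).
  apply: cvgV; first by rewrite mulf_neq0// gt_eqF// (lt_trans r1_gt0)// above.
  by apply: cvgM; [exact: cvg_cst|exact: sqrt_continuous].
move/cvgrPdist_le : cont => /(_ e e0)[d /= d0 hd].
exists (Num.min d (y0 - r1 ^+ 2)); first by rewrite lt_min d0 subr_gt0.
move=> y z _ _; wlog zy : y z / z <= y.
  move=> H; have [zy|/ltW yz hy hz] := leP z y; first exact: H.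
  rewrite [`|y - z|]distrC -[X in `|X|]opprK normrN.
  rewrite [X in `|X|](_ : _ = t (Num.sqrt z) - t (Num.sqrt y) - profile1 y0 * (z - y)); last by ring.
  exact: H.
move: zy; rewrite le_eqVlt => /predU1P[->|zy].
  by rewrite !subrr mulr0 subr0 normr0 mulr0.
rewrite !lt_min => /andP[yd yr1] /andP[zd zr1].
have rz : r1 ^+ 2 < z by move: zr1; rewrite ltr_norml => /andP[]; lra.
have [c|| c] := @MVT R (t \o Num.sqrt) profile1 z y zy.
- rewrite in_itv/= => /andP[zc _]; apply: der; exact: lt_trans zc.
- apply: continuous_subspaceT => x; apply: continuous_comp; first exact: sqrt_continuous.
  exact: rp_cont rp _.
rewrite in_itv/= => /andP[zc cy] /= ->.
rewrite -mulrBl normrM ler_wpM2r// distrC; apply: hd => /=.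
move: yd zd; rewrite !ltr_norml => /andP[? ?] /andP[? ?].
by apply/andP; split; lra.
Qed.

Lemma profile_bernstein (B : R) : 0 < B -> exists (P : nat -> {poly R}) (K : R),
  forall y, 0 <= y <= B ->
    [/\ forall n, `|(P n).[y]| <= K, forall n, `|(deriv (P n)).[y]| <= M / r1,
        (P n).[y] @[n --> \oo] --> t (Num.sqrt y) &
        y != r1 ^+ 2 -> (deriv (P n)).[y] @[n --> \oo] --> profile1 y].
Proof.
move=> B0; apply: (@bernstein_approx R (t \o Num.sqrt) profile1 B (M / r1) (r1 ^+ 2)) => //.
- by rewrite divr_ge0 ?profile_M_ge0// ltW.
- by move=> y z /andP[y0 _] /andP[z0 _]; exact: profile_sqrt_lip.
move=> y /andP[y0 _] yr e e0; have [d d0 hd] := profile_sqrt_diff y0 yr e0.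
by exists d => // u v /andP[u0 _] /andP[v0 _]; exact: hd.
Qed.

Lemma measurable_profile1 : measurable_fun [set: R] t1.
Proof.
rewrite (_ : t1 = fun r => if r1 < r then t1 r else 0); last first.
  by apply/funext => r; case: ltP => // rr; rewrite (rp_cst rp rr).2.
have mI : measurable (`]r1, +oo[%classic : set R) by exact: measurable_itv.
have -> : (fun r => if r1 < r then t1 r else 0) = patch (fun=> 0) `]r1, +oo[%classic t1.
  apply/funext => r; rewrite /patch mem_setE in_itv/= andbT.
  by case: ltP.
apply/measurable_restrict => //; rewrite setTI.
apply: open_continuous_measurable_fun; first exact: interval_open.
by move=> r; rewrite inE/= in_itv/= andbT => rr; exact: rp_cont1 rp _ rr.
Qed.

End RadialProfile.

(** * Null sets in R^3 *)

Section NullSets.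
Variable R : realType.
Local Notation R3 := (R * R * R)%type.
Local Notation mu := (@mu3 R).

Lemma mu3_countable_sections (S : set R3) :
  (forall p : R * R, countable [set z | S (p, z)]) -> mu S = 0.
Proof.
move=> cS; apply: integral0_eq => p _ /=; apply: countable_lebesgue_measure0.
by rewrite (_ : xsection S p = [set z | S (p, z)])//; apply/seteqP; split => z /=; rewrite /xsection/= inE.
Qed.

Lemma mu3_axis : mu [set x : R3 | x.1.1 = 0 /\ x.1.2 = 0] = 0.
Proof.
have -> : [set x : R3 | x.1.1 = 0 /\ x.1.2 = 0] = ([set 0] `*` [set 0]) `*` setT.
  by apply/seteqP; split => [x [? ?]|x [[? ?] _]].
rewrite mu3_prod//; last exact: measurableX.
by rewrite product_measure1E//= !lebesgue_measure_set1 mule0 mul0e.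
Qed.

End NullSets.

Section SquaredNorm.
Variable R : realType.
Local Notation R3 := (R * R * R)%type.
Implicit Types (x : R3).

Definition nsq x : R := \sum_i vec x i 0 ^+ 2.

Lemma enorm_nsq x : enorm x = Num.sqrt (nsq x). Proof. by []. Qed.

Lemma nsqE x : nsq x = coord 0 x * coord 0 x + coord 1 x * coord 1 x + coord 2 x * coord 2 x.
Proof.
rewrite /nsq !big_ord_recl big_ord0 addr0 !expr2 addrA /coord.
by congr (_ * _ + _ * _ + _ * _); rewrite !mxE.
Qed.

Lemma nsq_ge0 x : 0 <= nsq x.
Proof. by apply: sumr_ge0 => i _; exact: sqr_ge0. Qed.

Lemma enorm_sqr x : enorm x ^+ 2 = nsq x.
Proof. by rewrite sqr_sqrtr// nsq_ge0. Qed.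

Lemma enorm_ge0 x : 0 <= enorm x. Proof. exact: sqrtr_ge0. Qed.

Lemma coord_le_enorm i x : `|coord i x| <= enorm x.
Proof.
rewrite -ler_sqr ?nnegrE ?enorm_ge0// enorm_sqr real_normK ?num_real//.
by rewrite /nsq (bigD1 i)//= lerDl sumr_ge0// => j _; exact: sqr_ge0.
Qed.

Lemma smooth_nsq : smooth nsq.
Proof.
rewrite (_ : nsq = fun x => coord 0 x * coord 0 x + coord 1 x * coord 1 x + coord 2 x * coord 2 x).
  by apply: smoothD; [apply: smoothD|]; apply: smoothM; exact: smooth_coord.
by apply/funext => x; exact: nsqE.
Qed.

Lemma partial_nsq i x : partial i nsq x = 2 * coord i x.
Proof.
have d j (y : R3) : differentiable (coord j) y by have [] := differentiable_coord j y.
have dM j (y : R3) : differentiable (fun z => coord j z * coord j z) y.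
  exact: (smooth_differentiable _ (smoothM (smooth_coord j) (smooth_coord j))).
have dD (y : R3) : differentiable (fun z => coord 0 z * coord 0 z + coord 1 z * coord 1 z) y.
  exact: (smooth_differentiable _ (smoothD (smoothM (smooth_coord 0) (smooth_coord 0))
    (smoothM (smooth_coord 1) (smooth_coord 1)))).
have p j : partial i (@coord R j) x = (j == i)%:R.
  by rewrite /partial (differentiable_coord j x).2 coord_basis3.
rewrite (_ : nsq = fun x => (coord 0 x * coord 0 x + coord 1 x * coord 1 x) + coord 2 x * coord 2 x).
  rewrite (partialD _ (dD x) (dM 2 x)) (partialD _ (dM 0 x) (dM 1 x)).
  rewrite !(partialM _ (d _ x) (d _ x)) !p.
  case: i p => [[|[|[|//]]] hi] p /=.
  - by rewrite (_ : Ordinal hi = 0); [ring|exact: val_inj].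
  - by rewrite (_ : Ordinal hi = 1); [ring|exact: val_inj].
  - by rewrite (_ : Ordinal hi = 2); [ring|exact: val_inj].
by apply/funext => y; exact: nsqE.
Qed.

Lemma enorm_continuous : continuous (@enorm R).
Proof.
move=> x; apply: (@continuous_comp _ _ _ nsq Num.sqrt).
  exact: smooth_continuous smooth_nsq x.
exact: sqrt_continuous.
Qed.

Lemma smooth_horner (P : {poly R}) (f : R3 -> R) : smooth f -> smooth (fun x => P.[f x]).
Proof.
move=> sf; elim/poly_ind : P => [|P c ih].
  by rewrite (_ : (fun _ => _) = fun=> 0); [exact: smooth_cst|apply/funext => x; rewrite horner0].
rewrite (_ : (fun _ => _) = fun x => P.[f x] * f x + c).
  by apply: smoothD; [exact: smoothM|exact: smooth_cst].
by apply/funext => x; rewrite hornerMXaddC.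
Qed.

Lemma partial_horner i (P : {poly R}) (f : R3 -> R) x : smooth f ->
  partial i (fun x => P.[f x]) x = (deriv P).[f x] * partial i f x.
Proof.
move=> sf; elim/poly_ind : P => [|P c ih].
  rewrite deriv0 horner0 mul0r (_ : (fun _ => _) = cst 0); first exact: derive_cst.
  by apply/funext => y; rewrite horner0.
have sP := smooth_horner P sf.
rewrite (_ : (fun _ => _) = fun x => P.[f x] * f x + c); last first.
  by apply/funext => y; rewrite hornerMXaddC.
rewrite (partialD _ (smooth_differentiable _ (smoothM sP sf)) (smooth_differentiable _ (smooth_cst c))).
rewrite (partialM _ (smooth_differentiable _ sP) (smooth_differentiable _ sf)) ih.
rewrite (_ : partial i (fun=> c) x = 0); last exact: derive_cst.
by rewrite derivD derivM derivX derivC !(hornerE); ring.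
Qed.

(** Each line parallel to the third axis meets the sphere in at most two points. *)
Lemma mu3_sphere (a : R) : @mu3 R [set x | nsq x = a] = 0.
Proof.
apply: mu3_countable_sections => -[x1 x2]; apply: finite_set_countable.
pose s := Num.sqrt (a - (x1 * x1 + x2 * x2)).
apply: (@sub_finite_set _ _ [set s; - s]); last exact: finite_set2.
move=> z /=; rewrite nsqE; have [-> -> ->] := coordE (x1, x2, z) => /= e.
have -> : s = `|z| by rewrite /s -e addrAC subrr add0r -expr2 sqrtr_sqr.
by case: (ger0P z) => _; [left|right]; rewrite ?opprK.
Qed.

Lemma sphere_measurable (a : R) : measurable ([set x | nsq x = a] : set (mR3 R)).
Proof.
have := continuous_measurable3 (smooth_continuous smooth_nsq) measurableT (measurable_set1 a).
by rewrite setTI.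
Qed.

Lemma ae_nsq_neq (a : R) : {ae @mu3 R, forall x, nsq x != a}.
Proof.
exists [set x | nsq x = a]; split; [exact: sphere_measurable|exact: mu3_sphere|].
by move=> x /= /negP; rewrite negbK => /eqP.
Qed.

End SquaredNorm.

Lemma measurable_invr (R : realType) : measurable_fun [set: R] (@GRing.inv R).
Proof.
have oU : open ([set~ 0] : set R) by rewrite openC; exact: (accessible_closed_set1 (hausdorff_accessible (@norm_hausdorff _ R))).
have -> : @GRing.inv R = patch (fun=> 0) [set~ 0] (@GRing.inv R).
  apply/funext => x; rewrite /patch; case: ifPn => //.
  by rewrite notin_setE/= => /contrapT ->; rewrite invr0.
apply/measurable_restrict => //; first exact: open_measurable.
rewrite setTI; apply: open_continuous_measurable_fun => // x.
by rewrite inE/= => /eqP x0; exact: cvgV.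
Qed.

(** * Multiplication by a real radial profile on H^1_0 *)

Section Multiplier.
Variables (R : realType) (Om : set (R * R * R)).
Hypothesis oOm : open Om.
Local Notation R3 := (R * R * R)%type.
Local Notation fct := (R3 -> R[i]).
Local Notation gfct := (R3 -> 'cV[R[i]]_3).
Local Notation mu := (@mu3 R).
Local Notation Re := complex.Re.
Local Notation Im := complex.Im.
Local Notation L2r := (L2r mu (Om : set (mR3 R))).
Local Notation PH := (L2_ph oOm).
Local Notation PH1 := (H1_prehilbert oOm).
Local Notation N1 := (hnorm (dotH1 Om)).
Local Notation nrm2 := (hnorm (dotL2 Om)).
Local Notation mOm := (open_measurable3 oOm).

Lemma cvg0_eps (a : nat -> R) : a n @[n --> \oo] --> (0 : R) -> (forall n, 0 <= a n) ->
  forall e, 0 < e -> exists N, forall n, (N <= n)%N -> a n <= e.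
Proof.
move=> /cvgrPdist_le cv a0 e e0; have [N _ hN] := cv e e0; exists N => n Nn.
by have := hN n Nn; rewrite sub0r normrN ger0_norm.
Qed.

Lemma cvg0_squeeze (a b : nat -> R) : (forall n, 0 <= a n <= b n) ->
  b n @[n --> \oo] --> (0 : R) -> a n @[n --> \oo] --> (0 : R).
Proof.
move=> ab cb; apply: (@squeeze_cvgr _ _ _ _ (fun=> 0) b) => //; first exact: nearW.
exact: cvg_cst.
Qed.

Lemma cvg0_add (b c : nat -> R) : b n @[n --> \oo] --> (0 : R) ->
  c n @[n --> \oo] --> (0 : R) -> b n + c n @[n --> \oo] --> (0 : R).
Proof. by move=> b0 c0; rewrite -(addr0 0); exact: cvgD. Qed.

Lemma H10_limit (u_ : nat -> fct) (g_ : nat -> gfct) (u : fct) (g : gfct) :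
  (forall n, H10 Om (u_ n)) -> (forall n, weak_gradient Om (u_ n) (g_ n)) ->
  L2 Om u -> (forall i, L2 Om (fun x => g x i 0)) ->
  nrm2 (fun x => u_ n x - u x) @[n --> \oo] --> (0 : R) ->
  (forall i, nrm2 (fun x => g_ n x i 0 - g x i 0) @[n --> \oo] --> (0 : R)) ->
  H10 Om u /\ weak_gradient Om u g.
Proof.
move=> Hu_ wg_ Lu Lg cu cg.
have cu' := cvg0_eps cu (fun n => nrm_ge0 _ _).
have cg' i := cvg0_eps (cg i) (fun n => nrm_ge0 _ _).
have Lu_ n : L2 Om (u_ n) by exact: (H1_L2 (H10_H1 (Hu_ n))).
have wg : weak_gradient Om u g by exact: (weak_gradient_closed oOm Lu_ Lu wg_ Lg cu' cg').
have Hu : H1 Om u by exact: H1_intro wg.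
split=> //; apply: (H10_closed oOm Hu) => e e0.
have e2 : 0 < e / 2 by rewrite divr_gt0.
have [N hN] := cu' _ e2.
have /boolp.choice[Ng hNg] := fun i => cg' i _ e2.
pose n := (N + \sum_i Ng i)%N; exists (u_ n); first exact: Hu_.
rewrite (nrm_distC PH1 Hu (H10_H1 (Hu_ n))) -ler_sqr ?nnegrE ?nrm_ge0 ?(ltW e0)//.
have wd : weak_gradient Om (fun x => u_ n x - u x) (fun x => g_ n x - g x).
  have := weak_gradientD oOm (Lu_ n) (ph_domZ PH (-1) Lu) (wg_ n) (weak_gradientZ oOm (-1) Lu wg).
  congr weak_gradient; apply/funext => x; first by rewrite mulN1r.
  by rewrite scaleN1r.
rewrite -normH1E (normH1_sqr oOm (ph_domB PH1 (H10_H1 (Hu_ n)) Hu) wd).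
have small a : 0 <= a -> a <= e / 2 -> a ^+ 2 <= e ^+ 2 / 4.
  by move=> a0 ae; nra.
have s0 := small _ (nrm_ge0 _ _) (hN n (leq_addr _ _)).
have si i : nrm2 (fun x => (g_ n x - g x) i 0) ^+ 2 <= e ^+ 2 / 4.
  rewrite (_ : (fun x => _) = fun x => g_ n x i 0 - g x i 0); last first.
    by apply/funext => x; rewrite !mxE.
  apply: small; first exact: nrm_ge0.
  by apply: hNg; rewrite /n (bigD1 i)//= addnCA leq_addr.
rewrite !big_ord_recl big_ord0 addr0.
move: s0 (si 0) (si (lift ord0 ord0)) (si (lift ord0 (lift ord0 ord0))).
move: (nrm2 _ ^+ 2) (nrm2 _ ^+ 2) (nrm2 _ ^+ 2) (nrm2 _ ^+ 2) (e ^+ 2) => A1 A2 A3 A4 E.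
by lra.
Qed.

Lemma L2r_absC (psi : fct) : L2 Om psi -> L2r (fun x => absC (psi x)).
Proof.
move=> [mr mi wi]; split=> //.
under eq_fun do rewrite absC_def.
apply: (measurableT_comp (continuous_measurable_fun (@sqrt_continuous R))) => //.
by apply: measurable_funD; exact: measurable_funX.
Qed.

(** Dominated convergence with the bound [2 K |psi|]. Bounds and convergence are asked only where
    [psi] is nonzero, since the polynomials are controlled only on a bounded set. *)
Lemma mult_cvg (m_ : nat -> R3 -> R) (m : R3 -> R) (K : R) (psi : fct) : L2 Om psi ->
  (forall n, L2 Om (fun x => (m_ n x)%:C * psi x)) -> L2 Om (fun x => (m x)%:C * psi x) ->
  (forall n x, psi x != 0 -> `|m_ n x| <= K) -> (forall x, psi x != 0 -> `|m x| <= K) ->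
  {ae mu, forall x, psi x != 0 -> m_ n x @[n --> \oo] --> m x} ->
  nrm2 (fun x => (m_ n x)%:C * psi x - (m x)%:C * psi x) @[n --> \oo] --> (0 : R).
Proof.
move=> Lpsi Lm_ Lm bm_ bm cv.
pose g := fun x => (K + K) * absC (psi x).
have Lg : L2r g by apply: L2rZ; [exact: mOm|exact: L2r_absC].
apply: (@L2_dominated _ _ R mu _ mOm _ _ g) => //.
  apply: filterS cv => x cx _; rewrite !(ReM, ImM) !ImC !ReC !mul0r subr0 addr0.
  have [->|/cx h] := eqVneq (psi x) 0.
    split; rewrite ?Re0 ?Im0 mulr0.
      by under eq_fun do rewrite ReM ReC ImC mul0r subr0 mulr0; exact: cvg_cst.
    by under eq_fun do rewrite ImM ReC ImC mul0r addr0 mulr0; exact: cvg_cst.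
  split.
    by under eq_fun do rewrite ReM ReC ImC mul0r subr0; apply: cvgMr_tmp.
  by under eq_fun do rewrite ImM ReC ImC mul0r addr0; apply: cvgMr_tmp.
move=> n x _; rewrite /g -mulrBl -rmorphB absCM absCR.
have [->|p0] := eqVneq (psi x) 0; first by rewrite absC0 !mulr0.
rewrite ler_wpM2r ?absC_ge0// (le_trans (ler_normB _ _))// lerD//; [exact: bm_|exact: bm].
Qed.

Lemma test_support phi : test_function Om phi ->
  exists2 B : R, 0 < B & forall x, phi x != 0 -> nsq x <= B.
Proof.
move=> [_ _ [K [cK _ K0]]]; have [b hb] := compact_sub_gcbox cK.
have h3 x : K x -> nsq x <= 3 * b ^+ 2.
  move=> /hb; rewrite nsqE; have [-> -> ->] := coordE x.
  have h (y : R) : - b <= y -> y <= b -> y * y <= b ^+ 2 by move=> ? ?; nra.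
  case: x => -[x1 x2] x3 [/= /andP[l1 u1] /andP[l2 u2] /andP[l3 u3]].
  by have := h _ l1 u1; have := h _ l2 u2; have := h _ l3 u3; lra.
exists (1 + 3 * b ^+ 2); first by have := sqr_ge0 b; lra.
move=> x px; have Kx : K x by apply: contrapT => /K0 p0; rewrite p0 eqxx in px.
by have := h3 x Kx; lra.
Qed.

Section Profile.
Variables (r1 : R) (t t1 : R -> R) (C M : R).
Hypothesis r1_gt0 : 0 < r1.
Hypothesis rp : radial_profile r1 t t1 C M.

Definition radial (x : R3) : R := t (enorm x).
(** The chain rule for [t (|x|)]. At the origin the convention for division by zero gives 0, in
    accordance with the constancy of [t] near it. *)
Definition radial_grad (i : 'I_3) (x : R3) : R := t1 (enorm x) / enorm x * coord i x.

Lemma measurable_radial : measurable_fun (Om : set (mR3 R)) radial.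
Proof.
apply: measurable_funTS; apply: continuous_measurable3 => x.
by apply: continuous_comp; [exact: enorm_continuous|exact: (rp_cont rp)].
Qed.

Lemma measurable_radial_grad i : measurable_fun (Om : set (mR3 R)) (radial_grad i).
Proof.
have me := continuous_measurable3 (@enorm_continuous R).
apply: measurable_funTS; apply: measurable_funM.
  apply: measurable_funM; last exact: measurableT_comp (@measurable_invr R) me.
  exact: measurableT_comp (measurable_profile1 rp) me.
exact: (continuous_measurable3 (smooth_continuous (@smooth_coord R i))).
Qed.

Lemma radial_le x : `|radial x| <= C. Proof. exact: rp_le rp _. Qed.

Lemma radial_grad_le i x : `|radial_grad i x| <= `|t1 (enorm x)|.
Proof.
rewrite /radial_grad -mulrA normrM -[leRHS]mulr1 ler_wpM2l//.
have := coord_le_enorm i x; have := enorm_ge0 x.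
rewrite le_eqVlt => /predU1P[<-|e0 ce]; first by rewrite invr0 mul0r normr0.
by rewrite normrM normfV (gtr0_norm e0) mulrC ler_pdivrMr// mul1r.
Qed.

Lemma mult_L2 (m : R3 -> R) (K : R) (psi : fct) : measurable_fun (Om : set (mR3 R)) m ->
  (forall x, `|m x| <= K) -> L2 Om psi -> L2 Om (fun x => (m x)%:C * psi x) /\
  nrm2 (fun x => (m x)%:C * psi x) <= `|K| * nrm2 psi.
Proof.
move=> mm mK Lp; have m0 : measurable_fun (Om : set (mR3 R)) (fun=> 0 : R) by [].
have mC x : Om x -> absC (m x)%:C <= K by rewrite absCR.
split; first exact: (@L2M _ _ R mu _ mOm (fun x => (m x)%:C) psi K mm m0 mC Lp).
exact: (@nrm_L2M _ _ R mu _ mOm (fun x => (m x)%:C) psi K mm m0 mC Lp).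
Qed.

Lemma radial_L2 psi : L2 Om psi -> L2 Om (fun x => (radial x)%:C * psi x) /\
  nrm2 (fun x => (radial x)%:C * psi x) <= `|C| * nrm2 psi.
Proof. exact: mult_L2 measurable_radial radial_le. Qed.

Lemma radial_grad_L2 i psi : L2 Om psi -> L2 Om (fun x => (radial_grad i x)%:C * psi x) /\
  nrm2 (fun x => (radial_grad i x)%:C * psi x) <= `|M| * nrm2 psi.
Proof.
apply: mult_L2; first exact: measurable_radial_grad.
by move=> x; apply: le_trans (radial_grad_le i x) _; exact: rp_le1 rp _.
Qed.

Lemma test_realM (m : R3 -> R) phi : smooth m -> test_function Om phi ->
  test_function Om (fun x => (m x)%:C * phi x).
Proof. by move=> sm; apply: (@test_smoothM _ Om (fun x => (m x)%:C)) => //; exact: smooth_cst. Qed.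

Lemma partialC_realM (m : R3 -> R) phi i x : smooth m -> test_function Om phi ->
  partialC i (fun x => (m x)%:C * phi x) x =
  (m x)%:C * partialC i phi x + (partial i m x)%:C * phi x.
Proof.
move=> sm [sr si _]; have dm := smooth_differentiable x sm.
have dr := smooth_differentiable x sr; have di := smooth_differentiable x si.
have E1 : (fun y => Re ((m y)%:C * phi y)) = fun y => m y * Re (phi y).
  by apply/funext => y; rewrite ReM ReC ImC mul0r subr0.
have E2 : (fun y => Im ((m y)%:C * phi y)) = fun y => m y * Im (phi y).
  by apply/funext => y; rewrite ImM ReC ImC mul0r addr0.
rewrite /partialC E1 E2 (partialM _ dm dr) (partialM _ dm di).
move: (partial i m x) (partial i (fun y => Re (phi y)) x) (partial i (fun y => Im (phi y)) x).
by case: (phi x) => a b p q r; apply: complex_eq => /=; ring.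
Qed.

Definition radial_mul_grad (u : fct) (g : gfct) : gfct := fun x =>
  \col_i ((radial x)%:C * g x i 0 + (radial_grad i x)%:C * u x).

(** The approximants are polynomials in [nsq] times [phi], hence test functions. Their gradients
    converge off the sphere [nsq x = r1 ^+ 2], a null set, and are bounded uniformly on the
    support. *)
Lemma radial_mul_test phi : test_function Om phi ->
  H10 Om (fun x => (radial x)%:C * phi x) /\
  weak_gradient Om (fun x => (radial x)%:C * phi x)
    (radial_mul_grad phi (fun x => \col_i partialC i phi x)).
Proof.
move=> tphi; have [B0 B00 hB0] := test_support tphi.
have /boolp.choice[Bi hBi] : forall i, exists B : R, 0 < B /\ forall x, partialC i phi x != 0 -> nsq x <= B.
  by move=> i; have [B ? ?] := test_support (test_partialC i tphi); exists B.
(* One bound of [nsq] for all the places where [phi] or one of its derivatives is nonzero. *)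
pose B := B0 + \sum_i Bi i.
have B0B : B0 <= B by rewrite lerDl sumr_ge0// => i _; have [/ltW] := hBi i.
have BiB i : Bi i <= B.
  rewrite /B (bigD1 i)//= addrCA lerDl addr_ge0 ?(ltW B00)// sumr_ge0// => j _.
  by have [/ltW] := hBi j.
have Bgt : 0 < B by exact: lt_le_trans B0B.
have [P [K hP]] := profile_bernstein r1_gt0 rp Bgt.
have inB x : nsq x <= B -> 0 <= nsq x <= B by move=> h; rewrite nsq_ge0.
have phiB x : phi x != 0 -> 0 <= nsq x <= B by move=> /hB0 h; apply/inB/(le_trans h).
have dphiB i x : partialC i phi x != 0 -> 0 <= nsq x <= B.
  by have [_ h] := hBi i; move=> /h {}h; apply/inB/(le_trans h).
pose u_ n x := ((P n).[nsq x])%:C * phi x.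
have sP n : smooth (fun x => (P n).[nsq x]) by apply: smooth_horner; exact: smooth_nsq.
have tu n : test_function Om (u_ n).
  exact: test_realM (sP n) tphi.
pose d n i x := (deriv (P n)).[nsq x] * (2 * coord i x).
have dE n i x : partialC i (u_ n) x = ((P n).[nsq x])%:C * partialC i phi x + (d n i x)%:C * phi x.
  rewrite /u_ (partialC_realM i x (sP n) tphi) /d (partial_horner i _ x (@smooth_nsq R)).
  by rewrite partial_nsq.
have K0 n x : phi x != 0 -> `|(P n).[nsq x]| <= K by move=> /phiB /hP[h _ _ _]; exact: h.
have tP x : 0 <= nsq x <= B -> (P n).[nsq x] @[n --> \oo] --> radial x.
  by move=> /hP[_ _ h _].
have tK x : 0 <= nsq x <= B -> `|radial x| <= Num.max K C.
  by move=> _; rewrite le_max radial_le orbT.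
have PK n x : 0 <= nsq x <= B -> `|(P n).[nsq x]| <= Num.max K C.
  by move=> /hP[h _ _ _]; rewrite le_max h.
have Lphi := test_L2 oOm tphi.
have Ldphi i := test_L2 oOm (test_partialC i tphi).
have Lu n : L2 Om (u_ n) by exact: test_L2 (tu n).
have LPd n i : L2 Om (fun x => ((P n).[nsq x])%:C * partialC i phi x).
  exact: (test_L2 oOm (test_realM (sP n) (test_partialC i tphi))).
have Ld n i : L2 Om (fun x => (d n i x)%:C * phi x).
  apply: (test_L2 oOm); apply: test_realM tphi.
  apply: smoothM; first by apply: smooth_horner; exact: smooth_nsq.
  by apply: smoothM; [exact: smooth_cst|exact: smooth_coord].
have gE i : (fun x => radial_mul_grad phi (fun x => \col_i partialC i phi x) x i 0) =
    (fun x => (radial x)%:C * partialC i phi x + (radial_grad i x)%:C * phi x).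
  by apply/funext => x; rewrite !mxE.
apply: (@H10_limit u_ (fun n x => \col_i partialC i (u_ n) x)).
- by move=> n; exact: test_H10.
- by move=> n; exact: weak_gradient_test.
- exact: (radial_L2 Lphi).1.
- move=> i; rewrite gE; apply: (ph_domD PH); first exact: (radial_L2 (Ldphi i)).1.
  exact: (radial_grad_L2 i Lphi).1.
- apply: (mult_cvg (K := Num.max K C)) => //; first exact: (radial_L2 Lphi).1.
  + by move=> n x /phiB; exact: PK.
  + by move=> x /phiB; exact: tK.
  + by apply: aeW => x /phiB; exact: tP.
move=> i.
have aeP : {ae mu, forall x, partialC i phi x != 0 -> (P n).[nsq x] @[n --> \oo] --> radial x}.
  by apply: aeW => x /dphiB; exact: tP.
have c1 := @mult_cvg (fun n x => (P n).[nsq x]) radial (Num.max K C) _ (Ldphi i)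
  (fun n => LPd n i) (radial_L2 (Ldphi i)).1 (fun n x h => PK n x (dphiB i x h))
  (fun x h => tK x (dphiB i x h)) aeP.
have M0 := profile_M_ge0 rp.
have sB x : 0 <= nsq x <= B -> `|coord i x| <= 1 + B.
  move=> /andP[_ xB]; apply: le_trans (coord_le_enorm i x) _.
  by have := enorm_sqr x; have := enorm_ge0 x; nra.
have c2 := @mult_cvg (fun n => d n i) (radial_grad i) (Num.max (M / r1 * (2 * (1 + B))) M) _ Lphi
  (fun n => Ld n i) (radial_grad_L2 i Lphi).1.
have {}c2 : nrm2 (fun x => (d n i x)%:C * phi x - (radial_grad i x)%:C * phi x)
    @[n --> \oo] --> (0 : R).
  apply: c2.
  - move=> n x /phiB hx; rewrite le_max; apply/orP; left; rewrite normrM.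
    have [_ h _ _] := hP _ hx; apply: ler_pM => //.
    by rewrite normrM ger0_norm// ler_wpM2l//; exact: sB.
  - move=> x _; rewrite le_max; apply/orP; right.
    by apply: le_trans (radial_grad_le i x) _; exact: rp_le1 rp _.
  apply: filterS (ae_nsq_neq (r1 ^+ 2)) => x xr /phiB hx.
  have [_ _ _ /(_ xr) h] := hP _ hx.
  have -> : radial_grad i x = profile1 t1 (nsq x) * (2 * coord i x).
    rewrite /radial_grad /profile1 -enorm_nsq invfM.
    have [->|e0] := eqVneq (enorm x) 0; first by rewrite invr0 !(mulr0, mul0r).
    by field.
  by apply: cvgM h _; exact: cvg_cst.
apply: cvg0_squeeze (cvg0_add c1 c2) => n.
rewrite nrm_ge0/=.
rewrite (_ : (fun x => _ - _) = fun x =>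
    (((P n).[nsq x])%:C * partialC i phi x - (radial x)%:C * partialC i phi x) +
    ((d n i x)%:C * phi x - (radial_grad i x)%:C * phi x)); last first.
  by apply/funext => x; rewrite !mxE dE; ring.
apply: (nrmD PH).
  exact: (ph_domB PH (LPd n i) (radial_L2 (Ldphi i)).1).
exact: (ph_domB PH (Ld n i) (radial_grad_L2 i Lphi).1).
Qed.

(** The passage from [(u, g)] to the product and its gradient is bounded in L^2, so the case of test
    functions extends by density. *)
Lemma radial_mul_H10 u g : H10 Om u -> weak_gradient Om u g ->
  H10 Om (fun x => (radial x)%:C * u x) /\
  weak_gradient Om (fun x => (radial x)%:C * u x) (radial_mul_grad u g).
Proof.
move=> Hu wg; have /H10P[H1u hu] := Hu.
have Lu := H1_L2 H1u; have Lg i : L2 Om (fun x => g x i 0) by case: wg.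
have hp n : 0 < n.+1%:R^-1 :> R by rewrite invr_gt0.
have /boolp.choice[p hphi] : forall n, exists phi, test_function Om phi /\ N1 (fun x => u x - phi x) < n.+1%:R^-1.
  by move=> n; have [phi ? ?] := hu _ (hp n); exists phi.
have tp n := (hphi n).1.
pose gp n : gfct := fun x => \col_i partialC i (p n) x.
have gE (v : fct) (h : gfct) i : (fun x => radial_mul_grad v h x i 0) =
    (fun x => (radial x)%:C * h x i 0 + (radial_grad i x)%:C * v x).
  by apply/funext => x; rewrite !mxE.
have Hp n := test_H1 oOm (tp n); have Lp n := test_L2 oOm (tp n).
have Hd n := ph_domB PH1 (Hp n) H1u.
have wd n : weak_gradient Om (fun x => p n x - u x) (fun x => gp n x - g x).
  have := weak_gradientD oOm (Lp n) (ph_domZ PH (-1) Lu) (weak_gradient_test oOm (tp n))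
    (weak_gradientZ oOm (-1) Lu wg).
  by congr weak_gradient; apply/funext => x; rewrite ?mulN1r ?scaleN1r.
have small n : N1 (fun x => p n x - u x) <= n.+1%:R^-1.
  by rewrite (nrm_distC PH1 (Hp n) H1u); exact: ltW (hphi n).2.
have s0 n : nrm2 (fun x => p n x - u x) <= n.+1%:R^-1.
  by apply: le_trans (nrm2_le_H1 oOm (Hd n)) _; rewrite normH1E; exact: small n.
have si n i : nrm2 (fun x => (gp n x - g x) i 0) <= n.+1%:R^-1.
  by apply: le_trans (nrm2_grad_le_H1 oOm i (Hd n) (wd n)) _; rewrite normH1E; exact: small n.
have cv (c : R) : c * n.+1%:R^-1 @[n --> \oo] --> (0 : R).
  by rewrite -[X in _ --> X](mulr0 c); apply: cvgM; [exact: cvg_cst|exact: cvg_harmonic].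
have Ld n := ph_domB PH (Lp n) Lu.
have Lgd n i : L2 Om (fun x => (gp n x - g x) i 0) by have [] := wd n.
apply: (@H10_limit (fun n x => (radial x)%:C * p n x) (fun n => radial_mul_grad (p n) (gp n))).
- by move=> n; exact: (radial_mul_test (tp n)).1.
- by move=> n; exact: (radial_mul_test (tp n)).2.
- exact: (radial_L2 Lu).1.
- move=> i; rewrite gE; apply: (ph_domD PH); first exact: (radial_L2 (Lg i)).1.
  exact: (radial_grad_L2 i Lu).1.
- apply: cvg0_squeeze (cv `|C|) => n; rewrite nrm_ge0/=.
  rewrite (_ : (fun x => _ - _) = fun x => (radial x)%:C * (p n x - u x)); last first.
    by apply/funext => x; ring.
  apply: le_trans (radial_L2 (Ld n)).2 _; rewrite ler_wpM2l//; exact: s0 n.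
move=> i; apply: cvg0_squeeze (cv (`|C| + `|M|)) => n.
rewrite nrm_ge0/=.
rewrite (_ : (fun x => _ - _) = fun x =>
    (radial x)%:C * (gp n x - g x) i 0 + (radial_grad i x)%:C * (p n x - u x)); last first.
  by apply/funext => x; rewrite !mxE; ring.
apply: le_trans (nrmD PH (radial_L2 (Lgd n i)).1 (radial_grad_L2 i (Ld n)).1) _.
rewrite mulrDl; apply: lerD.
  by apply: le_trans (radial_L2 (Lgd n i)).2 _; rewrite ler_wpM2l//; exact: si n i.
by apply: le_trans (radial_grad_L2 i (Ld n)).2 _; rewrite ler_wpM2l//; exact: s0 n.
Qed.

End Profile.

End Multiplier.

(** * A Poincare inequality on small cubes *)

Section BoundedMeasurable.
Context d (T : measurableType d) (R : realType) (mu : {measure set T -> \bar R}).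
Variables (D : set T).
Hypotheses (mD : measurable D) (fD : (mu D < +oo)%E).
Implicit Types (F G H : T -> R) (c : R).
Local Notation I := (Rintegral mu D).

(** Bounded and measurable on the whole space rather than on [D], so that slices and partial
    integrals are again of this kind and integrability on sets of finite measure is automatic. *)
Definition bmf F := measurable_fun setT F /\ exists C, forall x, `|F x| <= C.

Lemma bmf_integrable F : bmf F -> mu.-integrable D (EFin \o F).
Proof.
move=> [mF [C hC]]; apply: measurable_bounded_integrable => //; first exact: measurable_funTS.
exists C; split; first exact: num_real.
by move=> x Cx y _; apply: le_trans (hC y) (ltW Cx).
Qed.

Lemma bmf_cst c : bmf (fun=> c). Proof. by split => //; exists `|c|. Qed.

Lemma bmfD F G : bmf F -> bmf G -> bmf (fun x => F x + G x).
Proof.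
move=> [mF [C hC]] [mG [K hK]]; split; first exact: measurable_funD.
by exists (C + K) => x; rewrite (le_trans (ler_normD _ _))// lerD.
Qed.

Lemma bmfM F G : bmf F -> bmf G -> bmf (fun x => F x * G x).
Proof.
move=> [mF [C hC]] [mG [K hK]]; split; first exact: measurable_funM.
by exists (C * K) => x; rewrite normrM ler_pM.
Qed.

Lemma bmfZ c F : bmf F -> bmf (fun x => c * F x).
Proof. exact/bmfM/bmf_cst. Qed.

Lemma bmfN F : bmf F -> bmf (fun x => - F x).
Proof. by move=> /(bmfZ (-1)); under eq_fun do rewrite mulN1r. Qed.

Lemma bmfB F G : bmf F -> bmf G -> bmf (fun x => F x - G x).
Proof. by move=> bF /bmfN; exact: bmfD. Qed.

Lemma bmf_sqr F : bmf F -> bmf (fun x => F x ^+ 2).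
Proof. by move=> bF; exact: bmfM. Qed.

Lemma intD F G : bmf F -> bmf G -> I (fun x => F x + G x) = I F + I G.
Proof. by move=> /bmf_integrable iF /bmf_integrable iG; exact: RintegralD. Qed.

Lemma intZ c F : bmf F -> I (fun x => c * F x) = c * I F.
Proof. by move=> /bmf_integrable iF; exact: RintegralZl. Qed.

Lemma intB F G : bmf F -> bmf G -> I (fun x => F x - G x) = I F - I G.
Proof. by move=> /bmf_integrable iF /bmf_integrable iG; exact: RintegralB. Qed.

Lemma int_cst c : I (fun=> c) = c * fine (mu D).
Proof. exact: Rintegral_cst. Qed.

Lemma le_int F G : bmf F -> bmf G -> (forall x, D x -> F x <= G x) -> I F <= I G.
Proof. by move=> /bmf_integrable iF /bmf_integrable iG; exact: le_Rintegral. Qed.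

Lemma le_intZ c F G : bmf F -> bmf G -> (forall x, D x -> F x <= c * G x) -> I F <= c * I G.
Proof. by move=> bF bG FG; rewrite -(intZ c bG); apply: le_int => //; exact: bmfZ. Qed.

Lemma le_intZD c F G H : bmf F -> bmf G -> bmf H ->
  (forall x, D x -> F x <= c * (G x + H x)) -> I F <= c * (I G + I H).
Proof. by move=> bF bG bH FG; rewrite -(intD bG bH); apply: le_intZ => //; exact: bmfD. Qed.

Lemma int_ge0 F : (forall x, 0 <= F x) -> 0 <= I F.
Proof. by move=> F0; apply: Rintegral_ge0. Qed.

(** Not normalized: on a set of positive finite measure it is the squared L^2 distance from [F] to
    the constants. *)
Definition variance F : R := I (fun x => F x ^+ 2) - I F ^+ 2 / fine (mu D).

Hypothesis D_gt0 : 0 < fine (mu D).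

Lemma varianceE c F : bmf F -> variance F =
  I (fun x => (F x - c) ^+ 2) - fine (mu D) * (c - I F / fine (mu D)) ^+ 2.
Proof.
move=> bF; have E : I (fun x => (F x - c) ^+ 2) =
    I (fun x => F x ^+ 2) - (2 * c) * I F + c ^+ 2 * fine (mu D).
  have -> : (fun x => (F x - c) ^+ 2) = fun x => (F x ^+ 2 - (2 * c) * F x) + c ^+ 2.
    by apply/funext => x; ring.
  have b1 := bmf_sqr bF; have b2 := bmfZ (2 * c) bF.
  by rewrite (intD (bmfB b1 b2) (bmf_cst _)) (intB b1 b2) (intZ _ bF) int_cst.
by rewrite E /variance; field; rewrite gt_eqF.
Qed.

Lemma variance_le c F : bmf F -> variance F <= I (fun x => (F x - c) ^+ 2).
Proof.
by move=> /(varianceE c) ->; rewrite gerBl mulr_ge0 ?sqr_ge0// ltW.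
Qed.

Lemma variance_mean F : bmf F ->
  variance F = I (fun x => (F x - I F / fine (mu D)) ^+ 2).
Proof. by move=> /(varianceE (I F / fine (mu D))) ->; rewrite subrr; ring. Qed.

Lemma variance_ge0 F : bmf F -> 0 <= variance F.
Proof. by move=> /variance_mean ->; apply: int_ge0 => x; exact: sqr_ge0. Qed.

Lemma sqr_int_le F : bmf F -> I F ^+ 2 <= fine (mu D) * I (fun x => F x ^+ 2).
Proof.
by move=> /variance_ge0; rewrite subr_ge0 ler_pdivrMr// mulrC.
Qed.

End BoundedMeasurable.

Section BoundedMeasurableProduct.
Context d1 d2 (T1 : measurableType d1) (T2 : measurableType d2) (R : realType).
Variables (m1 : {sigma_finite_measure set T1 -> \bar R})
  (m2 : {sigma_finite_measure set T2 -> \bar R}).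
Local Notation m12 := (m1 \x m2)%E.
Implicit Types (F : T1 * T2 -> R).

Lemma bmf_section1 F a : bmf F -> bmf (fun b => F (a, b)).
Proof.
move=> [mF [C hC]]; split; last by exists C.
by apply: (measurableT_comp mF); exact: measurable_fun_pair.
Qed.

Lemma bmf_section2 F b : bmf F -> bmf (fun a => F (a, b)).
Proof.
move=> [mF [C hC]]; split; last by exists C.
by apply: (measurableT_comp mF); exact: measurable_fun_pair.
Qed.

Lemma bmf_int1 F (B : set T2) : measurable B -> (m2 B < +oo)%E -> bmf F ->
  bmf (fun a => Rintegral m2 B (fun b => F (a, b))).
Proof.
move=> mB fB bF; have [mF [C hC]] := bF; split; last first.
  exists (C * fine (m2 B)) => a; have bFa := bmf_section1 a bF.
  apply: le_trans (le_normr_Rintegral mB (bmf_integrable mB fB bFa)) _.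
  rewrite -(Rintegral_cst m2 mB); apply: (le_int mB fB) => //; last exact: bmf_cst.
  by split; [exact: measurableT_comp bFa.1|exists C => b; rewrite normr_id].
(* Adding the bound [C] and cutting off by the indicator of [B] gives a nonnegative integrand on the
   whole product, for which Tonelli's theorem yields measurability. *)
have E : (fun a => Rintegral m2 B (fun b => F (a, b))) =
    fun a => fine (fubini_F m2 (fun p => ((F p + C) * \1_B p.2)%:E) a) - C * fine (m2 B).
  apply/funext => a; have bFa := bmf_section1 a bF.
  rewrite -(Rintegral_cst m2 mB) -(_ : Rintegral m2 B (fun b => F (a, b) + C) = fine _).
    by rewrite (intD mB fB bFa (bmf_cst _ C)) addrK.
  rewrite Rintegral_mkcond /Rintegral; congr fine; apply: eq_integral => b _.
  by rewrite /= patchE indicE; case: ifP => _; rewrite ?mulr1 ?mulr0.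
rewrite E; apply: measurable_funB => //.
apply: (measurableT_comp (@fine_measurable R setT measurableT)).
apply: measurable_fun_fubini_tonelli_F.
  apply/measurable_EFinP; apply: measurable_funM; first exact: measurable_funD.
  have m1B : measurable_fun setT (\1_B : T2 -> R) by exact: measurable_indic.
  exact: (measurableT_comp m1B measurable_snd).
move=> p; rewrite lee_fin mulr_ge0//.
by have := hC p; rewrite ler_norml => /andP[]; lra.
Qed.

End BoundedMeasurableProduct.

(** * Tensorization of the variance *)

Section VarianceTensor.
Context d1 d2 (T1 : measurableType d1) (T2 : measurableType d2) (R : realType).
Variables (m1 : {sigma_finite_measure set T1 -> \bar R})
  (m2 : {sigma_finite_measure set T2 -> \bar R}) (A : set T1) (B : set T2).
Hypotheses (mA : measurable A) (mB : measurable B).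
Hypotheses (fA : (m1 A < +oo)%E) (fB : (m2 B < +oo)%E).
Local Notation m12 := (m1 \x m2)%E.
Local Notation IA := (Rintegral m1 A).
Local Notation IB := (Rintegral m2 B).
Local Notation IAB := (Rintegral m12 (A `*` B)).
Implicit Types (F : T1 * T2 -> R).

Lemma bmf_int2 F : bmf F -> bmf (fun b => IA (fun a => F (a, b))).
Proof.
move=> [mF [C hC]]; apply: (@bmf_int1 _ _ _ _ _ m1 (fun p => F (p.2, p.1)) _ mA fA).
split; last by exists C => x; exact: hC.
apply: (measurableT_comp mF).
by apply: measurable_fun_pair => //; exact: measurable_snd.
Qed.

Lemma prod_fin : (m12 (A `*` B) < +oo)%E.
Proof. by rewrite product_measure1E// lte_mul_pinfty// ge0_fin_numE. Qed.

Lemma fine_prod : fine (m12 (A `*` B)) = fine (m1 A) * fine (m2 B).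
Proof. by rewrite product_measure1E// fineM// ge0_fin_numE. Qed.

Let prod_integrable F : bmf F -> m12.-integrable setT (EFin \o (F \_ (A `*` B))).
Proof.
move=> bF; rewrite -restrict_EFin; apply/integrable_restrict => //; first exact: measurableX.
by rewrite setTI; apply: bmf_integrable => //; [exact: measurableX|exact: prod_fin].
Qed.

Lemma int_prod1 F : bmf F -> IAB F = IA (fun a => IB (fun b => F (a, b))).
Proof.
move=> bF; rewrite Rintegral_mkcond [RHS]Rintegral_mkcond /Rintegral; congr fine.
rewrite -(integral12_prod_meas1 (prod_integrable bF)); apply: eq_integral => a _.
rewrite /fubini_F /= [in RHS]patchE; case: ifPn => Aa.
  rewrite fineK; last first.
    apply: integrable_fin_num => //; apply: bmf_integrable => //; exact: bmf_section1.
  rewrite [RHS]integral_mkcond; apply: eq_integral => b _ /=.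
  by rewrite restrict_EFin /= !patchE in_setX Aa.
rewrite integral0_eq// => b _; rewrite patchE in_setX.
by rewrite (negbTE Aa).
Qed.

Lemma int_prod2 F : bmf F -> IAB F = IB (fun b => IA (fun a => F (a, b))).
Proof.
move=> bF; rewrite Rintegral_mkcond [RHS]Rintegral_mkcond /Rintegral; congr fine.
rewrite -(integral21_prod_meas1 (prod_integrable bF)); apply: eq_integral => b _.
rewrite /fubini_G /= [in RHS]patchE; case: ifPn => Bb.
  rewrite fineK; last first.
    apply: integrable_fin_num => //; apply: bmf_integrable => //; exact: bmf_section2.
  rewrite [RHS]integral_mkcond; apply: eq_integral => a _ /=.
  by rewrite restrict_EFin /= !patchE in_setX Bb andbT.
rewrite integral0_eq// => a _; rewrite patchE in_setX.
by rewrite (negbTE Bb) andbF.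
Qed.

Hypotheses (A_gt0 : 0 < fine (m1 A)) (B_gt0 : 0 < fine (m2 B)).
Local Notation VA := (variance m1 A).
Local Notation VB := (variance m2 B).

Lemma bmf_varianceA F : bmf F -> bmf (fun b => VA (fun a => F (a, b))).
Proof.
move=> bF; rewrite /variance; apply: bmfB; first exact: (bmf_int2 (bmf_sqr bF)).
under eq_fun do rewrite mulrC.
by apply: bmfZ; apply: bmf_sqr; exact: bmf_int2.
Qed.

Lemma bmf_varianceB F : bmf F -> bmf (fun a => VB (fun b => F (a, b))).
Proof.
move=> bF; rewrite /variance; apply: bmfB; first exact: (bmf_int1 mB fB (bmf_sqr bF)).
under eq_fun do rewrite mulrC.
by apply: bmfZ; apply: bmf_sqr; exact: (bmf_int1 mB fB bF).
Qed.

(* Convexity of the variance, by duality: the variance of the averaged function is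
   its pairing with its own centered part. *)
Lemma variance_int F : bmf F ->
  VB (fun b => IA (fun a => F (a, b))) <= fine (m1 A) * IA (fun a => VB (fun b => F (a, b))).
Proof.
move=> bF; pose G b := IA (fun a => F (a, b)); have bG : bmf G := bmf_int2 bF.
pose s := fine (m1 A); pose w b := G b - IB G / fine (m2 B).
have bw : bmf w by apply: bmfB => //; exact: bmf_cst.
have Iw : IB w = 0.
  by rewrite (intB mB fB bG (bmf_cst _ _)) int_cst// divfK ?subrr// gt_eqF.
have VG : VB G = IB (fun b => w b ^+ 2) by rewrite (variance_mean mB fB B_gt0 bG).
have bFw : bmf (fun p => F p * w p.2).
  apply: bmfM => //; split; last by have [_ [C hC]] := bw; exists C => x.
  exact: (measurableT_comp bw.1 measurable_snd).
have E1 : VB G = IA (fun a => IB (fun b => F (a, b) * w b)).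
  rewrite -(int_prod1 bFw) (int_prod2 bFw) VG.
  have -> : (fun b => w b ^+ 2) = fun b => G b * w b - IB G / fine (m2 B) * w b.
    by apply/funext => b; rewrite expr2 {1}/w; ring.
  rewrite (intB mB fB (bmfM bG bw) (bmfZ _ bw)) (intZ mB fB _ bw) Iw mulr0 subr0.
  congr Rintegral; apply/funext => b; rewrite /= [RHS](_ : _ = IA (fun a => w b * F (a, b))).
    by rewrite (intZ mA fA _ (bmf_section2 b bF)) mulrC.
  by congr Rintegral; apply/funext => a; rewrite mulrC.
(* Young's inequality with weight [s], after subtracting from the slice its mean, which is allowed
   because [w] has integral zero. Half of [VG] is absorbed at the end. *)
have le_a a : IB (fun b => F (a, b) * w b) <=
    2^-1 * (s * VB (fun b => F (a, b))) + 2^-1 * (VB G / s).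
  have bFa := bmf_section1 a bF; pose c := IB (fun b => F (a, b)) / fine (m2 B).
  have bc : bmf (fun b => F (a, b) - c) by apply: bmfB => //; exact: bmf_cst.
  have -> : IB (fun b => F (a, b) * w b) = IB (fun b => (F (a, b) - c) * w b).
    have -> : (fun b => (F (a, b) - c) * w b) = fun b => F (a, b) * w b - c * w b.
      by apply/funext => b; ring.
    by rewrite (intB mB fB (bmfM bFa bw) (bmfZ _ bw)) (intZ mB fB _ bw) Iw mulr0 subr0.
  rewrite (variance_mean mB fB B_gt0 bFa) -/c VG.
  have b1 := bmfZ (2^-1 * s) (bmf_sqr bc); have b2 := bmfZ (2^-1 / s) (bmf_sqr bw).
  rewrite mulrA [2^-1 * (_ / s)]mulrCA [X in _ + X]mulrC.
  rewrite -(intZ mB fB _ (bmf_sqr bc)) -(intZ mB fB _ (bmf_sqr bw)).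
  rewrite -(intD mB fB b1 b2); apply: (le_int mB fB (bmfM bc bw) (bmfD b1 b2)) => b _.
  have s0 : 0 < s by []; move: (F (a, b) - c) (w b) => x y.
  have -> : 2^-1 * s * x ^+ 2 + 2^-1 / s * y ^+ 2 = x * y + (2^-1 / s) * (s * x - y) ^+ 2.
    by field; rewrite gt_eqF.
  by rewrite lerDl mulr_ge0 ?sqr_ge0// mulr_ge0 ?invr_ge0 ?(ltW s0).
have bV := bmf_varianceB bF.
have : VB G <= 2^-1 * (s * IA (fun a => VB (fun b => F (a, b)))) + 2^-1 * VB G.
  rewrite {1}E1; have b1 := bmfZ (2^-1) (bmfZ s bV).
  apply: le_trans (le_int mA fA (bmf_int1 mB fB bFw) (bmfD b1 (bmf_cst _ _)) (fun a _ => le_a a)) _.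
  rewrite (intD mA fA b1 (bmf_cst _ _)) (intZ mA fA _ (bmfZ s bV)) (intZ mA fA _ bV) int_cst//.
  by rewrite lerD2l -mulrA divfK// gt_eqF.
by rewrite -/G -/s; lra.
Qed.

(** The law of total variance: up to normalization, the variance is the integral of the variances
    over [A] plus the variance of the mean over [A]. The convexity in [variance_int] bounds the
    latter. *)
Lemma variance_prod F : bmf F -> variance m12 (A `*` B) F <=
  IB (fun b => VA (fun a => F (a, b))) + IA (fun a => VB (fun b => F (a, b))).
Proof.
move=> bF; have b2 := bmf_sqr bF; pose G b := IA (fun a => F (a, b)).
have bG : bmf G := bmf_int2 bF; have := variance_int bF; rewrite -/G.
have -> : IB (fun b => VA (fun a => F (a, b))) =
    IAB (fun p => F p ^+ 2) - IB (fun b => G b ^+ 2) / fine (m1 A).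
  rewrite (int_prod2 b2) mulrC -(intZ mB fB _ (bmf_sqr bG)).
  rewrite -(intB mB fB (bmf_int2 b2) (bmfZ _ (bmf_sqr bG))).
  by congr Rintegral; apply/funext => b; rewrite /variance mulrC.
rewrite {1 3}/variance fine_prod (int_prod2 bF) -/G => h.
have h2 : (IB (fun b => G b ^+ 2) - IB G ^+ 2 / fine (m2 B)) / fine (m1 A) <=
    IA (fun a => VB (fun b => F (a, b))) by rewrite ler_pdivrMr//; apply: le_trans h _; rewrite [leRHS]mulrC.
have -> : IB G ^+ 2 / (fine (m1 A) * fine (m2 B)) = IB G ^+ 2 / fine (m2 B) / fine (m1 A).
  by field; rewrite !gt_eqF.
by rewrite mulrBl in h2; lra.
Qed.

End VarianceTensor.

(** * The Poincare inequality on one cube *)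

Section CubePoincare.
Variable R : realType.
Local Notation R3 := (R * R * R)%type.
Local Notation mu := (@mu3 R).
Local Notation lam := (@lebesgue_measure R).
Local Notation lam2 := (sfprod lam lam).

Lemma lam_itv (a h : R) : 0 < h -> lam `[a, a + h[%classic = h%:E.
Proof.
by move=> h0; rewrite lebesgue_measure_itv /= lte_fin ltrDl h0 -EFinB addrAC subrr add0r.
Qed.

(** Comparison with the value [g a] instead of the mean, then the fundamental theorem of calculus
    and the Cauchy-Schwarz inequality. The constant [h^2] is not sharp, but only its smallness
    matters. *)
Lemma interval_poincare (g : R -> R) (a h : R) : 0 < h -> (forall t, derivable g t 1) ->
  continuous (derive1 g) -> bmf (g : measurableTypeR R -> R) ->
  bmf (derive1 g : measurableTypeR R -> R) ->
  variance lam `[a, a + h[%classic g <=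
  h ^+ 2 * Rintegral lam `[a, a + h[%classic (fun t => derive1 g t ^+ 2).
Proof.
move=> h0 dg cg bg bg'; set I := `[a, a + h[%classic.
have mI : measurable (I : set (measurableTypeR R)) by exact: measurable_itv.
have lI : lam I = h%:E by exact: lam_itv.
have fI : (lam I < +oo)%E by rewrite lI ltry.
have hI : 0 < fine (lam I) by rewrite lI.
set J := Rintegral lam I (fun t => derive1 g t ^+ 2).
apply: le_trans (variance_le mI fI hI (g a) bg) _.
have -> : h ^+ 2 * J = Rintegral lam I (fun=> h * J).
  have lIf : fine (lam I) = h by rewrite lI.
  by rewrite (Rintegral_cst _ mI) [fine _]lIf; ring.
have bga : bmf (fun t : measurableTypeR R => (g t - g a) ^+ 2).
  by apply: bmf_sqr; apply: bmfB => //; exact: bmf_cst.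
apply: (le_int mI fI bga (bmf_cst _ _)) => x.
rewrite /I /= in_itv/= => /andP[ax xb].
have J0 : 0 <= J by apply: int_ge0 => t; exact: sqr_ge0.
move: ax; rewrite le_eqVlt => /predU1P[->|ax].
  by rewrite subrr expr0n /= mulr_ge0 ?(ltW h0).
have mK : measurable (`[a, x]%classic : set (measurableTypeR R)) by exact: measurable_itv.
have lK : lam `[a, x]%classic = (x - a)%:E.
  by rewrite lebesgue_measure_itv /= lte_fin ax -EFinB.
have fK : (lam `[a, x]%classic < +oo)%E by rewrite lK ltry.
have ftc : g x - g a = Rintegral lam `[a, x]%classic (derive1 g).
  have cont (t : R) : g y @[y --> t] --> g t.
    by apply/differentiable_continuous/derivable1_diffP; exact: dg.
  have lr : derivable_oo_LRcontinuous g a x.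
    split; first by move=> t _; exact: dg.
      by apply: cvg_at_right_filter; exact: cont.
    by apply: cvg_at_left_filter; exact: cont.
  have cw : {within `[a, x], continuous (derive1 g)} by exact: continuous_subspaceT.
  have ein : {in `]a, x[%R, derive1 g =1 derive1 g} by [].
  by rewrite /Rintegral (continuous_FTC2 ax cw lr ein).
have K0 : 0 < fine (lam `[a, x]%classic) by rewrite lK /= subr_gt0.
rewrite ftc; apply: le_trans (sqr_int_le mK fK K0 bg') _.
have lKf : fine (lam `[a, x]%classic) = x - a by rewrite lK.
rewrite [fine _]lKf; apply: ler_pM; [by rewrite subr_ge0 ltW| |by lra|].
  by apply: int_ge0 => t; exact: sqr_ge0.
have bs := bmf_sqr bg'.
apply: fine_le; [by apply: integrable_fin_num => //; exact: bmf_integrable bs|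
  by apply: integrable_fin_num => //; exact: bmf_integrable bs|].
apply: ge0_subset_integral => //.
- by apply/measurable_EFinP/measurable_funTS; exact: bs.1.
- by move=> t _; rewrite lee_fin sqr_ge0.
- move=> t; rewrite /I /= !in_itv/= => /andP[at_ tx]; rewrite at_ /=.
  exact: le_lt_trans tx xb.
Qed.

Lemma sum3 (v : 'I_3 -> R) : \sum_i v i = v 0 + v 1 + v 2.
Proof.
rewrite !big_ord_recl big_ord0 addr0 addrA; congr (_ + v _ + v _); exact: val_inj.
Qed.

(** Half-open, so that the cubes of a grid are disjoint and cover. *)
Definition cube (a : R3) (h : R) : set R3 :=
  (`[a.1.1, a.1.1 + h[%classic `*` `[a.1.2, a.1.2 + h[%classic) `*` `[a.2, a.2 + h[%classic.

Lemma cube_measurable a (h : R) : measurable (cube a h : set (mR3 R)).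
Proof. by apply: measurableX; [apply: measurableX|]; exact: measurable_itv. Qed.

Lemma mu3_cube a (h : R) : 0 < h -> mu (cube a h) = (h ^+ 3)%:E.
Proof.
move=> h0; rewrite /cube mu3_prod; last 2 first.
- by apply: measurableX; exact: measurable_itv.
- exact: measurable_itv.
rewrite product_measure1E; [|exact: measurable_itv..].
have l (c : R) := lam_itv c h0.
rewrite (l a.2) [X in (X * _ * _)%E](l a.1.1) [X in (_ * X * _)%E](l a.1.2).
by rewrite -!EFinM; congr EFin; ring.
Qed.

(** Two tensorizations, in the plane and then with the third coordinate, reduce to the inequality on
    lines parallel to the axes. Each direction keeps the one-dimensional constant [h^2]. *)
Lemma cube_poincare (f : R3 -> R) a (h : R) : 0 < h -> smooth f ->
  bmf (f : mR3 R -> R) -> (forall i, bmf (partial i f : mR3 R -> R)) ->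
  variance mu (cube a h) f <= h ^+ 2 *
    \sum_i Rintegral mu (cube a h) (fun x => partial i f x ^+ 2).
Proof.
move=> h0 sf bf bp; have mI (c : R) : measurable (`[c, c + h[%classic : set (measurableTypeR R)).
  exact: measurable_itv.
have fI (c : R) : (lam `[c, (c + h)%R[%classic < +oo)%E by rewrite lam_itv// ltry.
have hI (c : R) : 0 < fine (lam `[c, c + h[%classic) by rewrite lam_itv.
set I1 := `[a.1.1, a.1.1 + h[%classic; set I2 := `[a.1.2, a.1.2 + h[%classic.
set I3 := `[a.2, a.2 + h[%classic.
have mA : measurable (I1 `*` I2 : set (measurableTypeR R * measurableTypeR R)).
  by apply: measurableX; exact: mI.
have fA : (lam2 (I1 `*` I2) < +oo)%E.
  exact: (prod_fin (m1 := lam) (m2 := lam) (mI _) (mI _) (fI _) (fI _)).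
have hA : 0 < fine (lam2 (I1 `*` I2)).
  rewrite [fine _](fine_prod (m1 := lam) (m2 := lam) (mI _) (mI _) (fI _) (fI _)).
  exact: (mulr_gt0 (hI _) (hI _)).
have cpair (U V W : topologicalType) (u : U -> V) (v : U -> W) :
    continuous u -> continuous v -> continuous (fun t => (u t, v t)).
  by move=> cu cv t; apply: cvg_pair; [exact: cu|exact: cv].
have ccst (U V : topologicalType) (c : V) : continuous (fun _ : U => c).
  by move=> t; exact: cvg_cst.
have cid : continuous (fun t : R => t) by move=> t; exact: cvg_id.
have cp i : continuous (partial i f) by exact/smooth_continuous/smooth_partial.
have slice i (l : R -> R3) (c : R) : (forall s k, l (k + s) = k *: basis3 R i + l s) ->
    continuous l -> measurable_fun setT (l : measurableTypeR R -> mR3 R) ->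
    variance lam `[c, c + h[%classic (f \o l) <=
    h ^+ 2 * Rintegral lam `[c, c + h[%classic (fun t => partial i f (l t) ^+ 2).
  move=> hl cl ml; have D t := slice_derive hl (smooth_differentiable (l t) sf).
  have E : derive1 (f \o l) = partial i f \o l by apply/funext => t; have [_ ->] := D t.
  have bl (g : mR3 R -> R) : bmf g -> bmf (g \o l : measurableTypeR R -> R).
    by move=> [mg [C hC]]; split; [exact: measurableT_comp mg ml|exists C => t; exact: hC].
  have := @interval_poincare (f \o l) c h h0; rewrite E; apply.
  - by move=> t; have [] := D t.
  - by move=> t; apply: continuous_comp; [exact: cl|exact: cp].
  - exact: bl bf.
  - exact: bl (bp i).
have bs i := bmf_sqr (bp i).
pose P i p z := partial i f (p, z) ^+ 2.
have step2 z : variance lam2 (I1 `*` I2) (fun p => f (p, z)) <= h ^+ 2 *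
    (Rintegral lam2 (I1 `*` I2) (fun p => P 0 p z) + Rintegral lam2 (I1 `*` I2) (fun p => P 1 p z)).
  have bz := bmf_section2 (T1 := (measurableTypeR R * measurableTypeR R)%type) z bf.
  have bPz i := bmf_section2 (T1 := (measurableTypeR R * measurableTypeR R)%type) z (bs i).
  apply: le_trans (variance_prod (m1 := lam) (m2 := lam) (mI a.1.1) (mI a.1.2) (fI _) (fI _) (hI _) (hI _) bz) _.
  have e0 := int_prod2 (m1 := lam) (m2 := lam) (mI a.1.1) (mI a.1.2) (fI _) (fI _) (bPz 0).
  have e1 := int_prod1 (m1 := lam) (m2 := lam) (mI a.1.1) (mI a.1.2) (fI _) (fI _) (bPz 1).
  rewrite [X in _ * (X + _)]e0 [X in _ * (_ + X)]e1 mulrDr.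
  have b1 := bmf_int2 (m1 := lam) (mI a.1.1) (fI a.1.1) (bPz 0).
  have b2 := bmf_int1 (m2 := lam) (mI a.1.2) (fI a.1.2) (bPz 1).
  apply: lerD.
    apply: (le_intZ (mI a.1.2) (fI _) _ b1).
      exact: (bmf_varianceA (m1 := lam) (mI a.1.1) (fI _) bz).
    move=> x2 _; apply: (slice 0 (fun t => (t, x2, z))).
    - move=> s k; transitivity (k * 1 + s, k * 0 + x2, k * 0 + z); last by [].
    by rewrite mulr1 mulr0 !add0r.
    - by apply: (cpair _ _ _ (fun t => (t, x2))) => //; apply: cpair.
    - by apply: measurable_fun_pair => //; apply: measurable_fun_pair.
  apply: (le_intZ (mI a.1.1) (fI _) _ b2).
    exact: (bmf_varianceB (m2 := lam) (mI a.1.2) (fI _) bz).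
  move=> x1 _; apply: (slice 1 (fun t => (x1, t, z))).
  - move=> s k; transitivity (k * 0 + x1, k * 1 + s, k * 0 + z); last by [].
    by rewrite mulr1 mulr0 !add0r.
  - by apply: (cpair _ _ _ (fun t => (x1, t))) => //; apply: cpair.
  - by apply: measurable_fun_pair => //; apply: measurable_fun_pair.
apply: le_trans (variance_prod (m1 := lam2) (m2 := lam) mA (mI a.2) fA (fI _) hA (hI _) bf) _.
have bP i := bmf_int2 (m1 := lam2) mA fA (bs i).
have bP1 := bmf_int1 (m2 := lam) (mI a.2) (fI a.2) (bs 2).
have e0 := int_prod2 (m1 := lam2) (m2 := lam) mA (mI a.2) fA (fI a.2) (bs 0).
have e1 := int_prod2 (m1 := lam2) (m2 := lam) mA (mI a.2) fA (fI a.2) (bs 1).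
have e2 := int_prod1 (m1 := lam2) (m2 := lam) mA (mI a.2) fA (fI a.2) (bs 2).
have sE : h ^+ 2 * \sum_i Rintegral mu (cube a h) (fun x => partial i f x ^+ 2) =
    h ^+ 2 * (Rintegral lam I3 (fun z => Rintegral lam2 (I1 `*` I2) (fun p => P 0 p z)) +
      Rintegral lam I3 (fun z => Rintegral lam2 (I1 `*` I2) (fun p => P 1 p z))) +
    h ^+ 2 * Rintegral lam2 (I1 `*` I2) (fun p => Rintegral lam I3 (fun z => P 2 p z)).
  by rewrite sum3 mulrDr; congr (_ * (_ + _) + _ * _); [exact: e0|exact: e1|exact: e2].
rewrite [leRHS]sE; apply: lerD.
  apply: (le_intZD (mI a.2) (fI _) _ (bP 0) (bP 1)).
    exact: (bmf_varianceA (m1 := lam2) mA fA bf).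
  by move=> z _; exact: step2.
apply: (le_intZ mA fA _ bP1).
  exact: (bmf_varianceB (m2 := lam) (mI a.2) (fI _) bf).
move=> -[x1 x2] _; apply: (slice 2 (fun t => (x1, x2, t))).
- move=> s k; transitivity (k * 0 + x1, k * 0 + x2, k * 1 + s); last by [].
    by rewrite mulr1 mulr0 !add0r.
- by apply: (cpair _ _ _ (fun=> (x1, x2))).
- by apply: measurable_fun_pair.
Qed.

End CubePoincare.

(** * Summation over a grid of cubes and passage to H^1_0 *)

Section GridPoincare.
Variables (R : realType) (Om : set (R * R * R)).
Hypothesis oOm : open Om.
Local Notation R3 := (R * R * R)%type.
Local Notation fct := (R3 -> R[i]).
Local Notation mu := (@mu3 R).
Local Notation Re := complex.Re.
Local Notation Im := complex.Im.
Local Notation L2r := (L2r mu (Om : set (mR3 R))).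
Local Notation ipr := (ipr mu (Om : set (mR3 R))).
Local Notation PH := (L2_ph oOm).
Local Notation PH1 := (H1_prehilbert oOm).
Local Notation N1 := (hnorm (dotH1 Om)).
Local Notation nrm2 := (hnorm (dotL2 Om)).
Local Notation mOm := (open_measurable3 oOm).

Definition cut (Q : set R3) (u : fct) : fct := fun x => (\1_Q x)%:C * u x.
Definition indC (Q : set R3) : fct := fun x => (\1_Q x)%:C.

Lemma indic_sqr (Q : set R3) x : \1_Q x * \1_Q x = \1_Q x :> R.
Proof. by rewrite indicE; case: (x \in Q); rewrite ?mulr1 ?mulr0. Qed.

Lemma indic_le1 (Q : set R3) x : `|\1_Q x : R| <= 1.
Proof. by rewrite indicE; case: (x \in Q); rewrite ?normr1 ?normr0. Qed.

Lemma cut_L2 Q u : measurable (Q : set (mR3 R)) -> L2 Om u ->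
  L2 Om (cut Q u) /\ nrm2 (cut Q u) <= nrm2 u.
Proof.
move=> mQ Lu; have mi : measurable_fun (Om : set (mR3 R)) (\1_Q : R3 -> R).
  by apply: measurable_funTS; exact: measurable_indic.
have [? h] := mult_L2 oOm mi (indic_le1 Q) Lu; split => //.
by rewrite normr1 mul1r in h.
Qed.

Lemma cut_sqr Q u : measurable (Q : set (mR3 R)) -> L2 Om u ->
  nrm2 (cut Q u) ^+ 2 = ipr (fun x => \1_Q x * Re (u x)) (fun x => \1_Q x * Re (u x)) +
    ipr (fun x => \1_Q x * Im (u x)) (fun x => \1_Q x * Im (u x)).
Proof.
move=> mQ Lu; have [Lc _] := cut_L2 mQ Lu.
rewrite (nrm_sqr PH Lc) (dotL2E oOm Lc Lc) /=.
by congr (ipr _ _ + ipr _ _); apply/funext => x; rewrite /cut ?ReM ?ImM ReC ImC mul0r ?subr0 ?addr0.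
Qed.

Section Family.
Variables (I : finType) (Q : I -> set R3).
Hypothesis mQ : forall i, measurable (Q i : set (mR3 R)).
Hypothesis tQ : forall i j x, Q i x -> Q j x -> i = j.

(** For disjoint sets this is the indicator of their union. *)
Definition count_in x : R := \sum_i \1_(Q i) x.

Lemma count_inE x i : Q i x -> count_in x = 1.
Proof.
move=> Qi; rewrite /count_in (bigD1 i)//= indicE mem_set// big1 ?addr0// => j ji.
by rewrite indicE memNset// => Qj; move/eqP: ji; apply; exact: tQ Qj Qi.
Qed.

Lemma count_in01 x : count_in x = 0 \/ count_in x = 1.
Proof.
have [[i Qi]|nQ] := pselect (exists i, Q i x); first by right; exact: count_inE Qi.
by left; rewrite /count_in big1// => i _; rewrite indicE memNset// => Qi; apply: nQ; exists i.
Qed.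

Lemma count_in_le1 x : `|count_in x| <= 1.
Proof. by have [->|->] := count_in01 x; rewrite ?normr0 ?normr1. Qed.

Lemma indic_L2r (A : set R3) f : measurable (A : set (mR3 R)) -> L2r f -> L2r (fun x => \1_A x * f x).
Proof.
by move=> mA Lf; apply: (L2rM mOm (C := 1)) => // x _; exact: indic_le1.
Qed.

Lemma count_in_L2r f : L2r f -> L2r (fun x => count_in x * f x).
Proof.
move=> Lf; apply: (L2rM mOm (C := 1)) => //; last by move=> x _; exact: count_in_le1.
by apply: measurable_sum => i; apply: measurable_funTS; exact: measurable_indic.
Qed.

Lemma sum_ipr_cut f : L2r f -> \sum_i ipr (fun x => \1_(Q i) x * f x) (fun x => \1_(Q i) x * f x) =
  ipr (fun x => count_in x * f x) (fun x => count_in x * f x).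
Proof.
move=> Lf; have E1 (A : set R3) : ipr (fun x => \1_A x * f x) (fun x => \1_A x * f x) =
    ipr (fun x => \1_A x * f x) f.
  by apply: eq_Rintegral => x _; rewrite mulrACA indic_sqr mulrA.
have -> : ipr (fun x => count_in x * f x) (fun x => count_in x * f x) =
    ipr (fun x => count_in x * f x) f.
  apply: eq_Rintegral => x _; have [->|->] := count_in01 x; first by rewrite !mul0r.
  by rewrite mul1r.
rewrite (eq_bigr _ (fun i _ => E1 (Q i))).
have -> : (fun x => count_in x * f x) = fun x => \sum_i \1_(Q i) x * f x.
  by apply/funext => x; rewrite mulr_suml.
suff H (s : seq I) : L2r (fun x => \sum_(i <- s) \1_(Q i) x * f x) /\
    \sum_(i <- s) ipr (fun x => \1_(Q i) x * f x) f = ipr (fun x => \sum_(i <- s) \1_(Q i) x * f x) f.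
  exact: (H _).2.
elim: s => [|i s [Ls ih]].
  under [X in L2r X]eq_fun do rewrite big_nil.
  under [X in ipr X]eq_fun do rewrite big_nil.
  rewrite big_nil; split; first exact: L2r0.
  have := iprZl mOm 0 Lf Lf; rewrite mul0r => h; rewrite -[LHS]h.
  by congr ipr; apply/funext => x; rewrite mul0r.
under [X in L2r X]eq_fun do rewrite big_cons.
under [X in ipr X]eq_fun do rewrite big_cons.
have Li := indic_L2r (mQ i) Lf.
by rewrite big_cons; split; [exact: (L2rD mOm Li Ls)|rewrite (iprDl mOm Li Ls Lf) ih].
Qed.

Lemma sum_ipr_cut_le f : L2r f ->
  \sum_i ipr (fun x => \1_(Q i) x * f x) (fun x => \1_(Q i) x * f x) <= ipr f f.
Proof.
move=> Lf; rewrite sum_ipr_cut//; apply: (le_iprr mOm (count_in_L2r Lf) Lf) => x _.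
have [->|->] := count_in01 x; last by rewrite mul1r.
by rewrite mul0r expr0n /= sqr_ge0.
Qed.

Lemma cut_le_sum (A : set R3) u : measurable (A : set (mR3 R)) ->
  (forall x, A x -> exists i, Q i x) -> L2 Om u ->
  nrm2 (cut A u) ^+ 2 <= \sum_i nrm2 (cut (Q i) u) ^+ 2.
Proof.
move=> mA AQ Lu; have /(L2c_L2r oOm)[Lr Li] := Lu.
rewrite (cut_sqr mA Lu) (eq_bigr _ (fun i _ => cut_sqr (mQ i) Lu)) big_split /=.
have le f : L2r f -> ipr (fun x => \1_A x * f x) (fun x => \1_A x * f x) <=
    \sum_i ipr (fun x => \1_(Q i) x * f x) (fun x => \1_(Q i) x * f x).
  move=> Lf; rewrite (sum_ipr_cut Lf).
  apply: (le_iprr mOm (indic_L2r mA Lf) (count_in_L2r Lf)) => x _.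
  have [/AQ[i Qi]|nA] := pselect (A x).
    by rewrite (count_inE Qi) mul1r exprMn indicE; case: (x \in A); rewrite ?expr1n ?mul1r ?expr0n ?mul0r ?sqr_ge0.
  by rewrite indicE memNset// mul0r expr0n /= sqr_ge0.
by apply: lerD; exact: le.
Qed.

End Family.

Lemma real_test_bmf f : real_test Om f -> bmf (f : mR3 R -> R).
Proof.
move=> [sf [K [cK _ K0]]]; split.
  by apply: continuous_measurable3; exact: smooth_continuous.
have /compact_bounded : compact (f @` K).
  by apply: continuous_compact => //; apply: continuous_subspaceT; exact: smooth_continuous.
move=> [M [_ hM]]; exists (`|M| + 1) => x.
have [Kx|/K0 ->] := pselect (K x); last by rewrite normr0 addr_ge0.
apply: (hM (`|M| + 1)); last by exists x.
by rewrite (le_lt_trans (ler_norm M))// ltrDl.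
Qed.

Lemma Rintegral_cut (Q : set R3) (g : R3 -> R) : (forall x, ~ Om x -> g x = 0) ->
  Rintegral mu Q g = Rintegral mu Om (fun x => \1_Q x * g x).
Proof.
move=> g0; rewrite Rintegral_mkcond [RHS]Rintegral_mkcond; congr Rintegral; apply/funext => x.
rewrite !patchE indicE; have [Ox|Ox] := pselect (Om x).
  by rewrite (mem_set Ox); case: (x \in Q); rewrite ?mul1r ?mul0r.
by rewrite (memNset Ox) g0// if_same.
Qed.

(** The cube may stick out of [Om]: a test function of [Om] is smooth on all of R^3 and vanishes off
    [Om], so integrals over the cube equal those over its part in [Om]. *)
Lemma real_cube_poincare f a h : 0 < h -> real_test Om f ->
  ipr (fun x => \1_(cube a h) x * f x) (fun x => \1_(cube a h) x * f x) <=
  h ^+ 2 * \sum_i ipr (fun x => \1_(cube a h) x * partial i f x)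
                      (fun x => \1_(cube a h) x * partial i f x) +
  ipr f \1_(cube a h) ^+ 2 / h ^+ 3.
Proof.
move=> h0 tf; have tp i := real_test_partial i tf.
have out g x : real_test Om g -> ~ Om x -> g x = 0.
  by move=> [_ [K [_ KO K0]]] nO; apply: K0 => /KO.
have E g : real_test Om g -> ipr (fun x => \1_(cube a h) x * g x) (fun x => \1_(cube a h) x * g x) =
    Rintegral mu (cube a h) (fun x => g x ^+ 2).
  move=> tg; rewrite Rintegral_cut; last by move=> x nO; rewrite (out g)// expr0n.
  by apply: eq_Rintegral => x _; rewrite mulrACA indic_sqr.
rewrite (E f tf) (eq_bigr _ (fun i _ => E _ (tp i))).
have -> : ipr f \1_(cube a h) = Rintegral mu (cube a h) f.
  rewrite Rintegral_cut; last by move=> x nO; exact: out.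
  by apply: eq_Rintegral => x _; rewrite mulrC.
have [sf _] := tf.
have := cube_poincare a h0 sf (real_test_bmf tf) (fun i => real_test_bmf (tp i)).
rewrite /variance; have -> : fine (mu (cube a h)) = h ^+ 3 by rewrite mu3_cube.
by rewrite lerBlDr.
Qed.

Lemma sum_cut_le (I : finType) (Q : I -> set R3) u :
  (forall i, measurable (Q i : set (mR3 R))) ->
  (forall i j x, Q i x -> Q j x -> i = j) -> L2 Om u ->
  \sum_i nrm2 (cut (Q i) u) ^+ 2 <= nrm2 u ^+ 2.
Proof.
move=> mQ tQ Lu; have /(L2c_L2r oOm)[Lr Li] := Lu.
rewrite (eq_bigr _ (fun i _ => cut_sqr (mQ i) Lu)) big_split (nrm_sqr PH Lu) (dotL2E oOm Lu Lu) /=.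
by apply: lerD; exact: sum_ipr_cut_le.
Qed.

Lemma indC_L2 a (h : R) : 0 < h -> L2 Om (indC (cube a h)).
Proof.
move=> h0; apply/(L2c_L2r oOm); split; last exact: L2r0.
have mQ := cube_measurable a h.
have fQ : (mu (cube a h) < +oo)%E by rewrite mu3_cube// ltry.
apply: (L2r_bounded_support mOm mQ fQ (M := 1)).
- by apply: measurable_funTS; exact: measurable_indic.
- by move=> x _ _; exact: indic_le1.
- by move=> x _ nQ; rewrite /indC ReC indicE memNset.
Qed.

Lemma test_cube_poincare phi a (h : R) : 0 < h -> test_function Om phi ->
  nrm2 (cut (cube a h) phi) ^+ 2 <=
  h ^+ 2 * \sum_i nrm2 (cut (cube a h) (partialC i phi)) ^+ 2 +
  absC (dotL2 Om phi (indC (cube a h))) ^+ 2 / h ^+ 3.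
Proof.
move=> h0 tphi; have /test_real[tr ti] := tphi.
have mQ := cube_measurable a h; have Lp := test_L2 oOm tphi.
rewrite (cut_sqr mQ Lp) (eq_bigr _ (fun i _ => cut_sqr mQ (test_L2 oOm (test_partialC i tphi)))).
rewrite big_split /= mulrDr absC_sqr mulrDl addrACA (dotL2E oOm Lp (indC_L2 a h0)) /=.
have z g : ipr g (fun=> 0) = 0.
  transitivity (Rintegral mu Om (fun=> 0 : R)); first by apply: eq_Rintegral => x _; rewrite mulr0.
  by rewrite (Rintegral_cst _ mOm) mul0r.
have -> : (fun x => Im (indC (cube a h) x)) = fun=> 0 by [].
rewrite !z addr0 subr0; apply: lerD; exact: real_cube_poincare.
Qed.

Section Density.
Variables (I : finType) (a : I -> R3) (h : R).
Hypothesis h_gt0 : 0 < h.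
Local Notation Q := (fun i => cube (a i) h).
Hypothesis tQ : forall i j x, Q i x -> Q j x -> i = j.
Local Notation ell := (fun i u => dotL2 Om u (indC (Q i))).

(** By disjointness the gradient terms of all cubes add up to at most one squared H^1 norm, so the
    factor [h^2] does not grow with the number of cubes. *)
Lemma test_family_poincare phi : test_function Om phi ->
  \sum_i nrm2 (cut (Q i) phi) ^+ 2 <=
  h ^+ 2 * N1 phi ^+ 2 + \sum_i absC (ell i phi) ^+ 2 / h ^+ 3.
Proof.
move=> tphi; apply: le_trans (ler_sum _ (fun i _ => test_cube_poincare (a i) h_gt0 tphi)) _.
rewrite big_split /= lerD2r -mulr_sumr ler_wpM2l ?sqr_ge0// exchange_big /=.
have mQ i : measurable (Q i : set (mR3 R)) by exact: cube_measurable.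
have tp i := test_L2 oOm (test_partialC i tphi).
apply: le_trans (ler_sum _ (fun i _ => sum_cut_le mQ tQ (tp i))) _.
rewrite -normH1E (normH1_sqr oOm (test_H1 oOm tphi) (weak_gradient_test oOm tphi)).
rewrite (eq_bigr (fun i => nrm2 (fun x => (\col_i partialC i phi x) i 0) ^+ 2)).
  by rewrite lerDr sqr_ge0.
by move=> i _; congr (nrm2 _ ^+ 2); apply/funext => x; rewrite mxE.
Qed.

Lemma cvg_near_harmonic (u : nat -> R) (l C : R) :
  (forall n, `|u n - l| <= C * n.+1%:R^-1) -> u n @[n --> \oo] --> l.
Proof.
move=> ul; apply: cvg_eps_harmonic => e e0; exists C => n.
by apply: le_trans (ul n) _; rewrite lerDr ltW.
Qed.

Lemma cvg_sumr (J : finType) (u : J -> nat -> R) (l : J -> R) :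
  (forall j, u j n @[n --> \oo] --> l j) -> \sum_j u j n @[n --> \oo] --> \sum_j l j.
Proof.
move=> ul; elim: (index_enum J) => [|j s ih].
  by rewrite big_nil; under eq_fun do rewrite big_nil; exact: cvg_cst.
by rewrite big_cons; under eq_fun do rewrite big_cons; exact: cvgD (ul j) ih.
Qed.

(** Every term is continuous for the H^1 norm, so the inequality passes from test functions to their
    closure. *)
Lemma family_poincare u : H10 Om u ->
  \sum_i nrm2 (cut (Q i) u) ^+ 2 <=
  h ^+ 2 * N1 u ^+ 2 + \sum_i absC (ell i u) ^+ 2 / h ^+ 3.
Proof.
move=> Hu; have /H10P[H1u hu] := Hu; have Lu := H1_L2 H1u.
have hp n : 0 < n.+1%:R^-1 :> R by rewrite invr_gt0.
have /boolp.choice[p hphi] : forall n, exists phi, test_function Om phi /\ N1 (fun x => u x - phi x) < n.+1%:R^-1.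
  by move=> n; have [phi ? ?] := hu _ (hp n); exists phi.
have tp n := (hphi n).1; have Hp n := test_H1 oOm (tp n); have Lp n := test_L2 oOm (tp n).
have Hd n := ph_domB PH1 H1u (Hp n); have Ld n := ph_domB PH Lu (Lp n).
have d1 n : N1 (fun x => u x - p n x) <= n.+1%:R^-1 by exact: ltW (hphi n).2.
have d2 n : nrm2 (fun x => u x - p n x) <= n.+1%:R^-1.
  by apply: le_trans (nrm2_le_H1 oOm (Hd n)) _; rewrite normH1E; exact: d1.
have mQ i : measurable (Q i : set (mR3 R)) by exact: cube_measurable.
have absB (b c e : R) : b <= c + e -> c <= b + e -> `|c - b| <= e.
  by move=> ? ?; rewrite ler_norml; apply/andP; split; lra.
have c1 : N1 (p n) @[n --> \oo] --> N1 u.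
  apply: (@cvg_near_harmonic _ _ 1) => n; rewrite mul1r; apply: absB.
    by apply: le_trans (nrm_sub_le PH1 H1u (Hp n)) _; rewrite lerD2l; exact: d1.
  apply: le_trans (nrm_sub_le PH1 (Hp n) H1u) _; rewrite lerD2l.
  by rewrite (nrm_distC PH1 (Hp n) H1u); exact: d1.
have c2 i : nrm2 (cut (Q i) (p n)) @[n --> \oo] --> nrm2 (cut (Q i) u).
  have Lcu := (cut_L2 (mQ i) Lu).1; have Lcp n := (cut_L2 (mQ i) (Lp n)).1.
  have e n : nrm2 (fun x => cut (Q i) u x - cut (Q i) (p n) x) <= n.+1%:R^-1.
    rewrite (_ : (fun x => _) = cut (Q i) (fun x => u x - p n x)).
      by apply: le_trans (cut_L2 (mQ i) (Ld n)).2 (d2 n).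
    by apply/funext => x; rewrite /cut mulrBr.
  apply: (@cvg_near_harmonic _ _ 1) => n; rewrite mul1r; apply: absB.
    by apply: le_trans (nrm_sub_le PH Lcu (Lcp n)) _; rewrite lerD2l; exact: e.
  apply: le_trans (nrm_sub_le PH (Lcp n) Lcu) _; rewrite lerD2l.
  by rewrite (nrm_distC PH (Lcp n) Lcu); exact: e.
have c3 i : absC (ell i (p n)) @[n --> \oo] --> absC (ell i u).
  have Lq := indC_L2 (a i) h_gt0.
  apply: (@cvg_near_harmonic _ _ (nrm2 (indC (Q i)))) => n.
  have e : absC (ell i u - ell i (p n)) <= nrm2 (indC (Q i)) * n.+1%:R^-1.
    rewrite -(ph_ipBl PH Lu (Lp n) Lq); apply: le_trans (ph_CS PH (Ld n) Lq) _.
    by rewrite mulrC ler_wpM2l ?nrm_ge0//; exact: d2.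
  have tri (b c : R[i]) : absC b <= absC c + absC (b - c).
    by rewrite -{1}[b](subrK c) addrC absCD.
  apply: absB; first by apply: le_trans (tri _ (ell i (p n))) _; rewrite lerD2l; exact: e.
  by apply: le_trans (tri _ (ell i u)) _; rewrite lerD2l -opprB absCN; exact: e.
have cL : \sum_i nrm2 (cut (Q i) (p n)) ^+ 2 @[n --> \oo] --> \sum_i nrm2 (cut (Q i) u) ^+ 2.
  by apply: cvg_sumr => i; apply: cvgM; exact: c2.
have cR : h ^+ 2 * N1 (p n) ^+ 2 + \sum_i absC (ell i (p n)) ^+ 2 / h ^+ 3 @[n --> \oo] -->
    h ^+ 2 * N1 u ^+ 2 + \sum_i absC (ell i u) ^+ 2 / h ^+ 3.
  apply: cvgD; first by apply: cvgM; [exact: cvg_cst|apply: cvgM; exact: c1].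
  apply: cvg_sumr => i; apply: cvgM; last exact: cvg_cst.
  by apply: cvgM; exact: c3.
apply: (ler_cvg_to cL cR); apply: nearW => n; exact: test_family_poincare (tp n).
Qed.

End Density.

(** Finitely many averages are the only obstruction to a small L^2 norm on a ball. This takes the
    place of the compact embedding of H^1_0 into L^2 of bounded sets. *)
Lemma local_poincare (e rho : R) : 0 < e -> exists (m : nat) (a : 'I_m * 'I_m * 'I_m -> R3) (h : R),
  0 < h /\ forall u, H10 Om u ->
  nrm2 (cut [set x | enorm x <= rho] u) ^+ 2 <=
  e * N1 u ^+ 2 + \sum_i absC (dotL2 Om u (indC (cube (a i) h))) ^+ 2 / h ^+ 3.
Proof.
(* [h = 1/n < e] together with [h <= 1] gives [h^2 <= e]. The [2 N n] cubes along each axis fill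
   [[-N, N)], where [N > rho]. *)
move=> e0; pose n := (Num.truncn e^-1).+1; pose N := (Num.truncn (Num.max 0 rho)).+1.
have n0 : 0 < n%:R :> R by [].
pose h : R := n%:R^-1; have h0 : 0 < h by rewrite invr_gt0.
have h1 : h <= 1 by rewrite invf_le1// ler1n.
have hn : h * n%:R = 1 by rewrite mulVf// gt_eqF.
have he : h ^+ 2 <= e.
  have : e^-1 < n%:R by have /truncn_itv/andP[] : 0 <= e^-1 by rewrite invr_ge0 ltW.
  by rewrite invf_plt ?posrE// -/h => he; nra.
have rN : rho < N%:R.
  have /truncn_itv/andP[_] : 0 <= Num.max 0 rho by rewrite le_max lexx.
  by apply: le_lt_trans; rewrite le_max lexx orbT.
pose m := (2 * (N * n))%N; pose c (k : nat) : R := - N%:R + h * k%:R.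
pose a (i : 'I_m * 'I_m * 'I_m) : R3 := (c i.1.1, c i.1.2, c i.2).
exists m, a, h; split => // u Hu; have Lu := H1_L2 (H10_H1 Hu).
have inj1 (k l : nat) (t : R) : c k <= t < c k + h -> c l <= t < c l + h -> (k <= l)%N.
  rewrite /c => /andP[k1 _] /andP[_ l2]; rewrite -ltnS -(ltr_nat R) -natr1.
  by rewrite -(ltr_pM2l h0) mulrDr; lra.
have tQ i j x : cube (a i) h x -> cube (a j) h x -> i = j.
  case: i j => -[i1 i2] i3 [[j1 j2] j3] [[/= p1 p2] p3] [[/= q1 q2] q3].
  rewrite !in_itv/= in p1 p2 p3 q1 q2 q3.
  by congr (_, _, _); apply: val_inj; apply/eqP; rewrite eqn_leq;
    apply/andP; split; apply: inj1; eassumption.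
have cover (t : R) : `|t| <= rho -> exists k : 'I_m, c k <= t < c k + h.
  move=> tr; have /(le_lt_trans tr) {tr} := rN; rewrite ltr_norml => /andP[t1 t2].
  have y0 : 0 <= (t + N%:R) * n%:R by rewrite mulr_ge0//; lra.
  have /andP[k1 k2] := truncn_itv y0.
  have km : (Num.truncn ((t + N%:R) * n%:R) < m)%N.
    rewrite -(ltr_nat R); apply: le_lt_trans k1 _.
    by rewrite /m !natrM mulrA ltr_pM2r//; lra.
  exists (Ordinal km); rewrite /c /=; move: k1 k2.
  move: (Num.truncn _) => k; rewrite -natr1.
  rewrite -(ler_pM2l h0) -(ltr_pM2l h0).
  have -> : h * ((t + N%:R) * n%:R) = t + N%:R by rewrite mulrCA hn mulr1.
  by rewrite mulrDr => ? ?; apply/andP; split; lra.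
have mQ i : measurable (cube (a i) h : set (mR3 R)) by exact: cube_measurable.
have mA : measurable ([set x | enorm x <= rho] : set (mR3 R)).
  have mr : measurable (`]-oo, rho]%classic : set R) by exact: measurable_itv.
  have := continuous_measurable3 (@enorm_continuous R) measurableT mr.
  by rewrite setTI; congr measurable; apply/seteqP; split => x /=; rewrite in_itv/=.
apply: le_trans (cut_le_sum mQ tQ mA _ Lu) _.
  move=> x /= xr; have cx i : `|coord i x| <= rho := le_trans (coord_le_enorm i x) xr.
  have [cx0 cx1 cx2] := coordE x.
  have [k0 hk0] := cover _ (cx 0); have [k1 hk1] := cover _ (cx 1); have [k2 hk2] := cover _ (cx 2).
  exists (k0, k1, k2); rewrite cx0 in hk0; rewrite cx1 in hk1; rewrite cx2 in hk2.
  by split; [split|] => /=; rewrite in_itv/=.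
apply: le_trans (family_poincare h0 tQ Hu) _.
by rewrite lerD2r ler_wpM2r ?sqr_ge0.
Qed.

End GridPoincare.

(** * Compactness of finite rank operators *)

Section FiniteRank.
Variables (R : realType) (Om : set (R * R * R)).
Hypothesis oOm : open Om.
Local Notation R3 := (R * R * R)%type.
Local Notation fct := (R3 -> R[i]).
Local Notation Re := complex.Re.
Local Notation Im := complex.Im.
Local Notation PH := (L2_ph oOm).
Local Notation PH1 := (H1_prehilbert oOm).
Local Notation PH10 := (H10_prehilbert oOm).
Local Notation N1 := (hnorm (dotH1 Om)).
Local Notation nrm2 := (hnorm (dotL2 Om)).

Lemma increasing_seq_homo (s : nat -> nat) : increasing_seq s -> {homo s : m n / (m < n)%N}.
Proof. by move=> hs m n mn; rewrite !ltnNge; move: mn; rewrite ltnNge -(hs n m). Qed.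

Lemma homo_ge_id (s : nat -> nat) : {homo s : m n / (m < n)%N} -> forall n, (n <= s n)%N.
Proof. by move=> hs; elim=> // n ih; apply: leq_ltn_trans ih (hs _ _ (ltnSn n)). Qed.

Lemma cvg_subseq (u : nat -> R) (l : R) (s : nat -> nat) : {homo s : m n / (m < n)%N} ->
  u n @[n --> \oo] --> l -> u (s n) @[n --> \oo] --> l.
Proof.
move=> hs ul; apply: cvg_comp ul => A [N _ hN]; exists N => // n /= Nn.
by apply: hN => /=; apply: leq_trans Nn (homo_ge_id hs n).
Qed.

Lemma common_subsequence (J : eqType) (js : seq J) (x : J -> nat -> R) (C : R) :
  (forall j n, `|x j n| <= C) -> exists s : nat -> nat, {homo s : m n / (m < n)%N} /\
  forall j, j \in js -> exists l : R, x j (s n) @[n --> \oo] --> l.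
Proof.
move=> xC; elim: js => [|j js [s [hs cs]]]; first by exists id; split => // j; rewrite in_nil.
have [|t /increasing_seq_homo ht ct] := @bolzano_weierstrass R (x j \o s).
  exists C; split; first exact: num_real.
  by move=> M CM n _ /=; apply: le_trans (xC _ _) (ltW CM).
exists (s \o t); split; first by move=> m n /ht /hs.
move=> k; rewrite inE => /predU1P[->|/cs[l hl]].
  by exists (lim (((x j \o s) \o t) n @[n --> \oo])).
by exists l; exact: cvg_subseq ht hl.
Qed.

Lemma H10_sum (I : Type) (r : seq I) (a : I -> R[i]) (w : I -> fct) : (forall i, H10 Om (w i)) ->
  H10 Om (fun x => \sum_(i <- r) a i * w i x) /\
  N1 (fun x => \sum_(i <- r) a i * w i x) <= \sum_(i <- r) absC (a i) * N1 (w i).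
Proof.
move=> Hw; elim: r => [|i r [Hs hs]].
  have E : (fun x : R3 => \sum_(i <- [::]) a i * w i x) = fun=> 0.
    by apply/funext => x; rewrite big_nil.
  by rewrite E big_nil (nrm0 PH1); split => //; exact: (ph_dom0 PH10).
have E : (fun x => \sum_(j <- i :: r) a j * w j x) =
    fun x => a i * w i x + \sum_(j <- r) a j * w j x.
  by apply/funext => x; rewrite big_cons.
have Hi := H10Z oOm (a i) (Hw i); rewrite E big_cons; split; first exact: (H10D oOm Hi Hs).
apply: le_trans (nrmD PH10 Hi Hs) _; apply: lerD hs.
by rewrite (nrmZ PH10 (a i) (Hw i)).
Qed.

Lemma dotH1_suml (I : Type) (r : seq I) (a : I -> R[i]) (w : I -> fct) v :
  (forall i, H10 Om (w i)) -> H10 Om v ->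
  dotH1 Om (fun x => \sum_(i <- r) a i * w i x) v = \sum_(i <- r) a i * dotH1 Om (w i) v.
Proof.
move=> Hw Hv; elim: r => [|i r ih].
  have E : (fun x : R3 => \sum_(i <- [::]) a i * w i x) = fun x => 0 * v x.
    by apply/funext => x; rewrite big_nil mul0r.
  by rewrite E big_nil (ph_ipZl PH10 0 Hv Hv) mul0r.
have E : (fun x => \sum_(j <- i :: r) a j * w j x) =
    fun x => a i * w i x + \sum_(j <- r) a j * w j x.
  by apply/funext => x; rewrite big_cons.
have [Hs _] := H10_sum r a Hw; have Hi := H10Z oOm (a i) (Hw i).
by rewrite E big_cons (ph_ipDl PH10 Hi Hs Hv) ih (ph_ipZl PH10 (a i) (Hw i) Hv).
Qed.

(** [K u] is the combination, with coefficients [c * l i u], of the Riesz representatives of the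
    functionals [l i]. Along a bounded sequence the finitely many coefficients have a common
    convergent subsequence. *)
Lemma finite_rank_compact (I : finType) (psi : I -> fct) (c : R[i]) :
  (forall i, L2 Om (psi i)) -> exists2 K, compact_operator Om K &
  forall u v, H10 Om u -> H10 Om v ->
    dotH1 Om (K u) v = c * \sum_i dotL2 Om u (psi i) * (dotL2 Om v (psi i))^*.
Proof.
move=> Lpsi; pose l i u := dotL2 Om u (psi i).
have L u : H10 Om u -> L2 Om u by move=> /H10_H1/H1_L2.
have lD i u v : H10 Om u -> H10 Om v -> l i (fun x => u x + v x) = l i u + l i v.
  by move=> Hu Hv; exact: (ph_ipDl PH (L _ Hu) (L _ Hv) (Lpsi i)).
have lZ i a u : H10 Om u -> l i (fun x => a * u x) = a * l i u.
  by move=> Hu; exact: (ph_ipZl PH a (L _ Hu) (Lpsi i)).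
have lb i u : H10 Om u -> absC (l i u) <= nrm2 (psi i) * N1 u.
  move=> Hu; apply: le_trans (ph_CS PH (L _ Hu) (Lpsi i)) _; rewrite mulrC.
  by apply: ler_wpM2l; [exact: nrm_ge0|rewrite -normH1E; exact: nrm2_le_H1 (H10_H1 Hu)].
have /boolp.choice[w hw] : forall i, exists w, H10 Om w /\
    forall v, H10 Om v -> dotH1 Om w v = (l i v)^*.
  move=> i; have [|||w Hw hw] := @riesz _ _ _ _ PH10 (H10_complete oOm)
    (fun v => (l i v)^*) (nrm2 (psi i)).
  - by move=> u v Hu Hv; rewrite (lD i u v Hu Hv) conjcD.
  - by move=> a v Hv; rewrite (lZ i a v Hv) conjcM.
  - by move=> v Hv; rewrite absCJ; exact: lb.
  by exists w.
have Hw i := (hw i).1.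
pose K u : fct := fun x => \sum_i (c * l i u) * w i x.
have HK u : H10 Om (K u) by exact: (H10_sum _ (fun i => c * l i u) Hw).1.
exists K; last first.
  move=> u v Hu Hv; rewrite /K (dotH1_suml _ _ Hw Hv) mulr_sumr.
  by apply: eq_bigr => i _; rewrite ((hw i).2 v Hv) mulrA.
split.
  split; first by move=> u _; exact: HK u.
    move=> a u v Hu Hv; have Hau := H10Z oOm a Hu; apply: aeW => x _.
    rewrite /K mulr_sumr -big_split; apply: eq_bigr => i _ /=.
    by rewrite (lD i _ _ Hau Hv) (lZ i a u Hu); ring.
  exists (\sum_i absC c * nrm2 (psi i) * N1 (w i)) => u Hu; rewrite !normH1E.
  apply: le_trans (H10_sum _ (fun i => c * l i u) Hw).2 _.
  rewrite mulr_suml; apply: ler_sum => i _; rewrite absCM.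
  have := ler_wpM2l (absC_ge0 c) (lb i u Hu); have := nrm_ge0 (dotH1 Om) (w i).
  move: (N1 (w i)) (absC (l i u)) (absC c) (nrm2 _) (N1 u) => p q r s t p0 h.
  have -> : r * s * p * t = r * (s * t) * p by ring.
  exact: ler_wpM2r.
move=> u_ Hu [C hC].
(* Real and imaginary parts of the coefficients, told apart by a boolean, so that the real
   Bolzano-Weierstrass theorem applies. *)
pose x (j : I * bool) n := if j.2 then Re (l j.1 (u_ n)) else Im (l j.1 (u_ n)).
pose B := \sum_i nrm2 (psi i) * `|C|.
have xB j n : `|x j n| <= B.
  apply: (@le_trans _ _ (absC (l j.1 (u_ n)))).
    by rewrite /x; case: j.2; [exact: ReZ_absC|exact: ImZ_absC].
  apply: le_trans (lb _ _ (Hu n)) _; rewrite /B (bigD1 j.1)//=.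
  apply: ler_wpDr; first by apply: sumr_ge0 => i _; rewrite mulr_ge0// nrm_ge0.
  apply: ler_wpM2l; first exact: nrm_ge0.
  by rewrite -normH1E; apply: le_trans (hC n) (ler_norm C).
have [s [hs cs]] := common_subsequence (enum {: I * bool}) xB.
have /boolp.choice[y hy] : forall j, exists y : R, x j (s n) @[n --> \oo] --> y.
  by move=> j; apply: cs; rewrite mem_enum.
pose lim_ i : R[i] := y (i, true) +i* y (i, false).
pose v : fct := fun x => \sum_i (c * lim_ i) * w i x.
have Hv : H10 Om v by exact: (H10_sum _ (fun i => c * lim_ i) Hw).1.
exists s, v; split; [exact: hs|exact: Hv|].
pose b n := \sum_i absC c * (`|x (i, true) (s n) - y (i, true)| +
  `|x (i, false) (s n) - y (i, false)|) * N1 (w i).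
apply: (@cvg0_squeeze _ _ b) => [n|].
  rewrite normH1E nrm_ge0/=.
  rewrite (_ : (fun t => _) = fun t => \sum_i (c * (l i (u_ (s n)) - lim_ i)) * w i t); last first.
    apply/funext => t; rewrite /K /v -sumrB; apply: eq_bigr => i _; ring.
  apply: le_trans (H10_sum _ (fun i => c * (l i (u_ (s n)) - lim_ i)) Hw).2 _.
  apply: ler_sum => i _; rewrite absCM; apply: ler_wpM2r; first exact: nrm_ge0.
  apply: ler_wpM2l; first exact: absC_ge0.
  by apply: le_trans (absC_le _) _; rewrite ReD ImD ReN ImN.
have -> : 0 = \sum_(i : I) absC c * (0 + 0) * N1 (w i).
  by rewrite big1// => i _; rewrite addr0 mulr0 mul0r.
have ab j : `|x j (s n) - y j| @[n --> \oo] --> (0 : R).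
  rewrite -(normr0 R); apply: cvg_norm; rewrite -(subrr (y j)).
  by apply: cvgB; [exact: hy|exact: cvg_cst].
apply: cvg_sumr => i; apply: cvgM; last exact: cvg_cst.
by apply: cvgM; [exact: cvg_cst|exact: cvgD].
Qed.

End FiniteRank.

(** * The pointwise quadratic form *)

Section RayleighQuotient.
Variable R : realType.
Implicit Types (s A : 'M[R]_3) (u v w : 'cV[R]_3).

Definition bform s u v : R := (u^T *m s *m v) 0 0.
Definition dotv u v : R := \sum_i u i 0 * v i 0.

Lemma bformE s u v : bform s u v = dotv u (s *m v).
Proof. by rewrite /bform /dotv -mulmxA mxE; apply: eq_bigr => i _; rewrite mxE. Qed.

Lemma bformDr s u v w : bform s u (v + w) = bform s u v + bform s u w.
Proof. by rewrite /bform mulmxDr mxE. Qed.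
Lemma bformZr s a u v : bform s u (a *: v) = a * bform s u v.
Proof. by rewrite /bform -scalemxAr mxE. Qed.
Lemma bformDl s u v w : bform s (u + v) w = bform s u w + bform s v w.
Proof. by rewrite /bform linearD /= !mulmxDl mxE. Qed.
Lemma bformZl s a u v : bform s (a *: u) v = a * bform s u v.
Proof. by rewrite /bform linearZ /= -!scalemxAl mxE. Qed.
Lemma bformNr s u v : bform s u (- v) = - bform s u v.
Proof. by rewrite -[- v]scaleN1r bformZr mulN1r. Qed.
Lemma bformNl s u v : bform s (- u) v = - bform s u v.
Proof. by rewrite -[- u]scaleN1r bformZl mulN1r. Qed.
Lemma bformC s u v : s^T = s -> bform s u v = bform s v u.
Proof.
move=> ss; rewrite /bform -[LHS](mxE trmx_key (fun i j => (u^T *m s *m v) j i)).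
by rewrite -/(trmx _) !trmx_mul trmxK ss mulmxA.
Qed.

Lemma dotvE u v : dotv u v = u 0 0 * v 0 0 + u 1 0 * v 1 0 + u 2 0 * v 2 0.
Proof. exact: sum3. Qed.

Lemma dotvC u v : dotv u v = dotv v u.
Proof. by rewrite !dotvE; ring. Qed.
Lemma dotvDr u v w : dotv u (v + w) = dotv u v + dotv u w.
Proof. by rewrite !dotvE !mxE; ring. Qed.
Lemma dotvZr a u v : dotv u (a *: v) = a * dotv u v.
Proof. by rewrite !dotvE !mxE; ring. Qed.
Lemma dotvDl u v w : dotv (u + v) w = dotv u w + dotv v w.
Proof. by rewrite !dotvE !mxE; ring. Qed.
Lemma dotvZl a u v : dotv (a *: u) v = a * dotv u v.
Proof. by rewrite !dotvE !mxE; ring. Qed.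
Lemma dotv_ge0 u : 0 <= dotv u u.
Proof. by rewrite dotvE; nra. Qed.
Lemma dotv_eq0 u : dotv u u = 0 -> u = 0.
Proof.
rewrite dotvE => h; have [h0 h1 h2] : [/\ u 0 0 = 0, u 1 0 = 0 & u 2 0 = 0].
  by split; nra.
apply/matrixP => i j; rewrite !ord1 mxE.
by case: i => [[|[|[|//]]] hi]; [rewrite -h0|rewrite -h1|rewrite -h2]; congr (u _ _); exact: val_inj.
Qed.

Lemma dotv_CS u v : dotv u v ^+ 2 <= dotv u u * dotv v v.
Proof.
rewrite !dotvE; move: (u 0 0) (u 1 0) (u 2 0) (v 0 0) (v 1 0) (v 2 0) => a b c x y z.
rewrite -subr_ge0 (_ : _ - _ = (a * y - b * x) ^+ 2 + (a * z - c * x) ^+ 2 + (b * z - c * y) ^+ 2); last by ring.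
by rewrite !addr_ge0 ?sqr_ge0.
Qed.

Lemma mulmx_bound A : exists2 N, 0 < N & forall v, dotv (A *m v) (A *m v) <= N * dotv v v.
Proof.
pose N := 1 + \sum_i dotv (row i A)^T (row i A)^T.
have s0 : 0 <= \sum_i dotv (row i A)^T (row i A)^T by apply: sumr_ge0 => i _; exact: dotv_ge0.
exists N; first by rewrite /N; lra.
move=> v; have h i : (A *m v) i 0 * (A *m v) i 0 <= dotv (row i A)^T (row i A)^T * dotv v v.
  have -> : (A *m v) i 0 = dotv (row i A)^T v.
    by rewrite /dotv mxE; apply: eq_bigr => j _; rewrite !mxE.
  by rewrite -expr2; exact: dotv_CS.
apply: le_trans (ler_sum _ (fun i _ => h i)) _.
by rewrite -mulr_suml ler_wpM2r ?dotv_ge0// /N; lra.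
Qed.

Lemma bform_bound A : exists2 M, 0 < M & forall v, `|bform A v v| <= M * dotv v v.
Proof.
have [N N0 hN] := mulmx_bound A; exists (1 + N); first by lra.
move=> v; have := hN v; rewrite bformE; have := dotv_CS v (A *m v).
have := dotv_ge0 v; have := dotv_ge0 (A *m v).
move: (dotv v v) (dotv _ (A *m v)) (dotv v _) => a b c b0 a0 cab bN.
by rewrite ler_norml; apply/andP; split; nra.
Qed.

(** Positivity at [v - M^-1 A v] gives [|A v|^2 <= M (A v . v)], and invertibility bounds [|v|] by a
    multiple of [|A v|]. *)
Lemma psd_unit_coercive A : A^T = A -> (forall v, 0 <= bform A v v) -> A \in unitmx ->
  exists2 c, 0 < c & forall v, c * dotv v v <= bform A v v.
Proof.
move=> As Apsd uA; have [M M0 hM] := bform_bound A; have [N N0 hN] := mulmx_bound (invmx A).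
exists (M * N)^-1; first by rewrite invr_gt0 mulr_gt0.
move=> v; set w := A *m v.
have vw : dotv v v <= N * dotv w w by have := hN w; rewrite /w mulKmx.
have h := Apsd (v + (- M^-1) *: w).
have Ew : bform A v w = dotv w w by rewrite bformC// bformE.
rewrite bformDl !bformDr !bformZl !bformZr Ew [bform A w v]bformE -/w in h.
have hw : bform A w w <= M * dotv w w by apply: le_trans (ler_norm _) (hM w).
have MM : M^-1 * M = 1 by rewrite mulVf// gt_eqF.
rewrite mulrC ler_pdivrMr ?mulr_gt0//; apply: le_trans vw _.
have M10 : 0 < M^-1 by rewrite invr_gt0.
have : M^-1 * (M^-1 * bform A w w) <= M^-1 * dotv w w.
  by rewrite ler_pM2l// mulrC ler_pdivrMr// mulrC.
move: h (dotv_ge0 w); move: (bform A v v) (bform A w w) (dotv w w) (M^-1) MM M10 => a b c k kM k0.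
move=> h c0 kb; have hc : k * c <= a by nra.
have : M * (k * c) <= M * a by rewrite ler_pM2l.
by rewrite mulrA [M * k]mulrC kM mul1r => ?; nra.
Qed.

(** [m] is the largest lower bound of the Rayleigh quotient. If [s - m] were invertible it would be
    coercive, and [m] could be raised. *)
Lemma min_eigenvalue s : s^T = s -> exists2 m, eigenvalue s m & forall v, m * dotv v v <= bform s v v.
Proof.
move=> ss; have [M M0 hM] := bform_bound s.
pose E := [set a | forall v, a * dotv v v <= bform s v v].
have E0 : E !=set0.
  by exists (- M) => v; have := hM v; rewrite ler_norml mulNr => /andP[].
pose e := delta_mx 0 0 : 'cV[R]_3.
have ee : dotv e e = 1.
  by rewrite dotvE !mxE /=; ring.
have Eub : has_ubound E by exists (bform s e e) => a /(_ e); rewrite ee mulr1.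
pose m := sup E.
have Em v : m * dotv v v <= bform s v v.
  have [v0|v0] := eqVneq (dotv v v) 0.
    by have [a Ea] := E0; have := Ea v; rewrite v0 !mulr0.
  have {}v0 : 0 < dotv v v by rewrite lt_def v0 dotv_ge0.
  rewrite -ler_pdivlMr//; apply: ge_sup => // a Ea.
  by rewrite ler_pdivlMr//; exact: Ea.
exists m => //; rewrite /eigenvalue; apply/negP => /eqP k0.
have uB : s - m%:M \in unitmx.
  by rewrite -row_free_unit -kermx_eq0; apply/eqP.
have Bs : (s - m%:M)^T = s - m%:M by rewrite linearB /= ss tr_scalar_mx.
have BE v : bform (s - m%:M) v v = bform s v v - m * dotv v v.
  rewrite !bformE mulmxBl mul_scalar_mx.
  by rewrite dotvDr -scaleNr dotvZr mulNr.
have Bpsd v : 0 <= bform (s - m%:M) v v by rewrite BE subr_ge0.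
have [c c0 hc] := psd_unit_coercive Bs Bpsd uB.
have : E (m + c) by move=> v; have := hc v; rewrite BE; lra.
by move=> /(ub_le_sup Eub); rewrite -/m; lra.
Qed.

Lemma eigenvalue_form s a : eigenvalue s a -> exists2 v, 0 < dotv v v & bform s v v = a * dotv v v.
Proof.
move=> /eigenvalueP[r rs r0]; exists r^T.
  rewrite lt_neqAle dotv_ge0 andbT; apply: contra_neq r0 => /esym/dotv_eq0 h.
  by rewrite -[r]trmxK h trmx0.
rewrite /bform trmxK rs -scalemxAl mxE; congr (_ * _).
by rewrite mxE; apply: eq_bigr => i _; rewrite !mxE.
Qed.

(** The extreme Rayleigh quotients, obtained from [s] and [- s], are eigenvalues, and every
    eigenvalue is a Rayleigh quotient; so they are the infimum and the supremum of the spectrum. *)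
Lemma eig_bounds s : s^T = s -> forall v,
  eig_min s * dotv v v <= bform s v v <= eig_max s * dotv v v.
Proof.
move=> ss v; have [m em hm] := min_eigenvalue ss.
have [m' em' hm'] := min_eigenvalue (s := - s) (etrans (linearN _ _) (congr1 -%R ss)).
have bN w : bform (- s) w w = - bform s w w.
  by rewrite !bformE mulNmx -scaleN1r dotvZr mulN1r.
have eM : eigenvalue s (- m').
  move: em' => /eigenvalueP[r rs r0]; apply/eigenvalueP; exists r => //.
  by rewrite -[s]opprK mulmxN rs scaleNr.
have bd a : eigenvalue s a -> m <= a <= - m'.
  move=> /eigenvalue_form[w w0 hw]; have := hm w; have := hm' w; rewrite bN hw -mulNr.
  by rewrite !ler_pM2r// => h1 h2; apply/andP; split => //; rewrite lerNr.
have -> : eig_min s = m.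
  apply/eqP; rewrite eq_le; apply/andP; split.
    by apply: ge_inf => //; exists m => a /bd/andP[].
  by apply: lb_le_inf; [exists m|move=> a /bd/andP[]].
have -> : eig_max s = - m'.
  apply/eqP; rewrite eq_le; apply/andP; split.
    by apply: ge_sup; [exists m|move=> a /bd/andP[]].
  by apply: ub_le_sup => //; exists (- m') => a /bd/andP[].
by have := hm v; have := hm' v; rewrite bN => h1 -> /=; lra.
Qed.

Lemma eig_max_gt0 s : sym_posdef s -> 0 < eig_max s.
Proof.
move=> [ss sp]; pose e := delta_mx 0 0 : 'cV[R]_3.
have ee : dotv e e = 1 by rewrite dotvE !mxE /=; ring.
have e0 : e != 0 by apply: contra_eq_neq ee => ->; rewrite dotvE !mxE mul0r !addr0 eq_sym oner_eq0.
have /andP[_] := eig_bounds ss e; rewrite ee mulr1; apply: lt_le_trans.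
exact: sp.
Qed.

End RayleighQuotient.

(** * The sector that contains the radially scaled form *)

Section RotatedForm.
Variable R : realType.
Local Notation Re := complex.Re.
Local Notation Im := complex.Im.
Implicit Types (s : 'M[R]_3) (a b n : 'cV[R]_3) (v w y : 'cV[R[i]]_3).

(** For a unit vector [n], the reflection that fixes [n] and reverses its orthogonal complement. *)
Definition refl n b : 'cV[R]_3 := (2 * dotv n b) *: n - b.

Lemma dotvBr a b n : dotv a (b - n) = dotv a b - dotv a n.
Proof. by rewrite !dotvE !mxE; ring. Qed.
Lemma dotvBl a b n : dotv (b - n) a = dotv b a - dotv n a.
Proof. by rewrite !dotvE !mxE; ring. Qed.

Lemma refl_dot n a b : dotv n n = 1 -> dotv (refl n a) (refl n b) = dotv a b.
Proof.
move=> n1; rewrite /refl !(dotvBr, dotvBl, dotvZl, dotvZr) n1 (dotvC a n); ring.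
Qed.

Lemma refl_sym n a b : dotv a (refl n b) = dotv (refl n a) b.
Proof. by rewrite /refl !(dotvBr, dotvBl, dotvZl, dotvZr) (dotvC a n); ring. Qed.

Section Estimate.
Variables (s : 'M[R]_3) (lo hi : R).
Hypothesis ss : s^T = s.
Hypothesis s_bounds : forall a, lo * dotv a a <= bform s a a <= hi * dotv a a.
Variables (n a b : 'cV[R]_3) (c t : R).
Hypotheses (n1 : dotv n n = 1) (ct : c ^+ 2 + t ^+ 2 = 1).
(** [p + i r] is the image of [a + i b] under [c + i t S], with [S] the reflection [refl n]. This
    matrix is unitary because [S] is symmetric with square 1 and [c^2 + t^2 = 1]. *)
Let p := c *: a + (- t) *: refl n b.
Let r := c *: b + t *: refl n a.
Let N := dotv a a + dotv b b.

Lemma bform_polar (u v : 'cV[R]_3) : bform s u v = 2^-1 * (bform s u u + bform s v v - bform s (u - v) (u - v)).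
Proof.
rewrite !(bformDr, bformDl, bformNl, bformNr) (bformC v u ss).
by field.
Qed.

(** Polarization: [|a|^2 + |b|^2] and [|p|^2 + |r|^2] both equal [N] and contribute [lo], while
    [|a - p|^2 + |b - r|^2 = 2 (1 - c) N] costs [(1 - c) hi]. *)
Lemma rotated_re : (lo - (1 - c) * hi) * N <= bform s a p + bform s b r.
Proof.
have [pN dN] : dotv p p + dotv r r = N /\
    dotv (a - p) (a - p) + dotv (b - r) (b - r) = 2 * (1 - c) * N.
  have F1 := refl_dot a a n1; have F2 := refl_dot b b n1; have F3 := refl_sym n a b.
  rewrite /p /r /N; move: (refl n a) (refl n b) F1 F2 F3 => a' b' F1 F2 F3.
  have pN : dotv (c *: a + (- t) *: b') (c *: a + (- t) *: b') +
      dotv (c *: b + t *: a') (c *: b + t *: a') = dotv a a + dotv b b.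
    rewrite !(dotvDr, dotvDl, dotvZl, dotvZr) (dotvC b' a) (dotvC b a') F1 F2 F3.
    rewrite [LHS](_ : _ = (c ^+ 2 + t ^+ 2) * (dotv a a + dotv b b)); last by ring.
    by rewrite ct mul1r.
  split; first exact: pN.
  have E (P Q : 'cV[R]_3) : dotv (a - P) (a - P) + dotv (b - Q) (b - Q) =
      (dotv a a + dotv b b) + (dotv P P + dotv Q Q) - 2 * (dotv a P + dotv b Q).
    by rewrite !(dotvBr, dotvBl) (dotvC P a) (dotvC Q b); ring.
  rewrite E pN !(dotvDr, dotvZr) F3 (dotvC b a'); ring.
rewrite (bform_polar a p) (bform_polar b r).
have /andP[a1 _] := s_bounds a; have /andP[b1 _] := s_bounds b.
have /andP[p1 _] := s_bounds p; have /andP[r1 _] := s_bounds r.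
have /andP[_ e1] := s_bounds (a - p); have /andP[_ e2] := s_bounds (b - r).
have : lo * dotv p p + lo * dotv r r = lo * N by rewrite -mulrDr pN.
have : hi * dotv (a - p) (a - p) + hi * dotv (b - r) (b - r) = 2 * (1 - c) * (hi * N).
  by rewrite -mulrDr dN; ring.
have : lo * dotv a a + lo * dotv b b = lo * N by rewrite -mulrDr.
have -> : (lo - (1 - c) * hi) * N = lo * N - (1 - c) * (hi * N) by ring.
move: a1 b1 p1 r1 e1 e2; move: (lo * _) (lo * _) (lo * _) (lo * _) (lo * N) (hi * _) (hi * _) (hi * N).
move: (bform _ _ _) (bform _ _ _) (bform _ _ _) (bform _ _ _) (bform _ _ _) (bform _ _ _).
by intros; lra.
Qed.

(** The terms in [c] cancel by symmetry. What remains is [t] times [bform s u (refl n u)] at [a] and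
    at [b], bounded by polarization and positivity since the reflection preserves lengths. *)
Lemma rotated_im : (forall u, 0 <= bform s u u) -> `|bform s a r - bform s b p| <= hi * `|t| * N.
Proof.
move=> psd; have -> : bform s a r - bform s b p = t * (bform s a (refl n a) + bform s b (refl n b)).
  rewrite /p /r; move: (refl n a) (refl n b) => a' b'.
  by rewrite !(bformDr, bformZr) (bformC a b ss); ring.
have half u : `|bform s u (refl n u)| <= hi * dotv u u.
  have /andP[_ u1] := s_bounds u; have /andP[_ u2] := s_bounds (refl n u).
  rewrite refl_dot// in u2.
  have h1 := bform_polar u (refl n u); have h2 := bform_polar u (- refl n u).
  have e1 : bform s u (- refl n u) = - bform s u (refl n u) by rewrite bformNr.
  have e2 : bform s (- refl n u) (- refl n u) = bform s (refl n u) (refl n u).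
    by rewrite bformNr bformNl opprK.
  have d1 := psd (u - refl n u); have d2 := psd (u - - refl n u).
  by rewrite e1 e2 in h2; rewrite ler_norml; apply/andP; split; lra.
rewrite normrM [hi * _]mulrC -mulrA ler_wpM2l// (le_trans (ler_normD _ _))//.
by rewrite /N mulrDr lerD.
Qed.

End Estimate.

Definition re_vec v : 'cV[R]_3 := \col_i Re (v i 0).
Definition im_vec v : 'cV[R]_3 := \col_i Im (v i 0).
Definition hdot v w : R[i] := \sum_i v i 0 * (w i 0)^*.
Definition hsqr v : R := dotv (re_vec v) (re_vec v) + dotv (im_vec v) (im_vec v).

Lemma sum3C (f : 'I_3 -> R[i]) : \sum_i f i = f 0 + f 1 + f 2.
Proof.
rewrite !big_ord_recl big_ord0 addr0 addrA; congr (_ + f _ + f _); exact: val_inj.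
Qed.

Lemma hsqrE v : hsqr v = \sum_i absC (v i 0) ^+ 2.
Proof.
by rewrite /hsqr -big_split /=; apply: eq_bigr => i _; rewrite !mxE absC_sqr -!expr2.
Qed.

Lemma hsqr_ge0 v : 0 <= hsqr v.
Proof. by rewrite addr_ge0// dotv_ge0. Qed.

Lemma hdot_real s w y : hdot (map_mx (real_complex R) s *m w) y =
  (bform s (re_vec y) (re_vec w) + bform s (im_vec y) (im_vec w)) +i*
  (bform s (re_vec y) (im_vec w) - bform s (im_vec y) (re_vec w)).
Proof.
have E i : (map_mx (real_complex R) s *m w) i 0 =
    ((s *m re_vec w) i 0) +i* ((s *m im_vec w) i 0).
  rewrite !mxE; apply: complex_eq; rewrite ?Re_sum ?Im_sum /=; apply: eq_bigr => j _.
    by rewrite !mxE ReM ReC ImC mul0r subr0.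
  by rewrite !mxE ImM ReC ImC mul0r addr0.
rewrite !bformE /hdot sum3C !E !dotvE !mxE.
by apply: complex_eq; rewrite !(ReD, ImD, ReM, ImM, ReJ, ImJ) /=; ring.
Qed.

(* The tensor [F M F^T / (d~ d)] of the spherical frame: it scales the radial
   direction [n] by [q] and fixes its orthogonal complement. *)
Definition radial_mx (n : 'cV[R]_3) (q : R[i]) : 'M[R[i]]_3 :=
  \matrix_(i, j) ((i == j)%:R + (q - 1) * (n i 0 * n j 0)%:C).

Section Pointwise.
Variables (n : 'cV[R]_3) (q : R[i]) (kappa c t : R).
Hypotheses (n1 : dotv n n = 1) (ct : c ^+ 2 + t ^+ 2 = 1).
Hypothesis qE : q = kappa%:C * (c +i* t).
Variable v : 'cV[R[i]]_3.
Let sg : R[i] := \sum_i (n i 0)%:C * v i 0.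
(** The adjoint of [radial_mx n q] applied to [v]. *)
Let y : 'cV[R[i]]_3 := v + ((q^* - 1) * sg) *: map_mx (real_complex R) n.

Lemma radial_mxE (w : 'cV[R[i]]_3) i : (radial_mx n q *m w) i 0 =
  w i 0 + (q - 1) * (\sum_j (n j 0)%:C * w j 0) * (n i 0)%:C.
Proof.
rewrite mxE [LHS](eq_bigr (fun j => (i == j)%:R * w j 0 +
    (q - 1) * (n i 0)%:C * ((n j 0)%:C * w j 0))).
  rewrite big_split /= -mulr_sumr; congr (_ + _); last by ring.
  by rewrite (bigD1 i)//= eqxx mul1r big1 ?addr0// => j ji; rewrite eq_sym (negbTE ji) mul0r.
by move=> j _; rewrite mxE rmorphM /=; ring.
Qed.

Lemma hdot_radial (w : 'cV[R[i]]_3) : hdot (radial_mx n q *m w) v = hdot w y.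
Proof.
rewrite /hdot [LHS](eq_bigr (fun i => w i 0 * (v i 0)^* +
    (q - 1) * (\sum_j (n j 0)%:C * w j 0) * ((n i 0)%:C * (v i 0)^*))); last first.
  by move=> i _; rewrite radial_mxE; ring.
rewrite [RHS](eq_bigr (fun i => w i 0 * (v i 0)^* +
    (q - 1) * sg^* * ((n i 0)%:C * w i 0))); last first.
  move=> i _; rewrite !mxE conjcD !conjcM conjC_real conjcD conjcN conjCi_K.
  by rewrite (_ : 1^* = 1) ?rmorph1//; ring.
rewrite !big_split /= -!mulr_sumr /sg; congr (_ + _).
have -> : (\sum_i (n i 0)%:C * v i 0)^* = \sum_i (n i 0)%:C * (v i 0)^*.
  by rewrite !sum3C !conjcD !conjcM !conjC_real.
ring.
Qed.

Lemma radial_sum : \sum_i (n i 0)%:C * y i 0 = q^* * sg.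
Proof.
rewrite (eq_bigr (fun i => (n i 0)%:C * v i 0 + (q^* - 1) * sg * (n i 0 * n i 0)%:C)).
  rewrite big_split /= -mulr_sumr -rmorph_sum /= -/(dotv n n) n1 -/sg.
  by rewrite (_ : 1%:C = 1)//; ring.
by move=> i _; rewrite !mxE rmorphM /=; ring.
Qed.

Lemma hsqr_radial : hsqr y = hsqr v + (absC q ^+ 2 - 1) * absC sg ^+ 2.
Proof.
pose K : R[i] := (q^* - 1) * sg.
have rE : re_vec y = re_vec v + Re K *: n.
  by apply/matrixP => i j; rewrite (ord1 j) !mxE ReD [Re (_ * _%:C)]ReM ReC ImC mulr0 subr0.
have iE : im_vec y = im_vec v + Im K *: n.
  by apply/matrixP => i j; rewrite (ord1 j) !mxE ImD [Im (_ * _%:C)]ImM ReC ImC mulr0 add0r.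
have nr : dotv n (re_vec v) = Re sg.
  by rewrite Re_sum; apply: eq_bigr => i _; rewrite ReM ReC ImC mul0r subr0 mxE.
have ni : dotv n (im_vec v) = Im sg.
  by rewrite Im_sum; apply: eq_bigr => i _; rewrite ImM ReC ImC mul0r addr0 mxE.
rewrite /hsqr rE iE !(dotvDr, dotvDl, dotvZl, dotvZr) n1 (dotvC _ n) nr (dotvC _ n) ni.
rewrite !absC_sqr /K; move: sg => z.
by rewrite !(ReD, ImD, ReM, ImM, ReJ, ImJ, ReN, ImN, Re1, Im1); ring.
Qed.

Let a := re_vec y.
Let b := im_vec y.
Let p := c *: a + (- t) *: refl n b.
Let r := c *: b + t *: refl n a.

Lemma rot_identity (V z : R[i]) (m : R) : let Y := V + (q^* - 1) * z * m%:C in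
  V + (q - 1) * z * m%:C = (c +i* t) *
    ((c * Re Y + (- t) * (2 * Im (q^* * z) * m - Im Y)) +i*
     (c * Im Y + t * (2 * Re (q^* * z) * m - Re Y))).
Proof.
have ReI (x1 x2 : R) : Re (x1 +i* x2) = x1 by [].
have ImI (x1 x2 : R) : Im (x1 +i* x2) = x2 by [].
move=> Y; rewrite /Y qE; case: z {Y} => s1 s2; case: V => v1 v2.
by apply: complex_eq;
  rewrite !(ReI, ImI, ReD, ImD, ReM, ImM, ReJ, ImJ, ReN, ImN, ReC, ImC, Re1, Im1);
  (* The identity holds modulo [c^2 + t^2 = 1]; multiplying the left side by this 1 makes it an
     identity of polynomials. *)
  rewrite -[LHS]mul1r -[X in X * _ = _]ct; ring.
Qed.

(** Along [n] the matrix and its adjoint scale by [q] and its conjugate, whose ratio is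
    [(c + i t)^2]; orthogonally to [n] both are the identity. So the matrix is its adjoint followed
    by [(c + i t) (c + i t S)], where [S] is 1 along [n] and -1 orthogonally to it. *)
Lemma radial_mx_rot i : (radial_mx n q *m v) i 0 = (c +i* t) * (p i 0 +i* r i 0).
Proof.
rewrite radial_mxE -/sg.
have na : dotv n a = Re (q^* * sg).
  rewrite -radial_sum Re_sum; apply: eq_bigr => j _; rewrite ReM ReC ImC mul0r subr0.
  by rewrite /a mxE.
have nb : dotv n b = Im (q^* * sg).
  rewrite -radial_sum Im_sum; apply: eq_bigr => j _; rewrite ImM ReC ImC mul0r addr0.
  by rewrite /b mxE.
rewrite /p /r /refl na nb !mxE.
exact: rot_identity.
Qed.

Lemma sg_le : absC sg ^+ 2 <= hsqr v.
Proof.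
have nr : dotv n (re_vec v) = Re sg.
  by rewrite Re_sum; apply: eq_bigr => i _; rewrite ReM ReC ImC mul0r subr0 mxE.
have ni : dotv n (im_vec v) = Im sg.
  by rewrite Im_sum; apply: eq_bigr => i _; rewrite ImM ReC ImC mul0r addr0 mxE.
rewrite absC_sqr -nr -ni /hsqr; apply: lerD.
  by rewrite -[leRHS]mul1r -n1; exact: dotv_CS.
by rewrite -[leRHS]mul1r -n1; exact: dotv_CS.
Qed.

(** The radial part of [v] is scaled by [|q|], the tangential part is unchanged. *)
Lemma hsqr_radial_ge (e : R) : 0 <= e <= 1 -> e <= absC q ^+ 2 -> e * hsqr v <= hsqr y.
Proof.
move=> /andP[e0 e1] eq; rewrite hsqr_radial.
by have := sg_le; have := sqr_ge0 (absC sg); have := hsqr_ge0 v; nra.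
Qed.

(** The outer factor moves to the right as its adjoint and produces [y]; the inner one is expressed
    through [y] by [radial_mx_rot], which brings out the phase and leaves the rotated form. *)
Lemma pointwise_form (s : 'M[R]_3) (lo hi : R) : s^T = s ->
  (forall u, lo * dotv u u <= bform s u u <= hi * dotv u u) -> (forall u, 0 <= bform s u u) ->
  exists Z1 Z2 : R, [/\
    hdot (radial_mx n q *m (map_mx (real_complex R) s *m (radial_mx n q *m v))) v =
      (c +i* t) * (Z1 +i* Z2),
    (lo - (1 - c) * hi) * hsqr y <= Z1 & `|Z2| <= hi * `|t| * hsqr y].
Proof.
move=> ss sb psd.
exists (bform s a p + bform s b r), (bform s a r - bform s b p); split; last 2 first.
- exact: (rotated_re ss sb a b n1 ct).
- exact: (rotated_im ss sb a b c t n1 psd).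
pose w : 'cV[R[i]]_3 := \col_i (p i 0 +i* r i 0).
have -> : radial_mx n q *m v = (c +i* t) *: w.
  by apply/matrixP => i j; rewrite (ord1 j) radial_mx_rot [RHS]mxE [w i 0]mxE.
rewrite hdot_radial -scalemxAr.
have -> : hdot ((c +i* t) *: (map_mx (real_complex R) s *m w)) y =
    (c +i* t) * hdot (map_mx (real_complex R) s *m w) y.
  by rewrite /hdot mulr_sumr; apply: eq_bigr => i _; rewrite mxE mulrA.
rewrite hdot_real; have -> : re_vec w = p by apply/matrixP => i j; rewrite (ord1 j) !mxE.
by have -> : im_vec w = r by apply/matrixP => i j; rewrite (ord1 j) !mxE.
Qed.

End Pointwise.

End RotatedForm.

(** * The scaling functions *)

Section VanishingProfile.
Variable R : realType.
Implicit Types (f g : R -> R).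

Definition C1fun g := exists2 g1 : R -> R, forall x : R, is_derive x 1 g (g1 x) & continuous g1.

Lemma is_derive_add f g (x a b : R) : is_derive x 1 f a -> is_derive x 1 g b ->
  is_derive x 1 (fun y => f y + g y) (a + b).
Proof. by move=> df dg; apply: is_deriveD. Qed.

Lemma is_derive_mul f g (x a b : R) : is_derive x 1 f a -> is_derive x 1 g b ->
  is_derive x 1 (fun y => f y * g y) (f x * b + g x * a).
Proof. by move=> df dg; apply: is_deriveM. Qed.

Lemma is_derive_cont (f : R -> R) (x df : R) : is_derive x 1 f df -> {for x, continuous f}.
Proof. by move=> [h _]; exact/differentiable_continuous/derivable1_diffP. Qed.

Lemma C1_cont g : C1fun g -> continuous g.
Proof. by move=> [g1 dg _] x; exact: is_derive_cont (dg x). Qed.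

Lemma C1_cst c : C1fun (fun=> c).
Proof. by exists (fun=> 0) => [x|x]; [exact: is_derive_cst|exact: cvg_cst]. Qed.

Lemma C1_id : C1fun id.
Proof. by exists (fun=> 1) => [x|x]; [exact: is_derive_id|exact: cvg_cst]. Qed.

Lemma C1D f g : C1fun f -> C1fun g -> C1fun (fun x => f x + g x).
Proof.
move=> [f1 df cf] [g1 dg cg]; exists (fun x => f1 x + g1 x) => [x|x].
  exact: is_derive_add (df x) (dg x).
by apply: cvgD; [exact: cf|exact: cg].
Qed.

Lemma C1M f g : C1fun f -> C1fun g -> C1fun (fun x => f x * g x).
Proof.
move=> C1f C1g; have cf0 := C1_cont C1f; have cg0 := C1_cont C1g.
move: C1f C1g => [f1 df cf] [g1 dg cg]; exists (fun x => f x * g1 x + g x * f1 x) => [x|x].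
  exact: is_derive_mul (df x) (dg x).
by apply: cvgD; apply: cvgM; [exact: cf0|exact: cg|exact: cg0|exact: cf].
Qed.

Lemma C1_invsqrt g : C1fun g -> (forall x, 0 < g x) -> C1fun (fun x => (Num.sqrt (g x))^-1).
Proof.
move=> C1g g0; have cg0 := C1_cont C1g; move: C1g => [g1 dg cg].
have s0 x : Num.sqrt (g x) != 0 by rewrite gt_eqF// sqrtr_gt0.
have cs : continuous (fun x => Num.sqrt (g x)).
  by move=> x; apply: continuous_comp; [exact: cg0|exact: sqrt_continuous].
exists (fun x => - (Num.sqrt (g x))^-1 ^+ 2 * ((2 * Num.sqrt (g x))^-1 * g1 x)) => [x|x].
  have ds := is_derive1_comp (is_derive1_sqrt (g0 x)) (dg x).
  have dv := @is_deriveV R (fun y => Num.sqrt (g y)) x _ 1 (s0 x) ds.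
  by apply: is_derive_eq dv _; rewrite exprVn.
have ci : {for x, continuous (fun y => (Num.sqrt (g y))^-1)} by apply: cvgV; [exact: s0|exact: cs].
apply: cvgM; first by apply: cvgN; apply: cvgM; exact: ci.
apply: cvgM; last exact: cg.
apply: cvgV; first by rewrite mulf_neq0.
by apply: cvgM; [exact: cvg_cst|exact: cs].
Qed.

Lemma cont_segment_bounded f (a b : R) : (forall x, a <= x <= b -> {for x, continuous f}) ->
  exists K : R, forall x, a <= x <= b -> `|f x| <= K.
Proof.
move=> cf; have /compact_bounded : compact (f @` `[a, b]%classic).
  apply: continuous_compact; last exact: segment_compact.
  by apply: continuous_in_subspaceT => x; rewrite inE/= in_itv/=; exact: cf.
move=> [M [_ hM]]; exists (M + 1) => x ab; apply: (hM (M + 1)); first by rewrite ltrDl.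
by exists x => //=; rewrite in_itv.
Qed.

(** The decay of the derivative makes the term with the gradient of the multiplier small outside a
    large ball. *)
Definition vprofile (r1 : R) f := exists f1 C M,
  radial_profile r1 f f1 C M /\ f1 r @[r --> +oo] --> (0 : R).

Variable r1 : R.

Lemma vp_cst c : vprofile r1 (fun=> c).
Proof.
exists (fun=> 0), `|c|, 0; split; last exact: cvg_cst.
by split => // [x|r _|r _|r]; [exact: cvg_cst|exact: is_derive_cst|exact: cvg_cst|rewrite normr0].
Qed.

Lemma vpD f g : vprofile r1 f -> vprofile r1 g -> vprofile r1 (fun x => f x + g x).
Proof.
move=> [f1 [C [M [pf f0]]]] [g1 [C' [M' [pg g0]]]].
exists (fun r => f1 r + g1 r), (C + C'), (M + M'); split; last first.
  by rewrite -[X in _ --> X](addr0 0); exact: cvgD.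
split => [r rr|x|r rr|r rr|r|r].
- by rewrite (rp_cst pf rr).1 (rp_cst pf rr).2 (rp_cst pg rr).1 (rp_cst pg rr).2 addr0.
- by apply: cvgD; [exact: (@rp_cont _ _ _ _ _ _ pf _)|exact: (@rp_cont _ _ _ _ _ _ pg _)].
- exact: is_derive_add (rp_der pf rr) (rp_der pg rr).
- by apply: cvgD; [exact: (@rp_cont1 _ _ _ _ _ _ pf _ rr)|exact: (@rp_cont1 _ _ _ _ _ _ pg _ rr)].
- by apply: le_trans (ler_normD _ _) _; apply: lerD; [exact: (rp_le pf r)|exact: (rp_le pg r)].
- by apply: le_trans (ler_normD _ _) _; apply: lerD; [exact: (rp_le1 pf r)|exact: (rp_le1 pg r)].
Qed.

Lemma cvg0_bounded_mul (u w : R -> R) (K : R) : (forall r, `|u r| <= K) ->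
  w r @[r --> +oo] --> (0 : R) -> u r * w r @[r --> +oo] --> (0 : R).
Proof.
move=> uK /cvgrPdist_le cw; apply/cvgrPdist_le => e e0.
have K1 : 0 < 1 + `|K| by rewrite ltr_pwDl.
have := cw _ (divr_gt0 e0 K1); apply: filterS => r; rewrite !sub0r !normrN normrM => wr.
apply: le_trans (_ : _ <= (1 + `|K|) * (e / (1 + `|K|))) _; last by rewrite mulrC divfK// gt_eqF.
apply: ler_pM => //; apply: le_trans (uK r) _.
by apply: le_trans (ler_norm K) _; rewrite lerDr.
Qed.

Lemma vpM f g : vprofile r1 f -> vprofile r1 g -> vprofile r1 (fun x => f x * g x).
Proof.
move=> [f1 [C [M [pf f0]]]] [g1 [C' [M' [pg g0]]]].
exists (fun r => f r * g1 r + g r * f1 r), (C * C'), (C * M' + C' * M); split; last first.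
  rewrite -[X in _ --> X](addr0 0); apply: cvgD.
    exact: cvg0_bounded_mul (rp_le pf) g0.
  exact: cvg0_bounded_mul (rp_le pg) f0.
split => [r rr|x|r rr|r rr|r|r].
- rewrite (rp_cst pf rr).1 (rp_cst pf rr).2 (rp_cst pg rr).1 (rp_cst pg rr).2.
  by rewrite !mulr0 addr0.
- by apply: cvgM; [exact: (@rp_cont _ _ _ _ _ _ pf _)|exact: (@rp_cont _ _ _ _ _ _ pg _)].
- exact: is_derive_mul (rp_der pf rr) (rp_der pg rr).
- apply: cvgD; apply: cvgM; [exact: (@rp_cont _ _ _ _ _ _ pf _)|exact: (@rp_cont1 _ _ _ _ _ _ pg _ rr)|
    exact: (@rp_cont _ _ _ _ _ _ pg _)|exact: (@rp_cont1 _ _ _ _ _ _ pf _ rr)].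
- by rewrite normrM; apply: ler_pM => //; [exact: (rp_le pf r)|exact: (rp_le pg r)].
- apply: le_trans (ler_normD _ _) _; rewrite !normrM.
  by apply: lerD; apply: ler_pM => //; [exact: (rp_le pf r)|exact: (rp_le1 pg r)|
    exact: (rp_le pg r)|exact: (rp_le1 pf r)].
Qed.

Lemma vpN f : vprofile r1 f -> vprofile r1 (fun x => - f x).
Proof. by move=> /(vpM (vp_cst (-1))); under eq_fun do rewrite mulN1r. Qed.

Lemma vpB f g : vprofile r1 f -> vprofile r1 g -> vprofile r1 (fun x => f x - g x).
Proof. by move=> vf /vpN; exact: vpD. Qed.

Lemma vp_comp g f : C1fun g -> vprofile r1 f -> vprofile r1 (g \o f).
Proof.
move=> C1g [f1 [C [M [pf f0]]]]; have cg0 := C1_cont C1g; move: C1g => [g1 dg cg].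
have [K hK] := @cont_segment_bounded g (- C) C (fun x _ => cg0 x).
have [K1 hK1] := @cont_segment_bounded g1 (- C) C (fun x _ => cg x).
have fC r : - C <= f r <= C by rewrite -ler_norml; exact: (rp_le pf r).
exists (fun r => g1 (f r) * f1 r), K, (K1 * M); split; last first.
  by apply: (@cvg0_bounded_mul _ _ K1) => // r; exact: hK1.
split => [r rr|x|r rr|r rr|r|r].
- by rewrite /= (rp_cst pf rr).1 (rp_cst pf rr).2 mulr0.
- by apply: continuous_comp; [exact: (@rp_cont _ _ _ _ _ _ pf _)|exact: cg0].
- exact: (is_derive1_comp (dg (f r)) (rp_der pf rr)).
- apply: cvgM; last exact: (@rp_cont1 _ _ _ _ _ _ pf _ rr).
  by apply: continuous_comp; [exact: (@rp_cont _ _ _ _ _ _ pf _)|exact: cg].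
- exact: hK.
- by rewrite normrM; apply: ler_pM => //; [exact: hK1|exact: (rp_le1 pf r)].
Qed.

(** The derivative is known to decay at infinity and to have a right limit at [r1]. Its uniform
    bound joins a right neighbourhood of [r1], a compact interval and a neighbourhood of
    infinity. *)
Lemma vp_base g g1 (a a1 : R -> R) (C l : R) : (forall x : R, is_derive x 1 g (g1 x)) -> continuous g1 ->
  (forall x, `|g x| <= C) -> continuous a -> (forall r, r <= r1 -> a r = a r1) ->
  (forall r, r1 < r -> is_derive r 1 a (a1 r)) ->
  (forall r, r1 < r -> {for r, continuous a1}) -> a1 r @[r --> r1^'+] --> l ->
  g1 (a r) * a1 r @[r --> +oo] --> (0 : R) -> vprofile r1 (g \o a).
Proof.
move=> dg cg gC ca ac da ca1 al h0; pose h r := g1 (a r) * a1 r.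
have cg0 x : {for x, continuous g} by exact: is_derive_cont (dg x).
have cga r : g1 (a s) @[s --> r] --> g1 (a r) by apply: continuous_comp; [exact: ca|exact: cg].
have ch r : r1 < r -> {for r, continuous h}.
  by move=> rr; apply: cvgM; [exact: cga|exact: ca1].
have hl : h r @[r --> r1^'+] --> g1 (a r1) * l.
  by apply: cvgM => //; apply: cvg_at_right_filter; exact: cga.
have [K hK] : exists K : R, forall r, r1 < r -> `|h r| <= K.
  have [d d0 hd] : exists2 d : R, 0 < d & forall r, r1 < r -> r < r1 + d -> `|h r| <= 1 + `|g1 (a r1) * l|.
    move/cvgrPdist_le : hl => /(_ 1 ltr01)[d /= d0 hd]; exists d => // r rr rd.
    have /= := hd r; rewrite ltr0_norm ?subr_lt0// opprB => /(_ _ rr) hr.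
    have {}hr : `|g1 (a r1) * l - h r| <= 1 by apply: hr; lra.
    rewrite -[h r](subKr (g1 (a r1) * l)); apply: le_trans (ler_normB _ _) _.
    by rewrite addrC lerD2r.
  move/cvgrPdist_le : h0 => /(_ 1 ltr01)[A [_ hA]].
  have chs x : r1 + d / 2 <= x <= A + 1 -> {for x, continuous h}.
    by move=> /andP[dx _]; apply: ch; lra.
  have [K hK] := cont_segment_bounded chs.
  exists (2 + `|g1 (a r1) * l| + `|K|) => r rr.
  have n1 := normr_ge0 (g1 (a r1) * l); have n2 := normr_ge0 K; have n3 := ler_norm K.
  have [rd|rd] := ltP r (r1 + d); first by have := hd r rr rd; lra.
  have [rA|rA] := leP r (A + 1).
    have : `|h r| <= K by apply: hK; apply/andP; split => //; lra.
    lra.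
  have := hA r; rewrite sub0r normrN => /(_ _) hr.
  have : `|h r| <= 1 by apply: hr; lra.
  lra.
pose f1 r := if r1 < r then h r else 0.
have f1h r : r1 < r -> \forall s \near r, f1 s = h s.
  move=> rr; near=> s; rewrite /f1 ifT//; near: s.
  exact: lt_nbhsr.
exists f1, C, `|K|; split; last first.
  apply: cvg_trans h0; apply: near_eq_cvg; exists r1; split; first exact: num_real.
  by move=> r rr; rewrite /f1 rr.
split => [r rr|x|r rr|r rr|r|r].
- by rewrite /= (ac r rr) /f1 ltNge rr.
- by apply: continuous_comp; [exact: ca|exact: cg0].
- by rewrite /f1 rr; exact: (is_derive1_comp (dg (a r)) (da r rr)).
- have c := ch r rr; rewrite /prop_for /continuous_at (_ : f1 r = h r) ?/f1 ?rr//.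
  by apply: cvg_trans c; apply: near_eq_cvg; have := f1h r rr; apply: filterS => s; rewrite /f1 => ->.
- exact: gC.
- rewrite /f1; case: ifP => rr; last by rewrite normr0.
  by apply: le_trans (hK r rr) (ler_norm K).
Unshelve. all: by end_near.
Qed.

End VanishingProfile.

(** * Complex limits and phases *)

Section ComplexLimits.
Variable R : realType.
Local Notation Re := complex.Re.
Local Notation Im := complex.Im.

Lemma cvgC_absC (T : Type) (F : set_system T) (FF : Filter F) (f : T -> R[i]) (l : R[i]) :
  (f x @[x --> F] --> (l : R[i]^o)) <-> absC (l - f x) @[x --> F] --> (0 : R).
Proof.
have P := @cvgrPdist_le _ (R[i]^o) T F FF f l; split=> [/P cf|/cvgrPdist_le cf].
  apply/cvgrPdist_le => e e0; have eC : (0 : R[i]) < e%:C by rewrite ltcR.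
  have := cf _ eC; apply: filterS => x.
  move=> h; have : (absC (l - f x))%:C <= e%:C by rewrite -absCE.
  by rewrite lecR sub0r normrN ger0_norm ?absC_ge0.
apply/P => e; case: e => e1 e2; rewrite ltcE /= => /andP[/eqP -> e0].
have := cf _ e0; apply: filterS => x; rewrite sub0r normrN ger0_norm ?absC_ge0//.
by rewrite -lecR -absCE.
Qed.

Lemma cvgC_comp (T : Type) (F : set_system T) (FF : Filter F) (f : T -> R[i]) (l : R[i]) :
  (f x @[x --> F] --> (l : R[i]^o)) <->
  (Re (f x) @[x --> F] --> Re l /\ Im (f x) @[x --> F] --> Im l).
Proof.
split=> [/cvgC_absC/cvgrPdist_le cf|[/cvgrPdist_le cr /cvgrPdist_le ci]].
  by split; apply/cvgrPdist_le => e /cf; apply: filterS => x;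
    rewrite sub0r normrN ger0_norm ?absC_ge0//; apply: le_trans;
    [have := ReZ_absC (l - f x); rewrite ReD ReN|have := ImZ_absC (l - f x); rewrite ImD ImN].
apply/cvgC_absC/cvgrPdist_le => e e0; have e2 : 0 < e / 2 by rewrite divr_gt0.
apply: filterS2 (cr _ e2) (ci _ e2) => x hr hi.
rewrite sub0r normrN ger0_norm ?absC_ge0// (le_trans (absC_le _))// ReD ReN ImD ImN.
by rewrite (splitr e) lerD.
Qed.

Definition phase (z : R[i]) : R[i] := z / `|z|.

Lemma phase_absC z : phase z = z * ((absC z)^-1)%:C.
Proof. by rewrite /phase absCE -fmorphV. Qed.

Lemma absC_phase z : z != 0 -> absC (phase z) = 1.
Proof.
move=> z0; rewrite phase_absC absCM absCR ger0_norm ?invr_ge0 ?absC_ge0//.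
by rewrite divff// absC_eq0.
Qed.

Lemma phase_mulK z : z != 0 -> z = (absC z)%:C * phase z.
Proof.
move=> z0; rewrite phase_absC mulrCA -rmorphM /= divff ?mulr1//.
by rewrite absC_eq0.
Qed.

Lemma phase_mulJ z : z != 0 -> phase z * (phase z)^* = 1.
Proof. by move=> z0; rewrite mulJ_absC absC_phase// expr1n. Qed.

Lemma expi_arg z : z != 0 -> expi (arg z) = phase z.
Proof.
move=> z0; have [_ _ e] := argP z0; rewrite phase_absC {2}e mulrAC -rmorphM /=.
by rewrite divff ?mul1r// absC_eq0.
Qed.

Lemma phase_div z w : z != 0 -> w != 0 -> phase (z / w) = phase z * (phase w)^*.
Proof.
move=> z0 w0; rewrite !phase_absC absCM absCV invfM invrK conjcM conjC_real rmorphM /=.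
have -> : w^-1 = w^* * ((absC w)^-1 ^+ 2)%:C.
  apply: (mulfI w0); rewrite divff// mulrA mulJ_absC -rmorphM /= -exprMn divff ?expr1n//.
  by rewrite absC_eq0.
have : (absC w)^-1 ^+ 2 * absC w = (absC w)^-1.
  by rewrite expr2 -mulrA mulVf ?mulr1// absC_eq0.
move: (absC w) (absC w)^-1 (absC z)^-1 => p q r pq.
rewrite -[q%:C in RHS](congr1 (real_complex R) pq) rmorphM /=; ring.
Qed.

End ComplexLimits.

Lemma near_cst_cvg (R : realType) (F : set_system R) (FF : Filter F) (f : R -> R) (c : R) :
  (\forall x \near F, f x = c) -> f x @[x --> F] --> c.
Proof.
move=> fc; have cc : (fun=> c : R) x @[x --> F] --> c by exact: cvg_cst.
by apply: cvg_trans cc; apply: near_eq_cvg; apply: filterS fc => x ->.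
Qed.

(** * Phases of the stretching functions as profiles *)

Section PhaseProfile.
Variables (R : realType) (r1 : R) (gamma : R[i]).
Local Notation Re := complex.Re.
Local Notation Im := complex.Im.
Local Notation gr := (complex.Re gamma).
Local Notation gi := (complex.Im gamma).
Hypothesis gi_gt0 : 0 < gi.

Definition stretch_norm (s : R) : R := Num.sqrt ((1 + gr * s) ^+ 2 + (gi * s) ^+ 2).
Definition phase_re (s : R) : R := (1 + gr * s) * (stretch_norm s)^-1.
Definition phase_im (s : R) : R := gi * s * (stretch_norm s)^-1.

Lemma stretch_norm2_gt0 (s : R) : 0 < (1 + gr * s) * (1 + gr * s) + (gi * s) * (gi * s).
Proof.
rewrite -!expr2; have [->|s0] := eqVneq s 0; first by rewrite !mulr0 addr0 expr1n expr0n /= addr0.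
apply: ltr_wpDl; first exact: sqr_ge0.
by rewrite lt_def sqr_ge0 andbT sqrf_eq0 mulf_neq0// gt_eqF.
Qed.

Lemma stretch_norm_gt0 s : 0 < stretch_norm s.
Proof. by rewrite /stretch_norm !expr2 sqrtr_gt0 stretch_norm2_gt0. Qed.

Lemma stretchE s : 1 + gamma * s%:C = (1 + gr * s) +i* (gi * s).
Proof. by case: gamma => a b; simpc. Qed.

Lemma absC_stretch s : absC (1 + gamma * s%:C) = stretch_norm s.
Proof. by rewrite stretchE. Qed.

Lemma phaseE s : phase (1 + gamma * s%:C) = phase_re s +i* phase_im s.
Proof. by rewrite phase_absC absC_stretch stretchE; simpc. Qed.

Lemma stretch_neq0 s : 1 + gamma * s%:C != 0.
Proof. by rewrite -absC_eq0 absC_stretch gt_eqF ?stretch_norm_gt0. Qed.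

Lemma phase_reE s : phase_re s = Re (phase (1 + gamma * s%:C)).
Proof. by rewrite phaseE. Qed.

Lemma phase_imE s : phase_im s = Im (phase (1 + gamma * s%:C)).
Proof. by rewrite phaseE. Qed.

Lemma phase_re_le1 s : `|phase_re s| <= 1.
Proof. by rewrite -(absC_phase (stretch_neq0 s)) phase_reE; exact: ReZ_absC. Qed.

Lemma phase_im_le1 s : `|phase_im s| <= 1.
Proof. by rewrite -(absC_phase (stretch_neq0 s)) phase_imE; exact: ImZ_absC. Qed.

Lemma C1_inv_stretch_norm : C1fun (fun s => (stretch_norm s)^-1).
Proof.
have cl c : C1fun (fun s : R => c * s) by apply: C1M; [exact: C1_cst|exact: C1_id].
have cr : C1fun (fun s : R => 1 + gr * s) by apply: C1D => //; exact: C1_cst.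
have := C1_invsqrt (C1D (C1M cr cr) (C1M (cl gi) (cl gi))) stretch_norm2_gt0.
by rewrite /stretch_norm; under [X in _ -> C1fun X]eq_fun do rewrite !expr2.
Qed.

Lemma C1_phase_re : C1fun phase_re.
Proof.
apply: C1M C1_inv_stretch_norm; apply: C1D; first exact: C1_cst.
by apply: C1M; [exact: C1_cst|exact: C1_id].
Qed.

Lemma C1_phase_im : C1fun phase_im.
Proof. by apply: C1M C1_inv_stretch_norm; apply: C1M; [exact: C1_cst|exact: C1_id]. Qed.

Variables (a a1 b : R -> R) (l : R).
Hypotheses (a_cont : continuous a) (a_cst : forall r, r <= r1 -> a r = a r1).
Hypothesis da : forall r, r1 < r -> is_derive r 1 a (a1 r).
Hypothesis ca1 : forall r, r1 < r -> {for r, continuous a1}.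
Hypothesis a1l : a1 r @[r --> r1^'+] --> l.
Hypothesis ab : forall r, r1 < r -> b r = a r.
Hypothesis db0 : derive1C (fun s => phase (1 + gamma * (b s)%:C)) r @[r --> +oo] --> (0 : R[i]^o).

(** The decay assumption concerns [b], which agrees with the continuous function [a] beyond [r1]
    only: for [a = alpha_hat], the function [b = alpha] may jump at [r1]. *)
Lemma vp_of_C1 g : C1fun g -> (forall s, `|g s| <= 1) ->
  derive1 (g \o b) r @[r --> +oo] --> (0 : R) -> vprofile r1 (g \o a).
Proof.
move=> [g1 dg cg] g1le h0; apply: (vp_base dg cg g1le a_cont a_cst da ca1 a1l).
apply: cvg_trans h0; apply: near_eq_cvg.
exists r1; split; [exact: num_real|move=> r rr].
have h := is_derive1_comp (dg (a r)) (da rr).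
have h2 : is_derive r 1 (g \o b) (g1 (a r) * a1 r).
  apply: near_eq_is_derive h; have := lt_nbhsr rr; apply: filterS => x xr.
  by rewrite /= (ab xr).
by rewrite derive1E derive_val.
Qed.

Lemma vp_phase_re : vprofile r1 (phase_re \o a).
Proof.
apply: vp_of_C1 C1_phase_re phase_re_le1 _; have /cvgC_comp[h _] := db0.
apply: cvg_trans h; apply: near_eq_cvg; near=> r; rewrite /derive1C.
by congr (derive1 _ r); apply/funext => s; rewrite /= phase_reE.
Unshelve. all: by end_near.
Qed.

Lemma vp_phase_im : vprofile r1 (phase_im \o a).
Proof.
apply: vp_of_C1 C1_phase_im phase_im_le1 _; have /cvgC_comp[_ h] := db0.
apply: cvg_trans h; apply: near_eq_cvg; near=> r; rewrite /derive1C.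
by congr (derive1 _ r); apply/funext => s; rewrite /= phase_imE.
Unshelve. all: by end_near.
Qed.

End PhaseProfile.

(** * Consequences of the scaling assumptions *)

Section ScalingFacts.
Variables (R : realType) (r1 : R) (gamma : R[i]) (ta : R -> R).
Local Notation Re := complex.Re.
Local Notation Im := complex.Im.
Local Notation gr := (complex.Re gamma).
Local Notation gi := (complex.Im gamma).
Local Notation alpha := (alpha r1 ta).
Local Notation alpha_hat := (alpha_hat r1 ta).
Local Notation dtilde := (dtilde gamma ta).
Local Notation dfun := (dfun r1 gamma ta).
Local Notation d_hat := (d_hat r1 gamma ta).
Hypothesis r1_gt0 : 0 < r1.
Hypothesis sc : scaling_assumptions r1 gamma ta.

Lemma gr_ge0 : 0 <= gr. Proof. by have [] := gammaP sc. Qed.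
Lemma gi_gt0 : 0 < gi. Proof. by have [] := gammaP sc. Qed.

(** [ta] is unconstrained at negative arguments; [ta0] is continuous on the whole line and constant
    up to [r1], as a profile must be. *)
Definition ta0 (r : R) : R := if r1 < r then ta r else 0.

Lemma ta0E r : 0 <= r -> ta0 r = ta r.
Proof. by move=> r0; rewrite /ta0; case: ltP => // rr; rewrite (ta_eq0 sc). Qed.

Lemma ta0_ge0 r : 0 <= ta0 r.
Proof. by rewrite /ta0; case: ltP => // rr; exact: ltW (ta_gt0 sc rr). Qed.

Lemma ta_is_derive r : r1 < r -> is_derive r 1 ta (derive1 ta r).
Proof. by move=> /(ta_C2 sc)[h _ _]; rewrite derive1E; exact/derivableP. Qed.

Lemma ta1_is_derive r : r1 < r -> is_derive r 1 (derive1 ta) (derive1n 2 ta r).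
Proof. by move=> /(ta_C2 sc)[_ h _]; rewrite /derive1n /= derive1E; exact/derivableP. Qed.

Lemma ta_cont r : 0 < r -> {for r, continuous ta}.
Proof.
move=> r0; have sub : (`]0, +oo[%classic : set R) `<=` `[0, +oo[%classic.
  by move=> x /=; rewrite !in_itv/= !andbT; exact: ltW.
have := continuous_subspaceW sub (ta_continuous sc).
rewrite continuous_open_subspace; last exact: interval_open.
by move=> h; apply: h; rewrite inE/= in_itv/= r0.
Qed.

Lemma near_gt (r s : R) : r < s -> \forall x \near s, r < x.
Proof. by move=> rs; exact: lt_nbhsr. Qed.

Lemma ta0_cont : continuous ta0.
Proof.
move=> r; have [r0|r0] := leP r 0.
  have rr : r < r1 by exact: le_lt_trans r1_gt0.
  rewrite /continuous_at {2}/ta0 ltNge (ltW rr) /=.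
  apply: near_cst_cvg.
  have : \forall x \near r, x < r1 by exact: lt_nbhsl.
  by apply: filterS => x xr; rewrite /ta0 ltNge (ltW xr).
rewrite /continuous_at (ta0E (ltW r0)); apply: cvg_trans (ta_cont r0).
apply: near_eq_cvg; have := near_gt r0; apply: filterS => x x0.
by rewrite (ta0E (ltW x0)).
Qed.

Lemma ta0_is_derive r : r1 < r -> is_derive r 1 ta0 (derive1 ta r).
Proof.
move=> rr; apply: near_eq_is_derive (ta_is_derive rr).
by have := near_gt rr; apply: filterS => x xr; rewrite /ta0 xr.
Qed.

Definition l1 := lim (derive1 ta r @[r --> r1^'+]).
Definition l2 := lim (derive1n 2 ta r @[r --> r1^'+]).

Lemma alpha_cvg : alpha r @[r --> r1^'+] --> r1 * l1.
Proof.
have c1 : r * derive1 ta r + ta0 r @[r --> r1^'+] --> r1 * l1 + ta0 r1.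
  apply: cvgD; last by apply: cvg_at_right_filter; exact: ta0_cont.
  by apply: cvgM; [apply: cvg_at_right_filter; exact: cvg_id|exact: (ta_C2_extends sc).1].
rewrite {2}/ta0 ltxx addr0 in c1; apply: cvg_trans c1; apply: near_eq_cvg.
near=> r; have rr : r1 < r by near: r; exact: nbhs_right_gt.
by rewrite /Defs.alpha /ta0 rr.
Unshelve. all: by end_near.
Qed.

Lemma alpha_hatE r : alpha_hat r = if r1 < r then alpha r else r1 * l1.
Proof.
rewrite /Defs.alpha_hat; case: ltP => // _; apply: cvg_lim; last exact: alpha_cvg.
exact: norm_hausdorff.
Qed.

Definition alpha1 (r : R) := r * derive1n 2 ta r + 2 * derive1 ta r.

Lemma alpha_hat_is_derive r : r1 < r -> is_derive r 1 alpha_hat (alpha1 r).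
Proof.
move=> rr; have d1 := is_derive_add (is_derive_mul (@is_derive_id _ R r 1) (ta1_is_derive rr)) (ta_is_derive rr).
have -> : alpha1 r = id r * derive1n 2 ta r + derive1 ta r * 1 + derive1 ta r.
  by rewrite /alpha1; ring.
apply: near_eq_is_derive d1.
by have := near_gt rr; apply: filterS => x xr; rewrite alpha_hatE /Defs.alpha xr.
Qed.

Lemma alpha1_cont r : r1 < r -> {for r, continuous alpha1}.
Proof.
move=> rr; have [_ _ c2] := ta_C2 sc rr.
apply: cvgD; apply: cvgM; [exact: cvg_id|exact: c2|exact: cvg_cst|].
exact: is_derive_cont (ta1_is_derive rr).
Qed.

Lemma ta1_cont r : r1 < r -> {for r, continuous (derive1 ta)}.
Proof. by move=> rr; exact: is_derive_cont (ta1_is_derive rr). Qed.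

Lemma alpha1_cvg : alpha1 r @[r --> r1^'+] --> r1 * l2 + 2 * l1.
Proof.
apply: cvgD; apply: cvgM; [|exact: (ta_C2_extends sc).2|exact: cvg_cst|exact: (ta_C2_extends sc).1].
by apply: cvg_at_right_filter; exact: cvg_id.
Qed.

Lemma alpha_hat_in r : r <= r1 -> alpha_hat r = r1 * l1.
Proof. by move=> rr; rewrite alpha_hatE ltNge rr. Qed.

Lemma alpha_hat_out r : r1 < r -> alpha_hat r = alpha r.
Proof. by move=> rr; rewrite alpha_hatE rr. Qed.

Lemma alpha_hat_cont : continuous alpha_hat.
Proof.
move=> r; have [rr|rr|->] := ltgtP r r1.
- rewrite /continuous_at (alpha_hat_in (ltW rr)).
  apply: near_cst_cvg.
  have : \forall x \near r, x < r1 by exact: lt_nbhsl.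
  by apply: filterS => x xr; exact: alpha_hat_in (ltW xr).
- exact: is_derive_cont (alpha_hat_is_derive rr).
apply/left_right_continuousP; split; rewrite (alpha_hat_in (lexx r1)).
  apply: near_cst_cvg; near=> x.
  have xr : x < r1 by near: x; exact: nbhs_left_lt.
  exact: alpha_hat_in (ltW xr).
apply: cvg_trans alpha_cvg; apply: near_eq_cvg; near=> x.
have xr : r1 < x by near: x; exact: nbhs_right_gt.
by rewrite (alpha_hat_out xr).
Unshelve. all: by end_near.
Qed.

Lemma derive_ta_ge0 r : r1 < r -> 0 <= derive1 ta r.
Proof.
move=> rr; have [h _ _] := ta_C2 sc rr; rewrite derive1E /derive.
apply: (limr_ge h).
have e0 : 0 < r - r1 by rewrite subr_gt0.
near=> k; have kr : `|k| < r - r1 by near: k; exact: dnbhs0_lt.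
have kA : k%:A = k :> R by rewrite /GRing.scale/= mulr1.
have k1 : r1 < k + r by move: kr; rewrite ltr_norml => /andP[]; lra.
have r2 : 0 <= r by exact: ltW (lt_trans r1_gt0 rr).
have k2 : 0 <= k + r by exact: ltW (lt_trans r1_gt0 k1).
rewrite /= kA /GRing.scale /=.
have [k0|k0] := leP 0 k.
  by rewrite mulr_ge0 ?invr_ge0// subr_ge0 (ta_nondecreasing sc)// lerDr.
by rewrite mulr_le0// ?invr_le0 ?(ltW k0)// subr_le0 (ta_nondecreasing sc)// gerDr (ltW k0).
Unshelve. all: by end_near.
Qed.

(** Beyond [r1] the difference is [r] times the derivative of the nondecreasing [ta]; up to [r1] the
    right side is a limit of nonnegative values of [alpha]. *)
Lemma alpha_hat_ge r : ta0 r <= alpha_hat r.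
Proof.
have [rr|rr] := leP r r1; last first.
  rewrite (alpha_hat_out rr) /ta0 rr /Defs.alpha rr lerDr mulr_ge0 ?derive_ta_ge0//.
  exact: ltW (lt_trans r1_gt0 rr).
rewrite (alpha_hat_in rr) /ta0 ltNge rr /= -(cvg_lim _ alpha_cvg); last exact: norm_hausdorff.
apply: limr_ge; first by apply/cvg_ex; eexists; exact: alpha_cvg.
near=> x; have xr : r1 < x by near: x; exact: nbhs_right_gt.
have x0 : 0 <= x by exact: ltW (lt_trans r1_gt0 xr).
by rewrite /Defs.alpha xr addr_ge0 ?(ta_ge0 sc)// mulr_ge0 ?derive_ta_ge0.
Unshelve. all: by end_near.
Qed.

Lemma alpha_hat_ge0 r : 0 <= alpha_hat r.
Proof. exact: le_trans (ta0_ge0 r) (alpha_hat_ge r). Qed.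

Lemma dtildeE r : 0 <= r -> dtilde r = 1 + gamma * (ta0 r)%:C.
Proof. by move=> r0; rewrite ta0E. Qed.

Local Notation pre := (phase_re gamma).
Local Notation pim := (phase_im gamma).

Lemma ta0_cst r : r <= r1 -> ta0 r = ta0 r1.
Proof. by move=> rr; rewrite /ta0 ltxx ltNge rr. Qed.

Lemma alpha_hat_cst r : r <= r1 -> alpha_hat r = alpha_hat r1.
Proof. by move=> rr; rewrite (alpha_hat_in rr) (alpha_hat_in (lexx r1)). Qed.

Lemma vp_ta : vprofile r1 (pre \o ta0) /\ vprofile r1 (pim \o ta0).
Proof.
have ab r : r1 < r -> ta r = ta0 r by rewrite /ta0 => ->.
by split; [apply: (vp_phase_re gi_gt0 ta0_cont ta0_cst ta0_is_derive ta1_cont (ta_C2_extends sc).1 ab)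
          |apply: (vp_phase_im gi_gt0 ta0_cont ta0_cst ta0_is_derive ta1_cont (ta_C2_extends sc).1 ab)];
  exact: (phase_derive_lim sc).1.
Qed.

Lemma vp_alpha : vprofile r1 (pre \o alpha_hat) /\ vprofile r1 (pim \o alpha_hat).
Proof.
have ab r : r1 < r -> alpha r = alpha_hat r by move=> rr; rewrite (alpha_hat_out rr).
by split; [apply: (vp_phase_re gi_gt0 alpha_hat_cont alpha_hat_cst alpha_hat_is_derive alpha1_cont alpha1_cvg ab)
          |apply: (vp_phase_im gi_gt0 alpha_hat_cont alpha_hat_cst alpha_hat_is_derive alpha1_cont alpha1_cvg ab)];
  exact: (phase_derive_lim sc).2.
Qed.

(** The imaginary part of the phase of [dtilde] times the conjugate phase of [d_hat], that is
    [sin tau_hat] for [r >= 0], in a form to which the calculus of profiles applies. *)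
Definition phase_cross (r : R) : R :=
  pim (ta0 r) * pre (alpha_hat r) - pre (ta0 r) * pim (alpha_hat r).

(** Up to a positive factor this is [Im gamma] times [ta0 - alpha_hat]. The sign decides into which
    half plane the multiplier turns the sector. *)
Lemma phase_cross_le0 r : phase_cross r <= 0.
Proof.
rewrite /phase_cross /phase_re /phase_im.
set n := (stretch_norm _ _)^-1; set m := (stretch_norm _ _)^-1.
have n0 : 0 <= n by rewrite invr_ge0 sqrtr_ge0.
have m0 : 0 <= m by rewrite invr_ge0 sqrtr_ge0.
have -> : gi * ta0 r * n * ((1 + gr * alpha_hat r) * m) -
    (1 + gr * ta0 r) * n * (gi * alpha_hat r * m) =
  n * m * (gi * (ta0 r - alpha_hat r)) by ring.
apply: mulr_ge0_le0; first exact: mulr_ge0.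
by apply: mulr_ge0_le0; [exact: ltW gi_gt0|rewrite subr_le0; exact: alpha_hat_ge].
Qed.

Lemma vp_phase_cross : vprofile r1 phase_cross.
Proof.
have [ar ai] := vp_ta; have [br bi] := vp_alpha.
exact: vpB (vpM ai br) (vpM ar bi).
Qed.

Lemma phase_hat (a b : R) : phase ((1 + gamma * a%:C) / (1 + gamma * b%:C)) =
  (pre a * pre b + pim a * pim b) +i* (pim a * pre b - pre a * pim b).
Proof.
rewrite phase_div ?(stretch_neq0 gi_gt0)// !phaseE; simpc.
by congr (_ +i* _); ring.
Qed.

Lemma sin_tau_hat r : 0 <= r -> sin (tau_hat r1 gamma ta r) = phase_cross r.
Proof.
move=> r0; rewrite /tau_hat (dtildeE r0) /Defs.d_hat.
set z := _ / _; have z0 : z != 0 by rewrite mulf_neq0 ?invr_eq0 ?(stretch_neq0 gi_gt0).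
by have := congr1 (fun z : R[i] => Im z) (expi_arg z0); rewrite /= => ->; rewrite /z phase_hat.
Qed.

Lemma dfunE r : r1 < r -> dfun r = 1 + gamma * (alpha_hat r)%:C.
Proof. by move=> rr; rewrite alpha_hat_out. Qed.

Lemma dfun_in r : r <= r1 -> dfun r = 1.
Proof. by move=> rr; rewrite /Defs.dfun /Defs.alpha ltNge rr /= mulr0 addr0. Qed.

Lemma dtilde_in r : 0 <= r -> r <= r1 -> dtilde r = 1.
Proof. by move=> r0 rr; rewrite /Defs.dtilde (ta_eq0 sc r0 rr) mulr0 addr0. Qed.

Lemma stretch_norm_ge1 s : 0 <= s -> 1 <= stretch_norm gamma s.
Proof.
move=> s0; have grs : 0 <= gr * s by rewrite mulr_ge0 ?gr_ge0.
rewrite -[leLHS]sqrtr1 ler_sqrt; last by rewrite addr_ge0 ?sqr_ge0.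
apply: (@le_trans _ _ ((1 + gr * s) ^+ 2)); last by rewrite lerDl sqr_ge0.
by rewrite -[leLHS](expr1n R 2) ler_sqr ?nnegrE ?lerDl// addr_ge0.
Qed.

Lemma stretch_norm_le (s C : R) : 0 <= s -> s <= C ->
  stretch_norm gamma s <= 1 + absC gamma * C.
Proof.
move=> s0 sC; rewrite -absC_stretch; apply: le_trans (absCD _ _) _.
rewrite absC1 absCM absCR (ger0_norm s0) lerD2l ler_wpM2l ?absC_ge0//.
Qed.

(** The lower bounds come from [Re gamma >= 0] and the nonnegativity of [ta] and [alpha]; they keep
    all quotients bounded. *)
Lemma stretch_bounds : exists2 C : R, 1 <= C & forall r, 0 <= r ->
  [/\ 1 <= absC (dtilde r), absC (dtilde r) <= C, 1 <= absC (dfun r) & absC (dfun r) <= C].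
Proof.
have [C hC] := ta_alpha_bounded sc.
have C0 : 0 <= C by have [h _] := hC 0 (lexx _); apply: le_trans h.
exists (1 + absC gamma * C) => [|r r0]; first by rewrite lerDl mulr_ge0 ?absC_ge0.
have [h1 h2] := hC r r0.
have al : 0 <= alpha r.
  have [rr|rr] := leP r r1; first by rewrite /Defs.alpha ltNge rr.
  by rewrite -(alpha_hat_out rr) alpha_hat_ge0.
rewrite /Defs.dtilde /Defs.dfun !absC_stretch; split.
- exact: stretch_norm_ge1 (ta_ge0 sc r0).
- exact: stretch_norm_le (ta_ge0 sc r0) (le_trans (ler_norm _) h1).
- exact: stretch_norm_ge1 al.
- exact: stretch_norm_le al (le_trans (ler_norm _) h2).
Qed.

End ScalingFacts.

Lemma cvgCM (R : realType) (T : Type) (F : set_system T) (FF : Filter F) (f g : T -> R[i])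
    (a b : R[i]) : f x @[x --> F] --> (a : R[i]^o) -> g x @[x --> F] --> (b : R[i]^o) ->
  f x * g x @[x --> F] --> (a * b : R[i]^o).
Proof.
move=> /cvgC_comp[fr fi] /cvgC_comp[gr gi]; apply/cvgC_comp.
have RM (z w : R[i]) : complex.Re (z * w) =
  complex.Re z * complex.Re w - complex.Im z * complex.Im w by case: z; case: w.
have IM (z w : R[i]) : complex.Im (z * w) =
  complex.Re z * complex.Im w + complex.Im z * complex.Re w by case: z; case: w.
rewrite RM IM; split.
  by under eq_fun do rewrite RM; exact: cvgB (cvgM fr gr) (cvgM fi gi).
by under eq_fun do rewrite IM; exact: cvgD (cvgM fr gi) (cvgM fi gr).
Qed.

(** Hence the first factor of the operator [opT] is the phase of [dtilde]. *)
Lemma conj_phase (R : realType) (z : R[i]) : z != 0 -> `|z| / z^* = phase z.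
Proof.
move=> z0; have J : z^* != 0 by rewrite fmorph_eq0.
apply: (mulIf J); rewrite divfK// phase_absC mulrAC mulJ_absC absCE -rmorphM /=.
by rewrite expr2 mulfK// absC_eq0.
Qed.

Lemma expiN (R : realType) (t : R) : expi (- t) = (expi t)^*.
Proof. by rewrite /expi cosN sinN. Qed.

(** * Coefficients of the form after multiplication by the conjugate of the multiplier *)

Section Coefficients.
Variables (R : realType) (r1 : R) (gamma : R[i]) (ta : R -> R) (sigma : 'M[R]_3).
Local Notation Re := complex.Re.
Local Notation Im := complex.Im.
Local Notation dtilde := (dtilde gamma ta).
Local Notation dfun := (dfun r1 gamma ta).
Local Notation psi_hat := (psi_hat r1 gamma ta sigma).
Local Notation tau_star := (tau_star r1 gamma ta).
Local Notation cross := (phase_cross r1 gamma ta).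
Local Notation d0 := (d0 gamma ta).
Local Notation pre := (phase_re gamma).
Local Notation pim := (phase_im gamma).
Hypothesis r1_gt0 : 0 < r1.
Hypothesis sc : scaling_assumptions r1 gamma ta.
Hypothesis sigmaP : sym_posdef sigma.
Hypothesis tauP : 1 - eig_min sigma / eig_max sigma < cos tau_star.
Local Notation lo := (eig_min sigma).
Local Notation hi := (eig_max sigma).
Let gi0 : 0 < Im gamma. Proof. exact: gi_gt0 sc. Qed.

(** The real part of the number whose argument is [psi_hat]; its positivity is the hypothesis on
    [cos tau_star]. *)
Definition k0 : R := lo - (1 - cos tau_star) * hi.

Lemma hi_gt0 : 0 < hi. Proof. exact: eig_max_gt0 sigmaP. Qed.

Lemma k0_gt0 : 0 < k0.
Proof.
have h := hi_gt0; have := tauP; rewrite -(ltr_pM2r h) mulrBl divfK ?gt_eqF// /k0; lra.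
Qed.

(** [psi_re s - i psi_im s] is the phase of [k0 - i hi s], which at [s = sin tau_hat] is
    [expi psi_hat]. As [k0 > 0], it is a continuously differentiable function of [s]. *)
Definition psi_norm (s : R) : R := Num.sqrt (k0 * k0 + (hi * s) * (hi * s)).
Definition psi_re (s : R) : R := k0 * (psi_norm s)^-1.
Definition psi_im (s : R) : R := hi * s * (psi_norm s)^-1.

Lemma psi_norm2_gt0 s : 0 < k0 * k0 + (hi * s) * (hi * s).
Proof. by rewrite -!expr2 ltr_pwDl ?sqr_ge0// exprn_gt0// k0_gt0. Qed.

Lemma psi_norm_gt0 s : 0 < psi_norm s.
Proof. by rewrite sqrtr_gt0 psi_norm2_gt0. Qed.

Lemma C1_psi : C1fun psi_re /\ C1fun psi_im.
Proof.
have cl : C1fun (fun s : R => hi * s) by apply: C1M; [exact: C1_cst|exact: C1_id].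
have ci := C1_invsqrt (C1D (C1_cst (k0 * k0)) (C1M cl cl)) psi_norm2_gt0.
by split; [exact: C1M (C1_cst k0) ci|exact: C1M cl ci].
Qed.

Lemma expi_psi r : 0 <= r -> expi (psi_hat r) = psi_re (cross r) -i* psi_im (cross r).
Proof.
move=> rr; rewrite /Defs.psi_hat (sin_tau_hat sc rr) -/k0.
set z := _ -i* _; have z0 : z != 0.
  by rewrite eq_complex /= negb_and gt_eqF ?k0_gt0.
rewrite expi_arg// phase_absC (_ : absC z = psi_norm (cross r)).
  by rewrite /z /psi_re /psi_im; simpc; rewrite -?mulNr; congr (_ +i* _); ring.
by rewrite absC_def /z /= sqrrN !expr2.
Qed.

Variable e : R.
Hypothesis e2 : e ^+ 2 = 1.

(** For [r >= 0] this is [expi (e * psi_hat r)]; the sign [e] selects one of the two cases of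
    [opT]. *)
Definition Tphase (r : R) : R[i] := psi_re (cross r) +i* (- (e * psi_im (cross r))).

Definition Tcoef (r : R) : R[i] := phase (1 + gamma * (ta0 r1 ta r)%:C) * Tphase r.

Lemma TcoefE r : 0 <= r -> Tcoef r =
  `|dtilde r| / (dtilde r)^* * expi (e * psi_hat r).
Proof.
move=> rr; rewrite /Tcoef conj_phase ?(dtildeE sc rr) ?(stretch_neq0 gi0)//; congr (_ * _).
have /orP[/eqP e1|/eqP e1] : (e == 1) || (e == -1) by rewrite -sqrf_eq1 e2.
  by rewrite /Tphase e1 !mul1r expi_psi.
by rewrite /Tphase e1 !mulN1r expiN expi_psi// opprK.
Qed.

Lemma vp_Tcoef : vprofile r1 (fun r => Re (Tcoef r)) /\ vprofile r1 (fun r => Im (Tcoef r)).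
Proof.
have [ar ai] := vp_ta r1_gt0 sc; have vc := vp_phase_cross r1_gt0 sc.
have [cr ci] := C1_psi; have vr := vp_comp cr vc; have vi := vp_comp ci vc.
have vei := vpM (vp_cst r1 e) vi.
split.
  have := vpB (vpM ar vr) (vpM ai (vpN vei)).
  by congr (vprofile _ _); apply/funext => r; rewrite /Tcoef (phaseE gamma).
have := vpD (vpM ar (vpN vei)) (vpM ai vr).
by congr (vprofile _ _); apply/funext => r; rewrite /Tcoef (phaseE gamma).
Qed.

Lemma absC_Tphase r : absC (Tphase r) = 1.
Proof.
apply/eqP; rewrite -(@eqrXn2 _ 2)// ?absC_ge0// expr1n /Tphase absC_sqr /= sqrrN (exprMn 2 e) e2 mul1r.
rewrite /psi_re /psi_im !exprMn -mulrDl exprVn sqr_sqrtr; last exact: ltW (psi_norm2_gt0 _).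
by rewrite -!expr2 exprMn divff// gt_eqF// -exprMn !expr2 psi_norm2_gt0.
Qed.

Lemma absC_Tcoef r : absC (Tcoef r) = 1.
Proof. by rewrite absCM absC_Tphase mulr1 absC_phase// stretch_neq0. Qed.

(** What the pointwise estimate needs from [dtilde / dfun]: a modulus bounded below, an argument
    within [tau_star], and the cancellation of the phases of [dfun] and of the quotient against the
    multiplier. *)
Lemma ratio_coef : exists2 kl, 0 < kl & forall r, 0 <= r -> exists kappa c s : R,
  [/\ dtilde r / dfun r = kappa%:C * (c +i* s), c ^+ 2 + s ^+ 2 = 1,
      kl <= kappa ^+ 2, k0 <= lo - (1 - c) * hi /\ `|s| <= `|cross r| &
      (Tcoef r)^* * dfun r * (c +i* s) = (absC (dfun r))%:C * (Tphase r)^*].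
Proof.
have [C C1 hC] := stretch_bounds r1_gt0 sc.
have Cp : 0 < C by apply: lt_le_trans C1.
exists (C^-1 ^+ 2) => [|r rr]; first by rewrite exprn_gt0// invr_gt0.
have [t1 tC f1 fC] := hC r rr; have t0 := lt_le_trans ltr01 t1; have f0 := lt_le_trans ltr01 f1.
have tn0 : dtilde r != 0 by rewrite -absC_gt0.
have fn0 : dfun r != 0 by rewrite -absC_gt0.
have qn0 : dtilde r / dfun r != 0 by rewrite mulf_neq0 ?invr_eq0.
pose q := phase (dtilde r / dfun r).
have qq : q = Re q +i* Im q by case: q.
exists (absC (dtilde r / dfun r)), (Re q), (Im q); split.
- by rewrite -qq -phase_mulK.
- by rewrite -absC_sqr absC_phase// expr1n.
- rewrite ler_sqr ?nnegrE ?absC_ge0// ?invr_ge0 ?(ltW Cp)// absCM absCV.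
  rewrite -[leLHS]mul1r; apply: ler_pM => //; first by rewrite invr_ge0 ltW.
  by rewrite lef_pV2.
(* Up to [r1] the quotient is 1, whereas [cross] refers to [d_hat] and may be nonzero there: hence a
   bound by [|cross r|] instead of an equality. *)
- have [rr1|rr1] := leP r r1.
    have -> : q = 1.
      by rewrite /q dfun_in// (dtilde_in sc)// divr1 /phase normr1 divr1.
    rewrite /= normr0; split => //; rewrite /k0 lerD2l lerN2 ler_wpM2r ?(ltW hi_gt0)//.
    by rewrite lerD2l lerN2 cos_le1.
  split; last first.
    by rewrite /q (dtildeE sc rr) (dfunE r1_gt0 sc)// (phase_hat sc).
  rewrite /k0 lerD2l lerN2 ler_wpM2r ?(ltW hi_gt0)// lerD2l lerN2.
  have -> : Re q = cos (arg (dtilde r / dfun r)) by rewrite /q -expi_arg.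
  set w := arg _; have wpi : `|w| <= pi.
    by have [h1 h2 _] := argP qn0; rewrite ler_norml h1 ltW.
  have wt : `|w| <= tau_star.
    apply: ub_le_sup; last by exists r.
    exists pi => _ [x /= xr <-]; have x0 := ltW (lt_trans r1_gt0 xr).
    have [a1 _ b1 _] := hC x x0.
    have n0 : dtilde x / dfun x != 0.
      by rewrite mulf_neq0 ?invr_eq0// -absC_gt0; [exact: lt_le_trans a1|exact: lt_le_trans b1].
    by have [h1 h2 _] := argP n0; rewrite ler_norml h1 ltW.
  have -> : cos w = cos `|w| by case: (ger0P w) => // _; rewrite cosN.
  (* Cosine decreases on [[0, pi]], so comparing [cos w] with [cos tau_star] requires that the
     supremum does not exceed [pi]. *)
  have tpi : tau_star <= pi.
    apply: sup_le_ub; first by exists `|w|; exists r.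
    move=> _ [x /= xr <-]; have x0 := ltW (lt_trans r1_gt0 xr).
    have [a1 _ b1 _] := hC x x0.
    have n0 : dtilde x / dfun x != 0.
      by rewrite mulf_neq0 ?invr_eq0// -absC_gt0; [exact: lt_le_trans a1|exact: lt_le_trans b1].
    by have [h1 h2 _] := argP n0; rewrite ler_norml h1 ltW.
  rewrite leNgt; apply/negP; rewrite ltr_cos ?in_itv/= ?normr_ge0 ?wpi ?tpi ?andbT//.
    by rewrite ltNge wt.
  exact: le_trans wt.
- rewrite -qq /q /Tcoef -(dtildeE sc rr) phase_div// rmorphM /= -mulrA.
  have fE := phase_mulK fn0; rewrite [X in _ * (X * _)]fE.
  set P := phase (dtilde r); set D := phase (dfun r).
  have PJ : P * P^* = 1 by exact: phase_mulJ.
  have DJ : D * D^* = 1 by exact: phase_mulJ.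
  transitivity ((P * P^*) * (D * D^*) * ((absC (dfun r))%:C * (Tphase r)^*)); first by ring.
  by rewrite PJ DJ !mul1r.
Qed.

Lemma Tphase_conjE r : (Tphase r)^* =
  ((psi_norm (cross r))^-1)%:C * (k0 -i* (e * - (hi * cross r))).
Proof. by rewrite /Tphase /psi_re /psi_im; simpc; congr (_ +i* _); ring. Qed.

Lemma mass_coef r : 0 <= r -> (Tcoef r)^* * (dtilde r ^+ 2 * dfun r) =
  (absC (dtilde r) ^+ 2 * absC (dfun r))%:C *
  (phase (dtilde r) * phase (dfun r) * (Tphase r)^*).
Proof.
have [C C1 hC] := stretch_bounds r1_gt0 sc.
move=> rr; have [t1 _ f1 _] := hC r rr.
have tn0 : dtilde r != 0 by rewrite -absC_gt0; exact: lt_le_trans t1.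
have fn0 : dfun r != 0 by rewrite -absC_gt0; exact: lt_le_trans f1.
rewrite /Tcoef -(dtildeE sc rr) rmorphM /= {2}(phase_mulK tn0) {1}(phase_mulK fn0).
set P := phase (dtilde r); have PJ : P * P^* = 1 by exact: phase_mulJ.
have -> : (absC (dtilde r) ^+ 2 * absC (dfun r))%:C =
    (absC (dtilde r))%:C ^+ 2 * (absC (dfun r))%:C by rewrite -rmorphXn -rmorphM.
transitivity ((P * P^*) * ((absC (dtilde r))%:C ^+ 2 * (absC (dfun r))%:C * (P * phase (dfun r) * (Tphase r)^*))).
  by ring.
by rewrite PJ mul1r.
Qed.

(** [d0] is a [lim], so convergence has to be shown: [ta] is nondecreasing and bounded, and the
    phase depends continuously on it. *)
Lemma phase_dtilde_lim : phase (dtilde r) @[r --> +oo] --> (d0 : R[i]^o).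
Proof.
have [C hC] := ta_alpha_bounded sc.
pose L := sup (range (ta0 r1 ta)).
have cL : ta0 r1 ta r @[r --> +oo] --> L.
  apply: nondecreasing_cvgr.
    move=> x y xy; rewrite /ta0; case: ltP => xr; case: ltP => yr //.
    - by apply: (ta_nondecreasing sc) => //; exact: ltW (lt_trans r1_gt0 xr).
    - by have := le_lt_trans yr (lt_le_trans xr xy); rewrite ltxx.
    - exact: ltW (ta_gt0 sc yr).
  exists C => _ [x _ <-]; rewrite /ta0; case: ltP => xr.
    by have [h _] := hC x (ltW (lt_trans r1_gt0 xr)); exact: le_trans (ler_norm _) h.
  by have [h _] := hC 0 (lexx 0); exact: le_trans h.
have c1 : phase (dtilde r) @[r --> +oo] --> (phase (1 + gamma * L%:C) : R[i]^o).
  apply/cvgC_comp; rewrite !phaseE /=.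
  split; [apply: cvg_trans (_ : pre (ta0 r1 ta r) @[r --> +oo] --> _)|
          apply: cvg_trans (_ : pim (ta0 r1 ta r) @[r --> +oo] --> _)].
  - apply: near_eq_cvg; exists 0; split; [exact: num_real|move=> r r0].
    by rewrite (dtildeE sc (ltW r0)) phaseE.
  - by apply: (cvg_comp _ _ cL); exact: C1_cont (C1_phase_re gi0) L.
  - apply: near_eq_cvg; exists 0; split; [exact: num_real|move=> r r0].
    by rewrite (dtildeE sc (ltW r0)) phaseE.
  - by apply: (cvg_comp _ _ cL); exact: C1_cont (C1_phase_im gi0) L.
suff -> : d0 = phase (1 + gamma * L%:C) by exact: c1.
by rewrite /Defs.d0; apply: (@cvg_lim R[i]^o); [exact: norm_hausdorff|exact: c1].
Qed.

Lemma ratio_lim : phase (dtilde r) * (phase (dfun r))^* @[r --> +oo] --> (1 : R[i]^o).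
Proof.
have [C C1 hC] := stretch_bounds r1_gt0 sc.
apply: cvg_trans (phase_ratio_lim sc); apply: near_eq_cvg.
exists 0; split; [exact: num_real|move=> r r0].
have [t1 _ f1 _] := hC r (ltW r0).
have tn0 : dtilde r != 0 by rewrite -absC_gt0; exact: lt_le_trans t1.
have fn0 : dfun r != 0 by rewrite -absC_gt0; exact: lt_le_trans f1.
rewrite -phase_div// /phase normrM normfV !invfM invrK; ring.
Qed.

(** [alpha] is not assumed to converge, but the quotient of the two phases tends to 1. *)
Lemma phase_dfun_lim : phase (dfun r) @[r --> +oo] --> (d0 : R[i]^o).
Proof.
have [C C1 hC] := stretch_bounds r1_gt0 sc.
have /cvgC_absC h1 := phase_dtilde_lim; have /cvgC_absC h2 := ratio_lim.
apply/cvgC_absC; apply: (@squeeze_cvgr _ _ _ _ (fun=> 0)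
  (fun r => absC (d0 - phase (dtilde r)) + absC (1 - phase (dtilde r) * (phase (dfun r))^*))).
- exists 0; split; [exact: num_real|move=> r r0].
  have [_ _ f1 _] := hC r (ltW r0).
  have fn0 : dfun r != 0 by rewrite -absC_gt0; exact: lt_le_trans f1.
  rewrite absC_ge0 /=.
  have -> : d0 - phase (dfun r) = (d0 - phase (dtilde r)) -
      (1 - phase (dtilde r) * (phase (dfun r))^*) * phase (dfun r).
    have J := phase_mulJ fn0.
    transitivity ((d0 - phase (dtilde r)) - phase (dfun r) +
      phase (dtilde r) * (phase (dfun r) * (phase (dfun r))^*)); last by ring.
    by rewrite J; ring.
  apply: le_trans (absCD _ _) _; rewrite lerD2l absCN absCM absC_phase// mulr1 lexx//.
- exact: cvg_cst.
- by rewrite -[X in _ --> X](addr0 0); exact: cvgD.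
Qed.

Lemma cross_lim : cross r @[r --> +oo] --> (0 : R).
Proof.
have /cvgC_comp[_ h] := ratio_lim; apply: cvg_trans h; apply: near_eq_cvg.
exists r1; split; [exact: num_real|move=> r rr].
have r0 := ltW (lt_trans r1_gt0 rr).
rewrite (dtildeE sc r0) (dfunE r1_gt0 sc rr) -phase_div ?(stretch_neq0 gi0)//.
by rewrite (phase_hat sc).
Qed.

Lemma mass_lim : phase (dtilde r) * phase (dfun r) * (Tphase r)^* @[r --> +oo] --> (d0 ^+ 2 : R[i]^o).
Proof.
have [cr ci] := C1_psi.
have hE : (Tphase r)^* @[r --> +oo] --> (1 : R[i]^o).
  apply/cvgC_comp; rewrite /=; split.
    have -> : 1 = psi_re 0.
      by rewrite /psi_re /psi_norm mulr0 mulr0 addr0 -expr2 sqrtr_sqr gtr0_norm ?k0_gt0// divff// gt_eqF// k0_gt0.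
    by apply: (cvg_comp _ _ cross_lim); exact: C1_cont cr 0.
  have -> : 0 = - (- (e * psi_im 0)) by rewrite /psi_im mulr0 mul0r mulr0 !oppr0.
  apply: cvgN; apply: cvgN; apply: cvgM; first exact: cvg_cst.
  by apply: (cvg_comp _ _ cross_lim); exact: C1_cont ci 0.
rewrite -[d0 ^+ 2]mulr1 expr2.
exact: (cvgCM _ (cvgCM _ phase_dtilde_lim phase_dfun_lim) hE).
Qed.

End Coefficients.

(** * The stretched form and its multiplier *)

Section BoundedMeasurable.
Variables (R : realType) (Om : set (R * R * R)).
Hypothesis oOm : open Om.
Local Notation R3 := (R * R * R)%type.
Local Notation fct := (R3 -> R[i]).
Local Notation Re := complex.Re.
Local Notation Im := complex.Im.
Local Notation mOm := (open_measurable3 oOm).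
Implicit Types (f g : fct) (p : R3 -> R).

Definition rbm p := measurable_fun (Om : set (mR3 R)) p /\ exists C : R, forall x, `|p x| <= C.

Definition cbm f := rbm (fun x => Re (f x)) /\ rbm (fun x => Im (f x)).

Lemma rbm_cst c : rbm (fun=> c).
Proof. by split; [exact: measurable_cst|exists `|c|]. Qed.

Lemma rbmN p : rbm p -> rbm (fun x => - p x).
Proof.
move=> [mp [C hp]]; split; first exact: measurableT_comp.
by exists C => x; rewrite normrN.
Qed.

Lemma rbmD p q : rbm p -> rbm q -> rbm (fun x => p x + q x).
Proof.
move=> [mp [C hp]] [mq [D hq]]; split; first exact: measurable_funD.
by exists (C + D) => x; rewrite (le_trans (ler_normD _ _))// lerD.
Qed.

Lemma rbmM p q : rbm p -> rbm q -> rbm (fun x => p x * q x).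
Proof.
move=> [mp [C hp]] [mq [D hq]]; split; first exact: measurable_funM.
by exists (C * D) => x; rewrite normrM ler_pM.
Qed.

Lemma rbm_le p C : measurable_fun (Om : set (mR3 R)) p -> (forall x, `|p x| <= C) -> rbm p.
Proof. by move=> mp pC; split => //; exists C. Qed.

Lemma cbm_cst c : cbm (fun=> c). Proof. by split; exact: rbm_cst. Qed.

Lemma cbm_real p : rbm p -> cbm (fun x => (p x)%:C).
Proof. by move=> hp; split => //=; exact: rbm_cst. Qed.

Lemma cbmD f g : cbm f -> cbm g -> cbm (fun x => f x + g x).
Proof.
move=> [fr fi] [gr gi]; split.
  by under eq_fun do rewrite ReD; exact: rbmD.
by under eq_fun do rewrite ImD; exact: rbmD.
Qed.

Lemma cbmM f g : cbm f -> cbm g -> cbm (fun x => f x * g x).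
Proof.
move=> [fr fi] [gr gi]; split.
  rewrite (_ : (fun x => _) = fun x => Re (f x) * Re (g x) + - (Im (f x) * Im (g x))).
    by apply: rbmD; [exact: rbmM|apply: rbmN; exact: rbmM].
  by apply/funext => x; case: (f x); case: (g x).
rewrite (_ : (fun x => _) = fun x => Re (f x) * Im (g x) + Im (f x) * Re (g x)).
  by apply: rbmD; exact: rbmM.
by apply/funext => x; case: (f x); case: (g x).
Qed.

Lemma cbmJ f : cbm f -> cbm (fun x => (f x)^*).
Proof.
move=> [fr fi]; split.
  by rewrite (_ : (fun x => _) = fun x => Re (f x)) //; apply/funext => x; case: (f x).
rewrite (_ : (fun x => _) = fun x => - Im (f x)); first exact: rbmN.
by apply/funext => x; case: (f x).
Qed.

Lemma cbmV f : cbm f -> (forall x, 1 <= absC (f x)) -> cbm (fun x => (f x)^-1).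
Proof.
move=> hf f1; have [[mr _] [mi _]] := hf.
have V x : (f x)^-1 = ((Re (f x) ^+ 2 + Im (f x) ^+ 2)^-1)%:C * (f x)^*.
  have f0 : f x != 0 by rewrite -absC_gt0; exact: lt_le_trans (f1 x).
  apply: (mulfI f0); rewrite divff// mulrCA mulJ_absC -absC_sqr -rmorphM /= mulVf//.
  by rewrite sqrf_eq0 absC_eq0.
rewrite (_ : (fun x => _) = fun x => ((Re (f x) ^+ 2 + Im (f x) ^+ 2)^-1)%:C * (f x)^*).
  apply: cbmM (cbmJ hf); apply: cbm_real; apply: (@rbm_le _ 1) => [|x].
    apply: measurableT_comp (@measurable_invr R) _.
    by apply: measurable_funD; exact: measurable_funX.
  rewrite -absC_sqr normfV ger0_norm ?sqr_ge0// invf_le1.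
    by rewrite exprn_ege1.
  by rewrite exprn_gt0//; exact: lt_le_trans (f1 x).
by apply/funext => x; exact: V.
Qed.

Lemma cbm_bound f : cbm f -> exists C, forall x, absC (f x) <= C.
Proof.
move=> [[_ [C hC]] [_ [D hD]]]; exists (C + D) => x.
by apply: le_trans (absC_le _) _; exact: lerD.
Qed.

Lemma cbm_L2 f : cbm f -> exists2 C : R, 0 <= C & forall u, L2 Om u ->
  L2 Om (fun x => f x * u x) /\
  hnorm (dotL2 Om) (fun x => f x * u x) <= C * hnorm (dotL2 Om) u.
Proof.
move=> hf; have [C hC] := cbm_bound hf; have [[mr _] [mi _]] := hf.
have C0 : 0 <= C by apply: le_trans (absC_ge0 _) (hC (0, 0, 0)).
exists C => // u Lu; have hC' : forall x, Om x -> absC (f x) <= C by move=> x _.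
have Lu' := Lu; rewrite L2_L2c in Lu'.
split; first by rewrite L2_L2c; exact: (L2M mOm mr mi hC' Lu').
by have := nrm_L2M mOm mr mi hC' Lu'; rewrite (ger0_norm C0).
Qed.

Lemma L2_mul_integrable u v : L2 Om u -> L2 Om v ->
  (@mu3 R).-integrable (Om : set (mR3 R)) (EFin \o (fun x => Re (u x * (v x)^*))).
Proof.
move=> /(L2c_L2r oOm)[ur ui] /(L2c_L2r oOm)[vr vi].
have := integrableD mOm (L2r_mul_integrable mOm ur vr) (L2r_mul_integrable mOm ui vi).
apply: eq_integrable; first exact: mOm.
by move=> x _ /=; rewrite !ReImE mulrN opprK.
Qed.

Lemma dotL2_sum (I : Type) (r : seq I) (a b : I -> fct) : (forall i, L2 Om (a i)) ->
  (forall i, L2 Om (b i)) ->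
  (@mu3 R).-integrable (Om : set (mR3 R)) (EFin \o (fun x => Re (\sum_(i <- r) a i x * (b i x)^*))) /\
  Re (\sum_(i <- r) dotL2 Om (a i) (b i)) =
  Rintegral (@mu3 R) (Om : set (mR3 R)) (fun x => Re (\sum_(i <- r) a i x * (b i x)^*)).
Proof.
move=> La Lb; elim: r => [|i r [ih1 ih2]].
  have e : (fun x => Re (\sum_(i <- [::]) a i x * (b i x)^*)) = fun=> 0.
    by apply/funext => x; rewrite big_nil Re0.
  rewrite e big_nil Re0; split; first exact: integrable0.
  by rewrite /Rintegral integral0.
have e : (fun x => Re (\sum_(j <- i :: r) a j x * (b j x)^*)) =
    fun x => Re (a i x * (b i x)^*) + Re (\sum_(j <- r) a j x * (b j x)^*).
  by apply/funext => x; rewrite big_cons ReD.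
have h := L2_mul_integrable (La i) (Lb i).
rewrite e big_cons ReD ih2; split.
  have := integrableD mOm h ih1; apply: eq_integrable; first exact: mOm.
  by move=> x _.
by rewrite (RintegralD mOm h ih1).
Qed.

(** Integrates a pointwise inequality between several L^2 pairings in one step, once all its terms
    are collected in a finite sum. *)
Lemma dotL2_sum_ge0 (I : finType) (a b : I -> fct) : (forall i, L2 Om (a i)) ->
  (forall i, L2 Om (b i)) ->
  {ae @mu3 R, forall x, Om x -> 0 <= Re (\sum_i a i x * (b i x)^*)} ->
  0 <= Re (\sum_i dotL2 Om (a i) (b i)).
Proof.
move=> La Lb h; have [int ->] := dotL2_sum (index_enum I) La Lb.
set f := (fun x => Re _); have mf : measurable_fun (Om : set (mR3 R)) f.
  by have /integrableP[+ _] := int; move=> /measurable_EFinP.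
rewrite /Rintegral (@ae_eq_integral _ _ _ _ (Om : set (mR3 R)) (fun x => `|f x|%:E)) //.
- by apply: fine_ge0; apply: integral_ge0 => x _; rewrite lee_fin.
- exact: mOm.
- exact/measurable_EFinP.
- by apply/measurable_EFinP; exact: measurableT_comp.
- by move: h; apply: filterS => x hx Ox; rewrite ger0_norm//; exact: hx.
Qed.

Definition cbmat (A : R3 -> 'M[R[i]]_3) := forall i j, cbm (fun x => A x i j).

Lemma cbm_sum (F : 'I_3 -> fct) : (forall i, cbm (F i)) -> cbm (fun x => \sum_i F i x).
Proof.
move=> hF; under eq_fun do rewrite !big_ord_recl big_ord0.
by apply: cbmD => //; apply: cbmD => //; apply: cbmD => //; exact: cbm_cst.
Qed.

Lemma cbmat_mul A B : cbmat A -> cbmat B -> cbmat (fun x => A x *m B x).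
Proof.
move=> hA hB i j; under eq_fun do rewrite mxE.
by apply: cbm_sum => k; exact: cbmM.
Qed.

Lemma cbmat_scale f A : cbm f -> cbmat A -> cbmat (fun x => f x *: A x).
Proof. by move=> hf hA i j; under eq_fun do rewrite mxE; exact: cbmM. Qed.

End BoundedMeasurable.

(** * The spherical frame in Cartesian coordinates *)

Section SphericalFrame.
Variables (R : realType) (Om : set (R * R * R)).
Hypothesis oOm : open Om.
Local Notation R3 := (R * R * R)%type.
Local Notation rbm := (rbm Om).
Implicit Types x : R3.

Definition axis_dist x : R := absC (x.1.1 +i* x.1.2).
Definition cos_theta x : R := x.2 / enorm x.
Definition sin_theta x : R := Num.sqrt (1 - cos_theta x ^+ 2).
Definition cos_phi x : R := x.1.1 / axis_dist x.
(* On the polar axis [x / 0 = 0] gives [arg 0 = acos 0 = pi / 2]. *)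
Definition sin_phi x : R := if axis_dist x == 0 then 1 else x.1.2 / axis_dist x.

Lemma ratio_le1 (a b : R) : `|a| <= b -> `|a / b| <= 1.
Proof.
move=> ab; have b0 : 0 <= b by exact: le_trans ab.
have [->|bn0] := eqVneq b 0; first by rewrite invr0 mulr0 normr0.
have bp : 0 < b by rewrite lt_def bn0.
by rewrite normrM normfV (gtr0_norm bp) ler_pdivrMr// mul1r.
Qed.

Lemma cos_theta_le1 x : `|cos_theta x| <= 1.
Proof.
apply: ratio_le1; have := coord_le_enorm 2 x.
by rewrite /coord mxE.
Qed.

Lemma cos_sph_theta x : cos (sph_theta x) = cos_theta x.
Proof. by rewrite /sph_theta acosK// in_itv/= -ler_norml cos_theta_le1. Qed.

Lemma sin_sph_theta x : sin (sph_theta x) = sin_theta x.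
Proof. by rewrite /sph_theta sin_acos// -ler_norml cos_theta_le1. Qed.

Lemma sph_phiE x : cos (sph_phi x) = cos_phi x /\ sin (sph_phi x) = sin_phi x.
Proof.
rewrite /sph_phi /cos_phi /sin_phi /axis_dist; set z := _ +i* _.
have [z0|zn0] := eqVneq z 0.
  have -> : absC z = 0 by rewrite z0 absC0.
  rewrite eqxx invr0 mulr0; have -> : arg z = pi / 2.
    by rewrite z0 /arg /= mul0r acos0 ltxx andbF.
  by rewrite cos_pihalf sin_pihalf.
have e := expi_arg zn0; rewrite absC_eq0 (negbTE zn0).
have := congr1 (fun w : R[i] => (complex.Re w, complex.Im w)) e.
by rewrite phase_absC /z; simpc => -[-> ->].
Qed.

Lemma cos_phi_le1 x : `|cos_phi x| <= 1.
Proof. by rewrite -(sph_phiE x).1 ler_norml cos_geN1 cos_le1. Qed.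

Lemma sin_phi_le1 x : `|sin_phi x| <= 1.
Proof. by rewrite -(sph_phiE x).2 ler_norml sin_geN1 sin_le1. Qed.

Lemma sin_theta_le1 x : `|sin_theta x| <= 1.
Proof. by rewrite -sin_sph_theta ler_norml sin_geN1 sin_le1. Qed.

Lemma measurable_coord3 : [/\ measurable_fun (Om : set (mR3 R)) (fun x : R3 => x.1.1),
  measurable_fun (Om : set (mR3 R)) (fun x : R3 => x.1.2) &
  measurable_fun (Om : set (mR3 R)) (fun x : R3 => x.2)].
Proof.
split; apply: measurable_funTS.
- exact: measurableT_comp measurable_fst measurable_fst.
- exact: measurableT_comp measurable_snd measurable_fst.
- exact: measurable_snd.
Qed.

Lemma measurable_enorm : measurable_fun (Om : set (mR3 R)) (@enorm R).
Proof. by apply: measurable_funTS; exact: continuous_measurable3 (@enorm_continuous R). Qed.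

Lemma measurable_sqrtr (p : R3 -> R) : measurable_fun (Om : set (mR3 R)) p ->
  measurable_fun (Om : set (mR3 R)) (fun x => Num.sqrt (p x)).
Proof. exact: measurableT_comp (continuous_measurable_fun (@sqrt_continuous R)). Qed.

Lemma rbm_trig : [/\ rbm cos_theta, rbm sin_theta, rbm cos_phi & rbm sin_phi].
Proof.
have [m1 m2 m3] := measurable_coord3; have me := measurable_enorm.
have mi (p : R3 -> R) : measurable_fun (Om : set (mR3 R)) p ->
    measurable_fun (Om : set (mR3 R)) (fun x => (p x)^-1).
  exact: measurableT_comp (@measurable_invr R).
have mct : measurable_fun (Om : set (mR3 R)) cos_theta by apply: measurable_funM => //; exact: mi.
have mad : measurable_fun (Om : set (mR3 R)) axis_dist.
  rewrite (_ : axis_dist = fun x : R3 => Num.sqrt (x.1.1 ^+ 2 + x.1.2 ^+ 2)); last first.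
    by apply/funext => x; rewrite /axis_dist absC_def.
  by apply: measurable_sqrtr; apply: measurable_funD; exact: measurable_funX.
split.
- exact: rbm_le mct cos_theta_le1.
- apply: rbm_le sin_theta_le1; apply: measurable_sqrtr.
  by apply: measurable_funB; [exact: measurable_cst|exact: measurable_funX].
- by apply: rbm_le cos_phi_le1; apply: measurable_funM => //; exact: mi.
- apply: rbm_le sin_phi_le1; apply: (measurable_fun_if (open_measurable3 oOm)).
  + exact: measurable_fun_eqr mad (measurable_cst _).
  + exact: measurable_cst.
  + apply: (measurable_funS (open_measurable3 oOm)); first exact: subIsetl.
    by apply: measurable_funM => //; exact: mi.
Qed.

(** Angles and derivatives are replaced by explicit functions of [x] whose measurability is clear;
    the formula holds on the polar axis as well. *)
Lemma FmxE x : Fmx x = \matrix_(i, j) nth 0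
  [:: nth 0 [:: sin_theta x * cos_phi x; sin_theta x * sin_phi x; cos_theta x] i;
      (sin_theta x)^-1 * nth 0 [:: - (sin_theta x * sin_phi x); sin_theta x * cos_phi x; 0] i;
      nth 0 [:: cos_theta x * cos_phi x; cos_theta x * sin_phi x; - sin_theta x] i] j.
Proof.
have [cp sp] := sph_phiE x; have ct := cos_sph_theta x; have st := sin_sph_theta x.
have dc (c : R) (f : R -> R) (t df : R) : is_derive t 1 f df -> derive1 (fun s => c * f s) t = c * df.
  move=> h; have hh := is_derive_mul (is_derive_cst c t 1) h.
  by rewrite derive1E derive_val mulr0 addr0.
have dcr (c : R) (f : R -> R) (t df : R) : is_derive t 1 f df -> derive1 (fun s => f s * c) t = df * c.
  by move=> h; under eq_fun do rewrite mulrC; rewrite (dc _ _ _ _ h) mulrC.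
apply/matrixP => i j; rewrite !mxE.
have -> : nth 0 [:: sin (sph_theta x) * cos (sph_phi x); sin (sph_theta x) * sin (sph_phi x);
    cos (sph_theta x)] i =
  nth 0 [:: sin_theta x * cos_phi x; sin_theta x * sin_phi x; cos_theta x] i.
  by rewrite cp sp ct st.
have -> : derive1 (fun p => xhat p (sph_theta x) i 0) (sph_phi x) =
    nth 0 [:: - (sin_theta x * sin_phi x); sin_theta x * cos_phi x; 0] i.
  under eq_fun do rewrite mxE.
  case: i => [[|[|[|//]]] ?] /=.
  - by rewrite (dc _ _ _ _ (is_derive_cos _)) st sp mulrN.
  - by rewrite (dc _ _ _ _ (is_derive_sin _)) st cp.
  - by rewrite derive1_cst.
have -> : derive1 (fun t => xhat (sph_phi x) t i 0) (sph_theta x) =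
    nth 0 [:: cos_theta x * cos_phi x; cos_theta x * sin_phi x; - sin_theta x] i.
  under eq_fun do rewrite mxE.
  case: i => [[|[|[|//]]] ?] /=.
  - by rewrite (dcr _ _ _ _ (is_derive_sin _)) ct cp.
  - by rewrite (dcr _ _ _ _ (is_derive_sin _)) ct sp.
  - by rewrite derive1E (@derive_val _ _ _ _ _ _ _ (is_derive_cos _)) st.
by rewrite st.
Qed.

Lemma rbm_Fmx i j : rbm (fun x => Fmx x i j).
Proof.
have [bct bst bcp bsp] := rbm_trig.
(* The unbounded factor [1 / sin theta] occurs only against [sin theta], and the product is 0 or
   1. *)
have bu : rbm (fun x => (sin_theta x)^-1 * sin_theta x).
  apply: (@rbm_le _ _ _ 1) => [|x].
    by apply: measurable_funM; [apply: measurableT_comp (@measurable_invr R) _|]; exact: bst.1.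
  by have [->|s0] := eqVneq (sin_theta x) 0; rewrite ?mulr0 ?normr0// mulVf// normr1.
under eq_fun do rewrite FmxE mxE.
case: j => [[|[|[|//]]] ?] /=; case: i => [[|[|[|//]]] ?] /=; try exact: rbmM; try exact: rbmN; try by [].
- under eq_fun do rewrite mulrN mulrA; apply: rbmN; exact: rbmM.
- under eq_fun do rewrite mulrA; exact: rbmM.
- by under eq_fun do rewrite mulr0; exact: rbm_cst.
Qed.

Definition unit_dir x : 'cV[R]_3 := \col_i (coord i x / enorm x).

Lemma off_axis x : ~ (x.1.1 = 0 /\ x.1.2 = 0) ->
  [/\ sin_theta x != 0, sin_theta x ^+ 2 + cos_theta x ^+ 2 = 1,
      cos_phi x ^+ 2 + sin_phi x ^+ 2 = 1 &
      unit_dir x = \col_i nth 0 [:: sin_theta x * cos_phi x; sin_theta x * sin_phi x; cos_theta x] i].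
Proof.
move=> ax; have z0 : x.1.1 +i* x.1.2 != 0 :> R[i].
  by apply/negP => /eqP[e1 e2]; apply: ax.
have rp : 0 < axis_dist x by rewrite absC_gt0.
have rE : axis_dist x ^+ 2 = x.1.1 ^+ 2 + x.1.2 ^+ 2 by rewrite absC_sqr.
have nE : enorm x ^+ 2 = x.1.1 ^+ 2 + x.1.2 ^+ 2 + x.2 ^+ 2.
  by rewrite enorm_sqr nsqE /coord !mxE /= !expr2.
have np : 0 < enorm x.
  rewrite lt_def enorm_ge0 andbT -sqrf_eq0 nE -rE gt_eqF// ltr_pwDl ?sqr_ge0// exprn_gt0//.
have sE : sin_theta x = axis_dist x / enorm x.
  have -> : axis_dist x / enorm x = Num.sqrt ((axis_dist x / enorm x) ^+ 2).
    by rewrite sqrtr_sqr ger0_norm// divr_ge0 ?ltW.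
  rewrite /sin_theta; congr Num.sqrt; rewrite /cos_theta !expr_div_n.
  have n2 : enorm x ^+ 2 != 0 by rewrite sqrf_eq0 gt_eqF.
  rewrite -[X in X - _ = _](divff n2) -mulrBl; congr (_ / _).
  by rewrite nE rE addrK.
have spE : sin_phi x = x.1.2 / axis_dist x by rewrite /sin_phi gt_eqF.
have n0 : enorm x != 0 by rewrite gt_eqF.
have r0 : axis_dist x != 0 by rewrite gt_eqF.
split.
- by rewrite sE mulf_neq0// invr_eq0.
- by rewrite sE /cos_theta !expr_div_n -mulrDl rE -nE divff// sqrf_eq0.
- by rewrite spE /cos_phi !expr_div_n -mulrDl -rE divff// sqrf_eq0.
apply/matrixP => i j; rewrite !mxE sE spE /cos_phi /cos_theta.
by case: i => [[|[|[|//]]] ?] /=; rewrite /coord mxE //= mulrAC; [rewrite mulrC -!mulrA..];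
   field; rewrite n0 r0.
Qed.

(** The columns are orthonormal and the first one is radial, so the projections onto the other two
    add up to the identity minus the radial projection. *)
Lemma frame_identity x i j : ~ (x.1.1 = 0 /\ x.1.2 = 0) ->
  Fmx x i 1 * Fmx x j 1 + Fmx x i 2 * Fmx x j 2 =
  (i == j)%:R - unit_dir x i 0 * unit_dir x j 0 /\ Fmx x i 0 = unit_dir x i 0.
Proof.
move=> ax; have [s0 sc CS ->] := off_axis ax; rewrite !FmxE !mxE /=.
move: sc CS s0; set s := sin_theta x; set c := cos_theta x; set C := cos_phi x; set S := sin_phi x.
move=> sc CS s0; split => //.
(* Equality modulo the two Pythagorean relations; [A] and [B] are the cofactors supplied in each of
   the nine cases. *)
have key (A B L M : R) : L - M = A * (s ^+ 2 + c ^+ 2 - 1) + B * (C ^+ 2 + S ^+ 2 - 1) -> L = M.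
  by move=> e; apply/eqP; rewrite -subr_eq0 e sc CS !subrr !mulr0 addr0.
case: i => [[|[|[|//]]] ?] /=; case: j => [[|[|[|//]]] ?] /=.
- by apply: (key (C * C) 1); field.
- by apply: (key (C * S) 0); field.
- by apply: (key 0 0); field.
- by apply: (key (C * S) 0); field.
- by apply: (key (S * S) 1); field.
- by apply: (key 0 0); field.
- by apply: (key 0 0); field.
- by apply: (key 0 0); field.
- by apply: (key 1 0); field.
Qed.

Lemma unit_dir_sqr x : ~ (x.1.1 = 0 /\ x.1.2 = 0) -> dotv (unit_dir x) (unit_dir x) = 1.
Proof.
move=> ax; have [_ sc CS ->] := off_axis ax; rewrite dotvE !mxE /=.
set s := sin_theta x; set c := cos_theta x; set C := cos_phi x; set S := sin_phi x.
transitivity (s ^+ 2 * (C ^+ 2 + S ^+ 2) + c ^+ 2); first by ring.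
by rewrite CS mulr1 sc.
Qed.

End SphericalFrame.

Lemma le_sum3 (R : realFieldType) (a b c n : R) : a <= n -> b <= n -> c <= n -> a + b + c <= 3 * n.
Proof. by move=> ha hb hc; lra. Qed.

Lemma bound_arith (R : realFieldType) (C D w a b x0 x1 x2 m y : R) :
  x0 <= 3 * C * a * b -> x1 <= 3 * C * a * b -> x2 <= 3 * C * a * b -> 0 <= w ->
  m <= D * a * b -> y <= x0 + x1 + x2 -> y + w * m <= (9 * C + w * D) * (a * b).
Proof.
move=> h0 h1 h2 w0 hm hy; have hw := ler_wpM2l w0 hm.
have -> : (9 * C + w * D) * (a * b) =
  3 * C * a * b + 3 * C * a * b + 3 * C * a * b + w * (D * a * b) by ring.
by lra.
Qed.

Lemma big_ord3 (V : nmodType) (F : 'I_3 -> V) : \sum_i F i = F 0 + F 1 + F 2.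
Proof.
rewrite !big_ord_recl big_ord0 addr0 addrA.
by congr (_ + F _ + F _); exact/val_inj.
Qed.

(** * The stretched form is bounded *)

Section StretchedForm.
Variables (R : realType) (r1 : R) (gamma : R[i]) (ta : R -> R) (sigma : 'M[R]_3).
Variables (Om : set (R * R * R)) (omega : R[i]).
Hypothesis oOm : open Om.
Hypothesis r1_gt0 : 0 < r1.
Hypothesis sc : scaling_assumptions r1 gamma ta.
Local Notation R3 := (R * R * R)%type.
Local Notation fct := (R3 -> R[i]).
Local Notation gfct := (R3 -> 'cV[R[i]]_3).
Local Notation Re := complex.Re.
Local Notation Im := complex.Im.
Local Notation dtilde := (dtilde gamma ta).
Local Notation dfun := (dfun r1 gamma ta).
Local Notation PH := (L2_ph oOm).
Local Notation PH1 := (H1_prehilbert oOm).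
Local Notation N1 := (hnorm (dotH1 Om)).
Local Notation nrm2 := (hnorm (dotL2 Om)).
Local Notation mOm := (open_measurable3 oOm).
Local Notation stilde := (sigma_tilde r1 gamma ta sigma).
Local Notation form := (scaled_form r1 gamma ta sigma Om omega).

Definition mass_weight (x : R3) : R[i] := dtilde (enorm x) ^+ 2 * dfun (enorm x).

Lemma rbm_radial (p : R -> R) (C : R) : measurable_fun [set: R] p ->
  (forall r, 0 <= r -> `|p r| <= C) -> rbm Om (fun x => p (enorm x)).
Proof.
move=> mp pC; apply: (@rbm_le _ _ _ C) => [|x]; last exact: pC (enorm_ge0 x).
by apply: measurableT_comp mp _; exact: measurable_enorm.
Qed.

(** [alpha] may jump at [r1]; writing it as the continuous [alpha_hat] beyond [r1] and 0 elsewhere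
    shows that it is measurable. *)
Lemma cbm_stretch : cbm Om (fun x => dtilde (enorm x)) /\ cbm Om (fun x => dfun (enorm x)).
Proof.
have [C hC] := ta_alpha_bounded sc.
have mt : measurable_fun [set: R] (ta0 r1 ta) by exact: continuous_measurable_fun (ta0_cont r1_gt0 sc).
have ma : measurable_fun [set: R] (fun r => if r1 < r then alpha_hat r1 ta r else 0).
  apply: measurable_fun_ifT; last exact: measurable_cst.
    exact: measurable_fun_ltr (measurable_cst _) (@measurable_id _ _ _).
  exact: continuous_measurable_fun (alpha_hat_cont r1_gt0 sc).
have bt : rbm Om (fun x => ta0 r1 ta (enorm x)).
  by apply: (@rbm_radial _ C mt) => r r0; rewrite (ta0E sc r0); exact: (hC r r0).1.
have aE r : (if r1 < r then alpha_hat r1 ta r else 0) = alpha r1 ta r.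
  by case: ifP => rr; [rewrite (alpha_hat_out r1_gt0 sc)|rewrite /Defs.alpha rr].
have ba : rbm Om (fun x => (fun r => if r1 < r then alpha_hat r1 ta r else 0) (enorm x)).
  by apply: (@rbm_radial _ C ma) => r r0; rewrite aE; exact: (hC r r0).2.
split.
  rewrite (_ : (fun x => _) = fun x => 1 + gamma * (ta0 r1 ta (enorm x))%:C).
    by apply: cbmD; [exact: cbm_cst|apply: cbmM; [exact: cbm_cst|exact: cbm_real]].
  by apply/funext => x; rewrite (dtildeE sc (enorm_ge0 x)).
rewrite (_ : (fun x => _) = fun x =>
    1 + gamma * ((fun r => if r1 < r then alpha_hat r1 ta r else 0) (enorm x))%:C).
  by apply: cbmD; [exact: cbm_cst|apply: cbmM; [exact: cbm_cst|exact: cbm_real]].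
by apply/funext => x; rewrite aE.
Qed.

Lemma cbm_mass : cbm Om mass_weight.
Proof.
have [ht hd] := cbm_stretch; apply: cbmM => //.
by rewrite (_ : (fun x => _) = fun x => dtilde (enorm x) * dtilde (enorm x)); [exact: cbmM|].
Qed.

Lemma mass_weight_ge1 x : 1 <= absC (mass_weight x).
Proof.
have [C C1 hC] := stretch_bounds r1_gt0 sc; have [t1 _ f1 _] := hC _ (enorm_ge0 x).
by rewrite absCM absCX mulr_ege1// exprn_ege1.
Qed.

Lemma cbmat_real (A : R3 -> 'M[R]_3) : (forall i j, rbm Om (fun x => A x i j)) ->
  cbmat Om (fun x => map_mx (real_complex R) (A x)).
Proof. by move=> hA i j; under eq_fun do rewrite mxE; exact: cbm_real. Qed.

Lemma cbmat_stilde : cbmat Om stilde.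
Proof.
have [ht hd] := cbm_stretch.
have hF : cbmat Om (fun x => map_mx (real_complex R) (Fmx x)).
  by apply: cbmat_real => i j; exact: rbm_Fmx.
have hFT : cbmat Om (fun x => (map_mx (real_complex R) (Fmx x))^T).
  by move=> i j; under eq_fun do rewrite mxE; exact: hF.
have hM : cbmat Om (fun x => Mmx r1 gamma ta (enorm x)).
  have hd3 (k : 'I_3) : cbm Om (fun x => nth 0 [:: dtilde (enorm x) ^+ 2;
      dtilde (enorm x) * dfun (enorm x); dtilde (enorm x) * dfun (enorm x)] k).
    case: k => [[|[|[|//]]] ?] /=; [|exact: cbmM|exact: cbmM].
    by rewrite (_ : (fun x => _) = fun x => dtilde (enorm x) * dtilde (enorm x)); [exact: cbmM|].
  move=> i j; under eq_fun do rewrite !mxE; case: (i == j); last exact: cbm_cst.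
  by under eq_fun do rewrite mulr1n; exact: hd3.
have hFMF := cbmat_mul (cbmat_mul hF hM) hFT.
have hs : cbmat Om (fun=> map_mx (real_complex R) sigma).
  by move=> i j; exact: cbm_cst.
exact: cbmat_scale (cbmV cbm_mass mass_weight_ge1) (cbmat_mul (cbmat_mul hFMF hs) hFMF).
Qed.

(** The tangential entries of [Mmx] are [dtilde d], and the radial entry [dtilde^2] is [dtilde d]
    times the quotient [dtilde / d]. *)
Lemma FMF_radial x : ~ (x.1.1 = 0 /\ x.1.2 = 0) ->
  map_mx (real_complex R) (Fmx x) *m Mmx r1 gamma ta (enorm x) *m (map_mx (real_complex R) (Fmx x))^T =
  (dtilde (enorm x) * dfun (enorm x)) *:
    radial_mx (unit_dir x) (dtilde (enorm x) / dfun (enorm x)).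
Proof.
have [C C1 hC] := stretch_bounds r1_gt0 sc; have [_ _ f1 _] := hC _ (enorm_ge0 x).
have fn0 : dfun (enorm x) != 0 by rewrite -absC_gt0; exact: lt_le_trans f1.
move=> ax; apply/matrixP => i j.
have [fi Fi] := frame_identity i j ax; have [_ Fj] := frame_identity j i ax.
have fC : (Fmx x i 1)%:C * (Fmx x j 1)%:C + (Fmx x i 2)%:C * (Fmx x j 2)%:C =
    (i == j)%:R - (unit_dir x i 0 * unit_dir x j 0)%:C :> R[i].
  by rewrite -!rmorphM -rmorphD fi rmorphB rmorph_nat.
move: (Fmx x) (unit_dir x) fi Fi Fj fC => F n fi Fi Fj fC.
rewrite /Mmx mul_mx_diag mxE [RHS]mxE [radial_mx _ _ _ _]mxE.
rewrite big_ord3 !mxE /= Fi Fj.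
transitivity ((dtilde (enorm x)) ^+ 2 * ((n i 0)%:C * (n j 0)%:C) +
   dtilde (enorm x) * dfun (enorm x) *
   ((F i 1)%:C * (F j 1)%:C + (F i 2)%:C * (F j 2)%:C)); first by ring.
rewrite fC -rmorphM; field.
by rewrite fn0.
Qed.

(** The scalars combine to [(dtilde d)^2 / (dtilde^2 d) = d]. *)
Lemma stilde_mul x (v : 'cV[R[i]]_3) : ~ (x.1.1 = 0 /\ x.1.2 = 0) ->
  let P := radial_mx (unit_dir x) (dtilde (enorm x) / dfun (enorm x)) in
  stilde x *m v = dfun (enorm x) *: (P *m (map_mx (real_complex R) sigma *m (P *m v))).
Proof.
move=> ax P; have [C C1 hC] := stretch_bounds r1_gt0 sc; have [t1 _ f1 _] := hC _ (enorm_ge0 x).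
have tn0 : dtilde (enorm x) != 0 by rewrite -absC_gt0; exact: lt_le_trans t1.
have fn0 : dfun (enorm x) != 0 by rewrite -absC_gt0; exact: lt_le_trans f1.
rewrite /sigma_tilde (FMF_radial ax) -/P -!scalemxAl -!scalemxAr !scalerA -!scalemxAl !mulmxA scalerA.
congr (_ *: _); field.
by rewrite fn0 tn0.
Qed.

Lemma cbmat_L2 (A : R3 -> 'M[R[i]]_3) : cbmat Om A -> exists2 C : R, 0 <= C &
  forall g : gfct, (forall i, L2 Om (fun x => g x i 0)) -> forall i,
  L2 Om (fun x => (A x *m g x) i 0) /\
  nrm2 (fun x => (A x *m g x) i 0) <= C * \sum_j nrm2 (fun x => g x j 0).
Proof.
move=> hA; have /boolp.choice[c hc] : forall ij : 'I_3 * 'I_3, exists C : R, 0 <= C /\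
    forall u, L2 Om u -> L2 Om (fun x => A x ij.1 ij.2 * u x) /\
      nrm2 (fun x => A x ij.1 ij.2 * u x) <= C * nrm2 u.
  by move=> [i j]; have [C C0 hC] := cbm_L2 oOm (hA i j); exists C.
exists (\sum_ij c ij) => [|g Lg i]; first by apply: sumr_ge0 => ij _; exact: (hc ij).1.
have cle ij : c ij <= \sum_kl c kl.
  by rewrite (bigD1 ij)//= lerDl sumr_ge0// => kl _; exact: (hc kl).1.
have L j : L2 Om (fun x => A x i j * g x j 0) by exact: ((hc (i, j)).2 _ (Lg j)).1.
have N j : nrm2 (fun x => A x i j * g x j 0) <= (\sum_ij c ij) * nrm2 (fun x => g x j 0).
  apply: le_trans ((hc (i, j)).2 _ (Lg j)).2 _.
  by apply: ler_wpM2r; [exact: nrm_ge0|exact: cle].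
rewrite (_ : (fun x => _) = fun x => A x i 0 * g x 0 0 + A x i 1 * g x 1 0 + A x i 2 * g x 2 0); last first.
  by apply/funext => x; rewrite mxE big_ord3.
have L01 := ph_domD PH (L 0) (L 1).
split; first exact: (ph_domD PH L01 (L 2)).
apply: le_trans (nrmD PH L01 (L 2)) _; rewrite big_ord3 mulrDr; apply: lerD; last exact: N.
apply: le_trans (nrmD PH (L 0) (L 1)) _; rewrite mulrDr; apply: lerD; exact: N.
Qed.

Lemma stilde_L2 (g : gfct) i : (forall i, L2 Om (fun x => g x i 0)) -> L2 Om (fun x => (stilde x *m g x) i 0).
Proof. by move=> Lg; have [C _ h] := cbmat_L2 cbmat_stilde; exact: (h g Lg i).1. Qed.

Lemma mass_L2 u : L2 Om u -> L2 Om (fun x => mass_weight x * u x).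
Proof. by move=> Lu; have [C _ h] := cbm_L2 oOm cbm_mass; exact: (h u Lu).1. Qed.

(** Frees the form from the choice made in [grad], so that the product rule gradient can be used for
    the multiplied function. *)
Lemma scaled_formE u v g h : H1 Om u -> H1 Om v -> weak_gradient Om u g -> weak_gradient Om v h ->
  form u v = \sum_i dotL2 Om (fun x => (stilde x *m g x) i 0) (fun x => h x i 0) -
    omega ^+ 2 * dotL2 Om (fun x => mass_weight x * u x) v.
Proof.
move=> Hu Hv wg wh; have Lg i : L2 Om (fun x => g x i 0) by case: wg.
rewrite /scaled_form dotL2vE; last 2 first.
- by move=> i; apply: stilde_L2 => j; exact: grad_L2.
- by move=> i; exact: grad_L2.
congr (_ - _); apply: eq_bigr => i _.
apply: (ae_dotc mOm); rewrite -?L2_L2c.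
- by apply: stilde_L2 => j; exact: grad_L2.
- exact: stilde_L2.
- exact: grad_L2.
- by case: wh.
- have ga j := grad_ae oOm j Hu wg.
  apply: filterS3 (ga 0) (ga 1) (ga 2) => x h0 h1 h2 Ox.
  by rewrite !mxE !big_ord3 h0// h1// h2.
- exact: grad_ae.
exact: oOm.
Qed.

Lemma scaled_form_bounded : bounded_form Om form.
Proof.
have H1of u : H10 Om u -> H1 Om u by move=> /H10P[].
have wgD u v : H1 Om u -> H1 Om v ->
    weak_gradient Om (fun x => u x + v x) (fun x => grad Om u x + grad Om v x).
  by move=> Hu Hv; exact: (weak_gradientD oOm (H1_L2 Hu) (H1_L2 Hv) (gradP Hu) (gradP Hv)).
have wgZ a u : H1 Om u -> weak_gradient Om (fun x => a * u x) (fun x => a *: grad Om u x).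
  by move=> Hu; exact: (weak_gradientZ oOm a (H1_L2 Hu) (gradP Hu)).
have Lg u i : H1 Om u -> L2 Om (fun x => grad Om u x i 0) by move=> Hu; exact: grad_L2.
have Ls u i : H1 Om u -> L2 Om (fun x => (stilde x *m grad Om u x) i 0).
  by move=> Hu; apply: stilde_L2 => j; exact: Lg.
split.
- move=> u v w /H1of Hu /H1of Hv /H1of Hw.
  have Huv := ph_domD PH1 Hu Hv.
  rewrite (scaled_formE Huv Hw (wgD u v Hu Hv) (gradP Hw)).
  rewrite (scaled_formE Hu Hw (gradP Hu) (gradP Hw)) (scaled_formE Hv Hw (gradP Hv) (gradP Hw)).
  have -> : (fun x => mass_weight x * (u x + v x)) = fun x => mass_weight x * u x + mass_weight x * v x.
    by apply/funext => x; rewrite mulrDr.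
  rewrite (ph_ipDl PH (mass_L2 (H1_L2 Hu)) (mass_L2 (H1_L2 Hv)) (H1_L2 Hw)).
  rewrite (eq_bigr (fun i => dotL2 Om (fun x => (stilde x *m grad Om u x) i 0) (fun x => grad Om w x i 0) +
     dotL2 Om (fun x => (stilde x *m grad Om v x) i 0) (fun x => grad Om w x i 0))).
    by rewrite big_split /= mulrDr opprD addrACA.
  move=> i _; rewrite -(ph_ipDl PH (Ls u i Hu) (Ls v i Hv) (Lg w i Hw)).
  by congr dotL2; apply/funext => x; rewrite mulmxDr mxE.
- move=> a u w /H1of Hu /H1of Hw.
  have Hau := ph_domZ PH1 a Hu.
  rewrite (scaled_formE Hau Hw (wgZ a u Hu) (gradP Hw)) (scaled_formE Hu Hw (gradP Hu) (gradP Hw)).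
  have -> : (fun x => mass_weight x * (a * u x)) = fun x => a * (mass_weight x * u x).
    by apply/funext => x; rewrite mulrCA.
  rewrite (ph_ipZl PH a (mass_L2 (H1_L2 Hu)) (H1_L2 Hw)).
  rewrite (eq_bigr (fun i => a * dotL2 Om (fun x => (stilde x *m grad Om u x) i 0) (fun x => grad Om w x i 0))).
    by rewrite -mulr_sumr mulrBr; congr (_ - _); exact: mulrCA.
  move=> i _; rewrite -(ph_ipZl PH a (Ls u i Hu) (Lg w i Hw)).
  by congr dotL2; apply/funext => x; rewrite -scalemxAr mxE.
- move=> w u v /H1of Hw /H1of Hu /H1of Hv.
  have Huv := ph_domD PH1 Hu Hv.
  rewrite (scaled_formE Hw Huv (gradP Hw) (wgD u v Hu Hv)).
  rewrite (scaled_formE Hw Hu (gradP Hw) (gradP Hu)) (scaled_formE Hw Hv (gradP Hw) (gradP Hv)).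
  rewrite (ph_ipDr PH (H1_L2 Hu) (H1_L2 Hv) (mass_L2 (H1_L2 Hw))).
  rewrite (eq_bigr (fun i => dotL2 Om (fun x => (stilde x *m grad Om w x) i 0) (fun x => grad Om u x i 0) +
     dotL2 Om (fun x => (stilde x *m grad Om w x) i 0) (fun x => grad Om v x i 0))).
    by rewrite big_split /= mulrDr opprD addrACA.
  move=> i _; rewrite -(ph_ipDr PH (Lg u i Hu) (Lg v i Hv) (Ls w i Hw)).
  by congr dotL2; apply/funext => x; rewrite mxE.
- move=> a w u /H1of Hw /H1of Hu.
  have Hau := ph_domZ PH1 a Hu.
  rewrite (scaled_formE Hw Hau (gradP Hw) (wgZ a u Hu)) (scaled_formE Hw Hu (gradP Hw) (gradP Hu)).
  rewrite (ph_ipZr PH a (H1_L2 Hu) (mass_L2 (H1_L2 Hw))).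
  rewrite (eq_bigr (fun i => a^* * dotL2 Om (fun x => (stilde x *m grad Om w x) i 0) (fun x => grad Om u x i 0))).
    by rewrite -mulr_sumr mulrBr; congr (_ - _); exact: mulrCA.
  move=> i _; rewrite -(ph_ipZr PH a (Lg u i Hu) (Ls w i Hw)).
  by congr dotL2; apply/funext => x; rewrite mxE.
have [C C0 hC] := cbmat_L2 cbmat_stilde; have [D D0 hD] := cbm_L2 oOm cbm_mass.
(* Each of the three components of the stretched gradient is bounded by [C] times a sum of three
   norms, hence the 9. *)
exists (9 * C + absC omega ^+ 2 * D) => u v /H1of Hu /H1of Hv.
have nu : 0 <= N1 u by exact: nrm_ge0.
have nv : 0 <= N1 v by exact: nrm_ge0.
have gu j : nrm2 (fun x => grad Om u x j 0) <= N1 u.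
  by rewrite -normH1E; exact: (nrm2_grad_le_H1 oOm j Hu (gradP Hu)).
have gv j : nrm2 (fun x => grad Om v x j 0) <= N1 v.
  by rewrite -normH1E; exact: (nrm2_grad_le_H1 oOm j Hv (gradP Hv)).
have lu : nrm2 u <= N1 u by rewrite -normH1E; exact: nrm2_le_H1.
have lv : nrm2 v <= N1 v by rewrite -normH1E; exact: nrm2_le_H1.
have T i : absC (dotL2 Om (fun x => (stilde x *m grad Om u x) i 0) (fun x => grad Om v x i 0)) <=
    3 * C * N1 u * N1 v.
  apply: le_trans (ph_CS PH (Ls u i Hu) (Lg v i Hv)) _.
  apply: ler_pM; [exact: nrm_ge0|exact: nrm_ge0| |exact: gv].
  apply: le_trans ((hC _ (fun j => Lg u j Hu) i).2) _.
  rewrite [leRHS]mulrAC [leRHS]mulrC; apply: ler_wpM2l; first exact: C0.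
  rewrite big_ord3.
  exact: (le_sum3 (gu 0) (gu 1) (gu 2)).
have M : absC (dotL2 Om (fun x => mass_weight x * u x) v) <= D * N1 u * N1 v.
  apply: le_trans (ph_CS PH (mass_L2 (H1_L2 Hu)) (H1_L2 Hv)) _.
  apply: ler_pM; [exact: nrm_ge0|exact: nrm_ge0| |exact: lv].
  exact: (le_trans ((hD _ (H1_L2 Hu)).2) (ler_wpM2l D0 lu)).
rewrite (scaled_formE Hu Hv (gradP Hu) (gradP Hv)).
apply: le_trans (absCD _ _) _; rewrite absCN absCM absCX big_ord3.
have o0 : 0 <= absC omega ^+ 2 by exact: exprn_ge0 (absC_ge0 _).
apply: (bound_arith (T 0) (T 1) (T 2) o0 M).
by apply: le_trans (absCD _ _) _; apply: lerD => //; exact: absCD.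
Qed.

End StretchedForm.

(** * The complex multiplier is a bounded operator on H^1_0 *)

Section StretchedMultiplier.
Variables (R : realType) (r1 : R) (t : R -> R[i]) (Om : set (R * R * R)).
Hypothesis oOm : open Om.
Hypothesis r1_gt0 : 0 < r1.
Local Notation R3 := (R * R * R)%type.
Local Notation fct := (R3 -> R[i]).
Local Notation gfct := (R3 -> 'cV[R[i]]_3).
Local Notation Re := complex.Re.
Local Notation Im := complex.Im.
Local Notation PH := (L2_ph oOm).
Local Notation PH1 := (H1_prehilbert oOm).
Local Notation N1 := (hnorm (dotH1 Om)).
Local Notation nrm2 := (hnorm (dotL2 Om)).
Variables (tr1 ti1 : R -> R) (C M C' M' : R).
Hypothesis pr : radial_profile r1 (fun r => Re (t r)) tr1 C M.
Hypothesis pi : radial_profile r1 (fun r => Im (t r)) ti1 C' M'.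

Definition mult_grad (x : R3) (i : 'I_3) : R[i] := radial_grad tr1 i x +i* radial_grad ti1 i x.

Lemma mult_grad_le x i : absC (mult_grad x i) <= `|tr1 (enorm x)| + `|ti1 (enorm x)|.
Proof. by apply: le_trans (absC_le _) _; apply: lerD; exact: radial_grad_le. Qed.

Lemma cbm_mult : cbm Om (fun x => t (enorm x)).
Proof.
split.
  by apply: (@rbm_le _ _ _ C) => [|x]; [refine (measurable_radial pr)|exact: (radial_le pr)].
by apply: (@rbm_le _ _ _ C') => [|x]; [refine (measurable_radial pi)|exact: (radial_le pi)].
Qed.

Lemma cbm_mult_grad i : cbm Om (fun x => mult_grad x i).
Proof.
split => /=.
  apply: (@rbm_le _ _ _ M) => [|x]; first refine (measurable_radial_grad pr i).
  by apply: le_trans (radial_grad_le _ _ _) _; exact: (rp_le1 pr).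
apply: (@rbm_le _ _ _ M') => [|x]; first refine (measurable_radial_grad pi i).
by apply: le_trans (radial_grad_le _ _ _) _; exact: (rp_le1 pi).
Qed.

Definition mult_weak_grad (u : fct) (g : gfct) : gfct := fun x =>
  \col_i (t (enorm x) * g x i 0 + mult_grad x i * u x).

Lemma mult_H10 u g : H10 Om u -> weak_gradient Om u g ->
  H10 Om (fun x => t (enorm x) * u x) /\
  weak_gradient Om (fun x => t (enorm x) * u x) (mult_weak_grad u g).
Proof.
move=> Hu wg; have [Hr wr] := radial_mul_H10 oOm r1_gt0 pr Hu wg.
have [Hi wi] := radial_mul_H10 oOm r1_gt0 pi Hu wg.
have Hii := H10Z oOm 'i%C Hi.
have H1of v : H10 Om v -> H1 Om v by move=> /H10P[].
have Lr := H1_L2 (H1of _ Hr); have Li := H1_L2 (H1of _ Hi).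
have wii := weak_gradientZ oOm 'i%C Li wi.
have ww := weak_gradientD oOm Lr (H1_L2 (H1of _ Hii)) wr wii.
have e : (fun x => t (enorm x) * u x) = fun x =>
    (radial (fun r => Re (t r)) x)%:C * u x + 'i%C * ((radial (fun r => Im (t r)) x)%:C * u x).
  apply/funext => x; rewrite mulrA -mulrDl; congr (_ * _).
  by rewrite /radial; case: (t (enorm x)) => a b; simpc.
have eg : mult_weak_grad u g = fun x =>
    radial_mul_grad (fun r => Re (t r)) tr1 u g x +
    'i%C *: radial_mul_grad (fun r => Im (t r)) ti1 u g x.
  apply/funext => x; apply/matrixP => i j; rewrite !mxE.
  have -> : mult_grad x i = (radial_grad tr1 i x)%:C + 'i%C * (radial_grad ti1 i x)%:C.
    by rewrite /mult_grad; simpc.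
  have -> : t (enorm x) = (radial (fun r => Re (t r)) x)%:C + 'i%C * (radial (fun r => Im (t r)) x)%:C.
    by rewrite /radial; case: (t (enorm x)) => a b; simpc.
  by ring.
by rewrite e eg; split; [exact: (H10D oOm Hr Hii)|exact: ww].
Qed.

Lemma H1norm_le_sum u g : H1 Om u -> weak_gradient Om u g ->
  N1 u <= nrm2 u + \sum_i nrm2 (fun x => g x i 0).
Proof.
move=> Hu wg; have h := normH1_sqr oOm Hu wg.
have g0 i : 0 <= nrm2 (fun x => g x i 0) by exact: nrm_ge0.
have u0 : 0 <= nrm2 u by exact: nrm_ge0.
have n0 : 0 <= N1 u by exact: nrm_ge0.
have s0 : 0 <= \sum_i nrm2 (fun x => g x i 0) by rewrite sumr_ge0.
rewrite -ler_sqr ?nnegrE ?addr_ge0//; rewrite normH1E in h; rewrite h.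
move: (g0 0) (g0 1) (g0 2) u0; rewrite !big_ord3.
move: (nrm2 _) (nrm2 _) (nrm2 _) (nrm2 _) => a b c d a0 b0 c0 d0.
by have := mulr_ge0 a0 b0; have := mulr_ge0 a0 c0; have := mulr_ge0 a0 d0; have := mulr_ge0 b0 c0;
   have := mulr_ge0 b0 d0; have := mulr_ge0 c0 d0; rewrite !expr2; lra.
Qed.

Lemma mult_bounded : bounded_operator Om (fun u x => t (enorm x) * u x).
Proof.
have H1of v : H10 Om v -> H1 Om v by move=> /H10P[].
split.
- by move=> u Hu; exact: (mult_H10 Hu (gradP (H1of _ Hu))).1.
- by move=> a u v _ _; apply: aeW => x _ /=; ring.
have [K K0 hK] := cbm_L2 oOm cbm_mult.
have /boolp.choice[k hk] : forall i, exists L : R, 0 <= L /\ forall u, L2 Om u ->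
    L2 Om (fun x => mult_grad x i * u x) /\ nrm2 (fun x => mult_grad x i * u x) <= L * nrm2 u.
  by move=> i; have [L L0 hL] := cbm_L2 oOm (cbm_mult_grad i); exists L.
(* [K] occurs once for the function and once for each of its three derivatives; the [k i] account
   for the gradient of the multiplier. *)
exists (4 * K + \sum_i k i) => u Hu; have H1u := H1of _ Hu.
have wg := gradP H1u; have [HT wT] := mult_H10 Hu wg; have Lu := H1_L2 H1u.
have Lg i : L2 Om (fun x => grad Om u x i 0) by exact: grad_L2.
have nu : nrm2 u <= N1 u by rewrite -normH1E; exact: nrm2_le_H1.
have ng j : nrm2 (fun x => grad Om u x j 0) <= N1 u.
  by rewrite -normH1E; exact: (nrm2_grad_le_H1 oOm j H1u wg).
rewrite !normH1E; apply: le_trans (H1norm_le_sum (H1of _ HT) wT) _.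
have hi i : nrm2 (fun x => mult_weak_grad u (grad Om u) x i 0) <= K * N1 u + k i * N1 u.
  rewrite (_ : (fun x => _) = fun x => t (enorm x) * grad Om u x i 0 + mult_grad x i * u x); last first.
    by apply/funext => x; rewrite mxE.
  have [L1 b1] := hK _ (Lg i); have [L2' b2] := (hk i).2 _ Lu.
  apply: le_trans (nrmD PH L1 L2') _; apply: lerD.
    by apply: le_trans b1 _; exact: ler_wpM2l.
  by apply: le_trans b2 _; apply: ler_wpM2l => //; exact: (hk i).1.
have h0 : nrm2 (fun x => t (enorm x) * u x) <= K * N1 u.
  by apply: le_trans (hK _ Lu).2 _; exact: ler_wpM2l.
move: h0 (hi 0) (hi 1) (hi 2); rewrite !big_ord3.
move: (nrm2 _) (nrm2 _) (nrm2 _) (nrm2 _) (N1 u) => a b c d n h0 h1 h2 h3.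
have -> : (4 * K + (k 0 + k 1 + k 2)) * n =
  K * n + (K * n + k 0 * n + (K * n + k 1 * n) + (K * n + k 2 * n)) by ring.
by lra.
Qed.

End StretchedMultiplier.

(** * Coercivity *)

Lemma Re_rotated (R : realType) (a b eta e k0 k1 Z1 Z2 : R) :
  complex.Re ((eta +i* e) * ((a * b)%:C * ((k0 -i* (e * k1)) * (Z1 +i* Z2)))) =
  a * b * ((eta * k0 + e ^+ 2 * k1) * Z1 + e * (eta * k1 - k0) * Z2).
Proof. by simpc => /=; ring. Qed.

Lemma Re_scale (R : realType) (k : R) (z : R[i]) : complex.Re (k%:C * z) = k * complex.Re z.
Proof. by case: z => a b /=; rewrite mul0r subr0. Qed.

(** The worst corner of the sector is [Z1 = a N], [|Z2| = b N] with the unfavourable sign of [Z2],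
    where both sides agree. [eta b <= a] fixes the sign of the coefficient of [Z2]. *)
Lemma coercive_arith (R : realFieldType) (a b eta e Z1 Z2 N : R) : 0 <= a -> 0 <= b ->
  0 <= eta -> e ^+ 2 = 1 -> eta * b <= a -> a * N <= Z1 -> `|Z2| <= b * N ->
  eta * (a ^+ 2 + b ^+ 2) * N <= (eta * a + b) * Z1 + e * (eta * b - a) * Z2.
Proof.
move=> a0 b0 eta0 e2 eb hZ1 hZ2.
have h1 : (eta * a + b) * (a * N) <= (eta * a + b) * Z1.
  by apply: ler_wpM2l => //; rewrite addr_ge0// mulr_ge0.
have ab : 0 <= a - eta * b by rewrite subr_ge0.
have h2 := ler_wpM2l ab hZ2.
have h3 : - ((a - eta * b) * `|Z2|) <= e * (eta * b - a) * Z2.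
  have zl := ler_norm Z2; have zn : - Z2 <= `|Z2| by rewrite -normrN ler_norm.
  have z1 := ler_wpM2l ab zl; have z2 := ler_wpM2l ab zn.
  have /orP[/eqP e1|/eqP e1] : (e == 1) || (e == -1) by rewrite -sqrf_eq1 e2.
    have -> : e * (eta * b - a) * Z2 = - ((a - eta * b) * Z2) by rewrite e1; ring.
    by rewrite lerN2.
  have -> : e * (eta * b - a) * Z2 = - ((a - eta * b) * - Z2) by rewrite e1; ring.
  by rewrite lerN2.
have -> : eta * (a ^+ 2 + b ^+ 2) * N = (eta * a + b) * (a * N) - (a - eta * b) * (b * N) by ring.
by lra.
Qed.

(** Young's inequality with weight [c / 6]. The 3 comes from squaring a sum of three moduli, so that
    half of [c H] is spent. *)
Lemma absorb_arith (R : realFieldType) (c n Y H P Q : R) : 0 < c -> n ^+ 2 <= 3 * H ->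
  c * H <= P -> `|Q| <= Y * n -> c / 2 * H - 3 / (2 * c) * Y ^+ 2 <= P + Q.
Proof.
move=> c0 hn hP hQ.
have q1 : - (Y * n) <= Q by move: hQ; rewrite ler_norml => /andP[].
have s0 := sqr_ge0 (c * n - 3 * Y).
have key : Y * n <= c / 6 * n ^+ 2 + 3 / (2 * c) * Y ^+ 2.
  have e : c / 6 * n ^+ 2 + 3 / (2 * c) * Y ^+ 2 - Y * n = (6 * c)^-1 * (c * n - 3 * Y) ^+ 2.
    by field; rewrite gt_eqF.
  by rewrite -subr_ge0 e mulr_ge0// invr_ge0 mulr_ge0// ltW.
have h6 : c / 6 * n ^+ 2 <= c / 6 * (3 * H) by rewrite ler_wpM2l// divr_ge0// ltW.
move: key h6; move: (3 / (2 * c) * Y ^+ 2) => z key h6; lra.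
Qed.

(** Used with [a = Re nu], [b = - e Im nu] and [B] a bound of [- hi sin tau_hat]. On the boundary
    line [b = 0] of the half plane, [nu] is a positive real number, which is the hypothesis on
    [a]. *)
Lemma small_weight (R : realFieldType) (a b k B : R) : 0 < k -> 0 <= B -> 0 <= b ->
  (b = 0 -> 0 < a) -> exists eta, [/\ 0 < eta, eta * B <= k & 0 < eta * a + b].
Proof.
move=> k0 B0 b0 ba; have B1 : 0 < B + 1 by rewrite ltr_wpDl.
have kB : 0 < k / (B + 1) by rewrite divr_gt0.
have le_k eta : 0 <= eta -> eta <= k / (B + 1) -> eta * B <= k.
  move=> e0 ek; apply: le_trans (_ : eta * (B + 1) <= k).
    by rewrite ler_wpM2l// lerDl.
  by rewrite -ler_pdivlMr.
have [bz|bn0] := eqVneq b 0.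
  exists (k / (B + 1)); split => //; first exact: le_k (ltW kB) (lexx _).
  by rewrite bz addr0 mulr_gt0// ba.
have bp : 0 < b by rewrite lt_def bn0.
have a1 : 0 < `|a| + 1 by rewrite ltr_wpDl.
(* Then [d |a| <= b / 2], so a negative [a] cannot use up [b]. *)
pose d := b / (`|a| + 1) / 2.
have dp : 0 < d by rewrite !divr_gt0.
have dE : d * (`|a| + 1) * 2 = b by rewrite /d; field; rewrite gt_eqF.
clearbody d.
exists (Num.min (k / (B + 1)) d); split.
- by rewrite lt_min kB.
- by apply: le_k; [rewrite le_min !ltW|rewrite ge_min lexx].
have m0 : 0 <= Num.min (k / (B + 1)) d by rewrite le_min !ltW.
have md : Num.min (k / (B + 1)) d <= d by rewrite ge_min lexx orbT.
move: (Num.min _ _) m0 md => eta m0 md.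
have na : - `|a| <= a by rewrite lerNl -normrN ler_norm.
have h1 := ler_wpM2l m0 na; have h2 : eta * `|a| <= d * `|a| by rewrite ler_wpM2r.
have {}dE : 2 * (d * `|a|) + 2 * d = b by rewrite -dE; ring.
have : 0 <= d * `|a| by rewrite mulr_ge0// ltW.
rewrite mulrN in h1; lra.
Qed.

Section Coercivity.
Variables (R : realType) (r1 : R) (gamma : R[i]) (ta : R -> R) (sigma : 'M[R]_3).
Variables (Om : set (R * R * R)) (omega : R[i]).
Hypothesis oOm : open Om.
Hypothesis r1_gt0 : 0 < r1.
Hypothesis sc : scaling_assumptions r1 gamma ta.
Hypothesis sigmaP : sym_posdef sigma.
Hypothesis tauP : 1 - eig_min sigma / eig_max sigma < cos (tau_star r1 gamma ta).
Local Notation R3 := (R * R * R)%type.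
Local Notation Re := complex.Re.
Local Notation Im := complex.Im.
Local Notation dtilde := (dtilde gamma ta).
Local Notation dfun := (dfun r1 gamma ta).
Local Notation stilde := (sigma_tilde r1 gamma ta sigma).
Local Notation mass := (mass_weight r1 gamma ta).
Local Notation cross := (phase_cross r1 gamma ta).
Local Notation k0 := (k0 r1 gamma ta sigma).
Local Notation hi := (eig_max sigma).
Local Notation d0 := (d0 gamma ta).
Variables (e eta : R).
Hypothesis e2 : e ^+ 2 = 1.
Hypothesis eta_gt0 : 0 < eta.
Hypothesis eta_small : forall r, eta * - (hi * cross r) <= k0.
Local Notation T := (Tcoef r1 gamma ta sigma e).
Local Notation m := (eta +i* e).
Hypothesis mass_pos : 0 < Re (m * (- omega ^+ 2 * d0 ^+ 2)).

(* The phase of [T] turns [sigma~ v . conj v] into a positive multiple of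
   [(k0 - i e k1) (Z1 + i Z2)]; [coercive_arith] is the rotation of the sector
   [|Z2| <= k1 N, k0 N <= Z1] by this factor and [eta + i e]. *)
Lemma principal_ge : exists2 c : R, 0 < c & forall x (v : 'cV[R[i]]_3),
  ~ (x.1.1 = 0 /\ x.1.2 = 0) ->
  c * hsqr v <= Re (m * \sum_i (stilde x *m v) i 0 * (T (enorm x) * v i 0)^*).
Proof.
have [kl kl0 hk] := ratio_coef r1_gt0 sc sigmaP e.
have k0p := k0_gt0 sigmaP tauP; have hip := hi_gt0 sigmaP.
have mk : 0 < Num.min kl 1 by rewrite lt_min kl0 ltr01.
(* [min kl 1] compares [N] with [|v|^2]. The factor [k0] bounds [a b (k0^2 + k1^2)] from below:
   there [a = |d| >= 1], and [b] is the inverse of [|k0 + i k1|]. *)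
exists (eta * k0 * Num.min kl 1) => [|x v ax]; first by rewrite !mulr_gt0.
have r0 := enorm_ge0 x; move: (stilde_mul sigma r1_gt0 sc v ax) => /= sE.
have [kappa [c [s [qE cs kle [kc scross] TE]]]] := hk _ r0.
have [ss spos] := sigmaP.
have psd u : 0 <= bform sigma u u.
  have [->|u0] := eqVneq u 0; first by rewrite /bform mulmx0 mxE.
  exact: ltW (spos u u0).
have [Z1 [Z2 [FE hZ1 hZ2]]] := pointwise_form (unit_dir_sqr ax) cs qE v ss (eig_bounds ss) psd.
have qa : absC (dtilde (enorm x) / dfun (enorm x)) ^+ 2 = kappa ^+ 2.
  by rewrite qE absCM absCR exprMn absC_sqr /= cs mulr1 real_normK ?num_real.
have hN := @hsqr_radial_ge R (unit_dir x) (dtilde (enorm x) / dfun (enorm x)) (unit_dir_sqr ax) v (Num.min kl 1).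
move: hZ1 hZ2 hN; set N := hsqr _ => hZ1 hZ2 hN.
have {}hN : Num.min kl 1 * hsqr v <= N.
  by apply: hN; [rewrite (ltW mk) ge_min lexx orbT|rewrite qa; apply: le_trans kle; rewrite ge_min lexx].
have N0 : 0 <= N by apply: le_trans hN; rewrite mulr_ge0 ?(ltW mk)// hsqr_ge0.
pose k1 := - (hi * cross (enorm x)).
have k10 : 0 <= k1 by rewrite /k1 -mulrN mulr_ge0 ?(ltW hip)// oppr_ge0 (phase_cross_le0 r1_gt0 sc).
have -> : \sum_i (stilde x *m v) i 0 * (T (enorm x) * v i 0)^* =
   (absC (dfun (enorm x)) * (psi_norm r1 gamma ta sigma (cross (enorm x)))^-1)%:C *
   ((k0 -i* (e * k1)) * (Z1 +i* Z2)).
  have -> : \sum_i (stilde x *m v) i 0 * (T (enorm x) * v i 0)^* =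
     (T (enorm x))^* * dfun (enorm x) * hdot (radial_mx (unit_dir x) (dtilde (enorm x) / dfun (enorm x)) *m
       (map_mx (real_complex R) sigma *m (radial_mx (unit_dir x) (dtilde (enorm x) / dfun (enorm x)) *m v))) v.
    by rewrite sE /hdot mulr_sumr; apply: eq_bigr => i _; rewrite mxE rmorphM /=; ring.
  by rewrite FE [LHS]mulrA TE Tphase_conjE -/k1 [in RHS]rmorphM /=; ring.
set a := absC _; set b := (psi_norm _ _ _ _ _)^-1.
have a1 : 1 <= a by have [C C1 hC] := stretch_bounds r1_gt0 sc; have [] := hC _ r0.
have zp := psi_norm_gt0 sigmaP tauP (cross (enorm x)).
have b0 : 0 < b by rewrite invr_gt0.
have zE : psi_norm r1 gamma ta sigma (cross (enorm x)) ^+ 2 = k0 ^+ 2 + k1 ^+ 2.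
  rewrite /psi_norm sqr_sqrtr; last exact: ltW (psi_norm2_gt0 sigmaP tauP _).
  by rewrite /k1 sqrrN !expr2.
have bk : k0 <= b * (k0 ^+ 2 + k1 ^+ 2).
  rewrite -zE /b expr2 mulKf ?gt_eqF//.
  by rewrite -ler_sqr ?nnegrE ?(ltW zp) ?(ltW k0p)// zE lerDl sqr_ge0.
have main : eta * (k0 ^+ 2 + k1 ^+ 2) * N <= (eta * k0 + k1) * Z1 + e * (eta * k1 - k0) * Z2.
  apply: coercive_arith => //; [exact: ltW|exact: ltW|exact: eta_small| |].
    by apply: le_trans hZ1; rewrite ler_wpM2r.
  apply: le_trans hZ2 _; apply: ler_wpM2r => //.
  have -> : k1 = hi * `|cross (enorm x)| by rewrite /k1 ler0_norm ?(phase_cross_le0 r1_gt0 sc)// mulrN.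
  by rewrite ler_wpM2l// ltW.
have -> : Re (m * ((a * b)%:C * ((k0 -i* (e * k1)) * (Z1 +i* Z2)))) =
    a * b * ((eta * k0 + e ^+ 2 * k1) * Z1 + e * (eta * k1 - k0) * Z2).
  exact: Re_rotated.
rewrite e2 mul1r.
have ab0 : 0 <= a * b by rewrite mulr_ge0 ?(ltW b0)// (le_trans ler01 a1).
apply: le_trans (ler_wpM2l ab0 main).
have -> : a * b * (eta * (k0 ^+ 2 + k1 ^+ 2) * N) = eta * N * (a * (b * (k0 ^+ 2 + k1 ^+ 2))) by ring.
have -> : eta * k0 * Num.min kl 1 * hsqr v = eta * (Num.min kl 1 * hsqr v) * k0 by ring.
apply: ler_pM => //.
- by rewrite !mulr_ge0 ?(ltW eta_gt0) ?(ltW mk)// hsqr_ge0.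
- exact: ltW.
- by rewrite ler_wpM2l// ltW.
apply: le_trans bk _; rewrite ler_peMl//.
by rewrite mulr_ge0 ?(ltW b0)// addr_ge0// sqr_ge0.
Qed.

(** Isolates the size [th] of the gradient of the multiplier, with a constant independent of the
    point: far away [th] is small and the term can be absorbed. *)
Lemma cross_term_le : exists2 X : R, 0 <= X & forall x (v w : 'cV[R[i]]_3) (u : R[i]) (th : R),
  (forall i, absC (w i 0) <= th) ->
  absC (m * \sum_i (stilde x *m v) i 0 * (w i 0 * u)^*) <=
    X * th * absC u * (absC (v 0 0) + absC (v 1 0) + absC (v 2 0)).
Proof.
have hs := cbmat_stilde sigma oOm r1_gt0 sc.
have /boolp.choice[c hc] : forall ij : 'I_3 * 'I_3, exists C : R, forall x, absC (stilde x ij.1 ij.2) <= C.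
  by move=> [i j]; exact: (cbm_bound (hs i j)).
have c0 ij : 0 <= c ij by apply: le_trans (absC_ge0 _) (hc ij (0, 0, 0)).
pose S := \sum_ij c ij.
have cS ij : c ij <= S by rewrite /S (bigD1 ij)//= lerDl sumr_ge0.
have S0 : 0 <= S by rewrite sumr_ge0.
exists (absC m * (3 * S)) => [|x v w u th hw]; first by rewrite !mulr_ge0 ?absC_ge0.
set n := absC (v 0 0) + absC (v 1 0) + absC (v 2 0).
have row i : absC ((stilde x *m v) i 0) <= S * n.
  rewrite mxE big_ord3; apply: le_trans (absCD _ _) _; rewrite /n mulrDr; apply: lerD.
    apply: le_trans (absCD _ _) _; rewrite mulrDr; apply: lerD.
      by rewrite absCM; exact: (ler_wpM2r (absC_ge0 _) (le_trans (hc (i, 0) x) (cS _))).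
    by rewrite absCM; exact: (ler_wpM2r (absC_ge0 _) (le_trans (hc (i, 1) x) (cS _))).
  by rewrite absCM; exact: (ler_wpM2r (absC_ge0 _) (le_trans (hc (i, 2) x) (cS _))).
have term i : absC ((stilde x *m v) i 0 * (w i 0 * u)^*) <= S * n * (th * absC u).
  rewrite absCM absCJ absCM; apply: ler_pM;
    [exact: absC_ge0|exact: mulr_ge0 (absC_ge0 _) (absC_ge0 _)|exact: row|].
  by rewrite ler_wpM2r ?absC_ge0.
rewrite absCM -!mulrA; apply: ler_wpM2l; first exact: absC_ge0.
rewrite big_ord3; apply: le_trans (absCD _ _) _.
apply: le_trans (lerD (absCD _ _) (lexx _)) _.
have -> : 3 * (S * (th * (absC u * n))) = 3 * (S * n * (th * absC u)) by ring.
exact: (le_sum3 (term 0) (term 1) (term 2)).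
Qed.

Variables (tr1 ti1 : R -> R) (C M C' M' : R).
Hypothesis pr : radial_profile r1 (fun r => Re (T r)) tr1 C M.
Hypothesis pi : radial_profile r1 (fun r => Im (T r)) ti1 C' M'.
Hypothesis tr0 : tr1 r @[r --> +oo] --> (0 : R).
Hypothesis ti0 : ti1 r @[r --> +oo] --> (0 : R).

(** Outside a ball the gradient of the multiplier is small and the mass coefficient exceeds half of
    its limit. Inside, all terms in [|u|^2] are covered by the last one. *)
Lemma pointwise_coercive : exists cc mu CC R0 : R, [/\ 0 < cc, 0 < mu, 0 <= CC &
  forall x (u : R[i]) (v : 'cV[R[i]]_3), ~ (x.1.1 = 0 /\ x.1.2 = 0) ->
  cc * hsqr v + mu * absC u ^+ 2 <=
  Re (m * (\sum_i (stilde x *m v) i 0 * (T (enorm x) * v i 0 + mult_grad tr1 ti1 x i * u)^*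
           - omega ^+ 2 * (mass x * u * (T (enorm x) * u)^*))) +
  CC * (\1_[set y | enorm y <= R0] x * absC u ^+ 2)].
Proof.
have [c cp hc] := principal_ge; have [X X0 hX] := cross_term_le.
have [D hD] := cbm_bound (cbm_mass Om r1_gt0 sc).
have D0 : 0 <= D by apply: le_trans (absC_ge0 _) (hD (0, 0, 0)).
(* The coefficient of [(th |u|)^2] that [absorb_arith] leaves. *)
pose B := 3 / (2 * c) * X ^+ 2.
have B0 : 0 <= B by rewrite /B mulr_ge0 ?sqr_ge0// divr_ge0// mulr_ge0// ltW.
pose mu0 := Re (m * (- omega ^+ 2 * d0 ^+ 2)) / 2.
have mu0p : 0 < mu0 by rewrite divr_gt0.
pose th (r : R) := `|tr1 r| + `|ti1 r|.
have th_lim : th r @[r --> +oo] --> (0 : R).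
  by rewrite -[X in _ --> X](addr0 0) -{1}(normr0 R) -{2}(normr0 R); apply: cvgD; exact: cvg_norm.
pose Wr (r : R) := Re (m * (- omega ^+ 2 * (phase (dtilde r) * phase (dfun r) *
  (Tphase r1 gamma ta sigma e r)^*))).
have W_lim : Wr r @[r --> +oo] --> Re (m * (- omega ^+ 2 * d0 ^+ 2)).
  have ml := mass_lim r1_gt0 sc sigmaP tauP e.
  have cc (z : R[i]) : (fun _ : R => z) r @[r --> pinfty_nbhs R] --> (z : R[i]^o)
    by apply/cvgC_comp; split; exact: cvg_cst.
  have h : m * (- omega ^+ 2 * (phase (dtilde r) * phase (dfun r) *
      (Tphase r1 gamma ta sigma e r)^*)) @[r --> +oo] --> (m * (- omega ^+ 2 * d0 ^+ 2) : R[i]^o).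
    exact: (cvgCM _ (cc m) (cvgCM _ (cc (- omega ^+ 2)) ml)).
  by have /cvgC_comp[] := h.
(* Small enough for [B dl^2 <= mu0 / 2]; the minimum with 1 gives [dl^2 <= dl]. *)
pose dl := Num.min 1 (mu0 / 2 / (B + 1)).
have B1 : 0 < B + 1 by rewrite ltr_wpDl.
have dlp : 0 < dl by rewrite lt_min ltr01 !divr_gt0.
have dlB : B * dl ^+ 2 <= mu0 / 2.
  have d1 : dl <= 1 by rewrite ge_min lexx.
  have d2 : dl * (B + 1) <= mu0 / 2 by rewrite -ler_pdivlMr// ge_min lexx orbT.
  have d3 : dl ^+ 2 <= dl by rewrite expr2 ler_piMl// ltW.
  have d4 := ler_wpM2l B0 d3; have d5 := ltW dlp; rewrite mulrDr mulr1 mulrC in d2; lra.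
have mu0lt : mu0 < Re (m * (- omega ^+ 2 * d0 ^+ 2)).
  by rewrite /mu0 ltr_pdivrMr// ltr_pMr// ltr1n.
have [R0 [_ hR0]] : \forall r \near +oo, th r < dl /\ mu0 < Wr r.
  by apply: filterS2 (cvgr_lt _ th_lim _ dlp) (cvgr_gt _ W_lim _ mu0lt) => r ? ?.
pose Cm := absC m * (absC omega ^+ 2 * D).
have Cm0 : 0 <= Cm by rewrite !mulr_ge0 ?absC_ge0// exprn_ge0// absC_ge0.
(* A bound of the mass coefficient, the largest value of the absorbed gradient term, and the
   [mu0 / 2] demanded by the left side. *)
pose CC := Cm + B * (M + M') ^+ 2 + mu0 / 2.
have CC0 : 0 <= CC.
  apply: addr_ge0; first by apply: addr_ge0; [exact: Cm0|exact: mulr_ge0 B0 (sqr_ge0 _)].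
  by rewrite divr_ge0// ltW.
exists (c / 2), (mu0 / 2), CC, R0; split => //; [by rewrite divr_gt0..|].
move=> x u v ax; set r := enorm x; have r0 : 0 <= r by exact: enorm_ge0.
pose w : 'cV[R[i]]_3 := \col_i mult_grad tr1 ti1 x i.
pose n := absC (v 0 0) + absC (v 1 0) + absC (v 2 0).
have hn : n ^+ 2 <= 3 * hsqr v.
  rewrite hsqrE big_ord3 /n.
  move: (absC (v 0 0)) (absC (v 1 0)) (absC (v 2 0)) => p q s.
  by have := sqr_ge0 (p - q); have := sqr_ge0 (p - s); have := sqr_ge0 (q - s); rewrite !expr2; lra.
have th0 : 0 <= th r by rewrite addr_ge0.
have hw i : absC (w i 0) <= th r by rewrite mxE; exact: mult_grad_le.
have := hX x v w u (th r) hw; rewrite -/n => hQ.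
set P := Re (m * \sum_i (stilde x *m v) i 0 * (T r * v i 0)^*).
set Q := Re (m * \sum_i (stilde x *m v) i 0 * (w i 0 * u)^*).
set W := Re (m * (- omega ^+ 2 * ((T r)^* * mass x))).
have -> : Re (m * (\sum_i (stilde x *m v) i 0 * (T r * v i 0 + mult_grad tr1 ti1 x i * u)^*
           - omega ^+ 2 * (mass x * u * (T r * u)^*))) = P + Q + absC u ^+ 2 * W.
  have -> : \sum_i (stilde x *m v) i 0 * (T r * v i 0 + mult_grad tr1 ti1 x i * u)^* =
      \sum_i (stilde x *m v) i 0 * (T r * v i 0)^* + \sum_i (stilde x *m v) i 0 * (w i 0 * u)^*.
    by rewrite -big_split /=; apply: eq_bigr => i _; rewrite -mulrDr -rmorphD [w i 0]mxE.
  rewrite mulrBr ReD mulrDr ReD ReN; congr (_ + _).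
  have -> : m * (omega ^+ 2 * (mass x * u * (T r * u)^*)) =
      - ((absC u ^+ 2)%:C * (m * (- omega ^+ 2 * ((T r)^* * mass x)))).
    by rewrite -mulJ_absC rmorphM /=; ring.
  by rewrite ReN opprK Re_scale.
have hQ' : `|Q| <= X * th r * absC u * n by apply: le_trans (ReZ_absC _) hQ.
have PQ := absorb_arith cp hn (hc x v ax) hQ'.
have BE : 3 / (2 * c) * (X * th r * absC u) ^+ 2 = B * th r ^+ 2 * absC u ^+ 2 by rewrite /B; ring.
rewrite BE -/r -/P in PQ; have U0 := sqr_ge0 (absC u).
have [rR|rR] := leP r R0.
  have -> : \1_[set y : R3 | enorm y <= R0] x = 1 :> R by rewrite indicE mem_set.
  rewrite mul1r.
  have hW : - Cm <= W.
    have : `|W| <= Cm.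
      apply: le_trans (ReZ_absC _) _; rewrite absCM ler_wpM2l ?absC_ge0//.
      rewrite absCM absCN absCX ler_wpM2l ?exprn_ge0 ?absC_ge0//.
      by rewrite absCM absCJ (absC_Tcoef sc sigmaP tauP e2) mul1r.
    by rewrite ler_norml => /andP[].
  have thM : th r ^+ 2 <= (M + M') ^+ 2.
    have hh : th r <= M + M' by apply: lerD; [exact: (rp_le1 pr)|exact: (rp_le1 pi)].
    by rewrite ler_sqr ?nnegrE// (le_trans th0).
  have g1 := ler_wpM2r U0 (ler_wpM2l B0 thM); have g2 := ler_wpM2r U0 hW.
  rewrite /CC !mulrDl; rewrite mulNr [W * _]mulrC in g2.
  by clearbody P Q W; move: PQ g1 g2; lra.
have -> : \1_[set y : R3 | enorm y <= R0] x = 0 :> R.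
  by rewrite indicE memNset//= -/r; apply/negP; rewrite -ltNge.
rewrite mul0r mulr0 addr0; have [hth hW] := hR0 r rR.
have WE : W = absC (dtilde r) ^+ 2 * absC (dfun r) * Wr r.
  rewrite /W (mass_coef sigma r1_gt0 sc e r0) /Wr -[RHS]Re_scale.
  by congr (complex.Re _); ring.
have [C2 C21 hC2] := stretch_bounds r1_gt0 sc; have [t1 _ f1 _] := hC2 r r0.
(* The limit concerns the phases; the moduli are at least 1 and can only increase a positive real
   part. *)
have b1 : 1 <= absC (dtilde r) ^+ 2 * absC (dfun r) by rewrite mulr_ege1// exprn_ege1.
have WW : mu0 <= W.
  rewrite WE; apply: le_trans (ltW hW) _; rewrite ler_peMl// (le_trans (ltW mu0p))//; exact: ltW.
have thd : th r ^+ 2 <= dl ^+ 2 by rewrite ler_sqr ?nnegrE ?(ltW dlp)// ltW.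
have g1 := ler_wpM2l B0 thd.
have g2 : B * th r ^+ 2 <= mu0 / 2 by exact: le_trans g1 dlB.
have g3 := ler_wpM2r U0 g2; have g4 := ler_wpM2r U0 WW.
rewrite [absC u ^+ 2 * W]mulrC; move: PQ g3 g4.
move: (absC u ^+ 2) (B * th r ^+ 2) U0 => U z U0 PQ g3 g4.
by clearbody P Q W; lra.
Qed.

End Coercivity.

(** * Integration of the pointwise estimate *)

Section Assembly.
Variables (R : realType) (r1 : R) (gamma : R[i]) (ta : R -> R) (sigma : 'M[R]_3).
Variables (Om : set (R * R * R)) (omega : R[i]).
Hypothesis oOm : open Om.
Hypothesis r1_gt0 : 0 < r1.
Hypothesis sc : scaling_assumptions r1 gamma ta.
Local Notation R3 := (R * R * R)%type.
Local Notation fct := (R3 -> R[i]).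
Local Notation Re := complex.Re.
Local Notation Im := complex.Im.
Local Notation PH := (L2_ph oOm).
Local Notation N1 := (hnorm (dotH1 Om)).
Local Notation nrm2 := (hnorm (dotL2 Om)).
Local Notation stilde := (sigma_tilde r1 gamma ta sigma).
Local Notation mass := (mass_weight r1 gamma ta).
Local Notation form := (scaled_form r1 gamma ta sigma Om omega).

Lemma ae_off_axis : {ae @mu3 R, forall x : R3, ~ (x.1.1 = 0 /\ x.1.2 = 0)}.
Proof.
exists [set x : R3 | x.1.1 = 0 /\ x.1.2 = 0]; split.
- have -> : [set x : R3 | x.1.1 = 0 /\ x.1.2 = 0] = ([set 0] `*` [set 0]) `*` setT.
    by apply/seteqP; split => [x [? ?]|x [[? ?] _]].
  by apply: measurableX => //; apply: measurableX; exact: measurable_set1.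
- exact: mu3_axis.
- by move=> x /= /contrapT.
Qed.

Lemma ball_measurable (rho : R) : measurable ([set x | enorm x <= rho] : set (mR3 R)).
Proof.
have := continuous_measurable3 (@enorm_continuous R) measurableT (measurable_itv (Interval (BInfty R true) (BRight rho))).
by rewrite setTI; congr (measurable _); apply/seteqP; split => x /=; rewrite in_itv.
Qed.

Variables (T : R -> R[i]) (tr1 ti1 : R -> R) (C M C' M' : R).
Hypothesis pr : radial_profile r1 (fun r => Re (T r)) tr1 C M.
Hypothesis pi : radial_profile r1 (fun r => Im (T r)) ti1 C' M'.
Variables (m : R[i]) (cc mu CC R0 : R).
Hypothesis pointwise : forall x (u : R[i]) (v : 'cV[R[i]]_3), ~ (x.1.1 = 0 /\ x.1.2 = 0) ->
  cc * hsqr v + mu * absC u ^+ 2 <=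
  Re (m * (\sum_i (stilde x *m v) i 0 * (T (enorm x) * v i 0 + mult_grad tr1 ti1 x i * u)^*
           - omega ^+ 2 * (mass x * u * (T (enorm x) * u)^*))) +
  CC * (\1_[set y | enorm y <= R0] x * absC u ^+ 2).
Local Notation Q := [set y : R3 | enorm y <= R0].

Lemma integrated_coercive u : H10 Om u ->
  cc * \sum_i nrm2 (fun x => grad Om u x i 0) ^+ 2 + mu * nrm2 u ^+ 2 <=
  Re (m * form u (fun x => T (enorm x) * u x)) + CC * nrm2 (cut Q u) ^+ 2.
Proof.
move=> Hu; have H1of v : H10 Om v -> H1 Om v by move=> /H10P[].
have H1u := H1of _ Hu; have wg := gradP H1u; have Lu := H1_L2 H1u.
have [HT wT] := mult_H10 oOm r1_gt0 pr pi Hu wg; have LT := H1_L2 (H1of _ HT).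
have Lg i : L2 Om (fun x => grad Om u x i 0) by exact: grad_L2.
pose A i : fct := fun x => (stilde x *m grad Om u x) i 0.
pose h i : fct := fun x => mult_weak_grad T tr1 ti1 u (grad Om u) x i 0.
have LA i : L2 Om (A i) by exact: (stilde_L2 sigma oOm r1_gt0 sc i Lg).
have Lh i : L2 Om (h i) by have [hh _] := wT; exact: hh.
have LM : L2 Om (fun x => mass x * u x) by exact: (mass_L2 oOm r1_gt0 sc Lu).
have Lc : L2 Om (cut Q u) by exact: (cut_L2 oOm (ball_measurable R0) Lu).1.
(* Three blocks: the principal terms, the terms [- cc |g|^2], and then the mass term, [- mu |u|^2]
   and the ball term. Nonnegativity of the real part of the sum is the pointwise estimate. *)
pose a (k : 'I_3 + 'I_3 + 'I_3) : fct := match k with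
  | inl (inl i) => fun x => m * A i x
  | inl (inr i) => fun x => (- cc)%:C * grad Om u x i 0
  | inr j => nth (fun=> 0) [:: (fun x => - (m * omega ^+ 2) * (mass x * u x));
      (fun x => (- mu)%:C * u x); (fun x => CC%:C * cut Q u x)] j end.
pose b (k : 'I_3 + 'I_3 + 'I_3) : fct := match k with
  | inl (inl i) => h i
  | inl (inr i) => fun x => grad Om u x i 0
  | inr j => nth (fun=> 0) [:: (fun x => T (enorm x) * u x); u; cut Q u] j end.
have La k : L2 Om (a k).
  case: k => [[i|i]|[[|[|[|//]]] ?]] /=.
  - exact: (ph_domZ PH m (LA i)).
  - exact: (ph_domZ PH _ (Lg i)).
  - exact: (ph_domZ PH _ LM).
  - exact: (ph_domZ PH _ Lu).
  - exact: (ph_domZ PH _ Lc).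
have Lb k : L2 Om (b k).
  by case: k => [[i|i]|[[|[|[|//]]] ?]] /=; [exact: Lh|exact: Lg|exact: LT|exact: Lu|exact: Lc].
have pos : {ae @mu3 R, forall x, Om x -> 0 <= Re (\sum_k a k x * (b k x)^*)}.
  apply: filterS ae_off_axis => x ax _.
  have := pointwise (u x) (grad Om u x) ax.
  have -> : \sum_k a k x * (b k x)^* =
      m * (\sum_i A i x * (h i x)^* - omega ^+ 2 * (mass x * u x * (T (enorm x) * u x)^*)) +
      (- (cc * hsqr (grad Om u x)))%:C + (- (mu * absC (u x) ^+ 2))%:C +
      (CC * (\1_Q x * absC (u x) ^+ 2))%:C.
    rewrite !big_sumType /= [X in _ + X]big_ord3 /=.
    have -> : \sum_i m * A i x * (h i x)^* = m * \sum_i A i x * (h i x)^*.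
      by rewrite mulr_sumr; apply: eq_bigr => i _; rewrite mulrA.
    have -> : \sum_i (- cc)%:C * grad Om u x i 0 * (grad Om u x i 0)^* =
        (- (cc * hsqr (grad Om u x)))%:C.
      rewrite hsqrE mulr_sumr -sumrN rmorph_sum /=; apply: eq_bigr => i _.
      by rewrite -mulrA mulJ_absC -rmorphM /= mulNr.
    have -> : (- mu)%:C * u x * (u x)^* = (- (mu * absC (u x) ^+ 2))%:C.
      by rewrite -mulrA mulJ_absC -rmorphM /= mulNr.
    have -> : CC%:C * cut Q u x * (cut Q u x)^* = (CC * (\1_Q x * absC (u x) ^+ 2))%:C.
      rewrite -mulrA mulJ_absC -rmorphM /= /cut absCM absCR exprMn real_normK ?num_real//.
      by rewrite expr2 indic_sqr.
    by ring.
  have -> : \sum_i A i x * (h i x)^* = \sum_i (stilde x *m grad Om u x) i 0 *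
      (T (enorm x) * grad Om u x i 0 + mult_grad tr1 ti1 x i * u x)^*.
    by apply: eq_bigr => i _; rewrite /A /h [mult_weak_grad _ _ _ _ _ _ _ _]mxE.
  rewrite !ReD !ReC; move: (Re _) => p; move: (hsqr _) (_ * absC (u x) ^+ 2) => q s.
  by move: (absC (u x) ^+ 2) => t; lra.
have := dotL2_sum_ge0 oOm La Lb pos.
rewrite !big_sumType /= [X in _ + X]big_ord3 /=.
have -> : \sum_i dotL2 Om (fun x => m * A i x) (h i) = m * \sum_i dotL2 Om (A i) (h i).
  by rewrite mulr_sumr; apply: eq_bigr => i _; exact: (ph_ipZl PH m (LA i) (Lh i)).
rewrite (ph_ipZl PH _ LM LT) (ph_ipZl PH _ Lu Lu) (ph_ipZl PH _ Lc Lc).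
have -> : \sum_i dotL2 Om (fun x => (- cc)%:C * grad Om u x i 0) (fun x => grad Om u x i 0) =
    (- cc)%:C * \sum_i dotL2 Om (fun x => grad Om u x i 0) (fun x => grad Om u x i 0).
  by rewrite mulr_sumr; apply: eq_bigr => i _; exact: (ph_ipZl PH _ (Lg i) (Lg i)).
rewrite (scaled_formE sigma omega oOm r1_gt0 sc H1u (H1of _ HT) wg wT).
have nS : \sum_i nrm2 (fun x => grad Om u x i 0) ^+ 2 =
    Re (\sum_i dotL2 Om (fun x => grad Om u x i 0) (fun x => grad Om u x i 0)).
  by rewrite Re_sum; apply: eq_bigr => i _; exact: (nrm_sqr PH (Lg i)).
rewrite (nrm_sqr PH Lu) (nrm_sqr PH Lc) nS -/(h _) mulrBr !(ReD, Re_scale) ReN.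
have mE z : - (m * omega ^+ 2) * z = - (m * (omega ^+ 2 * z)) by rewrite mulNr mulrA.
rewrite mE ReN /A /h; move: (Re (m * \sum_i dotL2 Om _ _)) (Re (\sum_i _)) => p q.
move: (Re (m * (omega ^+ 2 * _))) (Re (dotL2 Om u u)) (Re (dotL2 Om (cut _ _) _)) => s t w.
by lra.
Qed.

End Assembly.

Lemma arg_sign (R : realType) (z : R[i]) : z != 0 ->
  if arg z <= 0 then complex.Im z <= 0 else 0 <= complex.Im z.
Proof.
move=> z0; have [h1 h2 zE] := argP z0.
have -> : complex.Im z = absC z * sin (arg z) by rewrite {1}zE /= mul0r addr0.
case: leP => h.
  rewrite -[arg z]opprK sinN mulrN oppr_le0 mulr_ge0 ?absC_ge0// sin_ge0_pi//.
  by rewrite oppr_ge0 h lerNl.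
by rewrite mulr_ge0 ?absC_ge0// sin_ge0_pi// ltW// ltW.
Qed.

Lemma opT_Tcoef (R : realType) (r1 : R) (gamma : R[i]) (ta : R -> R) (sigma : 'M[R]_3)
    (omega : R[i]) (e : R) : scaling_assumptions r1 gamma ta -> sym_posdef sigma ->
  1 - eig_min sigma / eig_max sigma < cos (tau_star r1 gamma ta) ->
  e = (if arg (- omega ^+ 2 * d0 gamma ta ^+ 2) <= 0 then 1 else -1) ->
  opT r1 gamma ta sigma omega = fun u x => Tcoef r1 gamma ta sigma e (enorm x) * u x.
Proof.
move=> sc sigmaP tauP eE; apply/funext => u; apply/funext => x; rewrite /opT; congr (_ * _).
have e2 : e ^+ 2 = 1 by rewrite eE; case: ifP; rewrite ?sqrrN expr1n.
rewrite (TcoefE sc sigmaP tauP e2 (enorm_ge0 x)); congr (_ * _).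
by rewrite eE; case: ifP => _; rewrite ?mul1r ?mulN1r.
Qed.

Lemma min_arith (R : realFieldType) (cc mu S U : R) : 0 <= S -> 0 <= U ->
  Num.min cc mu * (U + S) <= cc * S + mu * U.
Proof.
move=> S0 U0; have h1 : Num.min cc mu <= cc by rewrite ge_min lexx.
have h2 : Num.min cc mu <= mu by rewrite ge_min lexx orbT.
by have := ler_wpM2r S0 h1; have := ler_wpM2r U0 h2; rewrite mulrDr; lra.
Qed.

(* The form of the compact operator is [m^-1 C h^-3] times the sum of the squared
   integrals of [u] over the cubes of the local Poincare inequality. *)
Lemma weakly_coercive_of_Garding (R : realType) (Om : set (R * R * R))
    (T : ((R * R * R) -> R[i]) -> (R * R * R) -> R[i])
    (b : ((R * R * R) -> R[i]) -> ((R * R * R) -> R[i]) -> R[i]) (m : R[i]) (c C rho : R) :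
  open Om -> bounded_operator Om T -> bounded_form Om b -> m != 0 -> 0 < c -> 0 <= C ->
  (forall u, H10 Om u -> c * hnorm (dotH1 Om) u ^+ 2 <=
    complex.Re (m * b u (T u)) + C * hnorm (dotL2 Om) (cut [set y | enorm y <= rho] u) ^+ 2) ->
  weakly_T_coercive Om T (form_operator Om b).
Proof.
move=> oOm bT bb m0 c0 C0 garding; have PH1 := H1_prehilbert oOm.
have C1 : 0 < C + 1 by rewrite ltr_wpDl.
(* [C] times this is at most [c / 2], so half of the coercivity constant survives. *)
have e0 : 0 < c / (2 * (C + 1)) by rewrite divr_gt0// mulr_gt0.
have [k [a [h [h0 hP]]]] := local_poincare oOm rho e0.
pose psi (i : 'I_k * 'I_k * 'I_k) := indC (cube (a i) h) : _ -> R[i].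
have Lpsi i : L2 Om (psi i) by exact: indC_L2.
have [K cK KE] := finite_rank_compact oOm (m^-1 * (C / h ^+ 3)%:C) Lpsi.
exists K => //; have am : 0 < absC m by rewrite absC_gt0.
apply: (@lt_le_trans _ _ ((c / 2 / absC m)%:E)).
  by rewrite lte_fin !divr_gt0.
apply: le_ereal_inf_tmp => _ [u [Hu u0] <-]; rewrite lee_fin.
have bA := bounded_form_represents oOm bb.
have HA : H10 Om (form_operator Om b u) by case: bA => -[hA _ _] _; exact: hA.
have HTA := adjoint_H10 oOm bT HA.
have HK : H10 Om (K u) by case: cK => -[hK _ _] _; exact: hK.
have H1of v : H10 Om v -> H1 Om v by move=> /H10P[].
have DE : dotH1 Om (fun x => adjoint Om T (form_operator Om b u) x + K u x) u =
    b u (T u) + m^-1 * (\sum_i absC (dotL2 Om u (psi i)) ^+ 2 * C / h ^+ 3)%:C.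
  rewrite (ph_ipDl PH1 (H1of _ HTA) (H1of _ HK) (H1of _ Hu)).
  rewrite (adjoint_form_operatorE oOm bT bb Hu Hu) (KE u u Hu Hu); congr (_ + _).
  rewrite -mulrA; congr (_ * _); rewrite rmorph_sum mulr_sumr; apply: eq_bigr => i _ /=.
  by rewrite mulJ_absC -rmorphM /= mulrC -mulrA.
rewrite DE normH1E; set S := \sum_i _.
have SE : S = C * \sum_i absC (dotL2 Om u (psi i)) ^+ 2 / h ^+ 3.
  by rewrite mulr_sumr; apply: eq_bigr => i _; ring.
have n0 : 0 < hnorm (dotH1 Om) u.
  rewrite lt_def nrm_ge0 andbT; apply/negP => /eqP n0; apply: u0.
  exact: (normH1_eq0 oOm (H1of _ Hu) n0).
(* Multiplication by [m] cancels the [m^-1] in the compact operator, after which the modulus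
   dominates the real part in [garding]. *)
have key : c / 2 * hnorm (dotH1 Om) u ^+ 2 <=
    absC m * absC (b u (T u) + m^-1 * S%:C).
  rewrite -absCM mulrDr mulVKf//.
  apply: le_trans (le_trans (ler_norm _) (ReZ_absC _)).
  have g := garding u Hu; have p := ler_wpM2l C0 (hP u Hu).
  rewrite ReD ReC SE.
  move: g p; rewrite -/(psi _); move: (complex.Re _) (hnorm (dotL2 Om) _ ^+ 2) (\sum_i _) => p q s.
  move: (hnorm (dotH1 Om) u ^+ 2) (sqr_ge0 (hnorm (dotH1 Om) u)) => n n_0 g hp.
  have t : C * (c / (2 * (C + 1)) * n) <= c / 2 * n.
    have -> : C * (c / (2 * (C + 1)) * n) = c / 2 * n * (C / (C + 1)) by field; rewrite gt_eqF.
    rewrite ler_piMr//; first by rewrite mulr_ge0// divr_ge0// ltW.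
    by rewrite ler_pdivrMr// mul1r lerDl.
  rewrite mulrDr in hp; lra.
rewrite ler_pdivlMr ?exprn_gt0//.
have -> : c / 2 / absC m * hnorm (dotH1 Om) u ^+ 2 = c / 2 * hnorm (dotH1 Om) u ^+ 2 / absC m by rewrite mulrAC.
by rewrite ler_pdivrMr// [leRHS]mulrC.
Qed.

(** If [- z^2] is real and [z] is not, then [z] is purely imaginary and [- z^2 > 0]. With
    [z = omega d0] this keeps [- omega^2 d0^2] off the closed negative axis. *)
Lemma oppr_sqr_off_negative (R : realType) (z : R[i]) : complex.Im z != 0 ->
  complex.Im (- z ^+ 2) = 0 -> 0 < complex.Re (- z ^+ 2).
Proof.
rewrite expr2; case: z => p q /= q0; simpc => /= h.
have /eqP : 2 * (p * q) = 0 by lra.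
rewrite !mulf_eq0 pnatr_eq0 (negbTE q0) /= orbF => /eqP p0.
by rewrite p0 mul0r subr0 -expr2 lt_def sqr_ge0 sqrf_eq0 q0.
Qed.

Unset Implicit Arguments.

Theorem theorem3p6 (R : realType) (Om : set (R * R * R)) (r0 r1 : R)
    (sigma : 'M[R]_3) (gamma : R[i]) (ta : R -> R) (omega : R[i])
    (Om_connected : connected Om)
    (Om_lipschitz : lipschitz_domain Om)
    (Omc_compact : compact (~` Om))
    (Omc_nonempty : ~` Om !=set0)
    (r0_gt0 : 0 < r0)
    (Omc_ball : ~` Om `<=` eball r0)
    (sigmaP : sym_posdef sigma)
    (r0_lt_r1 : r0 < r1)
    (scaling : scaling_assumptions r1 gamma ta)
    (tau_starP : 1 - eig_min sigma / eig_max sigma < cos (tau_star r1 gamma ta))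
    (omegaP : Lambda gamma ta omega) :
  weakly_T_coercive Om (opT r1 gamma ta sigma omega)
    (opA r1 gamma ta sigma Om omega).
Proof.
have [oOm _] := Om_lipschitz; have r1_gt0 := lt_trans r0_gt0 r0_lt_r1.
set nu := - omega ^+ 2 * d0 gamma ta ^+ 2.
(* The sign of the case distinction in [opT]: [nu] and the turned sector both lie in the half plane
   where [e] times the imaginary part is at most 0. *)
pose e : R := if arg nu <= 0 then 1 else -1.
have e2 : e ^+ 2 = 1 by rewrite /e; case: ifP; rewrite ?sqrrN expr1n.
have nuE : nu = - (omega * d0 gamma ta) ^+ 2 by rewrite /nu exprMn mulNr.
(* Membership in [Lambda] reads [Re (i omega d0) != 0], and this real part is [- Im (omega d0)]. *)
have z0 : complex.Im (omega * d0 gamma ta) != 0.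
  move: omegaP; rewrite /Lambda /= -mulrA; case: (omega * _) => p q /=.
  by rewrite mul0r mul1r sub0r oppr_eq0.
have nu_im : complex.Im nu = 0 -> 0 < complex.Re nu.
  by rewrite nuE; exact: oppr_sqr_off_negative z0.
have nu0 : nu != 0.
  by apply/negP => /eqP n0; move: nu_im; rewrite n0 /= => /(_ erefl); rewrite ltxx.
have eb : 0 <= - e * complex.Im nu.
  have := arg_sign nu0; rewrite /e; case: ifP => _ h; last by rewrite opprK mul1r.
  by rewrite mulN1r oppr_ge0.
have k0p := k0_gt0 sigmaP tau_starP; have hip := hi_gt0 sigmaP.
have [cr1 [Kc [Mc [pc _]]]] := vp_phase_cross r1_gt0 scaling.
have Kc0 : 0 <= Kc by apply: le_trans (normr_ge0 _) (rp_le pc 0).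
have eim : - e * complex.Im nu = 0 -> 0 < complex.Re nu.
  move=> /eqP; rewrite mulf_eq0 oppr_eq0 => /orP[/eqP e0|/eqP /nu_im //].
  by move: e2; rewrite e0 expr0n /= => /eqP; rewrite eq_sym oner_eq0.
(* [hi * Kc] bounds [- hi * cross] at all radii, so a single [eta] tilts every sector by an
   admissible amount and gives the limit of the mass coefficient a positive real part. *)
have [eta [eta0 etaB eta_nu]] := small_weight k0p (mulr_ge0 (ltW hip) Kc0) eb eim.
have eta_small r : eta * - (eig_max sigma * phase_cross r1 gamma ta r) <= k0 r1 gamma ta sigma.
  apply: le_trans etaB; rewrite ler_wpM2l ?(ltW eta0)// -mulrN ler_wpM2l ?(ltW hip)//.
  by apply: le_trans (ler_norm _) _; rewrite normrN; exact: (rp_le pc r).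
have mass_pos : 0 < complex.Re ((eta +i* e) * nu).
  by move: eta_nu; case: (nu) => p q /=; rewrite mulNr.
have [[tr1 [C [M [pr tr0]]]] [ti1 [C' [M' [pi ti0]]]]] :=
  vp_Tcoef r1_gt0 scaling sigmaP tau_starP e.
have [cc [mu [CC [R0 [cc0 mu0 CC0 pw]]]]] := pointwise_coercive oOm r1_gt0 scaling sigmaP
  tau_starP e2 eta0 eta_small mass_pos pr pi tr0 ti0.
rewrite (@opT_Tcoef _ _ _ _ _ _ e)// /opA.
have m0 : eta +i* e != 0 by rewrite eq_complex /= negb_and gt_eqF.
have mn0 : 0 < Num.min cc mu by rewrite lt_min cc0.
have garding u : H10 Om u -> Num.min cc mu * hnorm (dotH1 Om) u ^+ 2 <=
    complex.Re ((eta +i* e) * scaled_form r1 gamma ta sigma Om omega u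
      (fun x => Tcoef r1 gamma ta sigma e (enorm x) * u x)) +
    CC * hnorm (dotL2 Om) (cut [set y | enorm y <= R0] u) ^+ 2.
  move=> Hu; have /H10P[H1u _] := Hu.
  apply: le_trans (integrated_coercive oOm r1_gt0 scaling pr pi pw Hu).
  rewrite -normH1E (normH1_sqr oOm H1u (gradP H1u)); apply: min_arith; last exact: sqr_ge0.
  by apply: sumr_ge0 => i _; exact: sqr_ge0.
exact: (weakly_coercive_of_Garding oOm (mult_bounded oOm r1_gt0 pr pi)
  (scaled_form_bounded sigma omega oOm r1_gt0 scaling) m0 mn0 CC0 garding).
Qed.
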